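(* For every integer $N\ge 1$ one has $Q<2\pi\log 2$. Moreover, there exists $u\in H^1(\mathbb{R}^N)\setminus\mathcal{M}$ such that $Q(u)=Q$.
   Context: All functions are real-valued, $N\ge1$, and $s^2\log s^2:=0$ at $s=0$. Let $\mathcal{M}:=\{a e^{-\frac{\pi}{2}|x-b|^2}: a\in\mathbb{R},\, b\in\mathbb{R}^N\}\subset H^1(\mathbb{R}^N)$. For $u\in H^1(\mathbb{R}^N)$ define the Euclidean logarithmic Sobolev deficit $$\delta[u]:=\int_{\mathbb{R}^N}|\nabla u|^2\,dx-\pi\int_{\mathbb{R}^N}u^2\log\frac{u^2}{\|u\|_{L^2(\mathbb{R}^N)}^2}\,dx-N\pi\int_{\mathbb{R}^N}u^2\,dx\in[0,+\infty]$$ (equal to $+\infty$ when the entropy integral is $-\infty$), the distance $d(u,\mathcal{M}):=\inf_{w\in\mathcal{M}}\|u-w\|_{L^2(\mathbb{R}^N)}$, and, for $u\in H^1(\mathbb{R}^N)\setminus\mathcal{M}$, the quotient $Q(u):=\delta[u]/d(u,\mathcal{M})^2$. The sharp stability constant is $$Q:=\inf_{u\in H^1(\mathbb{R}^N)\setminus\mathcal{M}}Q(u).$$ It is known that $Q>0$ and that $Q$ coincides with the analogous constant in the Gaussian formulation: with $\gamma(x):=e^{-\frac{\pi}{2}|x|^2}$, $d\gamma:=\gamma(x)^2dx$, and $\mathcal{M}_\gamma:=\{a e^{b\cdot x}: a\in\mathbb{R},\,b\in\mathbb{R}^N\}$, one has $$Q=\inf_{v\in H^1(\mathbb{R}^N,d\gamma)\setminus\mathcal{M}_\gamma}\frac{\int_{\mathbb{R}^N}|\nabla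 v|^2\,d\gamma-\pi\int_{\mathbb{R}^N}v^2\log\frac{v^2}{\|v\|_{L^2(\mathbb{R}^N,d\gamma)}^2}\,d\gamma}{\inf_{w\in\mathcal{M}_\gamma}\|v-w\|^2_{L^2(\mathbb{R}^N,d\gamma)}}.$$ *)

(* Defs.v *)
From HB Require Import structures.
From mathcomp Require Import all_boot all_order all_algebra.
From mathcomp Require Import all_classical all_reals all_analysis.

Set Implicit Arguments.
Unset Strict Implicit.
Unset Printing Implicit Defensive.

Import Order.TTheory GRing.Theory Num.Theory.
Import numFieldNormedType.Exports.

Local Open Scope classical_set_scope.
Local Open Scope ring_scope.

(* 'rV[R]_n carries the product sigma-algebra, which is the Borel one. *)
Fact measure_rV_display : measure_display. Proof. exact: default_measure_display. Qed.

Section measurable_rV.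
Variables (R : realType) (n : nat).

Let coors : 'I_n -> 'rV[R]_n -> measurableTypeR R := fun i x => x ord0 i.

Let rV_set0 : g_sigma_preimage coors set0.
Proof. exact: sigma_algebra0. Qed.

Let rV_setC A : g_sigma_preimage coors A -> g_sigma_preimage coors (~` A).
Proof. exact: sigma_algebraC. Qed.

Let rV_bigcup (F : (set 'rV[R]_n)^nat) :
  (forall i, g_sigma_preimage coors (F i)) ->
  g_sigma_preimage coors (\bigcup_i (F i)).
Proof. exact: sigma_algebra_bigcup. Qed.

HB.instance Definition _ := @isMeasurable.Build measure_rV_display
  'rV[R]_n (g_sigma_preimage coors) rV_set0 rV_setC rV_bigcup.

End measurable_rV.

Section rV_cons.
Variable R : realType.

Definition rV_cons n (p : measurableTypeR R * 'rV[R]_n) : 'rV[R]_n.+1 :=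
  \row_i (if unlift ord0 i is Some j then p.2 ord0 j else p.1).

Definition rV_behead n (x : 'rV[R]_n.+1) : 'rV[R]_n :=
  \row_j x ord0 (lift ord0 j).

Lemma measurable_rV_coord n (i : 'I_n) :
  measurable_fun setT (fun x : 'rV[R]_n => x ord0 i : measurableTypeR R).
Proof.
move=> _ Y mY; rewrite setTI; apply: sub_sigma_algebra => /=.
rewrite -bigcup_seq/=; exists i => /=; first by rewrite mem_index_enum.
by exists Y => //; rewrite setTI.
Qed.

Lemma measurable_fun_rV d (T : measurableType d) n (f : T -> 'rV[R]_n) :
  (forall i, measurable_fun setT (fun t => f t ord0 i : measurableTypeR R)) ->
  measurable_fun setT f.
Proof.
move=> mf _ Y mY; rewrite setTI.
pose F : set (set 'rV[R]_n) := [set A | measurable (f @^-1` A)].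
have : measurable `<=` F; last by move=> /(_ Y mY).
apply: smallest_sub.
  split => /=.
  - by rewrite /F/= preimage_set0.
  - by move=> A mA; rewrite /F/= setTD -preimage_setC; apply: measurableC.
  - by move=> A mA; rewrite /F/= preimage_bigcup; apply: bigcup_measurable => k _; exact: mA.
move=> A; rewrite -bigcup_seq => -[i _ [B mB <-]].
by rewrite /F/= setTI; have := mf i measurableT B mB; rewrite setTI.
Qed.

Lemma measurable_rV_cons n : measurable_fun setT (@rV_cons n).
Proof.
apply: measurable_fun_rV => i; case: (unliftP ord0 i) => [j|] ->.
  under eq_fun do rewrite mxE liftK.
  by apply: (measurableT_comp (measurable_rV_coord j)); exact: measurable_snd.
under eq_fun do rewrite mxE unlift_none.
exact: measurable_fst.
Qed.

Lemma measurable_rV_behead n : measurable_fun setT (@rV_behead n).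
Proof.
apply: measurable_fun_rV => i; under eq_fun do rewrite mxE.
exact: measurable_rV_coord.
Qed.

Definition rV_uncons n (x : 'rV[R]_n.+1) : measurableTypeR R * 'rV[R]_n :=
  (x ord0 ord0, rV_behead x).

Lemma rV_consK n : cancel (@rV_cons n) (@rV_uncons n).
Proof.
move=> [a y]; rewrite /rV_uncons mxE unlift_none/=; congr pair.
by apply/rowP => j; rewrite !mxE liftK.
Qed.

Lemma rV_unconsK n : cancel (@rV_uncons n) (@rV_cons n).
Proof.
move=> x; apply/rowP => i; rewrite mxE.
by case: (unliftP ord0 i) => [j|] -> //=; rewrite mxE.
Qed.

Lemma measurable_rV_uncons n : measurable_fun setT (@rV_uncons n).
Proof.
by apply: measurable_fun_pair; [exact: measurable_rV_coord|
  exact: measurable_rV_behead].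
Qed.

End rV_cons.

Section lebesgue_rV.
Variable R : realType.

Section cons.
Variables (n : nat) (mu : {sigma_finite_measure set 'rV[R]_n -> \bar R}).

Definition lebesgue_cons : set 'rV[R]_n.+1 -> \bar R :=
  pushforward (@lebesgue_measure R \x mu)%E (@rV_cons R n).

Let lebesgue_cons0 : lebesgue_cons set0 = 0%E.
Proof. by rewrite /lebesgue_cons /pushforward preimage_set0 measure0. Qed.

Let lebesgue_cons_ge0 A : (0 <= lebesgue_cons A)%E.
Proof. by rewrite /lebesgue_cons /pushforward; exact: measure_ge0. Qed.

Let lebesgue_cons_sigma_additive : semi_sigma_additive lebesgue_cons.
Proof.
have mf A : measurable A -> measurable (@rV_cons R n @^-1` A).
  by move=> mA; rewrite -[X in measurable X]setTI; exact: measurable_rV_cons.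
move=> F mF tF mUF; rewrite /lebesgue_cons /pushforward preimage_bigcup.
apply: measure_semi_sigma_additive.
- by move=> k; exact: mf.
- apply/trivIsetP => /= i j _ _ ij; rewrite -preimage_setI.
  by move/trivIsetP : tF => /(_ _ _ _ _ ij) ->//; rewrite preimage_set0.
- by rewrite -preimage_bigcup; exact: mf.
Qed.

HB.instance Definition _ := isMeasure.Build _ _ _ lebesgue_cons
  lebesgue_cons0 lebesgue_cons_ge0 lebesgue_cons_sigma_additive.

Let lebesgue_cons_sigma_finite : sigma_finite setT lebesgue_cons.
Proof.
have /sigma_finiteP[F [TF ndF Foo]] := sigma_finiteT (@lebesgue_measure R).
have /sigma_finiteP[G [TG ndG Goo]] := sigma_finiteT mu.
pose FG k := F k `*` G k.
have FGT : setT = \bigcup_k FG k.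
  rewrite -setXTT TF TG predeqE => -[x y]; split.
    move=> [/= [k _ Fkx] [l _ Gly]]; exists (maxn k l) => //; split.
    - by move: x Fkx; exact/subsetPset/ndF/leq_maxl.
    - by move: y Gly; exact/subsetPset/ndG/leq_maxr.
  by move=> [k _ []/= ? ?]; split; exists k.
exists (fun k => @rV_uncons R n @^-1` FG k).
  by rewrite -preimage_bigcup -FGT preimage_setT.
move=> k; have [mF Fk] := Foo k; have [mG Gk] := Goo k.
have mFG : measurable (FG k) by exact: measurableX.
split; first by rewrite -[X in measurable X]setTI; exact: measurable_rV_uncons.
rewrite /lebesgue_cons /pushforward -comp_preimage.
rewrite (_ : _ \o _ = id); last by apply/funext => x; exact: rV_consK.
rewrite preimage_id product_measure1E//.
by rewrite lte_mul_pinfty// ge0_fin_numE.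
Qed.

HB.instance Definition _ := Measure_isSigmaFinite.Build _ _ _ lebesgue_cons
  lebesgue_cons_sigma_finite.

End cons.

Fixpoint lebesgue_rV n : {sigma_finite_measure set 'rV[R]_n -> \bar R} :=
  match n with
  | 0 => \d_(0 : 'rV[R]_0)
  | m.+1 => lebesgue_cons (lebesgue_rV m)
  end.

End lebesgue_rV.

Lemma lebesgue_rV_prod (R : realType) n (A : 'I_n -> set (measurableTypeR R)) :
  (forall i, measurable (A i)) ->
  lebesgue_rV R n [set x : 'rV[R]_n | forall i, A i (x ord0 i)] =
  (\prod_(i < n) lebesgue_measure (A i))%E.
Proof.
elim: n A => [|n IHn] A mA.
  rewrite big_ord0 /= diracE.
  by rewrite (_ : [set _ | _] = setT) ?in_setT//; apply/seteqP; split=> // x _ [].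
have mB : measurable [set x : 'rV[R]_n | forall i, A (lift ord0 i) (x ord0 i)].
  rewrite (_ : [set _ | _] =
      \bigcap_(i in [set: 'I_n]) [set x : 'rV[R]_n | A (lift ord0 i) (x ord0 i)]).
    apply: fin_bigcap_measurable => // i _.
    rewrite -[X in measurable X]setTI.
    exact: (@measurable_rV_coord R n i measurableT _ (mA _)).
  by apply/seteqP; split=> x /= h i; [move=> _|]; exact: h.
rewrite big_ord_recl -IHn// -product_measure1E//=.
rewrite /lebesgue_cons /pushforward; congr product_measure1.
apply/seteqP; split=> -[a y] /=.
  move=> h; split; first by have := h ord0; rewrite mxE unlift_none.
  by move=> i; have := h (lift ord0 i); rewrite mxE liftK.
by move=> [h0 h] i; rewrite mxE; case: (unliftP ord0 i) => [j|] ->.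
Qed.

Section sobolev.
Variables (R : realType) (N : nat).

Local Notation RN := 'rV[R]_N.
Local Notation dx := (lebesgue_rV R N).
Implicit Types (u w g : RN -> R) (i : 'I_N).

Definition partial i (phi : RN -> R) : RN -> R := 'D_(delta_mx ord0 i) phi.

Definition smooth (phi : RN -> R) :=
  forall s : seq 'I_N, continuous (foldr partial phi s) /\
    forall i x, derivable (foldr partial phi s) x (delta_mx ord0 i).

Definition test_function (phi : RN -> R) :=
  smooth phi /\ compact (closure [set x | phi x != 0]).

Definition L2 : set (RN -> R) := [set u | u \in Lfun dx 2%:E].

Definition is_weak_partial i u g :=
  forall phi, test_function phi ->
    (\int[dx]_x (u x * partial i phi x)%:E =
     - \int[dx]_x (g x * phi x)%:E)%E.

Definition H1 : set (RN -> R) :=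
  [set u | L2 u /\ forall i, exists2 g, L2 g & is_weak_partial i u g].

(* A choice of representative: weak derivatives are unique up to dx-null sets. *)
Definition weak_partial i u : RN -> R :=
  xget (cst 0) [set g | L2 g /\ is_weak_partial i u g].

(* The norm `|x| on 'rV[R]_N is the sup norm, hence this definition. *)
Definition sqnorm (x : RN) : R := \sum_i x ord0 i ^+ 2.

Definition gaussians : set (RN -> R) :=
  [set w | exists (a : R) (b : RN),
    w = fun x => a * expR (- (pi / 2) * sqnorm (x - b))].

(* H^1(R^N) \ M, where elements of M are considered up to dx-a.e. equality. *)
Definition H1_not_gaussian : set (RN -> R) :=
  [set u | H1 u /\ ~ exists2 w, gaussians w & u = w %[ae dx]].

Definition normL2 u : \bar R := 'N[dx]_2%:E[EFin \o u].

Definition dirichlet u : \bar R :=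
  (\int[dx]_x (\sum_i weak_partial i u x ^+ 2)%:E)%E.

(* Since ln 0 = 0, the integrand is 0 where u vanishes. *)
Definition entropy u : \bar R :=
  (\int[dx]_x (u x ^+ 2 * ln (u x ^+ 2 / fine (normL2 u) ^+ 2))%:E)%E.

(* For u in H^1 the entropy is never +oo; if it is -oo, this is +oo. *)
Definition deficit u : \bar R :=
  (dirichlet u - pi%:E * entropy u
   - (N%:R * pi)%:E * \int[dx]_x (u x ^+ 2)%:E)%E.

Definition dist_gaussians u : \bar R :=
  ereal_inf [set normL2 (u \- w) | w in gaussians].

Definition quotient u : \bar R := (deficit u / dist_gaussians u ^+ 2)%E.

Definition sharp_constant : \bar R := ereal_inf (quotient @` H1_not_gaussian).

End sobolev.

(* Main.v *)
Require Import Defs.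
From HB Require Import structures.
From mathcomp Require Import all_boot all_order all_algebra.
From mathcomp Require Import all_classical all_reals all_analysis.
From mathcomp Require Import measurable_realfun.
From mathcomp Require Import ring lra.
Set Implicit Arguments.
Unset Strict Implicit.
Unset Printing Implicit Defensive.
Import Order.TTheory GRing.Theory Num.Theory.
Import numFieldNormedType.Exports.
Local Open Scope classical_set_scope.
Local Open Scope ring_scope.
Opaque pi.

(** Let q be the largest constant with q d^2 <= deficit on the C^1 functions of
    bounded support. Two Gaussians centred at +-beta e_1 give q < 2 pi ln 2: their
    interaction lowers the deficit below 2 pi ln 2 d^2 by an amount of order
    beta e^(-pi beta^2), while the overlap corrections are O(e^(-pi beta^2)).
    Near M the spectral gap beyond the first Hermite modes gives
    deficit >= 29/20 pi d^2 > 2 pi ln 2 d^2, so a minimising sequence stays away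
    from M. It is tight up to translation: otherwise cutting it along a slab of
    small mass splits it into two halves of masses a and b, and the mixing entropy
    pi ((a + b) ln (a + b) - a ln a - b ln b) >= 2 pi ln 2 min(a, b) exceeds
    what q < 2 pi ln 2 allows. The L^2 limit is then a minimiser: writing
    s^2 ln s^2 = s^2 ln (1 + s^2) - Phi(s) with 0 <= Phi <= 1, the first part is
    controlled by the gradient through the logarithmic Sobolev inequality, and
    the second passes to the limit by Fatou. *)

(** All estimates are proved for C^1 functions of bounded support carried with their gradient, where
    every integral is finite and integration by parts is exact; mollification, cut-offs and Fatou
    then reach H^1. Both the logarithmic Sobolev inequality and the Gaussian gap come from the line
    (monotone transport to the Gaussian; division by the second Hermite polynomial) and tensorise.
    Near M the obstacle is that s^2 ln s^2 has no quadratic bound at infinity. So v = u / gamma is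
    split into its smoothed excess t outside [0, 1] and the rest: the rest obeys the gap, and for t
    the logarithmic Sobolev inequality yields -tau ln tau, which beats any multiple of the small
    mass tau. In units of pi the second-order balance is 4 - 3 + 1 = 2; the losses leave 3/2, and
    29/20 lies between 2 ln 2 = 1.386... and 3/2. For the splitting, d^2 is the mass minus the
    largest squared overlap with a unit Gaussian. Each half overlaps at most its own mass, and up to
    a small error at most as much as u does, so the overlaps gain at most min(a, b): this costs q
    min(a, b), while the mixing entropy brings 2 pi ln 2 min(a, b). *)

Section integration.

(** * Real-valued integrals and the L^2 calculus *)

Context d (T : measurableType d) (R : realType) (mu : {measure set T -> \bar R}).
Implicit Types (f g h : T -> R) (a b c : R).

(** Integrals are taken in [R], with integrability as a separate fact, so that inequalities between
    them can be closed by [lra]; [Sq] plays the role of L^2. *)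
Definition Int f := mu.-integrable setT (EFin \o f).
Definition J f : R := \int[mu]_x f x.
Definition Sq f := measurable_fun setT f /\ Int (fun x => f x ^+ 2).

Lemma Int_meas f : Int f -> measurable_fun setT f.
Proof. by move=> /measurable_int/measurable_EFinP. Qed.

Lemma Int_dom f g : measurable_fun setT f -> Int g ->
  (forall x, `|f x| <= g x) -> Int f.
Proof.
move=> mf ig fg; apply: le_integrable ig => //; first exact/measurable_EFinP.
by move=> x _ /=; rewrite lee_fin (le_trans (fg x))// ler_norm.
Qed.

Lemma Int_abs f : Int f -> Int (fun x => `|f x|).
Proof. by move=> /integrable_abse. Qed.

Lemma Int_ext f g : f =1 g -> Int f -> Int g.
Proof. by move=> /funext ->. Qed.

Lemma IntD f g : Int f -> Int g -> Int (fun x => f x + g x).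
Proof. by move=> /(integrableD measurableT) h /h; apply: eq_integrable. Qed.

Lemma IntZ a f : Int f -> Int (fun x => a * f x).
Proof. by move=> /(integrableZl measurableT a); apply: eq_integrable. Qed.

Lemma IntN f : Int f -> Int (fun x => - f x).
Proof. by move=> /(IntZ (-1)); apply: Int_ext => x; rewrite mulN1r. Qed.

Lemma IntB f g : Int f -> Int g -> Int (fun x => f x - g x).
Proof. by move=> i /IntN; exact: IntD. Qed.

Lemma Int0 : Int (fun=> 0).
Proof. exact: integrable0. Qed.

Lemma Int_sum n (F : 'I_n -> T -> R) : (forall i, Int (F i)) ->
  Int (fun x => \sum_i F i x).
Proof.
elim: n F => [|n IH] F iF.
  by apply: Int_ext Int0 => x; rewrite big_ord0.
have := IntD (iF ord0) (IH (fun i => F (lift ord0 i)) (fun i => iF _)).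
by apply: Int_ext => x; rewrite big_ord_recl.
Qed.

Lemma J_ext f g : f =1 g -> J f = J g.
Proof. by move=> /funext ->. Qed.

Lemma JD f g : Int f -> Int g -> J (fun x => f x + g x) = J f + J g.
Proof. by move=> i j; rewrite /J RintegralD. Qed.

Lemma JZ a f : Int f -> J (fun x => a * f x) = a * J f.
Proof. by move=> i; rewrite /J RintegralZl. Qed.

Lemma JN f : Int f -> J (fun x => - f x) = - J f.
Proof.
by move=> i; rewrite -mulN1r -JZ//; apply: J_ext => x; rewrite mulN1r.
Qed.

Lemma JB f g : Int f -> Int g -> J (fun x => f x - g x) = J f - J g.
Proof. by move=> i j; rewrite /J RintegralB. Qed.

Lemma J0 : J (fun=> 0) = 0.
Proof. by rewrite /J /Rintegral integral0. Qed.

Lemma J_sum n (F : 'I_n -> T -> R) : (forall i, Int (F i)) ->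
  J (fun x => \sum_i F i x) = \sum_i J (F i).
Proof.
elim: n F => [|n IH] F iF.
  by rewrite big_ord0; under J_ext do rewrite big_ord0; exact: J0.
rewrite big_ord_recl -(IH (fun i => F (lift ord0 i)))// -JD//.
- by apply: J_ext => x; rewrite big_ord_recl.
- exact: Int_sum.
Qed.

Lemma J_le f g : Int f -> Int g -> (forall x, f x <= g x) -> J f <= J g.
Proof. by move=> i j h; apply: le_Rintegral. Qed.

Lemma J_ge0 f : (forall x, 0 <= f x) -> 0 <= J f.
Proof. by move=> h; apply: Rintegral_ge0. Qed.

Lemma J_abs f : Int f -> `|J f| <= J (fun x => `|f x|).
Proof. by move=> i; apply: le_normr_Rintegral. Qed.

Lemma J_absB f g h : Int f -> Int g -> Int h ->
  (forall x, `|f x - g x| <= h x) -> `|J f - J g| <= J h.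
Proof.
move=> i j k le; rewrite -JB// (le_trans (J_abs (IntB i j)))//.
by apply: J_le => //; apply: Int_abs; exact: IntB.
Qed.

Lemma JE f : Int f -> (\int[mu]_x (f x)%:E = (J f)%:E)%E.
Proof. by move=> i; rewrite /J /Rintegral fineK//; exact: integrable_fin_num. Qed.

Lemma Int_ge0 f B : measurable_fun setT f -> (forall x, 0 <= f x) ->
  (\int[mu]_x (f x)%:E <= B%:E)%E -> Int f /\ J f <= B.
Proof.
move=> mf f0 le; have i : Int f.
  apply/integrableP; split; first exact/measurable_EFinP.
  apply: le_lt_trans (ltry B); apply: le_trans le.
  apply: ge0_le_integral => //=.
  - by apply/measurable_EFinP; apply: measurableT_comp.
  - exact/measurable_EFinP.
  - by move=> x _; rewrite lee_fin ger0_norm.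
by split => //; rewrite -lee_fin -JE.
Qed.

Lemma J_eq0 f : Int f -> (forall x, 0 <= f x) -> J f = 0 ->
  {ae mu, forall x, f x = 0}.
Proof.
move=> i f0 Jf.
have : (\int[mu]_x `|(f x)%:E| = 0)%E.
  rewrite (_ : (fun x => _) = fun x => (f x)%:E) ?JE ?Jf//.
  by apply/funext => x /=; rewrite ger0_norm.
move/(ae_eq_integral_abs mu measurableT (measurable_int mu i)).
by apply: filterS => x /(_ I) /= [].
Qed.

Lemma J_ae f g : measurable_fun setT g -> Int f ->
  {ae mu, forall x, f x = g x} -> Int g /\ J g = J f.
Proof.
move=> mg i fg.
have fgE : ae_eq mu setT (EFin \o f) (EFin \o g).
  by apply: filterS fg => x e _ /=; rewrite e.
have mf := measurable_int mu i.
have mg' : measurable_fun setT (EFin \o g) by exact/measurable_EFinP.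
split; last first.
  by congr fine; apply: ae_eq_integral => //; apply: filterS fg => x e _ /=; rewrite e.
apply/integrableP; split => //.
case/integrableP : (i) => _; congr (_ < _)%E.
apply: ae_eq_integral => //; do ?[exact: measurableT_comp].
by apply: filterS fg => x e _ /=; rewrite e.
Qed.

Lemma dct (f_ : nat -> T -> R) f g : (forall n, measurable_fun setT (f_ n)) ->
  measurable_fun setT f -> Int g ->
  {ae mu, forall x, f_ n x @[n --> \oo] --> f x} ->
  (forall n x, `|f_ n x| <= g x) ->
  Int f /\ J (f_ n) @[n --> \oo] --> J f.
Proof.
move=> mf_ mf ig cf dom.
have [] := @dominated_convergence _ T R mu setT measurableT
  (fun n x => (f_ n x)%:E) (EFin \o f) (EFin \o g).
- by move=> n; exact/measurable_EFinP.
- exact/measurable_EFinP.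
- by apply: filterS cf => x cx _; apply: cvg_EFin => //; exact: nearW.
- exact: ig.
- by apply/nearW => x n _; rewrite /= lee_fin.
move=> iF _ cJ; split; first exact: iF.
have i_ n : Int (f_ n) by apply: Int_dom ig _.
by apply: (@fine_cvg _ _ _ _ (fun n => \int[mu]_x (f_ n x)%:E)%E); rewrite -JE.
Qed.

(** The bound on the integrals is required only eventually: the first N terms are discarded by the
    index shift in [F]. *)
Lemma fatouJ (f_ : nat -> T -> R) f B : (forall n, Int (f_ n)) ->
  (forall n x, 0 <= f_ n x) -> (forall x, 0 <= f x) ->
  measurable_fun setT f -> {ae mu, forall x, f_ n x @[n --> \oo] --> f x} ->
  (\forall n \near \oo, J (f_ n) <= B) -> Int f /\ J f <= B.
Proof.
move=> i_ f_0 f0 mf cf /= [N _ leB]; apply: Int_ge0 => //.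
pose F n x := (f_ (n + N)%N x)%:E.
have FE : ae_eq mu setT (EFin \o f) (fun x => limn_einf (F^~ x)).
  apply: filterS cf => x cx _ /=; apply/esym.
  have cF : F^~ x @ \oo --> (f x)%:E.
    apply: cvg_EFin; first exact: nearW.
    by rewrite (cvg_shiftn N (fun n => f_ n x)).
  by rewrite (is_cvg_limn_einfE (cvgP _ cF)); exact/cvg_lim.
have mF n : measurable_fun setT (F n).
  by apply/measurable_EFinP; exact: Int_meas.
have -> : (\int[mu]_x (f x)%:E = \int[mu]_x limn_einf (F^~ x))%E.
  apply: ae_eq_integral => //; first exact/measurable_EFinP.
  (* Measurability of the lower limit is that of minus the upper limit of the opposites. *)
  rewrite (_ : (fun x => _) = (fun x => - limn_esup (fun n => - F n x))%E).
    apply: measurableT_comp => //; apply: measurable_fun_limn_esup => n.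
    exact: measurableT_comp.
  by apply/funext => x; rewrite -limn_einfN; congr limn_einf; apply/funext => n; rewrite /comp oppeK.
apply: le_trans (fatou mu measurableT mF _) _.
  by move=> n x _; rewrite lee_fin.
rewrite (_ : (fun n => _) = EFin \o (fun n => J (f_ (n + N)%N))); last first.
  by apply/funext => n; rewrite /= /F JE.
rewrite limn_einf_lim; apply: lime_le; first exact: is_cvg_einfs.
apply/nearW => n; apply: (@le_trans _ _ (J (f_ (n + N)%N))%:E).
  by apply: ereal_inf_lbound; exists n => //=.
by rewrite lee_fin; apply: leB => /=; exact: leq_addl.
Qed.

(** For c > 0 the minimiser t = -b/c gives the claim; c < 0 is excluded because the polynomial is
    negative at a large K; for c = 0 a nonzero b would give the value -1. *)
Lemma quad_disc a b c : (forall t, 0 <= a + 2 * b * t + c * t ^+ 2) ->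
  b ^+ 2 <= a * c.
Proof.
move=> h; have [c0|c0|c0] := ltrgtP c 0.
- pose M : R := `|a| + `|b| + 1; exfalso.
  have M1 : 1 <= M by rewrite /M; have := normr_ge0 a; have := normr_ge0 b; lra.
  have [K [K1 KM]] : exists K, 1 <= K /\ 3 * M < - c * K.
    exists (1 + (3 * M + 1) / - c); split.
      by rewrite lerDl divr_ge0 ?oppr_ge0 ?ltW//; lra.
    rewrite (_ : - c * _ = - c + 3 * M + 1); last by field; rewrite lt_eqF.
    lra.
  have := h K; have := ler_norm a; have := ler_norm b; have := normr_ge0 b.
  have := normr_ge0 a.
  move: M1 KM; rewrite /M => *; nra.
- have := h (- b / c); rewrite expr2.
  rewrite (_ : _ + _ = a - b ^+ 2 / c); last by field; rewrite gt_eqF.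
  by rewrite subr_ge0 ler_pdivrMr.
- rewrite c0 mulr0; rewrite c0 in h.
  have [->|b0] := eqVneq b 0; first by rewrite expr0n.
  have := h (- (a + 1) / (2 * b)).
  rewrite (_ : _ + _ = -1); first by rewrite ler0N1.
  by field.
Qed.

Lemma Sq_meas f : Sq f -> measurable_fun setT f. Proof. by case. Qed.

Lemma Int_mul f g : Sq f -> Sq g -> Int (fun x => f x * g x).
Proof.
move=> [mf iF] [mg ig].
apply: (@Int_dom _ (fun x => f x ^+ 2 + g x ^+ 2)); first exact: measurable_funM.
  exact: IntD.
by move=> x; rewrite ler_norml; apply/andP; split; nra.
Qed.

Lemma Sq_dom f g : measurable_fun setT f -> Sq g ->
  (forall x, `|f x| <= `|g x|) -> Sq f.
Proof.
move=> mf [mg ig] le; split => //; apply: Int_dom ig _.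
  exact: measurable_funX.
by move=> x; rewrite normrX -(real_normK (num_real (g x))) lerXn2r ?nnegrE.
Qed.

Lemma SqZ a f : Sq f -> Sq (fun x => a * f x).
Proof.
move=> [mf iF]; split; first exact: measurable_funM.
by have := IntZ (a ^+ 2) iF; apply: Int_ext => x; rewrite exprMn.
Qed.

Lemma SqD f g : Sq f -> Sq g -> Sq (fun x => f x + g x).
Proof.
move=> sf sg; have [[mf iF] [mg ig]] := (sf, sg); split.
  exact: measurable_funD.
have := IntD (IntD iF (IntZ 2 (Int_mul sf sg))) ig.
by apply: Int_ext => x; rewrite sqrrD mulr_natl.
Qed.

Lemma SqN f : Sq f -> Sq (fun x => - f x).
Proof.
by move=> /(SqZ (-1)); congr Sq; apply/funext => x; rewrite mulN1r.
Qed.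

Lemma SqB f g : Sq f -> Sq g -> Sq (fun x => f x - g x).
Proof. by move=> sf /SqN; exact: SqD. Qed.

Lemma J_sqD a f g : Sq f -> Sq g -> J (fun x => (f x + a * g x) ^+ 2) =
  J (fun x => f x ^+ 2) + 2 * J (fun x => f x * g x) * a
  + J (fun x => g x ^+ 2) * a ^+ 2.
Proof.
move=> sf sg; have [[mf iF] [mg ig]] := (sf, sg).
rewrite (mulrAC 2) (mulrC (J _) (_ ^+ 2)) -(JZ (2 * a))//; last exact: Int_mul.
rewrite -JZ// -JD//; last by apply: IntZ; exact: Int_mul.
rewrite -JD//; last exact: IntZ.
  by apply: J_ext => x; ring.
by apply: IntD => //; apply: IntZ; exact: Int_mul.
Qed.

Lemma cauchy_schwarzJ f g : Sq f -> Sq g ->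
  J (fun x => f x * g x) ^+ 2 <= J (fun x => f x ^+ 2) * J (fun x => g x ^+ 2).
Proof.
move=> sf sg; apply: quad_disc => t; rewrite -J_sqD//.
by apply: J_ge0 => x; exact: sqr_ge0.
Qed.

Definition nrm f := Num.sqrt (J (fun x => f x ^+ 2)).

Lemma nrm_ge0 f : 0 <= nrm f. Proof. exact: sqrtr_ge0. Qed.

Lemma nrm_sq f : nrm f ^+ 2 = J (fun x => f x ^+ 2).
Proof. by rewrite sqr_sqrtr// J_ge0// => x; exact: sqr_ge0. Qed.

Lemma J_mul_le f g : Sq f -> Sq g -> `|J (fun x => f x * g x)| <= nrm f * nrm g.
Proof.
move=> sf sg; rewrite -(@ler_pXn2r _ 2)// ?nnegrE ?mulr_ge0 ?nrm_ge0//.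
by rewrite exprMn !nrm_sq real_normK ?num_real//; exact: cauchy_schwarzJ.
Qed.

Lemma nrmD f g : Sq f -> Sq g -> nrm (fun x => f x + g x) <= nrm f + nrm g.
Proof.
move=> sf sg; rewrite -(@ler_pXn2r _ 2)// ?nnegrE ?addr_ge0 ?nrm_ge0//.
have := J_sqD 1 sf sg; rewrite expr1n !mulr1 sqrrD !nrm_sq => e.
rewrite (J_ext (g := fun x => (f x + 1 * g x) ^+ 2)); last by move=> x; rewrite mul1r.
rewrite e lerD2r lerD2l mulr2n mulrDl mul1r lerD// (le_trans (ler_norm _))//;
exact: J_mul_le.
Qed.

Lemma nrmN f : nrm (fun x => - f x) = nrm f.
Proof. by congr Num.sqrt; apply: J_ext => x; rewrite sqrrN. Qed.

Lemma nrm_ext f g : f =1 g -> nrm f = nrm g.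
Proof. by move=> /funext ->. Qed.

Lemma nrmB f g : Sq f -> Sq g -> nrm f <= nrm g + nrm (fun x => f x - g x).
Proof.
move=> sf sg; have := nrmD sg (SqB sf sg); congr (_ <= _).
by apply: nrm_ext => x; rewrite addrC subrK.
Qed.

Lemma nrmC f g : nrm (fun x => f x - g x) = nrm (fun x => g x - f x).
Proof. by rewrite -nrmN; apply: nrm_ext => x; rewrite opprB. Qed.

Lemma nrm_dist f g : Sq f -> Sq g -> `|nrm f - nrm g| <= nrm (fun x => f x - g x).
Proof.
move=> sf sg; rewrite ler_norml; have := nrmB sf sg; have := nrmB sg sf.
by rewrite (nrmC g f); lra.
Qed.

Lemma nrm_tri f g h : Sq f -> Sq g -> Sq h ->
  nrm (fun x => f x - h x) <= nrm (fun x => f x - g x) + nrm (fun x => g x - h x).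
Proof.
move=> sf sg sh; have := nrmD (SqB sf sg) (SqB sg sh); congr (_ <= _).
by apply: nrm_ext => x; rewrite addrA subrK.
Qed.

End integration.

(** * Closure properties of continuous real functions *)

Section continuity.
Context (R : realType) (V : topologicalType).
Implicit Types (f g : V -> R).

Lemma cts_cst (c : R) : continuous (fun _ : V => c).
Proof. by move=> x; exact: cvg_cst. Qed.

Lemma ctsD f g : continuous f -> continuous g -> continuous (fun x => f x + g x).
Proof. by move=> cf cg x; apply: cvgD; [exact: cf|exact: cg]. Qed.

Lemma ctsN f : continuous f -> continuous (fun x => - f x).
Proof. by move=> cf x; apply: cvgN; exact: cf. Qed.

Lemma ctsB f g : continuous f -> continuous g -> continuous (fun x => f x - g x).
Proof. by move=> cf /ctsN; exact: ctsD. Qed.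

Lemma ctsM f g : continuous f -> continuous g -> continuous (fun x => f x * g x).
Proof. by move=> cf cg x; apply: cvgM; [exact: cf|exact: cg]. Qed.

Lemma ctsX n f : continuous f -> continuous (fun x => f x ^+ n).
Proof.
move=> cf; elim: n => [|n IH]; first exact: cts_cst.
by under eq_fun do rewrite exprS; exact: ctsM.
Qed.

Lemma ctsS n (F : 'I_n -> V -> R) :
  (forall i, continuous (F i)) -> continuous (fun x => \sum_i F i x).
Proof.
elim: n F => [|n IH] F cF.
  by under eq_fun do rewrite big_ord0; exact: cts_cst.
under eq_fun do rewrite big_ord_recl.
by apply: ctsD; [exact: cF|exact: IH].
Qed.

Lemma cts_norm f : continuous f -> continuous (fun x => `|f x|).
Proof. by move=> cf x; apply: cvg_norm; exact: cf. Qed.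

Lemma cts_comp (h : R -> R) f : continuous h -> continuous f ->
  continuous (fun x => h (f x)).
Proof. by move=> ch cf x; apply: continuous_comp; [exact: cf|exact: ch]. Qed.

Lemma cts_exp f : continuous f -> continuous (fun x => expR (f x)).
Proof. by apply: cts_comp => x; exact: continuous_expR. Qed.

End continuity.

(** * Coordinates, norms and Borel measurability on row vectors *)

Section row_vectors.
Context (R : realType).
Implicit Types (N n : nat).

Lemma coord_le_norm N (x : 'rV[R]_N) i : `|x ord0 i| <= `|x|.
Proof.
rewrite [leRHS]mx_normrE.
by apply: (@le_bigmax _ _ _ 0 (fun ij : 'I_1 * 'I_N => `|x ij.1 ij.2|) (ord0, i)).
Qed.

Lemma norm_le_coord N (x : 'rV[R]_N) M : 0 <= M ->
  (forall i, `|x ord0 i| <= M) -> `|x| <= M.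
Proof.
move=> M0 h; rewrite [leLHS]mx_normrE; apply: bigmax_le => // -[i j] _ /=.
by rewrite (ord1 i).
Qed.

Lemma sqnorm_ge0 N (x : 'rV[R]_N) : 0 <= sqnorm x.
Proof. by apply: sumr_ge0 => i _; exact: sqr_ge0. Qed.

Lemma coord_sq_le_sqnorm N (x : 'rV[R]_N) i : x ord0 i ^+ 2 <= sqnorm x.
Proof.
rewrite /sqnorm (bigD1 i)//= lerDl; apply: sumr_ge0 => j _; exact: sqr_ge0.
Qed.

Lemma norm_sq_le_sqnorm N (x : 'rV[R]_N) : `|x| ^+ 2 <= sqnorm x.
Proof.
rewrite -[leRHS]sqr_sqrtr ?sqnorm_ge0// lerXn2r ?nnegrE ?sqrtr_ge0//.
apply: norm_le_coord => [|i]; first exact: sqrtr_ge0.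
by rewrite -sqrtr_sqr ler_wsqrtr// coord_sq_le_sqnorm.
Qed.

Lemma continuous_sqnorm N : continuous (@sqnorm R N).
Proof.
by apply: ctsS => i; apply: ctsX; exact: coord_continuous.
Qed.

(** The sigma-algebra is generated by the coordinates; an open set belongs to it as the union of the
    countably many open cubes [B p] with rational centre and radius 1/(k+1) that it contains. *)
Lemma open_measurable_rV N (U : set 'rV[R]_N) : open U -> measurable U.
Proof.
move=> oU.
pose c (q : 'rV[rat]_N) : 'rV[R]_N := \row_i ratr (q ord0 i).
pose B (p : 'rV[rat]_N * nat) : set 'rV[R]_N :=
  [set x | forall i, `|x ord0 i - c p.1 ord0 i| < p.2.+1%:R^-1].
pose F p := if `[< B p `<=` U >] then B p else set0.
have mB p : measurable (B p).
  rewrite (_ : B p = \bigcap_(i in [set: 'I_N]) ((fun x : 'rV[R]_N =>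
    x ord0 i : measurableTypeR R) @^-1`
      `](c p.1 ord0 i - p.2.+1%:R^-1), (c p.1 ord0 i + p.2.+1%:R^-1)[)).
    apply: fin_bigcap_measurable => // i _; rewrite -[X in measurable X]setTI.
    by apply: measurable_rV_coord => //; exact: measurable_itv.
  apply/seteqP; split=> x /= h i.
    by move=> _; have := h i; rewrite ltr_distl /= in_itv.
  by have := h i I; rewrite ltr_distl /= in_itv.
have -> : U = \bigcup_p F p.
  apply/seteqP; split=> [x Ux|x [p _]]; last first.
    by rewrite /F; case: asboolP => // h; exact: h.
  have /nbhs_ballP[e /= e0 eU] : nbhs x U by exact: open_nbhs_nbhs.
  have [k kE] : exists k : nat, k.+1%:R^-1 < e / 2.
    exists (Num.truncn (e / 2)^-1).
    rewrite -[ltRHS]invrK ltf_pV2 ?posrE ?invr_gt0 ?divr_gt0// truncnS_gt//.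
  have kpos z : z - k.+1%:R^-1 < z + k.+1%:R^-1 :> R.
    by rewrite ltrBlDr -addrA ltrDl addr_gt0// invr_gt0 ltr0n.
  (* A rational centre within 1/(k+1) of x; since 1/(k+1) < e/2, its cube contains x and stays in
     the ball of radius e. *)
  pose q : 'rV[rat]_N := \row_i (xget 0 [set q | ratr q \in `](x ord0 i - k.+1%:R^-1), (x ord0 i + k.+1%:R^-1)[ ]).
  have qE i : `|x ord0 i - c q ord0 i| < k.+1%:R^-1.
    rewrite !mxE; case: xgetP => [r _ /=|/(_ _)].
      by rewrite in_itv/= -ltr_distlC.
    have [r rE] := @rat_in_itvoo R (x ord0 i - k.+1%:R^-1) (x ord0 i + k.+1%:R^-1)
      (kpos _).
    by move=> /(_ r).
  exists (q, k) => //; rewrite /F; case: asboolP => // -[] y yB; apply: eU.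
  split => // i j; have -> : i = ord0 by exact: ord1.
  rewrite /ball/=.
  apply: le_lt_trans (ler_distD (c q ord0 j) _ _) _.
  rewrite [e]splitr; apply: ltrD; apply: lt_trans kE; first exact: qE.
  by rewrite distrC; exact: (yB j).
apply: countable_bigcupT_measurable => [|p]; first exact: countableP.
by rewrite /F; case: ifP.
Qed.

Lemma continuous_measurable_rV N (f : 'rV[R]_N -> R) : continuous f ->
  measurable_fun setT f.
Proof.
move=> cf; apply: (measurability _ (RGenOInfty.measurableE R)).
move=> _ [_ [r ->] <-]; rewrite setTI; apply: open_measurable_rV.
by move/continuousP : cf; apply; exact: interval_open.
Qed.

Lemma continuous_measurable_R (f : R -> R) : continuous f ->
  measurable_fun setT f.
Proof.
by move=> cf; apply: open_continuous_measurable_fun; [exact: openT|move=> x _; exact: cf].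
Qed.

End row_vectors.

(** * Fubini's theorem for real-valued integrals *)

Section fubini.
Context (R : realType) d1 d2 (T1 : measurableType d1) (T2 : measurableType d2).
Context (m1 : {sigma_finite_measure set T1 -> \bar R}).
Context (m2 : {sigma_finite_measure set T2 -> \bar R}).
Implicit Types f : T1 * T2 -> R.

(** Integrability of every slice, and not of almost every one, makes the inner integral a function
    with values in [R]. *)
Lemma fubini12 f : Int (m1 \x m2)%E f -> (forall x, Int m2 (fun y => f (x, y))) ->
  Int m1 (fun x => J m2 (fun y => f (x, y))) /\
  J m1 (fun x => J m2 (fun y => f (x, y))) = J (m1 \x m2)%E f.
Proof.
move=> iF i2; have FE : fubini_F m2 (EFin \o f) =
    EFin \o (fun x => J m2 (fun y => f (x, y))).
  by apply/funext => x; rewrite /fubini_F /= JE.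
split; first by have := integrable_fubini_F iF; rewrite FE.
by rewrite /J /Rintegral -(integral12_prod_meas1 iF) FE.
Qed.

Lemma fubini21 f : Int (m1 \x m2)%E f -> (forall y, Int m1 (fun x => f (x, y))) ->
  J m2 (fun y => J m1 (fun x => f (x, y))) = J (m1 \x m2)%E f.
Proof.
move=> iF i1; have FE : fubini_G m1 (EFin \o f) =
    EFin \o (fun y => J m1 (fun x => f (x, y))).
  by apply/funext => y; rewrite /fubini_G /= JE.
by rewrite /J /Rintegral -(integral21_prod_meas1 iF) FE.
Qed.

End fubini.

Lemma ord01 : (0 : 'I_1) = ord0.
Proof. exact: val_inj. Qed.

(** * Translation invariance on the line *)

Section translation.
Context (R : realType).
Local Notation leb := (@lebesgue_measure R).

Lemma measurable_addR (c : R) :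
  measurable_fun setT (fun x : measurableTypeR R => x + c : measurableTypeR R).
Proof.
apply: continuous_measurable_R; apply: (@ctsD R R id); last exact: cts_cst.
by move=> x; exact: cvg_id.
Qed.

(** The translated measure agrees with Lebesgue measure on half-open intervals, hence everywhere by
    uniqueness. *)
Lemma lebesgue_measure_shift (c : R) (A : set (measurableTypeR R)) :
  measurable A -> pushforward leb (fun x => x + c) A = leb A.
Proof.
move=> mA; have mc := measurable_addR c.
pose m : {measure set (measurableTypeR R) -> \bar R} :=
  pushforward leb ((fun x => x + c) : measurableTypeR R -> measurableTypeR R).
apply/esym; apply: (lebesgue_measure_unique (mu := m mc)) => // X [[a b] _ <-].
rewrite /m /= /pushforward (_ : _ @^-1` _ = `](a - c), (b - c)]%classic).
  rewrite !lebesgue_measure_itv /= !lte_fin ltrD2r; case: ifPn => // _.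
  by rewrite -!EFinB; congr EFin; ring.
by apply/seteqP; split=> x /=; rewrite !in_itv/= ltrBlDr lerBrDr.
Qed.

Lemma ge0_integral_shiftR (f : measurableTypeR R -> \bar R) (c : R) :
  measurable_fun setT f -> (forall x, 0 <= f x)%E ->
  (\int[leb]_x f (x + c)%R = \int[leb]_x f x)%E.
Proof.
move=> mf f0; have mc := measurable_addR c.
pose m : {measure set (measurableTypeR R) -> \bar R} :=
  pushforward leb ((fun x => x + c) : measurableTypeR R -> measurableTypeR R).
transitivity (\int[m mc]_x f x)%E; last first.
  by apply: eq_measure_integral => A mA _; exact: lebesgue_measure_shift.
by rewrite (ge0_integral_pushforward mc).
Qed.

End translation.

(** * Iterated integrals and translations of row vectors *)

Section lebesgue_rV_integral.
Context (R : realType).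
Local Notation leb := (@lebesgue_measure R).
Implicit Types (n : nat).

Lemma ge0_integral_cons n (f : 'rV[R]_n.+1 -> \bar R) :
  measurable_fun setT f -> (forall x, 0 <= f x)%E ->
  (\int[lebesgue_rV R n.+1]_x f x =
   \int[leb]_a \int[lebesgue_rV R n]_y f (rV_cons (a, y)))%E.
Proof.
move=> mf f0; rewrite (ge0_integral_pushforward (@measurable_rV_cons R n))//.
rewrite preimage_setT (fubini_tonelli1 (f \o @rV_cons R n))//; last by move=> x /=.
by apply: measurableT_comp => //; exact: measurable_rV_cons.
Qed.

Lemma Int_cons n (f : 'rV[R]_n.+1 -> R) : Int (lebesgue_rV R n.+1) f ->
  Int (leb \x lebesgue_rV R n)%E (f \o @rV_cons R n).
Proof.
move=> iF; have mf := Int_meas iF.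
have mg : measurable_fun setT (f \o @rV_cons R n).
  by apply: measurableT_comp => //; exact: measurable_rV_cons.
apply/integrableP; split; first exact/measurable_EFinP.
case/integrableP : iF => _; congr (_ < _)%E.
rewrite (ge0_integral_pushforward (@measurable_rV_cons R n))// ?preimage_setT//.
by apply: measurableT_comp => //; exact/measurable_EFinP.
Qed.

Lemma J_cons n (f : 'rV[R]_n.+1 -> R) : Int (lebesgue_rV R n.+1) f ->
  J (leb \x lebesgue_rV R n)%E (f \o @rV_cons R n) = J (lebesgue_rV R n.+1) f.
Proof.
move=> iF; rewrite /J /Rintegral.
rewrite (integral_pushforward (@measurable_rV_cons R n))// ?preimage_setT//.
- exact: measurable_int iF.
- exact: Int_cons.
Qed.

Lemma fubini_cons n (f : 'rV[R]_n.+1 -> R) : Int (lebesgue_rV R n.+1) f ->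
  (forall a, Int (lebesgue_rV R n) (fun y => f (rV_cons (a, y)))) ->
  J (lebesgue_rV R n.+1) f = J leb (fun a => J (lebesgue_rV R n) (fun y => f (rV_cons (a, y)))).
Proof.
move=> iF i2; rewrite -(J_cons iF).
by have [_ ->] := fubini12 (Int_cons iF) i2.
Qed.

Lemma fubini_cons' n (f : 'rV[R]_n.+1 -> R) : Int (lebesgue_rV R n.+1) f ->
  (forall y, Int leb (fun a => f (rV_cons (a, y)))) ->
  J (lebesgue_rV R n.+1) f = J (lebesgue_rV R n) (fun y => J leb (fun a => f (rV_cons (a, y)))).
Proof.
by move=> iF i1; rewrite -(J_cons iF) -(fubini21 (Int_cons iF)).
Qed.

Lemma measurable_add_rV n (c : 'rV[R]_n) :
  measurable_fun setT (fun x : 'rV[R]_n => x + c).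
Proof.
apply: measurable_fun_rV => i; under eq_fun do rewrite mxE.
exact: (measurableT_comp (measurable_addR _) (measurable_rV_coord i)).
Qed.

(** Induction on the dimension: the tail is translated inside by the induction hypothesis, then the
    head by the one-dimensional case. *)
Lemma ge0_integral_shift n (f : 'rV[R]_n -> \bar R) (c : 'rV[R]_n) :
  measurable_fun setT f -> (forall x, 0 <= f x)%E ->
  (\int[lebesgue_rV R n]_x f (x + c)%R = \int[lebesgue_rV R n]_x f x)%E.
Proof.
elim: n f c => [|n IH] f c mf f0.
  by congr integral; apply/funext => x; congr f; apply/rowP => -[].
rewrite ge0_integral_cons; last 2 first.
- by apply: (measurableT_comp mf); exact: measurable_add_rV.
- by move=> x; exact: f0.
have mfc a : measurable_fun setT (fun y => f (rV_cons (a, y))).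
  apply: measurableT_comp => //; apply: measurableT_comp.
    exact: measurable_rV_cons.
  exact: measurable_pair1.
rewrite (ge0_integral_cons mf f0).
pose F a := (\int[lebesgue_rV R n]_y f (rV_cons (a, y)))%E.
transitivity (\int[leb]_a F (a + c ord0 ord0)%R)%E.
  congr integral; apply/funext => a; rewrite /F -[RHS](IH _ (rV_behead c))//.
  congr integral; apply/funext => y; congr f; apply/rowP => i; rewrite ord01 !mxE.
  by case: (unliftP ord0 i) => [j|] ->; rewrite /= ?mxE.
rewrite ge0_integral_shiftR// => [|x]; last exact: integral_ge0.
have := @measurable_fun_fubini_tonelli_F _ _ _ _ R (lebesgue_rV R n) (f \o @rV_cons R n).
apply; last by move=> x; exact: f0.
by apply: (measurableT_comp mf); exact: measurable_rV_cons.
Qed.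

Lemma Int_shift n (f : 'rV[R]_n -> R) (c : 'rV[R]_n) : Int (lebesgue_rV R n) f ->
  Int (lebesgue_rV R n) (fun x => f (x + c)).
Proof.
move=> iF; have mf := Int_meas iF.
have mg : measurable_fun setT (fun x : 'rV[R]_n => f (x + c)).
  by apply: measurableT_comp => //; exact: measurable_add_rV.
apply/integrableP; split; first exact/measurable_EFinP.
case/integrableP : iF => _; congr (_ < _)%E; apply/esym.
rewrite (@ge0_integral_shift _ (fun x => `|(f x)%:E|)%E c)//.
by apply: measurableT_comp => //; exact/measurable_EFinP.
Qed.

Lemma J_shift n (f : 'rV[R]_n -> R) (c : 'rV[R]_n) : Int (lebesgue_rV R n) f ->
  J (lebesgue_rV R n) (fun x => f (x + c)) = J (lebesgue_rV R n) f.
Proof.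
move=> iF; have mf := Int_meas iF.
(* Positive and negative parts, to which the Tonelli form of the invariance applies. *)
pose p x : R := 2^-1 * (`|f x| + f x); pose q x : R := 2^-1 * (`|f x| - f x).
have fE x : f x = p x - q x by rewrite /p /q; field.
have p0 x : 0 <= p x by rewrite /p; have := ler_norm (- f x); rewrite normrN; lra.
have q0 x : 0 <= q x by rewrite /q; have := ler_norm (f x); lra.
have ip : Int (lebesgue_rV R n) p by apply/IntZ/IntD => //; exact: Int_abs.
have iq : Int (lebesgue_rV R n) q by apply/IntZ/IntB => //; exact: Int_abs.
rewrite (J_ext _ fE) (_ : J _ (fun x : 'rV[R]_n => f (x + c)) =
  J (lebesgue_rV R n) (fun x : 'rV[R]_n => p (x + c) - q (x + c))); last exact: J_ext.
have pos g : Int (lebesgue_rV R n) g -> (forall x, 0 <= g x) ->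
    J (lebesgue_rV R n) (fun x => g (x + c)) = J (lebesgue_rV R n) g.
  move=> ig g0; congr fine.
  by rewrite (@ge0_integral_shift _ (EFin \o g) c)//; exact: measurable_int ig.
by rewrite (JB (Int_shift c ip) (Int_shift c iq)) (JB ip iq) !pos.
Qed.

End lebesgue_rV_integral.

(** * Continuous functions of bounded support *)

Section compact_support.
Context (R : realType) (V : normedModType R).
Implicit Types (f g : V -> R) (a : R).

(** A radius beyond which f vanishes is kept instead of a compact closure: it passes at once to
    products, slices and marginals. *)
Definition bsupp f := exists M : R, forall x, M < `|x| -> f x = 0.
Definition Cc f := continuous f /\ bsupp f.

Lemma bsupp_mul f g : bsupp f -> bsupp (fun x => f x * g x).
Proof. by move=> [M h]; exists M => x /h ->; rewrite mul0r. Qed.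

Lemma bsuppD f g : bsupp f -> bsupp g -> bsupp (fun x => f x + g x).
Proof.
move=> [M h] [M' h']; exists (Num.max M M') => x.
by rewrite gt_max => /andP[/h -> /h' ->]; rewrite addr0.
Qed.

Lemma bsupp_comp (k : R -> R) f : k 0 = 0 -> bsupp f -> bsupp (fun x => k (f x)).
Proof. by move=> k0 [M h]; exists M => x /h ->. Qed.

Lemma bsupp_pos f : bsupp f -> exists2 M : R, 0 < M & forall x, M < `|x| -> f x = 0.
Proof.
move=> [M h]; exists (Num.max M 1); first by rewrite lt_max ltr01 orbT.
by move=> x; rewrite gt_max => /andP[/h].
Qed.

Lemma Cc_cts f : Cc f -> continuous f. Proof. by case. Qed.

Lemma CcM f g : Cc f -> continuous g -> Cc (fun x => f x * g x).
Proof. by move=> [cf bf] cg; split; [exact: ctsM|exact: bsupp_mul]. Qed.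

Lemma CcMr f g : Cc g -> continuous f -> Cc (fun x => f x * g x).
Proof. by move=> cg cf; under eq_fun do rewrite mulrC; exact: CcM. Qed.

Lemma CcD f g : Cc f -> Cc g -> Cc (fun x => f x + g x).
Proof. by move=> [cf bf] [cg bg]; split; [exact: ctsD|exact: bsuppD]. Qed.

Lemma CcZ a f : Cc f -> Cc (fun x => a * f x).
Proof. by move=> cf; apply: CcMr => //; exact: cts_cst. Qed.

Lemma CcN f : Cc f -> Cc (fun x => - f x).
Proof. by move=> /(CcZ (-1)); under eq_fun do rewrite mulN1r. Qed.

Lemma CcB f g : Cc f -> Cc g -> Cc (fun x => f x - g x).
Proof. by move=> cf /CcN; exact: CcD. Qed.

Lemma CcX f n : Cc f -> Cc (fun x => f x ^+ n.+1).
Proof.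
by move=> cf; under eq_fun do rewrite exprS; apply: CcM => //; apply/ctsX/Cc_cts.
Qed.

Lemma Cc_comp (k : R -> R) f : continuous k -> k 0 = 0 -> Cc f ->
  Cc (fun x => k (f x)).
Proof. by move=> ck k0 [cf bf]; split; [exact: cts_comp|exact: bsupp_comp]. Qed.

(** Compactness of balls is abstracted so that the same two lemmas serve the line and row
    vectors. *)
Hypothesis ballK : forall M : R, compact [set x : V | `|x| <= M].

Lemma Cc_bounded f : Cc f -> exists2 C : R, 0 < C & forall x, `|f x| <= C.
Proof.
move=> [cf bf]; have [M M0 h] := bsupp_pos bf.
have K0 : [set x : V | `|x| <= M] !=set0 by exists 0; rewrite /= normr0 ltW.
have [|c _ hc] := @compact_EVT_max V R (fun x => `|f x|) _ K0 (@ballK M).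
  by apply: continuous_subspaceT; exact: cts_norm.
exists (`|f c| + 1) => [|x]; first exact: ltr_wpDl.
have [xM|xM] := leP `|x| M; last by rewrite (h _ xM) normr0 addr_ge0.
by rewrite (le_trans (hc x _)) ?lerDl// inE.
Qed.

(** Compactness of the ball of radius M + 1 gives a common modulus; the margin 1 ensures that, when
    x lies outside, both values vanish. *)
Lemma Cc_unif f : Cc f -> forall e : R, 0 < e ->
  exists2 d : R, 0 < d & forall x y, `|x - y| < d -> `|f x - f y| < e.
Proof.
move=> [cf bf] e e0; have [M M0 h] := bsupp_pos bf.
have := @compact_near_coveringP V [set x : V | `|x| <= M + 1].
move=> [/(_ (@ballK _)) + _] => /(_ R 0^'+ (fun d x => forall y, `|x - y| < d -> `|f x - f y| < e)).
case.
- move=> x _; have : \forall y \near x, `|f x - f y| < e / 2.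
    by have /cvgrPdist_lt/(_ (e / 2)) := cf x; apply; rewrite divr_gt0.
  move=> /nbhs_ballP[r /= r0 hr].
  exists (ball x (r / 2), [set d : R | d < r / 2]).
    split => /=; first by apply: nbhsx_ballx; rewrite divr_gt0.
    by apply: nbhs_right_lt; rewrite divr_gt0.
  move=> -[z d] /= [xz dr] y zy.
  have fz : `|f x - f z| < e / 2.
    by apply: hr; apply: le_ball xz; rewrite ler_pdivrMr//; lra.
  have fy : `|f x - f y| < e / 2.
    apply: hr; rewrite -ball_normE/= (le_lt_trans (ler_distD z _ _))//.
    by rewrite [r]splitr ltrD//; [rewrite -ball_normE in xz|exact: lt_trans dr].
  rewrite (le_lt_trans (ler_distD (f x) _ _))// [e]splitr ltrD//.
  by rewrite distrC.
move=> d /= d0 hd; exists (Num.min (d / 2) 1).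
  by rewrite lt_min divr_gt0//=.
move=> x y; rewrite lt_min => /andP[xyd xy1].
have hd2 := hd (d / 2); have {hd2} hd2 : forall x, `|x| <= M + 1 -> forall y, `|x - y| < d / 2 -> `|f x - f y| < e.
  move=> z zM w; apply: hd2 => //=; last by rewrite divr_gt0.
  by rewrite sub0r normrN gtr0_norm ?divr_gt0// ltr_pdivrMr//; lra.
have [xM|xM] := leP `|x| (M + 1); first exact: hd2.
rewrite (h x); last lra.
rewrite (h y) ?subrr ?normr0//.
have := ler_normD y (x - y); rewrite addrC subrK; lra.
Qed.

End compact_support.

(** * Integrability of continuous functions of bounded support *)

Section compact_support_Int.
Context (R : realType).
Local Notation leb := (@lebesgue_measure R).
Implicit Types (n : nat).

Lemma ball_compactR (M : R) : compact [set x : R | `|x| <= M].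
Proof.
rewrite (_ : [set _ | _] = `[- M, M]%classic); first exact: segment_compact.
by apply/seteqP; split=> x /=; rewrite in_itv/= ler_norml.
Qed.

Lemma ball_compact_rV n (M : R) : compact [set x : 'rV[R]_n | `|x| <= M].
Proof.
have [M0|M0] := ltP M 0.
  rewrite (_ : [set _ | _] = set0); first exact: compact0.
  by apply/seteqP; split=> x //=; rewrite leNgt (lt_le_trans M0).
rewrite (_ : [set _ | _] =
    [set v : 'rV[R]_n | forall i, `[- M, M]%classic (v ord0 i)]).
  apply: (@rV_compact R n (fun=> `[- M, M]%classic)) => i.
  exact: segment_compact.
apply/seteqP; split=> x /= h.
  by move=> i; rewrite in_itv/= -ler_norml; exact: le_trans (coord_le_norm x i) h.
by apply: norm_le_coord => // i; have := h i; rewrite in_itv/= -ler_norml.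
Qed.

Lemma Int_indic d (T : measurableType d) (mu : {measure set T -> \bar R}) A :
  measurable A -> (mu A < +oo)%E -> Int mu \1_A.
Proof.
move=> mA fA; apply/integrableP; split.
  by apply/measurable_EFinP; exact: measurable_indic.
rewrite (_ : (fun x => _) = (fun x => (\1_A x)%:E)); last first.
  by apply/funext => x /=; rewrite ger0_norm.
by rewrite integral_indic// setIT.
Qed.

Definition box n (M : R) : set 'rV[R]_n :=
  [set x | forall i, `[- M, M]%classic (x ord0 i)].

Lemma lebesgue_rV_box n (M : R) :
  measurable (@box n M) /\ (lebesgue_rV R n (@box n M) < +oo)%E.
Proof.
split.
  rewrite (_ : @box n M = \bigcap_(i in [set: 'I_n]) ((fun x : 'rV[R]_n =>
    x ord0 i : measurableTypeR R) @^-1` `[- M, M]%classic)).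
    apply: fin_bigcap_measurable => // i _; rewrite -[X in measurable X]setTI.
    by apply: measurable_rV_coord => //; exact: measurable_itv.
  by apply/seteqP; split=> x /= h i; [move=> _; exact: h|exact: h].
rewrite /box (lebesgue_rV_prod (A := fun=> `[- M, M]%classic))//.
rewrite (_ : (\prod_(i < n) _)%E = (\prod_(i < n) (Num.max (M + M) 0))%:E) ?ltry//.
elim/big_ind2 : _ => // [x1 x2 y1 y2 -> ->|i _]; first by rewrite EFinM.
rewrite lebesgue_measure_itv /= lte_fin; case: ifPn => h.
  by rewrite max_l -?EFinB ?opprK//; lra.
by rewrite max_r//; rewrite -leNgt in h; lra.
Qed.

Lemma Cc_IntR (f : R -> R) : Cc f -> Int leb f.
Proof.
move=> cf; have [C C0 hC] := Cc_bounded ball_compactR cf.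
have [M M0 h] := bsupp_pos cf.2.
have mB : measurable (`[- M, M]%classic : set (measurableTypeR R)) by [].
have fB : (leb `[(- M)%R, M%R]%classic < +oo)%E.
  by rewrite lebesgue_measure_itv /=; case: ifPn => // _; rewrite -EFinB ltry.
apply: (Int_dom _ (IntZ C (Int_indic mB fB))).
- by apply: continuous_measurable_R; exact: Cc_cts.
- move=> x; rewrite indicE; case: (boolP (x \in _)) => [_|].
    by rewrite mulr1.
  rewrite notin_setE /= in_itv/= -ler_norml => /negP; rewrite -ltNge => /h ->.
  by rewrite normr0 mulr0.
Qed.

Lemma Cc_Int n (f : 'rV[R]_n -> R) : Cc f -> Int (lebesgue_rV R n) f.
Proof.
move=> cf; have [C C0 hC] := Cc_bounded (@ball_compact_rV n) cf.
have [M M0 h] := bsupp_pos cf.2; have [mB fB] := lebesgue_rV_box n M.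
apply: (Int_dom _ (IntZ C (Int_indic mB fB))).
- by apply: continuous_measurable_rV; exact: Cc_cts.
- move=> x; rewrite indicE; case: (boolP (x \in _)) => [_|].
    by rewrite mulr1.
  rewrite notin_setE /= => xB; rewrite (h x) ?normr0 ?mulr0// ltNge; apply/negP.
  move=> xM; apply: xB => i; rewrite /= in_itv/= -ler_norml.
  exact: le_trans (coord_le_norm x i) xM.
Qed.

Lemma Cc_Sq n (f : 'rV[R]_n -> R) : Cc f -> Sq (lebesgue_rV R n) f.
Proof.
move=> cf; split; first by apply: continuous_measurable_rV; exact: Cc_cts.
by apply: Cc_Int; exact: (CcX 1).
Qed.

End compact_support_Int.

(** * Calculus of one variable *)

Section one_dimensional_calculus.
Context (R : realType).
Local Notation leb := (@lebesgue_measure R).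
Implicit Types (f F : R -> R).

Lemma is_derive_continuous f (df x : R) : is_derive x 1 f df -> {for x, continuous f}.
Proof.
by move=> h; apply: differentiable_continuous; apply/derivable1_diffP; exact: ex_derive.
Qed.

(** Derivatives are assembled from [dD], [dM], [dX] and the like, then matched with the expected
    function and value through this lemma. *)
Lemma dE f g (x a b : R) : is_derive x 1 f a -> f =1 g -> a = b -> is_derive x 1 g b.
Proof. by move=> h /funext <- <-. Qed.

Lemma dcst (c x : R) : is_derive x 1 (fun=> c) (0 : R).
Proof. exact: is_derive_cst. Qed.

Lemma did (x : R) : is_derive x 1 (fun t : R => t) (1 : R).
Proof. exact: is_derive_id. Qed.

Lemma dD f g (x a b : R) : is_derive x 1 f a -> is_derive x 1 g b ->
  is_derive x 1 (fun t => f t + g t) (a + b).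
Proof. by move=> df dg; exact: (is_deriveD df dg). Qed.

Lemma dN f (x a : R) : is_derive x 1 f a -> is_derive x 1 (fun t => - f t) (- a).
Proof. by move=> df; exact: (is_deriveN df). Qed.

Lemma dB f g (x a b : R) : is_derive x 1 f a -> is_derive x 1 g b ->
  is_derive x 1 (fun t => f t - g t) (a - b).
Proof. by move=> df /dN; exact: dD. Qed.

Lemma dM f g (x a b : R) : is_derive x 1 f a -> is_derive x 1 g b ->
  is_derive x 1 (fun t => f t * g t) (a * g x + f x * b).
Proof.
move=> df dg; apply: dE (is_deriveM df dg) _ _ => //.
by rewrite /GRing.scale /=; ring.
Qed.

Lemma dcomp (k f : R -> R) (x a b : R) : is_derive (f x) 1 k a ->
  is_derive x 1 f b -> is_derive x 1 (fun t => k (f t)) (a * b).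
Proof. by move=> dk df; exact: (is_derive1_comp dk df). Qed.

Lemma dX n f (x a : R) : is_derive x 1 f a ->
  is_derive x 1 (fun t => f t ^+ n) (n%:R * f x ^+ n.-1 * a).
Proof.
move=> df; elim: n => [|n IH]; first by apply: dE (dcst 1 x) _ _ => //; ring.
apply: dE (dM df IH) _ _ => [t|]; first by rewrite exprS.
by case: n {IH} => [|n] /=; rewrite ?expr0 ?exprS -?[in RHS]natr1; ring.
Qed.

Lemma dV f (x a : R) : f x != 0 -> is_derive x 1 f a ->
  is_derive x 1 (fun t => (f t)^-1) (- a / f x ^+ 2).
Proof.
move=> f0 df; have := is_deriveV f0 df.
by move=> h; apply: (dE h) => //; rewrite /GRing.scale /= mulrC mulrN mulNr.
Qed.

Lemma dexp f (x a : R) : is_derive x 1 f a ->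
  is_derive x 1 (fun t => expR (f t)) (expR (f x) * a).
Proof. by move=> df; apply: dcomp df; exact: is_derive_expR. Qed.

Lemma dln f (x a : R) : 0 < f x -> is_derive x 1 f a ->
  is_derive x 1 (fun t => ln (f t)) ((f x)^-1 * a).
Proof. by move=> f0 df; apply: dcomp df; exact: is_derive1_ln. Qed.

Lemma is_derive_cts f (df : R -> R) : (forall x : R, is_derive x 1 f (df x)) -> continuous f.
Proof. by move=> h x; exact: is_derive_continuous (h x). Qed.

Lemma FTC_itv F f a b : (forall x : R, is_derive x 1 F (f x)) -> continuous f ->
  a < b -> (\int[leb]_(x in `[a, b]) (f x)%:E = (F b - F a)%:E)%E.
Proof.
move=> dF cf ab; rewrite EFinB; apply: continuous_FTC2 => //.
- exact: continuous_subspaceT.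
- have cF := is_derive_cts dF; split.
  + by move=> x _; exact: ex_derive.
  + by apply: cvg_at_right_filter; exact: cF.
  + by apply: cvg_at_left_filter; exact: cF.
- by move=> x _; rewrite derive1E; exact: derive_val.
Qed.

Lemma J_itv f (M : R) : (forall x, M < `|x| -> f x = 0) ->
  J leb f = fine (\int[leb]_(x in `[(- M)%R, M]) (f x)%:E)%E.
Proof.
move=> h; congr fine; rewrite [RHS]integral_mkcond; congr integral.
apply/funext => x; rewrite patchE; case: ifPn => //.
rewrite notin_setE /= in_itv/= -ler_norml => /negP; rewrite -ltNge => /h ->.
by [].
Qed.

Lemma is_derive_bsupp f df : (forall x : R, is_derive x 1 f (df x)) -> bsupp f ->
  bsupp df.
Proof.
move=> d [M h]; exists M => x xM; rewrite -(@derive_val _ _ _ _ _ _ _ (d x)).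
rewrite -[RHS](@derive_val _ _ _ _ _ _ _ (dcst 0 x)); apply: near_eq_derive.
have : \forall y \near x, M < `|y|.
  by exact: (@cvgr_gt _ _ _ _ _ _ (@norm_continuous R R x) _ xM).
by apply: filterS => y /h.
Qed.

Lemma J_derive0 f df : (forall x : R, is_derive x 1 f (df x)) -> continuous df ->
  bsupp f -> J leb df = 0.
Proof.
move=> d cdf bf; have [M M0 h] := bsupp_pos bf.
have [M' M'0 h'] := bsupp_pos (is_derive_bsupp d bf).
pose K := M + M' + 1.
rewrite (@J_itv _ K) => [|x xK]; last by apply: h'; apply: lt_trans xK; rewrite /K; lra.
rewrite (FTC_itv d)//; last by rewrite /K; lra.
have K0 : 0 < K by rewrite /K; lra.
by rewrite /= !h ?subrr// ?normrN gtr0_norm// /K; lra.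
Qed.

Lemma is_derive_cvg (g : R -> R) (c l : R) : is_derive c 1 g l ->
  h^-1 *: (g (h + c) - g c) @[h --> (0 : R)^'] --> l.
Proof.
move=> dg; have := @ex_derive _ _ _ _ _ _ _ dg.
rewrite -[X in _ --> X](@derive_val _ _ _ _ _ _ _ dg).
move=> /cvg_ex[l' hl']; have := cvg_lim (@Rhausdorff R) hl'.
rewrite /derive => ->; move: hl'.
by under eq_fun do rewrite /= [_%:A]mulr1.
Qed.

(** Serves to remove the singularity of a quotient at a zero of g, where g is O(|x - c|). *)
Lemma is_derive_lipschitz_at (g : R -> R) (c l : R) : is_derive c 1 g l -> g c = 0 ->
  exists2 C : R, 0 < C & \forall x \near c, `|g x| <= C * `|x - c|.
Proof.
move=> /is_derive_cvg dg gc; exists (`|l| + 1); first exact: ltr_wpDl.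
have : \forall h \near (0 : R)^', `|h^-1 *: (g (h + c) - g c)| <= `|l| + 1.
  apply: (@cvgr_le _ _ _ _ _ `|l|); first exact: cvg_norm.
  by rewrite ltrDl.
move=> /nbhs_ballP[e /= e0 he]; apply/nbhs_ballP; exists e => //= x xe.
have [->|xc] := eqVneq x c; first by rewrite gc normr0 mulr_ge0// addr_ge0.
have := he (x - c); rewrite subrK gc subr0 normrZ normfV.
rewrite /ball/= sub0r normrN distrC subr_eq0 => /(_ xe xc).
have xc0 : 0 < `|c - x| by rewrite normr_gt0 subr_eq0 eq_sym.
by rewrite mulrC ler_pdivrMr.
Qed.

(** The difference quotients from the left and from the right have the same limit l. *)
Lemma is_derive_glue (f f1 f2 : R -> R) (c l : R) :
  (forall x, x <= c -> f x = f1 x) -> (forall x, c <= x -> f x = f2 x) ->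
  is_derive c 1 f1 l -> is_derive c 1 f2 l -> is_derive c 1 f l.
Proof.
move=> e1 e2 d1 d2.
have hf : h^-1 *: (f (h + c) - f c) @[h --> (0 : R)^'] --> l.
  have k1 := is_derive_cvg d1; have k2 := is_derive_cvg d2.
  apply/cvgrPdist_lt => e e0.
  move/cvgrPdist_lt : k1 => /(_ e e0) k1; move/cvgrPdist_lt : k2 => /(_ e e0) k2.
  near=> h; have [h0|h0] := leP h 0.
    by rewrite !e1 ?lexx//; [near: h|lra].
  by rewrite !e2 ?lexx//; [near: h|lra].
have hf' : h^-1 *: ((f \o shift c) (h *: (1 : R)) - f c) @[h --> (0 : R)^'] --> l.
  by under eq_fun do rewrite /= [_%:A]mulr1.
by split; [apply/cvg_ex; exists l|exact: cvg_lim].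
Unshelve. all: by end_near.
Qed.

End one_dimensional_calculus.

(** * Partial derivatives and C^1 functions with explicit gradient *)

Section partial_derivatives.
Context (R : realType) (N : nat).
Local Notation mu := (lebesgue_rV R N).
Implicit Types (u v : 'rV[R]_N -> R) (g h : 'I_N -> 'rV[R]_N -> R).

Definition e_ (i : 'I_N) : 'rV[R]_N := delta_mx ord0 i.

(** The derivative is that of a function of one real variable at 0, so the rules of one-variable
    calculus apply as they stand; the gradient is data and not the value of a choice operator. *)
Definition pd i u (g : 'rV[R]_N -> R) :=
  forall x, is_derive (0 : R) 1 (fun s : R => u (x + s *: e_ i)) (g x).

Definition C1 u g :=
  [/\ continuous u, forall i, continuous (g i) & forall i, pd i u (g i)].

Definition C1c u g := C1 u g /\ bsupp u.

Lemma pd_line i u (g : 'rV[R]_N -> R) x (s : R) : pd i u g ->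
  is_derive s 1 (fun t : R => u (x + t *: e_ i)) (g (x + s *: e_ i)).
Proof.
move=> d; have := d (x + s *: e_ i) => ds.
have e : (fun t : R => u (x + t *: e_ i)) =
    (fun t => u (x + s *: e_ i + t *: e_ i)) \o (fun t => t - s).
  by apply/funext => t /=; rewrite -addrA -scalerDl (addrC s) subrK.
rewrite e -[g _]mulr1; apply: is_derive1_comp; first by rewrite subrr.
by rewrite -[X in is_derive _ _ _ X]subr0; apply: is_deriveB.
Qed.

Lemma coord_line (x : 'rV[R]_N) s i j :
  (x + s *: e_ i) ord0 j = x ord0 j + s * (i == j)%:R.
Proof. by rewrite !mxE eqxx /= eq_sym. Qed.

Lemma continuous_line (x : 'rV[R]_N) i : continuous (fun s : R => x + s *: e_ i).
Proof.
move=> s; apply: cvgD; first exact: cvg_cst.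
by apply: cvgZl; exact: cvg_id.
Qed.

Lemma C1_ext u v g h : u =1 v -> g =2 h -> C1 u g -> C1 v h.
Proof.
by move=> /funext -> gh; have -> : g = h by apply/funext => i; exact/funext/(gh i).
Qed.

Lemma C1_cst (c : R) : C1 (fun=> c) (fun _ _ => 0).
Proof.
by split=> [|i|i x]; [exact: cts_cst|exact: cts_cst|exact: is_derive_cst].
Qed.

Lemma C1D u v g h : C1 u g -> C1 v h ->
  C1 (fun x => u x + v x) (fun i x => g i x + h i x).
Proof.
move=> [cu cg dg] [cv ch dh]; split=> [|i|i x]; [exact: ctsD|exact: ctsD|].
exact: (dD (dg i x) (dh i x)).
Qed.

Lemma C1M u v g h : C1 u g -> C1 v h ->
  C1 (fun x => u x * v x) (fun i x => g i x * v x + u x * h i x).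
Proof.
move=> [cu cg dg] [cv ch dh]; split=> [|i|i x]; first exact: ctsM.
  by apply: ctsD; exact: ctsM.
by apply: dE (dM (dg i x) (dh i x)) _ _ => //; rewrite scale0r addr0.
Qed.

Lemma C1Z (c : R) u g : C1 u g -> C1 (fun x => c * u x) (fun i x => c * g i x).
Proof.
move=> ug; apply: C1_ext (C1M (C1_cst c) ug) => // i x.
by rewrite mul0r add0r.
Qed.

Lemma C1N u g : C1 u g -> C1 (fun x => - u x) (fun i x => - g i x).
Proof.
by move=> /(C1Z (-1)); apply: C1_ext => [x|i x]; rewrite mulN1r.
Qed.

Lemma C1B u v g h : C1 u g -> C1 v h ->
  C1 (fun x => u x - v x) (fun i x => g i x - h i x).
Proof. by move=> ug /C1N; exact: C1D. Qed.

Lemma C1_comp (k dk : R -> R) u g : (forall x : R, is_derive x 1 k (dk x)) ->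
  continuous dk -> C1 u g -> C1 (fun x => k (u x)) (fun i x => dk (u x) * g i x).
Proof.
move=> dK cdk [cu cg dg]; split=> [|i|i x].
- by apply: cts_comp => //; exact: is_derive_cts dK.
- by apply: ctsM => //; exact: cts_comp.
- have := @dcomp R k (fun s : R => u (x + s *: e_ i)) 0 (dk (u x)) (g i x).
  by rewrite /= scale0r addr0; apply; exact: dg.
Qed.

Lemma C1_sum n (U : 'I_n -> 'rV[R]_N -> R) (G : 'I_n -> 'I_N -> 'rV[R]_N -> R) :
  (forall k, C1 (U k) (G k)) ->
  C1 (fun x => \sum_k U k x) (fun i x => \sum_k G k i x).
Proof.
elim: n U G => [|n IH] U G h.
  by apply: C1_ext (C1_cst 0) => [x|i x]; rewrite big_ord0.
apply: C1_ext (C1D (h ord0) (IH _ _ (fun k => h (lift ord0 k)))) => [x|i x];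
by rewrite big_ord_recl.
Qed.

Lemma C1_coord j : C1 (fun x => x ord0 j) (fun i _ => (i == j)%:R).
Proof.
split=> [|i|i x]; [exact: coord_continuous|exact: cts_cst|].
apply: dE (dD (dcst (x ord0 j) 0) (dM (did 0) (dcst (i == j)%:R 0))) _ _ => [s|].
  by rewrite coord_line.
by ring.
Qed.

Lemma C1_sqnorm : C1 (@sqnorm R N) (fun i x => 2 * x ord0 i).
Proof.
apply: C1_ext (C1_sum (fun j => C1M (C1_coord j) (C1_coord j))) => [x|i x].
  by apply: eq_bigr => j _; rewrite expr2.
rewrite (bigD1 i)//= big1 => [|j ji]; last by rewrite eq_sym (negPf ji) mul0r mulr0 addr0.
by rewrite eqxx mul1r mulr1 addr0; ring.
Qed.

Lemma C1_exp u g : C1 u g -> C1 (fun x => expR (u x)) (fun i x => expR (u x) * g i x).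
Proof.
by move=> ug; apply: C1_comp ug => x; exact: continuous_expR.
Qed.

Lemma C1_gauss (c : R) : C1 (fun x => expR (c * sqnorm x))
  (fun i x => 2 * c * x ord0 i * expR (c * sqnorm x)).
Proof.
by apply: C1_ext (C1_exp (C1Z c C1_sqnorm)) => // i x; ring.
Qed.

Lemma e_norm i : `|e_ i| <= 1.
Proof.
by apply: norm_le_coord => // j; rewrite !mxE; case: (_ && _); rewrite ?normr1 ?normr0.
Qed.

Lemma pd_bsupp i u (g : 'rV[R]_N -> R) : pd i u g -> bsupp u -> bsupp g.
Proof.
move=> d [M h]; exists M => x xM; have dx := d x.
rewrite -(@derive_val _ _ _ _ _ _ _ dx) -[RHS](@derive_val _ _ _ _ _ _ _ (dcst 0 0)).
apply: near_eq_derive.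
have : \forall y \near (0 : R), M < `|x + y *: e_ i|.
  have nc : `|x + y *: e_ i| @[y --> (0 : R)] --> `|x + 0 *: e_ i|.
    by apply: cvg_norm; exact: continuous_line.
  by apply: (@cvgr_gt _ _ _ _ _ _ nc); rewrite scale0r addr0.
by apply: filterS => y /h.
Qed.

Lemma C1c_Cc u g : C1c u g -> Cc u. Proof. by move=> [[cu _ _] bu]. Qed.

Lemma C1c_Ccd u g i : C1c u g -> Cc (g i).
Proof. by move=> [[_ cg dg] bu]; split; [exact: cg|exact: pd_bsupp (dg i) bu]. Qed.

Lemma C1cM u v g h : C1c u g -> C1 v h ->
  C1c (fun x => u x * v x) (fun i x => g i x * v x + u x * h i x).
Proof. by move=> [ug bu] vh; split; [exact: C1M|exact: bsupp_mul]. Qed.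

Lemma C1cD u v g h : C1c u g -> C1c v h ->
  C1c (fun x => u x + v x) (fun i x => g i x + h i x).
Proof. by move=> [ug bu] [vh bv]; split; [exact: C1D|exact: bsuppD]. Qed.

Lemma C1c_ext u v g h : u =1 v -> g =2 h -> C1c u g -> C1c v h.
Proof.
by move=> uv gh [ug bu]; split; [exact: C1_ext ug|rewrite -(funext uv)].
Qed.

Lemma C1cZ (c : R) u g : C1c u g -> C1c (fun x => c * u x) (fun i x => c * g i x).
Proof.
move=> /C1cM/(_ (C1_cst c)); apply: C1c_ext => [x|i x]; first by rewrite mulrC.
by rewrite mulr0 addr0 mulrC.
Qed.

Lemma C1cB u v g h : C1c u g -> C1c v h ->
  C1c (fun x => u x - v x) (fun i x => g i x - h i x).
Proof.
move=> ug /(C1cZ (-1))/(C1cD ug); apply: C1c_ext => [x|i x]; by rewrite mulN1r.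
Qed.

Lemma C1c_comp (k dk : R -> R) u g : (forall x : R, is_derive x 1 k (dk x)) ->
  continuous dk -> k 0 = 0 -> C1c u g ->
  C1c (fun x => k (u x)) (fun i x => dk (u x) * g i x).
Proof. by move=> dK cdk k0 [ug bu]; split; [exact: C1_comp|exact: bsupp_comp]. Qed.

End partial_derivatives.

Lemma cts_eps (R : realType) (V W : normedModType R) (f : V -> W) :
  (forall x (e : R), 0 < e ->
    exists2 d : R, 0 < d & forall z, `|x - z| < d -> `|f x - f z| < e) ->
  continuous f.
Proof.
move=> h x; apply/cvgrPdist_lt => e e0; have [d d0 hd] := h x e e0.
by near=> z; apply: hd; near: z; exact: cvgr_dist_lt.
Unshelve. all: by end_near.
Qed.

(** * Differentiation under the integral sign *)

Section parametric_integrals.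
Context (R : realType) d (T : measurableType d) (mu : {measure set T -> \bar R}).

Lemma is_derive_J (f f' : R -> T -> R) (G : T -> R) (a : R) :
  (forall (s : R) y, is_derive s 1 (f^~ y) (f' s y)) -> (forall s, Int mu (f s)) ->
  Int mu G -> (forall s y, `|s - a| < 1 -> `|f' s y| <= G y) ->
  is_derive a 1 (fun s => J mu (f s)) (J mu (f' a)).
Proof.
move=> df iF iG leG.
have Ia : `](a - 1), (a + 1)[%classic a by rewrite /= in_itv/=; lra.
have itvE s : `](a - 1), (a + 1)[%classic s -> `|s - a| < 1.
  by rewrite /= in_itv/= ltr_distl.
have G0 y : 0 <= G y.
  by apply: le_trans (leG a y _); rewrite ?subrr ?normr0.
have pE s y : partial1of2 f s y = f' s y.
  by rewrite /partial1of2 derive1E; exact: derive_val.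
have d1 s y : `](a - 1), (a + 1)[%classic s -> setT y -> derivable (f^~ y) s 1.
  by move=> _ _; exact: ex_derive.
have d2 s y : `](a - 1), (a + 1)[%classic s -> setT y -> `|partial1of2 f s y| <= G y.
  by move=> /itvE h _; rewrite pE; exact: leG.
have i1 s : `](a - 1), (a + 1)[%classic s -> mu.-integrable setT (EFin \o f s).
  by move=> _; exact: iF.
have h1 := @derivable_under_integral R _ _ mu f setT measurableT _ _ _ Ia i1 d1 G G0 iG d2.
have h2 := @differentiation_under_integral R _ _ mu f setT measurableT _ _ _ Ia i1 d1 G G0 iG d2.
split; first exact: h1.
by rewrite -derive1E h2; apply: eq_Rintegral => y _; rewrite pE.
Qed.

End parametric_integrals.

(** * Slices and marginals in the first coordinate *)

Section slices.
Context (R : realType) (n : nat).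
Local Notation leb := (@lebesgue_measure R).
Local Notation mu := (lebesgue_rV R n).
Local Notation cons a y := (@rV_cons R n (a, y)).
Implicit Types (f u g : 'rV[R]_n.+1 -> R) (a s : R) (y : 'rV[R]_n).

Lemma cons0 a y : (cons a y) ord0 ord0 = a.
Proof. by rewrite mxE unlift_none. Qed.

Lemma consS a y j : (cons a y) ord0 (lift ord0 j) = y ord0 j.
Proof. by rewrite mxE liftK. Qed.

Lemma cons_eP (x z : 'rV[R]_n.+1) : x ord0 ord0 = z ord0 ord0 ->
  (forall j, x ord0 (lift ord0 j) = z ord0 (lift ord0 j)) -> x = z.
Proof.
move=> h0 h; apply/rowP => i; rewrite ord01.
by case: (unliftP ord0 i) => [j|] ->.
Qed.

Lemma cons_e0 a y s : cons a y + s *: e_ R ord0 = cons (a + s) y.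
Proof.
apply: cons_eP => [|j]; rewrite coord_line ?cons0 ?consS ?eqxx ?mulr1//.
by rewrite mulr0 addr0.
Qed.

Lemma cons_eS a y s j : cons a y + s *: e_ R (lift ord0 j) = cons a (y + s *: e_ R j).
Proof.
apply: cons_eP => [|k]; rewrite coord_line ?cons0 ?consS.
  by rewrite mulr0 addr0.
by rewrite coord_line (inj_eq lift_inj).
Qed.

Lemma norm_cons a y : (`|a| <= `|cons a y|) /\ (`|y| <= `|cons a y|).
Proof.
split; first by rewrite -[X in `|X|](cons0 a y) coord_le_norm.
by apply: norm_le_coord => // i; rewrite -(consS a y i) coord_le_norm.
Qed.

Lemma norm_consB a y y' : `|cons a y - cons a y'| <= `|y - y'|.
Proof.
apply: norm_le_coord => // i; rewrite !mxE.
case: (unliftP ord0 i) => [j|] _ /=; last by rewrite subrr normr0.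
by have := coord_le_norm (y - y') j; rewrite !mxE.
Qed.

Lemma continuous_cons1 y : continuous (fun a : R => cons a y).
Proof.
have -> : (fun a : R => cons a y) = (fun a => cons 0 y + a *: e_ R ord0).
  by apply/funext => a; rewrite cons_e0 add0r.
exact: continuous_line.
Qed.

Lemma continuous_cons2 a : continuous (fun y => cons a y).
Proof.
apply: cts_eps => y e e0; exists e => // z; apply: le_lt_trans.
exact: norm_consB.
Qed.

Lemma Cc_slice1 f y : Cc f -> Cc (fun a : R => f (cons a y)).
Proof.
move=> [cf [M h]]; split.
  by move=> a; apply: continuous_comp; [exact: continuous_cons1|exact: cf].
by exists M => a aM; apply: h; exact: lt_le_trans aM (norm_cons a y).1.
Qed.

Lemma Cc_slice2 f a : Cc f -> Cc (fun y => f (cons a y)).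
Proof.
move=> [cf [M h]]; split.
  by move=> y; apply: continuous_comp; [exact: continuous_cons2|exact: cf].
by exists M => y yM; apply: h; exact: lt_le_trans yM (norm_cons a y).2.
Qed.

Lemma J_cons1 f : Cc f -> J (lebesgue_rV R n.+1) f =
  J leb (fun a => J mu (fun y => f (cons a y))).
Proof.
move=> cf; apply: fubini_cons; first exact: Cc_Int.
by move=> a; apply: Cc_Int; exact: Cc_slice2.
Qed.

Lemma J_cons2 f : Cc f -> J (lebesgue_rV R n.+1) f =
  J mu (fun y => J leb (fun a => f (cons a y))).
Proof.
move=> cf; apply: fubini_cons'; first exact: Cc_Int.
by move=> a; apply: Cc_IntR; exact: Cc_slice1.
Qed.

Lemma Int_itv (M : R) : Int leb \1_(`[- M, M]%classic : set (measurableTypeR R)).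
Proof.
apply: Int_indic => //=.
by rewrite lebesgue_measure_itv /=; case: ifPn => // _; rewrite -EFinB ltry.
Qed.

Lemma Int_box (M : R) : Int mu \1_(@box R n M).
Proof. by have [mB fB] := lebesgue_rV_box n M; exact: Int_indic. Qed.

Lemma indic_itvE (M a : R) : `|a| <= M ->
  \1_(`[- M, M]%classic : set (measurableTypeR R)) a = 1 :> R.
Proof. by move=> h; rewrite indicE mem_set//= in_itv/= -ler_norml. Qed.

Lemma indic_boxE (M : R) y : `|y| <= M -> \1_(@box R n M) y = 1 :> R.
Proof.
move=> h; rewrite indicE mem_set//= => i; rewrite /= in_itv/= -ler_norml.
exact: le_trans (coord_le_norm _ _) h.
Qed.


(** Uniform continuity makes two nearby slices differ by at most e/(K + 1) on an interval of length
    K, outside which both vanish. *)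
Lemma Cc_int1 f : Cc f -> Cc (fun y => J leb (fun a => f (cons a y))).
Proof.
move=> cf; have [M M0 h] := bsupp_pos cf.2; split; last first.
  exists M => y yM; rewrite -[RHS](@J0 _ _ _ leb); apply: J_ext => a.
  by apply: h; exact: lt_le_trans yM (norm_cons a y).2.
apply: cts_eps => y e e0.
pose K := J leb (\1_(`[- M, M]%classic : set (measurableTypeR R))).
have K0 : 0 <= K by apply: J_ge0 => a; rewrite indicE.
have K1 : 0 < K + 1 by rewrite ltr_wpDl.
have [d d0 hd] := Cc_unif (@ball_compact_rV R n.+1) cf (divr_gt0 e0 K1).
exists d => // z yz.
apply: (@le_lt_trans _ _ (e / (K + 1) * K)); last first.
  by rewrite mulrAC ltr_pdivrMr// ltr_pM2l// ltrDl.
rewrite -(JZ _ (Int_itv M)); apply: J_absB.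
- by apply: Cc_IntR; exact: Cc_slice1.
- by apply: Cc_IntR; exact: Cc_slice1.
- by apply: IntZ; exact: Int_itv.
move=> a; have [aM|aM] := leP `|a| M.
  rewrite indic_itvE// mulr1 ltW//; apply: hd.
  exact: le_lt_trans (norm_consB _ _ _) yz.
rewrite !h ?subrr ?normr0 ?mulr_ge0// ?indicE//; last 2 first.
  exact: lt_le_trans aM (norm_cons a _).1.
  exact: lt_le_trans aM (norm_cons a _).1.
  exact: ltW.
by rewrite invr_ge0 ltW.
Qed.

Lemma Cc_int2 f : Cc f -> Cc (fun a : R => J mu (fun y => f (cons a y))).
Proof.
move=> cf; have [M M0 h] := bsupp_pos cf.2; split; last first.
  exists M => a aM; rewrite -[RHS](@J0 _ _ _ mu); apply: J_ext => y.
  by apply: h; exact: lt_le_trans aM (norm_cons a y).1.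
apply: cts_eps => a e e0.
pose K := J mu (\1_(@box R n M)).
have K0 : 0 <= K by apply: J_ge0 => y; rewrite indicE.
have K1 : 0 < K + 1 by rewrite ltr_wpDl.
have [d d0 hd] := Cc_unif (@ball_compact_rV R n.+1) cf (divr_gt0 e0 K1).
exists d => // b ab.
apply: (@le_lt_trans _ _ (e / (K + 1) * K)); last first.
  by rewrite mulrAC ltr_pdivrMr// ltr_pM2l// ltrDl.
rewrite -(JZ _ (Int_box M)); apply: J_absB.
- by apply: Cc_Int; exact: Cc_slice2.
- by apply: Cc_Int; exact: Cc_slice2.
- by apply: IntZ; exact: Int_box.
move=> y; have [yM|yM] := leP `|y| M.
  rewrite indic_boxE// mulr1 ltW//; apply: hd.
  rewrite -(addrNK b a) [in cons _ _ - _](addrC (a - b)) -cons_e0 addrC addKr.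
  by rewrite normrZ (le_lt_trans _ ab)// -[leRHS]mulr1 ler_wpM2l// e_norm.
rewrite !h ?subrr ?normr0 ?mulr_ge0// ?indicE//; last 2 first.
  exact: lt_le_trans yM (norm_cons _ y).2.
  exact: lt_le_trans yM (norm_cons _ y).2.
  exact: ltW.
by rewrite invr_ge0 ltW.
Qed.

Lemma pd_cons0 u g y (a : R) : pd ord0 u g ->
  is_derive a 1 (fun a : R => u (cons a y)) (g (cons a y)).
Proof.
move=> d; have := pd_line (cons 0 y) a d; rewrite cons_e0 add0r => h.
by apply: (dE h) => // t; rewrite cons_e0 add0r.
Qed.

Lemma pd_consS u g a (j : 'I_n) : pd (lift ord0 j) u g ->
  pd j (fun y => u (cons a y)) (fun y => g (cons a y)).
Proof. by move=> d y; apply: dE (d (cons a y)) _ _ => // s; rewrite cons_eS. Qed.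

(** Differentiation under the integral; the derivative is dominated by its maximum times the
    indicator of an interval that contains its support. *)
Lemma pd_int1 u g (j : 'I_n) : Cc u -> Cc g -> pd (lift ord0 j) u g ->
  pd j (fun y => J leb (fun a => u (cons a y))) (fun y => J leb (fun a => g (cons a y))).
Proof.
move=> cu cg dg y; have [C C0 hC] := Cc_bounded (@ball_compact_rV R n.+1) cg.
have [M M0 h] := bsupp_pos cg.2.
have := @is_derive_J R _ _ leb (fun s a => u (cons a (y + s *: e_ R j)))
  (fun s a => g (cons a (y + s *: e_ R j)))
  (fun a => C * \1_(`[- M, M]%classic : set (measurableTypeR R)) a) 0.
rewrite scale0r addr0; apply.
- by move=> s a; exact: (pd_line y s (pd_consS a dg)).
- by move=> s; apply: Cc_IntR; exact: Cc_slice1.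
- by apply: IntZ; exact: Int_itv.
- move=> s a _; have [aM|aM] := leP `|a| M; first by rewrite indic_itvE// mulr1.
  rewrite h ?normr0 ?mulr_ge0// ?ltW//.
  exact: lt_le_trans aM (norm_cons a _).1.
Qed.

End slices.

(** By Fubini either the differentiated coordinate is the head and is integrated first, or the head
    is sliced off and the induction hypothesis applies. *)
Lemma J_pd0 (R : realType) n i (u g : 'rV[R]_n -> R) : Cc u -> Cc g -> pd i u g ->
  J (lebesgue_rV R n) g = 0.
Proof.
elim: n i u g => [[]//|n IH] i u g cu cg d.
case: (unliftP ord0 i) => [j|] iE; subst i.
  rewrite J_cons1// -[RHS](@J0 _ _ _ lebesgue_measure); apply: J_ext => a.
  by apply: (IH j (fun y => u (rV_cons (a, y)))); [exact: Cc_slice2|exact: Cc_slice2|exact: pd_consS].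
rewrite J_cons2// -[RHS](@J0 _ _ _ (lebesgue_rV R n)); apply: J_ext => y.
apply: (J_derive0 (f := fun a => u (rV_cons (a, y)))).
- by move=> a; exact: pd_cons0.
- by have [] := Cc_slice1 y cg.
- by have [] := Cc_slice1 y cu.
Qed.

Lemma J_C1c0 (R : realType) n (u : 'rV[R]_n -> R) g i : C1c u g ->
  J (lebesgue_rV R n) (g i) = 0.
Proof.
move=> ug; apply: (J_pd0 (C1c_Cc ug) (C1c_Ccd i ug)).
by have [[_ _ d] _] := ug; exact: d.
Qed.

Lemma pi_neq0 (R : realType) : pi != 0 :> R.
Proof. by rewrite lt0r_neq0// pi_gt0. Qed.

Ltac pi_field := match goal with |- context [@pi ?R] =>
  move: (pi_neq0 R); move: (@pi R) => ? ?; field; rewrite ?mulf_neq0 // end.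

Lemma Int_patch d (T : measurableType d) (R : realType) (mu : {measure set T -> \bar R})
  (A : set T) (f : T -> R) : measurable A -> Int mu f -> Int mu (f \_ A).
Proof.
move=> mA iF; apply: Int_dom (Int_abs iF) _ => [|t].
  by apply/(measurable_restrictT _ mA); apply: measurable_funTS; exact: Int_meas iF.
by rewrite patchE; case: ifP; rewrite ?normr0.
Qed.

(** * The spectral gap of the Gaussian on the line *)

Section gaussian_gap_1d.
Context (R : realType).
Local Notation leb := (@lebesgue_measure R).
Implicit Types (f : R -> R).

Definition w1 (x : R) : R := expR (- pi * x ^+ 2).

Let pi0 : 0 < pi :> R := pi_gt0 R.

Lemma w1_gt0 x : 0 < w1 x. Proof. exact: expR_gt0. Qed.

Lemma dw1 (x : R) : is_derive x 1 w1 (- 2 * pi * x * w1 x).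
Proof. by apply: (dE (dexp (dM (dcst (- pi) x) (dX 2 (did x))))) => //; rewrite /w1; ring. Qed.

Lemma cts_w1 : continuous w1. Proof. exact: is_derive_cts dw1. Qed.

(** The centred normal law of variance 1/(2 pi) has peak value 1, so integrability and total mass 1
    are inherited from it. *)
Lemma w1_normal_pdf : w1 = normal_pdf 0 (Num.sqrt (2 * pi))^-1.
Proof.
set s := (_)^-1; have s2 : s ^+ 2 = (2 * pi)^-1.
  by rewrite /s exprVn sqr_sqrtr// mulr_ge0// ltW.
have s0 : s != 0.
  by rewrite -sqrf_eq0 s2 invr_eq0 mulf_neq0// pi_neq0.
apply/funext => x; rewrite /normal_pdf (negPf s0).
have e1 : normal_peak s = 1.
  rewrite /normal_peak s2 (_ : _ *+ 2 = 1) ?sqrtr1 ?invr1//.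
  by rewrite -mulr_natl; pi_field.
have e2 : normal_fun 0 s x = w1 x.
  rewrite /normal_fun s2 /w1; congr expR.
  by rewrite -mulr_natl subr0; pi_field.
by rewrite e1 e2 mul1r.
Qed.

Lemma Int_w1 : Int leb w1.
Proof. by rewrite w1_normal_pdf; exact: integrable_normal_pdf. Qed.

Lemma J_w1 : J leb w1 = 1.
Proof. by rewrite w1_normal_pdf /J /Rintegral integral_normal_pdf. Qed.

(** Polynomial decay is all that the boundary terms x * w1 x at infinity require. *)
Lemma w1_le (x : R) : 1 <= x -> w1 x <= x ^- 4.
Proof.
move=> x1; rewrite /w1 mulNr expRN lef_pV2 ?posrE ?expR_gt0 ?exprn_gt0//; last lra.
have p2 := pi_ge2 R.
have x0 : 0 <= pi * x ^+ 2 by rewrite mulr_ge0 ?sqr_ge0// ltW.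
apply: le_trans (expR_ge1Dxn 1 x0).
have : 0 <= (pi ^+ 2 - 4) * x ^+ 4 by rewrite mulr_ge0 ?exprn_even_ge0//; nra.
rewrite (_ : 2`!%:R = 2 :> R)//.
have : 0 <= x ^+ 4 by rewrite exprn_even_ge0.
by rewrite exprMn -exprM; lra.
Qed.

(** The primitive from minus infinity, with the cut as a 0/1 factor so that it is an instance of
    [J]. *)
Definition prim f (x : R) : R := J leb (fun t : R => f t * (t <= x)%R%:R).

Lemma patch_prim f x : f \_ (`]-oo, x]%classic : set (measurableTypeR R)) =
  (fun t => f t * (t <= x)%R%:R).
Proof.
apply/funext => t; rewrite patchE mem_setE /= in_itv/=.
by case: (t <= x); rewrite ?mulr1 ?mulr0.
Qed.

Lemma Int_prim f x : Int leb f -> Int leb (fun t => f t * (t <= x)%R%:R).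
Proof. by move=> iF; rewrite -patch_prim; exact: Int_patch. Qed.

Lemma is_derive_prim f : continuous f -> Int leb f ->
  forall x : R, is_derive x 1 (prim f) (f x).
Proof.
move=> cf iF x; have xx : x < x + 1 by rewrite ltrDl.
have iS : leb.-integrable [set` Interval -oo%O (BRight (x + 1))] (EFin \o f).
  exact: integrableS iF.
have -> : prim f = (fun x => \int[leb]_(t in `]-oo, x]) f t).
  by apply/funext => y; rewrite /prim [RHS]Rintegral_mkcond patch_prim.
have oo : (-oo%O < BRight x)%E by rewrite ltNyr.
have [h1 h2] := @continuous_FTC1 R f -oo%O x (x + 1) xx iS oo (cf x).
split; first exact: h1.
by rewrite -derive1E h2.
Qed.

Lemma prim_eq0 f (M x : R) : (forall x, x < - M -> f x = 0) -> x < - M -> prim f x = 0.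
Proof.
move=> h xM; rewrite -[RHS](@J0 _ _ _ leb); apply: J_ext => t.
by case: (leP t x) => tx; rewrite ?mulr0// h ?mul0r// (le_lt_trans tx).
Qed.

Lemma prim_eqJ f (M x : R) : (forall x, M < x -> f x = 0) -> M < x -> prim f x = J leb f.
Proof.
move=> h xM; apply: J_ext => t.
by case: (leP t x) => tx; rewrite ?mulr1// h ?mul0r// (lt_trans xM).
Qed.

Lemma prim_bounds f x : Int leb f -> (forall x, 0 <= f x) -> 0 <= prim f x <= J leb f.
Proof.
move=> iF f0; apply/andP; split; first by apply: J_ge0 => t; rewrite mulr_ge0.
apply: J_le => // [|t]; first exact: Int_prim.
by case: (leP t x) => tx; rewrite ?mulr1 ?mulr0.
Qed.

Lemma derive_ndecr (f df : R -> R) p q : p <= q -> continuous f ->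
  (forall x : R, p < x < q -> is_derive x 1 f (df x)) ->
  (forall x, p < x < q -> 0 <= df x) -> f p <= f q.
Proof.
rewrite le_eqVlt => /predU1P[->//|pq] cf d d0.
have dd x : x \in `]p, q[ -> is_derive x 1 f (df x) by rewrite in_itv/=; exact: d.
have [c] := @MVT R f df p q pq dd (continuous_subspaceT cf).
rewrite in_itv/= => cpq e; rewrite -subr_ge0 e mulr_ge0 ?d0//.
by rewrite subr_ge0 ltW.
Qed.

Lemma tail_w1 : forall e : R, 0 < e -> exists M : R, forall x, M < x ->
  1 - e < prim w1 x - prim w1 (- x).
Proof.
move=> e e0.
pose f n (t : R) := w1 t * \1_(`[- n%:R, n%:R]%classic : set (measurableTypeR R)) t.
have mI n : measurable_fun setT (\1_(`[- n%:R, n%:R]%classic : set (measurableTypeR R)) : _ -> R).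
  exact: measurable_indic.
have iw := Int_meas Int_w1.
have i01 n t : 0 <= (\1_(`[- n%:R, n%:R]%classic : set (measurableTypeR R)) t : R) <= 1.
  by rewrite indicE; case: (_ \in _); rewrite ?ler01 ?lexx.
have mf n : measurable_fun (setT : set (measurableTypeR R)) (f n) by exact: measurable_funM.
have cf : {ae leb, forall t, f n t @[n --> \oo] --> w1 t}.
  apply: nearW => t; apply/cvgrPdist_lt => d d0; near=> n.
  rewrite /f indicE mem_set ?mulr1 ?subrr ?normr0//= in_itv/= -ler_norml.
  near: n; exact: nbhs_infty_ger.
have lef n x : `|f n x| <= w1 x.
  have /andP[? ?] := i01 n x.
  by rewrite /f ger0_norm ?mulr_ge0 ?(ltW (w1_gt0 _))// ler_piMr// ltW// w1_gt0.
have [_] := dct mf iw Int_w1 cf lef.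
rewrite J_w1 => /cvgrPdist_lt/(_ e e0)[n _ /(_ n (leqnn n))].
rewrite ltr_distlC => /andP[le _]; exists n%:R => x nx.
apply: (lt_le_trans le).
have iP (y : R) := Int_prim y Int_w1.
rewrite /prim -JB//.
have n0 : 0 <= n%:R :> R by [].
apply: J_le => [||t]; [exact: Int_dom Int_w1 (lef n)|exact: IntB|].
have w0 := ltW (w1_gt0 t).
rewrite /f indicE mem_setE /= in_itv/=.
case: (leP (- n%:R) t) => tn; case: (leP t n%:R) => tn'; case: (leP t x) => tx;
  case: (leP t (- x)) => tx' /=; rewrite ?(mulr0, mulr1, subr0, subrr)//; lra.
Unshelve. all: by end_near.
Qed.

(** As x tends to infinity the increment of the primitive tends to 1 and x * w1 x tends to 0. *)
Lemma w1_limit (k q b M : R) : 0 <= q -> 0 <= b ->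
  (forall x, M < x -> q * (prim w1 x - prim w1 (- x)) <= k + 4 * (b * (x * w1 x))) ->
  q <= k.
Proof.
move=> q0 b0 h; rewrite leNgt; apply/negP => lt.
have D0 : 0 < q - k by rewrite subr_gt0.
pose e := (q - k) / (4 * (q + 1)).
have e0 : 0 < e by rewrite divr_gt0// mulr_gt0// ltr_wpDl.
have [M' hW] := tail_w1 e0.
pose x := 1 + `|M| + `|M'| + 16 * (b + 1) / (q - k).
have A0 : 0 < 16 * (b + 1) / (q - k) by rewrite divr_gt0// mulr_gt0// ltr_wpDl.
have [x1 Mx M'x xA] : [/\ 1 < x, M < x, M' < x & 16 * (b + 1) / (q - k) < x].
  rewrite /x; have := ler_norm M; have := ler_norm M'; have := normr_ge0 M.
  have := normr_ge0 M'; move: A0; move: (_ / _) => z; clear; split; lra.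
have x0 : 0 < x by apply: lt_trans x1.
have := h x Mx; have := hW x M'x => hx hh.
have wx : w1 x <= x ^- 4 by apply: w1_le; exact: ltW.
have xw : x * w1 x <= x^-1.
  apply: (@le_trans _ _ (x * x ^- 4)); first by rewrite ler_wpM2l// ltW.
  rewrite (_ : x * _ = x^-1 * (x ^+ 2)^-1); last by field; rewrite gt_eqF.
  rewrite ler_piMr ?invr_ge0 ?(ltW x0)// invf_le1 ?exprn_gt0//.
  by rewrite exprn_ege1// ltW.
have bx : b * (x * w1 x) <= (q - k) / 16.
  apply: (@le_trans _ _ (b * x^-1)); first by rewrite ler_wpM2l.
  rewrite ler_pdivrMr//; move: xA; rewrite ltr_pdivrMr// => xA.
  by move: xA b0; clear; lra.
have qe : q * e <= (q - k) / 4.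
  rewrite /e mulrA ler_pdivrMr ?mulr_gt0 ?ltr_wpDl//.
  by move: D0 q0; clear; nra.
have : q * (1 - e) <= q * (prim w1 x - prim w1 (- x)) by rewrite ler_wpM2l// ltW.
by move: hh bx qe D0; clear; lra.
Qed.

(** The operator -f'' + 2 pi x f' has eigenvalues 0, 2 pi, 4 pi, ...; this is the gap 4 pi once the
    modes of degree 0 and 1 are added back. The chord of f through the zeros +-a of the second
    Hermite polynomial x^2 - c is subtracted. The difference g vanishes at +-a, and (g'^2 - 4 pi
    g^2) w1 equals the square (g' - 2 x g / (x^2 - c))^2 w1 plus the exact derivative of [G]
    (ground-state substitution). *)
Lemma gap_1d f df : (forall x : R, is_derive x 1 f (df x)) -> continuous df -> Cc f ->
  4 * pi * J leb (fun x => f x ^+ 2 * w1 x) <=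
  J leb (fun x => df x ^+ 2 * w1 x) + 4 * pi * J leb (fun x => f x * w1 x) ^+ 2
  + 4 * pi ^+ 2 * J leb (fun x : R => x * f x * w1 x) ^+ 2.
Proof.
move=> ddf cdf cf; have cf' : Cc df by split => //; exact: is_derive_bsupp ddf cf.2.
pose c : R := (2 * pi)^-1.
have c0 : 0 < c by rewrite invr_gt0 mulr_gt0.
have pic : pi * c = 2^-1 by rewrite /c; pi_field.
pose a : R := Num.sqrt c.
have a0 : 0 < a by rewrite sqrtr_gt0.
have a2 : a ^+ 2 = c by rewrite sqr_sqrtr ?ltW.
pose al : R := (f a - f (- a)) / (2 * a).
pose be : R := (f a + f (- a)) / 2.
pose g (x : R) : R := f x - (al * x + be).
pose dg (x : R) : R := df x - al.
have ga : g a = 0 by rewrite /g /al /be; field; rewrite gt_eqF.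
have gNa : g (- a) = 0 by rewrite /g /al /be; field; rewrite gt_eqF.
have ddg (x : R) : is_derive x 1 g (dg x).
  apply: (dE (dB (ddf x) (dD (dM (dcst al x) (did x)) (dcst be x)))) => //.
  by rewrite /dg; ring.
(* (g'^2 - 4 pi g^2) w1 is [k] - [q] [w1] plus the derivative of [Z]. Unlike it, [k] has bounded
   support and contains only the integrals of the statement. *)
pose k x := df x ^+ 2 * w1 x - 4 * pi * (f x ^+ 2 * w1 x)
  + 4 * pi * al * (x * f x * w1 x) + 8 * pi * be * (f x * w1 x).
have cx : continuous (fun x : R => x) by move=> x; exact: cvg_id.
have C1' : Cc (fun x => df x ^+ 2 * w1 x) by apply: CcM cts_w1; exact: (CcX 1).
have C2' : Cc (fun x => f x ^+ 2 * w1 x) by apply: CcM cts_w1; exact: (CcX 1).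
have C3' : Cc (fun x : R => x * f x * w1 x) by apply: CcM cts_w1; exact: CcMr.
have C4' : Cc (fun x => f x * w1 x) by apply: CcM cts_w1.
have Ck : Cc k.
  by apply: CcD; [apply: CcD; [apply: CcB => //; exact: CcZ|exact: CcZ]|exact: CcZ].
pose K := prim k.
pose W := prim w1.
pose Z x := (2 * al ^+ 2 * x + 4 * al * be - 2 * al * f x) * w1 x.
pose G (x : R) : R := 2 * x / (x ^+ 2 - c) * g x ^+ 2 * w1 x.
pose q := al ^+ 2 + 4 * pi * be ^+ 2.
pose H (x : R) : R := K x - q * W x + Z x - G x.
have dK (x : R) : is_derive x 1 K (k x) by exact: is_derive_prim (Cc_cts Ck) (Cc_IntR Ck) x.
have dW (x : R) : is_derive x 1 W (w1 x) by exact: is_derive_prim cts_w1 Int_w1 x.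
pose dZ x := (2 * al ^+ 2 - 2 * al * df x) * w1 x
  + (2 * al ^+ 2 * x + 4 * al * be - 2 * al * f x) * (- 2 * pi * x * w1 x).
have ddZ (x : R) : is_derive x 1 Z (dZ x).
  apply: (dE (dM (dB (dD (dM (dcst (2 * al ^+ 2) x) (did x)) (dcst (4 * al * be) x))
    (dM (dcst (2 * al) x) (ddf x))) (dw1 x))) => //.
  by rewrite /dZ; ring.
have nz (x : R) : x != a -> x != - a -> x ^+ 2 - c != 0.
  move=> xa xNa; rewrite -a2 subr_sqr mulf_neq0// ?subr_eq0//.
  by rewrite -[a]opprK subr_eq0.
pose dH x := w1 x * (dg x - 2 * x / (x ^+ 2 - c) * g x) ^+ 2.
have ddH (x : R) : x != a -> x != - a -> is_derive x 1 H (dH x).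
  move=> xa xNa; have D0 := nz _ xa xNa.
  have d1 := dB (dX 2 (did x)) (dcst c x).
  have d2 := dM (dM (dM (dM (dcst 2 x) (did x)) (@dV R (fun t : R => t ^+ 2 - c) x _ D0 d1)) (dX 2 (ddg x))) (dw1 x).
  have d3 := dD (dB (dK x) (dM (dcst q x) (dW x))) (ddZ x).
  have d4 : is_derive x 1 H _ := dB d3 d2.
  apply: (dE d4) => //=; clear d1 d2 d3 d4.
  rewrite /k /dZ /q /dH (_ : f x = g x + (al * x + be)); last by rewrite /g subrK.
  rewrite (_ : df x = dg x + al); last by rewrite /dg subrK.
  move: D0 (pi_neq0 R); rewrite /c.
  generalize (W x) (w1 x) (g x) (dg x) al be (@pi R) => W' w' g' dg' al' be' p D0 p0.
  have D1 : x ^+ 2 * (2 * p) - 1 != 0.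
    apply: contra_neq D0 => e; rewrite (_ : _ - _ = (x ^+ 2 * (2 * p) - 1) / (2 * p)); last by field.
    by rewrite e mul0r.
  field.
  by rewrite ?p0 ?D1.
(* Only [G] is delicate, at +-a: g is O(|y - x|) there, so g^2/(y^2 - c) tends to 0, which is also
   the value of [G]. *)
have cH : continuous H.
  move=> x; have [xa|xa] := boolP ((x != a) && (x != - a)).
    by case/andP: xa => xa xNa; exact: is_derive_continuous (ddH _ xa xNa).
  have x2 : x ^+ 2 = c.
    by move: xa; rewrite negb_and !negbK => /orP[] /eqP ->; rewrite ?sqrrN.
  have gx : g x = 0 by move: xa; rewrite negb_and !negbK => /orP[] /eqP ->.
  have x0 : 0 < `|x| by rewrite normr_gt0 -sqrf_eq0 x2 gt_eqF.
  apply: cvgB; last first.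
    have [C C0 hC] := is_derive_lipschitz_at (ddg x) gx.
    rewrite /G gx expr0n /= mulr0 mul0r; apply/cvgr0Pnorm_le => e e0; near=> y.
    (* The factor 6 C^2 comes from |y| <= 3 |y + x| and |g y| <= C |y - x|. *)
    have yx : `|y - x| <= Num.min (`|x| / 2) (e / (6 * C ^+ 2)).
      rewrite distrC; near: y; apply: cvgr_dist_le.
        exact: cvg_id.
      by rewrite lt_min !divr_gt0// mulr_gt0// exprn_gt0.
    move: yx; rewrite le_min => /andP[yx1 yx2].
    have gy : `|g y| <= C * `|y - x| by near: y.
    have [->|yx0] := eqVneq y x; first by rewrite gx expr0n/= mulr0 mul0r normr0 ltW.
    have xy : `|x| <= 2 * `|y + x|.
      have := ler_normB (y + x) (y - x); rewrite (_ : y + x - (y - x) = 2 * x); last by ring.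
      by rewrite normrM ger0_norm//; lra.
    have yx3 : `|y| <= 3 * `|y + x|.
      have := ler_normD (y - x) x; rewrite subrK; lra.
    have yx00 : 0 < `|y - x| by rewrite normr_gt0 subr_eq0.
    have yx01 : 0 < `|y + x| by lra.
    rewrite -x2 subr_sqr normrM (normrM (2 * y / _)) normrX (normrM (2 * y)) normfV.
    rewrite (normrM (y - x)) (normrM 2) (ger0_norm (ltW (w1_gt0 y))) (ger0_norm (ler0n _ 2)).
    have w1y : w1 y <= 1.
      by rewrite /w1 -expR0 ler_expR mulNr oppr_le0 mulr_ge0 ?sqr_ge0// ltW.
    apply: (@le_trans _ _ (2 * `|y| / (`|y - x| * `|y + x|) * `|g y| ^+ 2)).
      by rewrite ler_piMr// !mulr_ge0// ?invr_ge0 ?mulr_ge0 ?exprn_ge0.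
    apply: (@le_trans _ _ (2 * (3 * `|y + x|) / (`|y - x| * `|y + x|) * (C * `|y - x|) ^+ 2)).
      apply: ler_pM; rewrite ?exprn_ge0 ?mulr_ge0 ?invr_ge0 ?mulr_ge0//.
        by rewrite ler_wpM2r ?invr_ge0 ?mulr_ge0// ler_pM2l.
      by rewrite lerXn2r ?nnegrE// mulr_ge0// ltW.
    rewrite (_ : _ * _ ^+ 2 = `|y - x| * (6 * C ^+ 2)); last by field; rewrite !gt_eqF.
    by rewrite -ler_pdivlMr// mulr_gt0// exprn_gt0.
  apply: cvgD; last exact: is_derive_continuous (ddZ x).
  apply: cvgB; first exact: is_derive_continuous (dK x).
  by apply: cvgM; [exact: cvg_cst|exact: is_derive_continuous (dW x)].
have dH0 x : 0 <= dH x by rewrite mulr_ge0 ?sqr_ge0// ltW// w1_gt0.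
(* [H] is differentiated only off +-a; its continuity lets monotonicity be chained across these two
   points. *)
have seg p p' : p <= p' -> (forall x : R, p < x < p' -> x != a /\ x != - a) -> H p <= H p'.
  move=> pq h; apply: (derive_ndecr pq cH (df := dH)) => y py; last exact: dH0.
  by have [h1 h2] := h y py; exact: ddH.
have mono x : a < x -> H (- x) <= H x.
  clear -seg a0 => ax; apply: (@le_trans _ _ (H (- a))).
    apply: seg => [|y /andP[h1 h2]]; first lra.
    have ya : y < a by lra.
    by rewrite !lt_eqF.
  apply: (@le_trans _ _ (H a)).
    apply: seg => [|y /andP[h1 h2]]; first lra.
    by rewrite (lt_eqF h2) (gt_eqF h1).
  apply: seg => [|y /andP[h1 h2]]; first lra.
  have ya : - a < y by lra.
  by rewrite !gt_eqF.
have [M M0 hM] := bsupp_pos cf.2; have [M' M'0 hM'] := bsupp_pos Ck.2.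
have q0 : 0 <= q by rewrite addr_ge0 ?sqr_ge0// mulr_ge0 ?sqr_ge0// mulr_ge0// ltW.
(* Beyond the supports, H x - H (-x) is J k - q (W x - W (-x)) + 4 al^2 x w1 x minus the nonnegative
   [r]; then x tends to infinity. *)
have kq : q <= J leb k.
  apply: (@w1_limit _ _ (al ^+ 2) (1 + 2 * a + 2 * c + M + M')) => //; first exact: sqr_ge0.
  move=> x xM; have [ax Mx M'x] : [/\ a < x, M < x & M' < x].
    by clear -xM a0 c0 M0 M'0; split; lra.
  have x2c : 0 < x ^+ 2 - c by clear -xM a0 c0 M0 M'0; nra.
  have x0 : 0 < x := lt_trans a0 ax.
  have fx0 : f x = 0 by apply: hM; rewrite gtr0_norm.
  have fNx0 : f (- x) = 0 by apply: hM; rewrite normrN gtr0_norm.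
  have K1 : K (- x) = 0.
    apply: (@prim_eq0 _ M') => [y yM|]; last by rewrite ltrN2.
    have y0 : y < 0 by apply: lt_trans yM _; rewrite oppr_lt0.
    by apply: hM'; rewrite ltr0_norm// ltrNr.
  have K2 : K x = J leb k.
    by apply: (@prim_eqJ _ M') => // y yM; apply: hM'; rewrite gtr0_norm// (lt_trans M'0).
  have := mono x ax; rewrite /H K1 K2 /Z /G /g fx0 fNx0.
  have -> : w1 (- x) = w1 x by rewrite /w1 sqrrN.
  pose r := 2 * x / (x ^+ 2 - c) * w1 x * ((al * x + be) ^+ 2 + (be - al * x) ^+ 2).
  have r0 : 0 <= r.
    by rewrite !mulr_ge0 ?addr_ge0 ?sqr_ge0 ?invr_ge0 ?(ltW (w1_gt0 x)) ?(ltW x2c) ?(ltW x0).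
  move=> le; suff : q * (W x - W (- x)) <= J leb k + 4 * (al ^+ 2 * (x * w1 x)) - r.
    by move=> h; apply: le_trans h _; rewrite gerBl.
  rewrite -subr_ge0; move: le; rewrite -subr_ge0; congr (0 <= _).
  move: x2c; rewrite /r sqrrN => x2c.
  generalize (W x) (W (- x)) (w1 x) al be q (J leb k) => *.
  by field; rewrite gt_eqF.
move: kq; rewrite /k /q.
rewrite JD; [|by apply: Cc_IntR; apply: CcD; [apply: CcB => //; exact: CcZ|exact: CcZ]|by apply: Cc_IntR; exact: CcZ].
rewrite JD; [|by apply: Cc_IntR; apply: CcB => //; exact: CcZ|by apply: Cc_IntR; exact: CcZ].
rewrite JB; [|exact: Cc_IntR|by apply: Cc_IntR; exact: CcZ].
rewrite !JZ; try exact: Cc_IntR.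
set A := J _ _; set B := J _ _; set X := J _ _; set Y := J _ _ => le.
(* Completing squares replaces the interpolation coefficients [al], [be] by the mode coefficients 2
   pi X and Y. *)
have := sqr_ge0 (al - 2 * pi * X); have : 0 <= 4 * pi * (be - Y) ^+ 2.
  by rewrite mulr_ge0 ?sqr_ge0// mulr_ge0// ltW.
by move: le; generalize A B X Y al be (@pi R); clear => *; nra.
Unshelve. all: by end_near.
Qed.

End gaussian_gap_1d.

(** * Moments of the Gaussian on the line *)

Section gaussian_moments.
Context (R : realType).
Local Notation leb := (@lebesgue_measure R).

Lemma Int_expsq (c : R) : 0 < c -> Int leb (fun a : R => expR (- c * a ^+ 2)).
Proof.
move=> c0; pose s : R := (Num.sqrt (2 * c))^-1.
have s2 : s ^+ 2 = (2 * c)^-1.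
  by rewrite /s exprVn sqr_sqrtr// mulr_ge0// ltW.
have s0 : s != 0.
  by rewrite -sqrf_eq0 s2 invr_eq0 mulf_neq0// gt_eqF.
pose k : R := normal_peak s.
have k0 : k != 0.
  rewrite /k /normal_peak invr_eq0 sqrtr_eq0 -ltNge s2 mulrn_wgt0//.
  by rewrite mulr_gt0 ?pi_gt0// invr_gt0 mulr_gt0.
have := IntZ k^-1 (integrable_normal_pdf (0 : R) s).
apply: Int_ext => a; rewrite /normal_pdf (negPf s0) -/k mulrA mulVf// mul1r.
rewrite /normal_fun s2 subr0; congr expR; rewrite -mulr_natl.
by field; rewrite gt_eqF.
Qed.

Lemma sq_w1_le (a : R) : a ^+ 2 * w1 a <= expR (- 1 * a ^+ 2).
Proof.
have h : a ^+ 2 <= expR (a ^+ 2) by have := expR_ge1Dx (a ^+ 2); lra.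
apply: (@le_trans _ _ (expR (a ^+ 2) * w1 a)); first by rewrite ler_wpM2r ?expR_ge0.
rewrite /w1 -expRD ler_expR; have := pi_ge2 R; have := sqr_ge0 a; nra.
Qed.

Lemma Int_w1M : Int leb (fun a : R => a * w1 a) /\ Int leb (fun a : R => a ^+ 2 * w1 a).
Proof.
have cx : continuous (fun x : R => x) by move=> x; exact: cvg_id.
have i1 := Int_expsq (ltr01 : 0 < (1 : R)).
split.
- apply: (Int_dom _ (IntD (@Int_w1 R) i1)) => [|a].
    by apply: continuous_measurable_R; apply: ctsM => //; exact: cts_w1.
  have := sq_w1_le a; have := w1_gt0 a; rewrite normrM (gtr0_norm (w1_gt0 a)).
  have : `|a| <= 1 + a ^+ 2.
    by rewrite -(real_normK (num_real a)); have := normr_ge0 a; nra.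
  by move: (expR _) => z; nra.
- apply: (Int_dom _ i1) => [|a].
    by apply: continuous_measurable_R; apply: ctsM; [exact: ctsX|exact: cts_w1].
  rewrite ger0_norm; first exact: sq_w1_le.
  by rewrite mulr_ge0 ?sqr_ge0// ltW// w1_gt0.
Qed.

Lemma prim_limit (f : R -> R) : Int leb f -> forall e : R, 0 < e ->
  exists M : R, forall x, M < x -> `|J leb f - (prim f x - prim f (- x))| < e.
Proof.
move=> iF e e0.
pose i n : measurableTypeR R -> R := \1_(`[- n%:R, n%:R]%classic : set (measurableTypeR R)).
pose g n (t : measurableTypeR R) : R := `|f t| * i n t.
have mI n : measurable_fun setT (i n) by exact: measurable_indic.
have iA := Int_abs iF; have mA := Int_meas iA.
have i01 n t : 0 <= i n t <= 1.
  by rewrite /i indicE; case: (_ \in _); rewrite ?ler01 ?lexx.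
have mg n : measurable_fun (setT : set (measurableTypeR R)) (g n) by exact: measurable_funM.
have cg : {ae leb, forall t, g n t @[n --> \oo] --> `|f t|}.
  apply: nearW => t; apply/cvgrPdist_lt => d d0; near=> n.
  rewrite /g /i indicE mem_set ?mulr1 ?subrr ?normr0//= in_itv/= -ler_norml.
  near: n; exact: nbhs_infty_ger.
have leg n x : `|g n x| <= `|f x|.
  by have /andP[? ?] := i01 n x; rewrite /g ger0_norm ?mulr_ge0// ler_piMr.
have [_ /cvgrPdist_lt/(_ e e0)[n _ /(_ n (leqnn n))]] := dct mg mA iA cg leg.
have ig n' : Int leb (g n') by exact: Int_dom iA (leg n').
rewrite -JB// => lt; exists n%:R => x nx.
have iP y := Int_prim y iF.
have n0 : 0 <= n%:R :> R by [].
rewrite -JB// -JB//; last exact: IntB.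
apply: le_lt_trans lt; apply: le_trans (ler_norm _).
apply: le_trans (J_abs _) _; first by apply: IntB => //; exact: IntB.
apply: J_le => [||t]; [by apply: Int_abs; apply: IntB => //; exact: IntB|exact: IntB|].
have f0 := normr_ge0 (f t).
rewrite /g /i indicE mem_setE /= in_itv/=.
case: (leP (- n%:R) t) => tn; case: (leP t n%:R) => tn'; case: (leP t x) => tx;
  case: (leP t (- x)) => tx' /=; rewrite ?(mulr0, mulr1, subr0, subrr, sub0r, normrN, normr0)//; lra.
Unshelve. all: by end_near.
Qed.

(** The primitive of f and F have the same increment over [-x, x], and that of F vanishes in the
    limit. *)
Lemma J_derive_lim (F f : R -> R) : (forall x : R, is_derive x 1 F (f x)) ->
  continuous f -> Int leb f ->
  (forall e : R, 0 < e -> exists M : R, forall x, M < x -> `|F x| + `|F (- x)| < e) ->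
  J leb f = 0.
Proof.
move=> dF cf iF hF; apply/eqP; rewrite -normr_eq0 eq_le normr_ge0 andbT.
apply/ler_addgt0Pr => e e0; rewrite add0r.
have [M hM] := hF (e / 2) (divr_gt0 e0 (ltr0n _ 2)).
have [M' hM'] := prim_limit iF (divr_gt0 e0 (ltr0n _ 2)).
pose x := 1 + `|M| + `|M'|.
have [x0 Mx M'x] : [/\ 0 < x, M < x & M' < x].
  rewrite /x; have := ler_norm M; have := ler_norm M'; have := normr_ge0 M.
  by have := normr_ge0 M'; split; lra.
have := hM x Mx; have := hM' x M'x.
have -> : prim f x - prim f (- x) = F x - F (- x).
  pose D y := prim f y - F y.
  have dD y : is_derive (y : R) 1 D (0 : R).
    by have := dB (is_derive_prim cf iF y) (dF y); rewrite subrr.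
  have xx : - x <= x by lra.
  have e1 : D (- x) <= D x.
    by apply: (derive_ndecr (df := fun=> 0)) => //; exact: is_derive_cts dD.
  have e2 : - D (- x) <= - D x.
    apply: (derive_ndecr (f := fun y => - D y) (df := fun=> 0)) => //.
      by apply: ctsN; exact: is_derive_cts dD.
    by move=> y _; have := dN (dD y); rewrite oppr0.
  by move: e1 e2; rewrite /D; lra.
have := ler_norm (F x); have := ler_norm (- F (- x)); have := ler_norm (- F x).
have := ler_norm (F (- x)); rewrite !normrN => h1 h2 h3 h4.
by rewrite ltr_distl => /andP[h5 h6] h7; rewrite ler_norml; apply/andP; split; lra.
Qed.

(** Both moments come from exact derivatives: w1' = -2 pi x w1 and (x w1)' = w1 - 2 pi x^2 w1. *)
Lemma J_w1M : J leb (fun a : R => a * w1 a) = 0 /\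
  J leb (fun a : R => a ^+ 2 * w1 a) = (2 * pi)^-1.
Proof.
have cx : continuous (fun x : R => x) by move=> x; exact: cvg_id.
have [i1 i2] := Int_w1M; have p0 := pi_gt0 R; have p2 := pi_ge2 R.
(* A function bounded by k |x| w1 x for |x| >= 1 has no boundary terms at infinity. *)
have dec (k : R) (F : R -> R) : (forall x, 1 <= `|x| -> `|F x| <= k * `|x| * w1 x) ->
    0 <= k -> forall e : R, 0 < e ->
    exists M : R, forall x, M < x -> `|F x| + `|F (- x)| < e.
  move=> hF k0 e e0; exists (1 + 2 * (k + 1) / e) => x xM.
  have e1 : 0 < 2 * (k + 1) / e by rewrite divr_gt0// mulr_gt0// ltr_wpDl.
  have x1 : 1 < x by apply: lt_trans xM; rewrite ltrDl.
  have x0 : 0 < x by apply: lt_trans x1.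
  have := hF x; have := hF (- x); rewrite normrN (gtr0_norm x0) (_ : w1 (- x) = w1 x).
    move=> /(_ (ltW x1)) h1 /(_ (ltW x1)) h2.
    have wx : w1 x <= x ^- 4 by apply: w1_le; exact: ltW.
    have xw : x * w1 x <= x^-1.
      apply: (@le_trans _ _ (x * x ^- 4)); first by rewrite ler_wpM2l// ltW.
      rewrite (_ : x * _ = x^-1 * (x ^+ 2)^-1); last by field; rewrite gt_eqF.
      rewrite ler_piMr ?invr_ge0 ?(ltW x0)// invf_le1 ?exprn_gt0//.
      by rewrite exprn_ege1// ltW.
    have xe : 2 * (k + 1) * x^-1 < e.
      have : 2 * (k + 1) / e < x by apply: lt_trans xM; rewrite ltrDr.
      by rewrite !ltr_pdivrMr// (mulrC e).
    have : k * (x * w1 x) <= k * x^-1 by rewrite ler_wpM2l.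
    have : 0 < x^-1 by rewrite invr_gt0.
    by move: h1 h2 xe; rewrite -!mulrA; move: (x * w1 x) (x^-1) => z y; lra.
  by rewrite /w1 sqrrN.
split.
- have pn : - 2 * pi != 0 :> R by rewrite mulf_neq0 ?pi_neq0// oppr_eq0.
  apply: (mulfI pn); rewrite mulr0 -JZ//.
  have -> : (fun a : R => - 2 * pi * (a * w1 a)) = (fun a => - 2 * pi * a * w1 a).
    by apply/funext => a; ring.
  apply: (J_derive_lim (F := @w1 R)) => [x|||]; first exact: dw1.
  + by apply: ctsM; [apply: ctsM => //; exact: cts_cst|exact: cts_w1].
  + by have := IntZ (- 2 * pi) i1; apply: Int_ext => a; ring.
  + apply: (dec 1) => // x x1; rewrite mul1r ger0_norm ?(ltW (w1_gt0 x))//.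
    by rewrite ler_peMl// ltW// w1_gt0.
- have : J leb (fun a : R => w1 a - 2 * pi * (a ^+ 2 * w1 a)) = 0.
    apply: (J_derive_lim (F := fun a : R => a * w1 a)) => [x|||].
    + by apply: (dE (dM (did x) (dw1 x))) => //; ring.
    + by apply: ctsB; [exact: cts_w1|apply: ctsM; [exact: cts_cst|apply: ctsM;
        [exact: ctsX|exact: cts_w1]]].
    + by apply: IntB; [exact: Int_w1|exact: IntZ].
    + apply: (dec 1) => // x x1; rewrite mul1r normrM.
      by rewrite (ger0_norm (ltW (w1_gt0 x))).
  rewrite JB ?JZ ?J_w1//; [|exact: Int_w1|exact: IntZ].
  move: (J _ _) (pi_neq0 R); move: (@pi R) => p z p1 h.
  by have -> : z = (1 - (1 - 2 * p * z)) / (2 * p); [field|rewrite h subr0 mul1r].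
Qed.

(** The functions 1 and sqrt(2 pi) x are orthonormal for [w1]; the nonnegative integral of (h - p -
    2 pi q x)^2 w1 is expanded. *)
Lemma bessel_w1 (h : R -> R) : Cc h ->
  J leb (fun a : R => h a * w1 a) ^+ 2 + 2 * pi * J leb (fun a : R => a * h a * w1 a) ^+ 2
  <= J leb (fun a : R => h a ^+ 2 * w1 a).
Proof.
move=> ch; have cx : continuous (fun x : R => x) by move=> x; exact: cvg_id.
have [i1 i2] := Int_w1M; have [j1 j2] := J_w1M.
have c1 : Cc (fun a : R => h a * w1 a) by apply: CcM => //; exact: cts_w1.
have c2 : Cc (fun a : R => a * h a * w1 a).
  by apply: CcM; [exact: CcMr|exact: cts_w1].
have c3 : Cc (fun a : R => h a ^+ 2 * w1 a).
  by apply: CcM; [exact: (CcX 1)|exact: cts_w1].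
set p := J leb (fun a : R => h a * w1 a); set q := J leb (fun a : R => a * h a * w1 a).
have : 0 <= J leb (fun a : R => (h a - (p + 2 * pi * q * a)) ^+ 2 * w1 a).
  by apply: J_ge0 => a; rewrite mulr_ge0 ?sqr_ge0// ltW// w1_gt0.
have -> : (fun a : R => (h a - (p + 2 * pi * q * a)) ^+ 2 * w1 a) =
  (fun a => h a ^+ 2 * w1 a + ((- 2 * p) * (h a * w1 a) + ((- 4 * pi * q) * (a * h a * w1 a)
   + (p ^+ 2 * w1 a + ((4 * pi * p * q) * (a * w1 a) + (4 * pi ^+ 2 * q ^+ 2) * (a ^+ 2 * w1 a)))))).
  by apply/funext => a; move: (@pi R) => z; ring.
have k1 := Cc_IntR c1; have k2 := Cc_IntR c2; have k3 := Cc_IntR c3; have k4 := @Int_w1 R.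
have z6 := IntZ (4 * pi ^+ 2 * q ^+ 2) i2; have z5 := IntZ (4 * pi * p * q) i1.
have z4 := IntZ (p ^+ 2) k4; have z3 := IntZ (- 4 * pi * q) k2; have z2 := IntZ (- 2 * p) k1.
have y5 := IntD z5 z6; have y4 := IntD z4 y5; have y3 := IntD z3 y4; have y2 := IntD z2 y3.
rewrite (JD k3 y2) (JD z2 y3) (JD z3 y4) (JD z4 y5) (JD z5 z6) !JZ//.
rewrite j1 j2 J_w1 -/p -/q; move: (pi_neq0 R).
move=> pp0; have e : - 2 * p * p + (- 4 * pi * q * q + (p ^+ 2 * 1 + (4 * pi * p * q * 0 +
  4 * pi ^+ 2 * q ^+ 2 / (2 * pi)))) = - (p ^+ 2 + 2 * pi * q ^+ 2).
  by clear -pp0; generalize p q; move: pp0; generalize (@pi R); clear => p p0 x y; field.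
by rewrite e subr_ge0.
Qed.

End gaussian_moments.

(** * The Gaussian spectral gap in dimension n *)

Section gaussian_rV.
Context (R : realType).
Local Notation leb := (@lebesgue_measure R).
Implicit Types n : nat.

(** [gam] is the extremal Gaussian gamma, of unit L^2 norm, and [W] is its square, the density of
    the measure d gamma. *)
Definition W n (x : 'rV[R]_n) : R := expR (- pi * sqnorm x).
Definition gam n (x : 'rV[R]_n) : R := expR (- (pi / 2) * sqnorm x).

Lemma W_gt0 n (x : 'rV[R]_n) : 0 < W x. Proof. exact: expR_gt0. Qed.
Lemma gam_gt0 n (x : 'rV[R]_n) : 0 < gam x. Proof. exact: expR_gt0. Qed.

Lemma gam_sq n (x : 'rV[R]_n) : gam x ^+ 2 = W x.
Proof.
rewrite /gam /W expr2 -expRD; congr expR; generalize (sqnorm x) (@pi R) => s p.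
by field.
Qed.

Lemma sqnorm_cons n (a : R) (y : 'rV[R]_n) :
  sqnorm (rV_cons (a, y)) = a ^+ 2 + sqnorm y.
Proof.
rewrite /sqnorm big_ord_recl cons0; congr (_ + _).
by apply: eq_bigr => j _; rewrite consS.
Qed.

Lemma W_cons n (a : R) (y : 'rV[R]_n) : W (rV_cons (a, y)) = w1 a * W y.
Proof. by rewrite /W /w1 sqnorm_cons mulrDr expRD. Qed.

Lemma C1_W n : C1 (@W n) (fun i x => - 2 * pi * x ord0 i * W x).
Proof. by apply: C1_ext (C1_gauss n (- pi)) => // i x; rewrite /W; ring. Qed.

Lemma C1_gam n : C1 (@gam n) (fun i x => - pi * x ord0 i * gam x).
Proof. by apply: C1_ext (C1_gauss n (- (pi / 2))) => // i x; rewrite /gam; generalize (expR (- (pi / 2) * sqnorm x)) (@pi R) => e p; field. Qed.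

Lemma cts_W n : continuous (@W n). Proof. by have [] := C1_W n. Qed.
Lemma cts_gam n : continuous (@gam n). Proof. by have [] := C1_gam n. Qed.

(** For nonnegative factors Tonelli yields integrability of the product together with its
    integral. *)
Lemma J_prod n (p : R -> R) (q : 'rV[R]_n -> R) : Int leb p -> Int (lebesgue_rV R n) q ->
  (forall a, 0 <= p a) -> (forall y, 0 <= q y) ->
  Int (lebesgue_rV R n.+1) (fun x => p (x ord0 ord0) * q (rV_behead x)) /\
  J (lebesgue_rV R n.+1) (fun x => p (x ord0 ord0) * q (rV_behead x)) =
  J leb p * J (lebesgue_rV R n) q.
Proof.
move=> ip iq p0 q0; pose f (x : 'rV[R]_n.+1) := p (x ord0 ord0) * q (rV_behead x).
have mf : measurable_fun setT f.
  apply: measurable_funM.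
    exact: (measurableT_comp (Int_meas ip) (measurable_rV_coord ord0)).
  exact: (measurableT_comp (Int_meas iq) (@measurable_rV_behead R n)).
have f0 x : 0 <= f x by rewrite mulr_ge0.
have e : (\int[lebesgue_rV R n.+1]_x (f x)%:E = (J leb p * J (lebesgue_rV R n) q)%:E)%E.
  rewrite ge0_integral_cons; last 2 first.
  - exact/measurable_EFinP.
  - by move=> x; rewrite lee_fin.
  transitivity (\int[leb]_a (p a * J (lebesgue_rV R n) q)%:E)%E.
    apply: eq_integral => a _; rewrite -JZ// -JE; last exact: IntZ.
    apply: eq_integral => y _; rewrite /f cons0; congr (_ * q _)%:E.
    by apply/rowP => i; rewrite ord01 mxE consS.
  rewrite JE; last by have := IntZ (J (lebesgue_rV R n) q) ip; apply: Int_ext => a; rewrite mulrC.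
  congr (_%:E); rewrite mulrC -JZ//; apply: J_ext => a; exact: mulrC.
have le : (\int[lebesgue_rV R n.+1]_x (f x)%:E <= (J leb p * J (lebesgue_rV R n) q)%:E)%E by rewrite e.
have [i _] := Int_ge0 mf f0 le.
by split => //; apply/eqP; rewrite -eqe -JE//; exact/eqP.
Qed.

Lemma Int_J_W n : Int (lebesgue_rV R n) (@W n) /\ J (lebesgue_rV R n) (@W n) = 1.
Proof.
elim: n => [|n [iW jW]].
  have WE (x : 'rV[R]_0) : W x = 1 by rewrite /W /sqnorm big_ord0 mulr0 expR0.
  have e : (\int[lebesgue_rV R 0]_x (W x)%:E = 1)%E.
    rewrite (_ : (fun x => _) = cst 1%E); last by apply/funext => x; rewrite WE.
    by rewrite integral_cst// mul1e /= diracT.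
  have mW : measurable_fun setT (@W 0) by apply: continuous_measurable_rV; exact: cts_W.
  have le : (\int[lebesgue_rV R 0]_x (W x)%:E <= 1%:E)%E by rewrite e.
  have [i _] := Int_ge0 mW (fun x => ltW (W_gt0 x)) le.
  by split => //; apply/eqP; rewrite -eqe -JE// e.
have [i j] := J_prod (@Int_w1 R) iW (fun a => ltW (w1_gt0 a)) (fun y => ltW (W_gt0 y)).
have WE : @W n.+1 = (fun x => w1 (x ord0 ord0) * W (rV_behead x)).
  by apply/funext => x; rewrite -W_cons; congr W; rewrite -[LHS](rV_unconsK x).
by rewrite WE; split => //; rewrite j J_w1 jW mul1r.
Qed.

Lemma J_W n : J (lebesgue_rV R n) (@W n) = 1. Proof. by have [] := Int_J_W n. Qed.
Lemma Int_W n : Int (lebesgue_rV R n) (@W n). Proof. by have [] := Int_J_W n. Qed.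

Lemma J_xW n i : Int (lebesgue_rV R n) (fun x => x ord0 i ^+ 2 * W x) /\
  J (lebesgue_rV R n) (fun x => x ord0 i ^+ 2 * W x) = (2 * pi)^-1.
Proof.
elim: n i => [[]//|n IH] i; have [_ i2] := Int_w1M R; have [_ j2] := J_w1M R.
have WE (x : 'rV[R]_n.+1) : W x = w1 (x ord0 ord0) * W (rV_behead x).
  by rewrite -W_cons; congr W; rewrite -[LHS](rV_unconsK x).
case: (unliftP ord0 i) => [k|] ->.
  have [iI jI] := IH k.
  have [] := J_prod (@Int_w1 R) iI (fun a => ltW (w1_gt0 a)).
    by move=> y; rewrite mulr_ge0 ?sqr_ge0// ltW// W_gt0.
  rewrite J_w1 jI mul1r (_ : (fun x : 'rV[R]_n.+1 => x ord0 (lift ord0 k) ^+ 2 * W x) =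
    (fun x => w1 (x ord0 ord0) * (rV_behead x ord0 k ^+ 2 * W (rV_behead x))))//.
  by apply/funext => x; rewrite WE mxE; ring.
have [] := J_prod i2 (Int_W n) _ (fun y => ltW (W_gt0 y)).
  by move=> a; rewrite mulr_ge0 ?sqr_ge0// ltW// w1_gt0.
rewrite j2 J_W mulr1 (_ : (fun x : 'rV[R]_n.+1 => x ord0 ord0 ^+ 2 * W x) =
  (fun x => x ord0 ord0 ^+ 2 * w1 (x ord0 ord0) * W (rV_behead x)))//.
by apply/funext => x; rewrite WE mulrA.
Qed.

Lemma Sq_gam n : Sq (lebesgue_rV R n) (@gam n).
Proof.
split; first by apply: continuous_measurable_rV; exact: cts_gam.
by have := Int_W n; apply: Int_ext => x; rewrite gam_sq.
Qed.

Lemma Sq_xgam n i : Sq (lebesgue_rV R n) (fun x => x ord0 i * gam x).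
Proof.
split.
  apply: continuous_measurable_rV; apply: ctsM; last exact: cts_gam.
  exact: coord_continuous.
have := (J_xW i).1; apply: Int_ext => x.
by rewrite exprMn gam_sq.
Qed.

(* Cauchy-Schwarz for the probability density [W]. *)
Lemma sq_J_W n (f : 'rV[R]_n -> R) : Sq (lebesgue_rV R n) (fun x => f x * gam x) ->
  J (lebesgue_rV R n) (fun x => f x * W x) ^+ 2 <=
  J (lebesgue_rV R n) (fun x => f x ^+ 2 * W x).
Proof.
move=> sf; have := cauchy_schwarzJ sf (Sq_gam n).
rewrite (@J_ext _ _ _ _ (fun x => f x * gam x * gam x) ( fun x => f x * W x)); last first.
  by move=> x; rewrite -gam_sq expr2 mulrA.
rewrite (@J_ext _ _ _ _ (fun x => (f x * gam x) ^+ 2) ( fun x => f x ^+ 2 * W x)); last first.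
  by move=> x; rewrite exprMn gam_sq.
by rewrite (J_ext _ (@gam_sq n)) J_W mulr1.
Qed.

Lemma sq_J_xW n i (f : 'rV[R]_n -> R) : Sq (lebesgue_rV R n) (fun x => f x * gam x) ->
  J (lebesgue_rV R n) (fun x => x ord0 i * f x * W x) ^+ 2 <=
  J (lebesgue_rV R n) (fun x => f x ^+ 2 * W x) * (2 * pi)^-1.
Proof.
move=> sf; have := cauchy_schwarzJ sf (Sq_xgam i).
rewrite (@J_ext _ _ _ _ (fun x : 'rV[R]_n => f x * gam x * (x ord0 i * gam x)) (fun x => x ord0 i * f x * W x)); last first.
  by move=> x; rewrite -gam_sq; ring.
rewrite (@J_ext _ _ _ _ (fun x => (f x * gam x) ^+ 2) ( fun x => f x ^+ 2 * W x)); last first.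
  by move=> x; rewrite exprMn gam_sq.
rewrite (@J_ext _ _ _ _ (fun x : 'rV[R]_n => (x ord0 i * gam x) ^+ 2) (fun x => x ord0 i ^+ 2 * W x)).
  by rewrite (J_xW i).2.
by move=> x; rewrite exprMn gam_sq.
Qed.

Lemma CcW n (f : 'rV[R]_n -> R) : Cc f -> Cc (fun x => f x * W x).
Proof. by move=> cf; apply: CcM => //; exact: cts_W. Qed.

Lemma CcxW n i (f : 'rV[R]_n -> R) : Cc f -> Cc (fun x : 'rV[R]_n => x ord0 i * f x * W x).
Proof. by move=> cf; apply: CcW; apply: CcMr => //; exact: coord_continuous. Qed.

Lemma Cc2W n (f : 'rV[R]_n -> R) : Cc f -> Cc (fun x => f x ^+ 2 * W x).
Proof. by move=> cf; apply: CcW; exact: (CcX 1). Qed.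

(** The gap at the eigenvalue 4 pi, with the modes of degree 0 and 1 added back; [gap1] below is the
    Poincare inequality at 2 pi. *)
Definition gap2 n := forall (u : 'rV[R]_n -> R) g, C1c u g ->
  4 * pi * J (lebesgue_rV R n) (fun x => u x ^+ 2 * W x) <=
  \sum_i J (lebesgue_rV R n) (fun x => g i x ^+ 2 * W x)
  + 4 * pi * J (lebesgue_rV R n) (fun x => u x * W x) ^+ 2
  + 4 * pi ^+ 2 * \sum_i J (lebesgue_rV R n) (fun x => x ord0 i * u x * W x) ^+ 2.

Definition gap1 n := forall (u : 'rV[R]_n -> R) g, C1c u g ->
  2 * pi * J (lebesgue_rV R n) (fun x => u x ^+ 2 * W x) <=
  \sum_i J (lebesgue_rV R n) (fun x => g i x ^+ 2 * W x)
  + 2 * pi * J (lebesgue_rV R n) (fun x => u x * W x) ^+ 2.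

(** Integrating by parts, 2 pi times the first moment of u along i is the mean of g i;
    Cauchy-Schwarz then bounds the degree-one terms by the energy, and half of the result is the
    claim. *)
Lemma gap2_gap1 n : gap2 n -> gap1 n.
Proof.
move=> h u g ug; have := h u g ug; have p0 := pi_gt0 R.
have key i : 4 * pi ^+ 2 * J (lebesgue_rV R n) (fun x => x ord0 i * u x * W x) ^+ 2 <=
    J (lebesgue_rV R n) (fun x => g i x ^+ 2 * W x).
  have := J_C1c0 i (C1cM ug (C1_W n)) => /=.
  rewrite (@J_ext _ _ _ _ _ ( fun x => g i x * W x - (2 * pi) * (x ord0 i * u x * W x))); last first.
    by move=> x; ring.
  have cg := C1c_Ccd i ug; have cu := C1c_Cc ug.
  rewrite JB ?JZ; try (by apply: Cc_Int; try apply: CcZ; do ?[exact: CcW|exact: CcxW]).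
  move=> /eqP; rewrite subr_eq0 => /eqP e.
  rewrite (_ : 4 * pi ^+ 2 = (2 * pi) ^+ 2); last by rewrite exprMn -natrX.
  rewrite -exprMn -e; apply: sq_J_W.
  by apply: Cc_Sq; apply: CcM => //; exact: cts_gam.
have : 4 * pi ^+ 2 * (\sum_i J (lebesgue_rV R n) (fun x => x ord0 i * u x * W x) ^+ 2) <=
   \sum_i J (lebesgue_rV R n) (fun x => g i x ^+ 2 * W x).
  by rewrite mulr_sumr; apply: ler_sum => i _; exact: key.
by lra.
Qed.

Let gap2_arith (p a b c d e G1 G2 G3 x0 xs : R) : 0 < p ->
  4 * p * a <= b + 4 * p * c + 4 * p ^+ 2 * d ->
  4 * p * c <= G1 + 4 * p * e ^+ 2 + 4 * p ^+ 2 * xs ->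
  2 * p * d <= G2 + 2 * p * x0 ^+ 2 ->
  G1 + 2 * p * G2 <= G3 ->
  4 * p * a <= b + G3 + 4 * p * e ^+ 2 + 4 * p ^+ 2 * (x0 ^+ 2 + xs).
Proof.
move=> p0 h1 h2 h3 h4.
have : 2 * p * (2 * p * d) <= 2 * p * (G2 + 2 * p * x0 ^+ 2) by rewrite ler_pM2l ?mulr_gt0.
move: h1 h2 h4; move: (e ^+ 2) (x0 ^+ 2) => ee xx; lra.
Qed.

(** Expansion in the first variable: [gap_1d] leaves the modes of degree 0 and 1, whose coefficients
    [P0 u] and [P1 u] are functions of the other variables. [P0 u] can still have modes of degree 1
    and calls for [gap2]; [P1 u] already carries degree 1 and calls only for [gap1]. Bessel's
    inequality fits the two energies so used into that of u. *)
Lemma gap2_rec n : gap2 n -> gap2 n.+1.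
Proof.
move=> IH u g ug; have IH1 := gap2_gap1 IH; have p0 := pi_gt0 R.
have cu := C1c_Cc ug; have cg i := C1c_Ccd i ug.
have [[_ _ dg] _] := ug.
have cw : continuous (fun x : 'rV[R]_n.+1 => w1 (x ord0 ord0)).
  apply: cts_comp; [exact: cts_w1|exact: coord_continuous].
have c0 : continuous (fun x : 'rV[R]_n.+1 => x ord0 ord0) by exact: coord_continuous.
pose P0 (f : 'rV[R]_n.+1 -> R) y := J leb (fun a => f (rV_cons (a, y)) * w1 a).
pose P1 (f : 'rV[R]_n.+1 -> R) y := J leb (fun a => a * f (rV_cons (a, y)) * w1 a).
have P0E f : P0 f = fun y => J leb (fun a => (fun x : 'rV[R]_n.+1 => f x * w1 (x ord0 ord0)) (rV_cons (a, y))).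
  by apply/funext => y; apply: J_ext => a; rewrite cons0.
have P1E f : P1 f = fun y => J leb (fun a => (fun x : 'rV[R]_n.+1 => x ord0 ord0 * f x * w1 (x ord0 ord0)) (rV_cons (a, y))).
  by apply/funext => y; apply: J_ext => a; rewrite cons0.
have C0 f : Cc f -> Cc (fun x : 'rV[R]_n.+1 => f x * w1 (x ord0 ord0)) by move=> cf; exact: CcM.
have C1' f : Cc f -> Cc (fun x : 'rV[R]_n.+1 => x ord0 ord0 * f x * w1 (x ord0 ord0)).
  by move=> cf; apply: CcM => //; exact: CcMr.
have CP0 f : Cc f -> Cc (P0 f) by move=> cf; rewrite P0E; exact: (Cc_int1 (C0 _ cf)).
have CP1 f : Cc f -> Cc (P1 f) by move=> cf; rewrite P1E; exact: (Cc_int1 (C1' _ cf)).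
have pdw (j : 'I_n) (f h : 'rV[R]_n.+1 -> R) (k : R -> R) : pd (lift ord0 j) f h ->
    pd (lift ord0 j) (fun x => f x * k (x ord0 ord0)) (fun x => h x * k (x ord0 ord0)).
  move=> d x; apply: (dE (dM (d x) (dcst (k (x ord0 ord0)) 0))) => [s|]; last by rewrite mulr0 addr0.
  by rewrite coord_line eq_sym (negPf (neq_lift _ _)) mulr0 addr0.
have U0 : C1c (P0 u) (fun j => P0 (g (lift ord0 j))).
  have [cP bP] := CP0 _ cu; split=> //; split=> // [j|j]; first by have [] := CP0 _ (cg (lift ord0 j)).
  by rewrite !P0E; exact: (pd_int1 (C0 _ cu) (C0 _ (cg _)) (pdw j _ _ (@w1 R) (dg _))).
have U1 : C1c (P1 u) (fun j => P1 (g (lift ord0 j))).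
  have [cP bP] := CP1 _ cu; split=> //; split=> // [j|j]; first by have [] := CP1 _ (cg (lift ord0 j)).
  rewrite !P1E; apply: (pd_int1 (C1' _ cu) (C1' _ (cg _))).
  have E (f : 'rV[R]_n.+1 -> R) : (fun x : 'rV[R]_n.+1 => x ord0 ord0 * f x * w1 (x ord0 ord0)) =
      (fun x : 'rV[R]_n.+1 => f x * (fun a => a * w1 a) (x ord0 ord0)).
    by apply/funext => x; rewrite /= mulrCA mulrA.
  by rewrite !E; exact: (pdw j _ _ (fun a => a * w1 a)).
have F2 f : Cc f -> J (lebesgue_rV R n.+1) (fun x => f x ^+ 2 * W x) =
    J (lebesgue_rV R n) (fun y => J leb (fun a => f (rV_cons (a, y)) ^+ 2 * w1 a) * W y).
  move=> cf; rewrite J_cons2; last exact: Cc2W.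
  apply: J_ext => y; rewrite mulrC -JZ; last first.
    by apply: Cc_IntR; apply: CcM; [exact/(CcX 1)/Cc_slice1|exact: cts_w1].
  by apply: J_ext => a; rewrite W_cons mulrA mulrC.
have Cs (f : 'rV[R]_n.+1 -> R) : Cc f -> Cc (fun y : 'rV[R]_n => J leb (fun a => f (rV_cons (a, y)) ^+ 2 * w1 a)).
  move=> cf; have := Cc_int1 (C0 _ (CcX 1 cf)); congr Cc; apply/funext => y.
  by apply: J_ext => a; rewrite cons0.
(* The one-dimensional gap on every line parallel to the first axis, integrated over the others. *)
have s1 : 4 * pi * J (lebesgue_rV R n.+1) (fun x => u x ^+ 2 * W x) <=
   J (lebesgue_rV R n.+1) (fun x => g ord0 x ^+ 2 * W x)
   + 4 * pi * J (lebesgue_rV R n) (fun y => P0 u y ^+ 2 * W y)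
   + 4 * pi ^+ 2 * J (lebesgue_rV R n) (fun y => P1 u y ^+ 2 * W y).
  have k1 := Cc_Int (CcW (Cs _ cu)); have k2 := Cc_Int (CcW (Cs _ (cg ord0))).
  have k3 := Cc_Int (Cc2W (CP0 _ cu)); have k4 := Cc_Int (Cc2W (CP1 _ cu)).
  have z3 := IntZ (4 * pi) k3; have z4 := IntZ (4 * pi ^+ 2) k4.
  rewrite (F2 _ cu) (F2 _ (cg ord0)) -(JZ (4 * pi) k1) -(JZ _ k3) -(JZ _ k4).
  have y3 := IntD k2 z3; rewrite -(JD k2 z3) -(JD y3 z4); apply: J_le => [||y].
  - exact: IntZ.
  - exact: IntD.
  have /= := @gap_1d R (fun a => u (rV_cons (a, y))) (fun a => g ord0 (rV_cons (a, y)))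
    (fun a => pd_cons0 y a (dg ord0)) (Cc_cts (Cc_slice1 y (cg ord0))) (Cc_slice1 y cu).
  rewrite -/(P0 u y) -/(P1 u y) => h; have := ler_wpM2r (ltW (W_gt0 y)) h.
  by congr (_ <= _); ring.
have s2 := IH _ _ U0; have s3 := IH1 _ _ U1.
have s4 (j : 'I_n) : J (lebesgue_rV R n) (fun y => P0 (g (lift ord0 j)) y ^+ 2 * W y) +
    2 * pi * J (lebesgue_rV R n) (fun y => P1 (g (lift ord0 j)) y ^+ 2 * W y) <=
    J (lebesgue_rV R n.+1) (fun x => g (lift ord0 j) x ^+ 2 * W x).
  set h := g _; have ch : Cc h := cg _.
  have k1 := Cc_Int (CcW (Cs _ ch)).
  have k3 := Cc_Int (Cc2W (CP0 _ ch)); have k4 := Cc_Int (Cc2W (CP1 _ ch)).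
  have z4 := IntZ (2 * pi) k4.
  rewrite (F2 _ ch) -(JZ _ k4) -(JD k3 z4); apply: J_le => [||y] //; first exact: IntD.
  have := bessel_w1 (Cc_slice1 y ch).
  rewrite -/(P0 h y) -/(P1 h y) => /(ler_wpM2r (ltW (W_gt0 y))).
  by congr (_ <= _); ring.
have E0 f : Cc f -> J (lebesgue_rV R n) (fun y => P0 f y * W y) = J (lebesgue_rV R n.+1) (fun x => f x * W x).
  move=> cf; rewrite [RHS]J_cons2; last exact: CcW.
  apply: J_ext => y; rewrite mulrC -JZ; last first.
    by apply: Cc_IntR; apply: CcM; [exact: Cc_slice1|exact: cts_w1].
  by apply: J_ext => a; rewrite W_cons [RHS]mulrA [RHS]mulrC.
have E1 : J (lebesgue_rV R n) (fun y => P1 u y * W y) = J (lebesgue_rV R n.+1) (fun x => x ord0 ord0 * u x * W x).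
  rewrite [RHS]J_cons2; last exact: CcxW.
  apply: J_ext => y; rewrite mulrC -JZ; last first.
    have := Cc_slice1 y (C1' _ cu) => /Cc_IntR; apply: Int_ext => a.
    by rewrite cons0.
  by apply: J_ext => a; rewrite W_cons cons0 [RHS]mulrA [RHS]mulrC.
have E2 (j : 'I_n) : J (lebesgue_rV R n) (fun y => y ord0 j * P0 u y * W y) =
    J (lebesgue_rV R n.+1) (fun x => x ord0 (lift ord0 j) * u x * W x).
  rewrite -(E0 (fun x => x ord0 (lift ord0 j) * u x)); last first.
    by apply: CcMr => //; exact: coord_continuous.
  apply: J_ext => y; congr (_ * _); rewrite -JZ; last first.
    by apply: Cc_IntR; apply: CcM; [exact: Cc_slice1|exact: cts_w1].
  by apply: J_ext => a; rewrite consS mulrA.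
have E3 : \sum_j J (lebesgue_rV R n) (fun y : 'rV[R]_n => y ord0 j * P0 u y * W y) ^+ 2 =
    \sum_(j < n) J (lebesgue_rV R n.+1) (fun x : 'rV[R]_n.+1 => x ord0 (lift ord0 j) * u x * W x) ^+ 2.
  by apply: eq_bigr => j _; rewrite E2.
have s5 : \sum_j J (lebesgue_rV R n) (fun y => P0 (g (lift ord0 j)) y ^+ 2 * W y) +
    2 * pi * \sum_j J (lebesgue_rV R n) (fun y => P1 (g (lift ord0 j)) y ^+ 2 * W y) <=
    \sum_(j < n) J (lebesgue_rV R n.+1) (fun x => g (lift ord0 j) x ^+ 2 * W x).
  by rewrite mulr_sumr -big_split; apply: ler_sum => j _; exact: s4.
rewrite !big_ord_recl; move: s1 s2 s3 s5; rewrite (E0 _ cu) E1 E3 => s1 s2 s3 s5.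
by exact: (gap2_arith p0 s1 s2 s3 s5).
Qed.

Lemma gap2_all n : gap2 n.
Proof.
elim: n => [|n]; last exact: gap2_rec.
(* In dimension 0 functions are constants and equality holds. *)
move=> u g ug; rewrite !big_ord0 mulr0 addr0 add0r ler_pM2l ?mulr_gt0 ?pi_gt0//.
have uE (x : 'rV[R]_0) : u x = u 0 by congr u; apply/rowP => -[].
rewrite (@J_ext _ _ _ _ _ ( fun x => u 0 ^+ 2 * W x)); last by move=> x; rewrite uE.
rewrite (@J_ext _ _ _ _ (fun x => u x * W x) ( fun x => u 0 * W x)); last by move=> x; rewrite uE.
by rewrite !JZ ?J_W ?mulr1//; exact: Int_W.
Qed.

End gaussian_rV.

(** * The functions x ln x and s^2 ln s^2 *)

Section xlnx.
Context (R : realType).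
Implicit Types (x y s : R).

Definition xln x : R := x * ln x.
Definition Fl s : R := xln (s ^+ 2).

Lemma xln0 : xln 0 = 0. Proof. by rewrite /xln mul0r. Qed.
Lemma Fl0 : Fl 0 = 0. Proof. by rewrite /Fl expr0n xln0. Qed.

Lemma ln_le_sub1 x : 0 < x -> ln x <= x - 1.
Proof. by move=> x0; have := expR_ge1Dx (ln x); rewrite lnK ?posrE//; lra. Qed.

Lemma ln_sqr s : s != 0 -> ln (s ^+ 2) = 2 * ln `|s|.
Proof.
move=> s0; rewrite -(real_normK (num_real s)) expr2 lnM ?posrE ?normr_gt0//.
by rewrite mulrDl mul1r.
Qed.

(** From ln y <= y - 1 at y = 1/|s| and at y = s^2: crude bounds, enough for continuity at 0 and for
    small arguments later. *)
Lemma Fl_bounds s : - (2 * `|s|) <= Fl s <= s ^+ 4.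
Proof.
have [->|s0] := eqVneq s 0; first by rewrite Fl0 normr0 mulr0 oppr0 expr0n/= lexx.
have r0 : 0 < `|s| by rewrite normr_gt0.
have s2 : 0 < s ^+ 2 by rewrite exprn_even_gt0.
apply/andP; split.
  rewrite /Fl /xln ln_sqr// -(real_normK (num_real s)); move: (`|s|) r0 => r r0.
  have := ln_le_sub1 (_ : 0 < r^-1); rewrite invr_gt0 lnV ?posrE// => /(_ r0) h.
  have rr : r ^+ 2 * r^-1 = r by field; rewrite gt_eqF.
  have : r ^+ 2 * - ln r <= r ^+ 2 * (r^-1 - 1) by rewrite ler_pM2l ?exprn_gt0.
  by rewrite mulrBr rr mulr1; have := sqr_ge0 r; lra.
have := ln_le_sub1 s2 => h; rewrite /Fl /xln.
have : s ^+ 2 * ln (s ^+ 2) <= s ^+ 2 * (s ^+ 2 - 1) by rewrite ler_pM2l.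
by rewrite (_ : s ^+ 4 = s ^+ 2 * s ^+ 2) ?mulrBr//; [lra|rewrite -exprD].
Qed.

Lemma cts_Fl : continuous Fl.
Proof.
move=> s; have [->|s0] := eqVneq s 0.
  apply/cvgrPdist_lt => e e0; near=> t.
  rewrite Fl0 sub0r normrN.
  have t1 : `|t| <= 1.
    near: t; apply/nbhs_ballP; exists 1 => //= t.
    by rewrite /ball/= sub0r normrN => /ltW.
  have te : `|t| < e / 3.
    near: t; apply/nbhs_ballP; exists (e / 3) => /=; first by rewrite divr_gt0.
    by move=> t; rewrite /ball/= sub0r normrN.
  have t0 := normr_ge0 t.
  have : `|Fl t| <= 3 * `|t|.
    have /andP[h1 h2] := Fl_bounds t.
    have : t ^+ 4 <= `|t|.
      rewrite -[t ^+ 4]ger0_norm ?exprn_even_ge0// normrX (exprSr _ 3).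
      by rewrite ler_piMl// exprn_ile1.
    by move=> h3; rewrite ler_norml; apply/andP; split; lra.
  by lra.
have d : is_derive s 1 (fun t : R => t ^+ 2 * ln (t ^+ 2)) (2%:R * s ^+ 1 * 1 * ln (s ^+ 2) + s ^+ 2 * ((s ^+ 2)^-1 * (2%:R * s ^+ 1 * 1))).
  apply: dM; first exact: (dX 2 (did s)).
  by apply: (dln _ (dX 2 (did s))); rewrite exprn_even_gt0.
exact: is_derive_continuous d.
Unshelve. all: by end_near. Qed.

(** True for negative x as well, where [ln] and [Num.sqrt] both return 0; continuity of [xln] is
    thereby inherited from [Fl]. *)
Lemma xlnE x : xln x = Fl (Num.sqrt x).
Proof.
have [x0|x0] := leP 0 x; first by rewrite /Fl sqr_sqrtr.
by rewrite ler0_sqrtr ?(ltW x0)// Fl0 /xln ln0 ?mulr0// ltW.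
Qed.

Lemma cts_xln : continuous xln.
Proof.
rewrite (_ : xln = Fl \o Num.sqrt); last by apply/funext => x; exact: xlnE.
by move=> x; apply: continuous_comp; [exact: sqrt_continuous|exact: cts_Fl].
Qed.

Lemma Cc_Fl (V : normedModType R) (f : V -> R) : Cc f -> Cc (fun v => Fl (f v)).
Proof. exact: (Cc_comp cts_Fl Fl0). Qed.

Lemma Cc_xln (V : normedModType R) (f : V -> R) : Cc f -> Cc (fun v => xln (f v)).
Proof. exact: (Cc_comp cts_xln xln0). Qed.

End xlnx.

(** * The logarithmic Sobolev inequality on the line *)

Section log_sobolev_line.
Context (R : realType).
Local Notation leb := (@lebesgue_measure R).
Implicit Types (x y s t : R).

Lemma prim_w1_onto y : 0 < y < 1 -> exists t, prim (@w1 R) t = y.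
Proof.
move=> /andP[y0 y1]; have e0 : 0 < Num.min y (1 - y) by rewrite lt_min y0 subr_gt0.
have [M hM] := tail_w1 e0; pose x := 1 + `|M|.
have Mx : M < x by rewrite /x; have := ler_norm M; lra.
have xx : - x <= x by rewrite /x; have := normr_ge0 M; lra.
have := hM x Mx.
have /andP[a1 a2] := prim_bounds x (@Int_w1 R) (fun x => ltW (w1_gt0 x)).
have /andP[b1 b2] := prim_bounds (- x) (@Int_w1 R) (fun x => ltW (w1_gt0 x)).
rewrite J_w1 in a2 b2; have : Num.min y (1 - y) <= y by rewrite ge_min lexx.
have : Num.min y (1 - y) <= 1 - y by rewrite ge_min lexx orbT.
move=> h1 h2 h3.
have [||t _ <-] := @IVT R (prim (@w1 R)) (- x) x y xx; last by exists t.
  apply: continuous_subspaceT; apply: is_derive_cts.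
  by apply: is_derive_prim; [exact: cts_w1|exact: Int_w1].
by rewrite ge_min le_max; apply/andP; split; apply/orP; [left|right]; lra.
Qed.

Lemma prim_w1_lt s t : s < t -> prim (@w1 R) s < prim (@w1 R) t.
Proof.
(* A positive lower bound of [w1] on (s, t), so that the primitive grows by at least c (t - s). *)
move=> st; pose c : R := expR (- pi * (s ^+ 2 + t ^+ 2)).
have c0 : 0 < c by exact: expR_gt0.
have d x : is_derive x 1 (fun z : R => prim (@w1 R) z - c * z) (w1 x - c).
  apply: (dE (dB (is_derive_prim (@cts_w1 R) (@Int_w1 R) x) (dM (dcst c x) (did x)))) => //.
  by rewrite mul0r add0r mulr1.
have := @derive_ndecr R _ (fun x => w1 x - c) s t (ltW st) (is_derive_cts d) (fun x _ => d x).
have h x : s < x < t -> 0 <= w1 x - c.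
  move=> /andP[sx xt]; rewrite subr_ge0 ler_expR ler_wnM2l ?oppr_le0 ?pi_ge0//.
  have : (x - s) * (x - t) <= 0 by rewrite mulr_ge0_le0//; lra.
  by have := sqr_ge0 (s + t - x); lra.
move=> /(_ h); have : 0 < c * (t - s) by rewrite mulr_gt0// subr_gt0.
by rewrite mulrBr; lra.
Qed.

(** The inverse of the Gaussian distribution function, with default value 0 outside its range. *)
Definition quantile y : R := xget 0 [set t | prim (@w1 R) t = y].

Lemma quantileK y : 0 < y < 1 -> prim (@w1 R) (quantile y) = y.
Proof. by move=> /prim_w1_onto [t ht]; rewrite /quantile; case: xgetP => [z _ //|/(_ t)]. Qed.

Lemma prim_w1K : cancel (prim (@w1 R)) quantile.
Proof.
move=> t; rewrite /quantile; case: xgetP => [z _ /= h|/(_ t) []//].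
case: (ltgtP z t) => // /prim_w1_lt; by rewrite h ltxx.
Qed.

Lemma is_derive_quantile y : 0 < y < 1 ->
  is_derive y 1 quantile (w1 (quantile y))^-1.
Proof.
move=> y01; have d := is_derive_prim (@cts_w1 R) (@Int_w1 R).
rewrite -{1}(quantileK y01); apply: (@is_derive_inverse R (prim (@w1 R))).
- by near=> z; exact: prim_w1K.
- by near=> z; exact: (is_derive_cts d).
- by rewrite gt_eqF// w1_gt0.
Unshelve. all: by end_near. Qed.

(** Logarithms of the transport equation give ln u^2; then ln (lam T') <= lam T' - 1 is used and the
    square of lam g / pi + T u is completed. The last bracket is the derivative of u^2 T and
    integrates to 0. The parameter lam is a dilation: lam = 1 gives the sharp inequality, a small
    lam a small multiple of the energy. *)
Lemma log_sobolev_pointwise (u g T T' lam m k : R) : 0 < lam -> 0 < m ->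
  T' * w1 T = expR (- k) / m * u ^+ 2 ->
  Fl u <= lam ^+ 2 / pi * g ^+ 2 + (ln m + k - 1 - ln lam) * u ^+ 2
    + lam * (2 * u * g * T + u ^+ 2 * T').
Proof.
move=> l0 m0 e; have p0 := pi_gt0 R.
have key : 0 <= lam ^+ 2 / pi * g ^+ 2 + lam * (2 * u * g * T) + pi * T ^+ 2 * u ^+ 2.
  have -> : lam ^+ 2 / pi * g ^+ 2 + lam * (2 * u * g * T) + pi * T ^+ 2 * u ^+ 2 =
      pi * (lam * g / pi + T * u) ^+ 2.
    by clear -p0; have := lt0r_neq0 p0; clear p0; move: (@pi R) => p p0; field.
  by rewrite mulr_ge0 ?sqr_ge0// ltW.
have [u0|u0] := eqVneq u 0.
  move: key; rewrite u0 Fl0 expr0n/= !(mulr0, mul0r, addr0)//.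
have u2 : 0 < u ^+ 2 by rewrite exprn_even_gt0.
have T'0 : 0 < T' by rewrite -(pmulr_lgt0 _ (w1_gt0 T)) e mulr_gt0 ?divr_gt0 ?expR_gt0.
have : ln (T' * w1 T) = ln (expR (- k) / m * u ^+ 2) by rewrite e.
rewrite lnM ?posrE ?w1_gt0// lnM ?posrE ?divr_gt0 ?expR_gt0// ln_div ?posrE ?expR_gt0//.
rewrite expRK /w1 expRK => e1.
have := @ln_le_sub1 R (lam * T') (mulr_gt0 l0 T'0); rewrite lnM ?posrE// => e2.
have : u ^+ 2 * ln (u ^+ 2) <= u ^+ 2 * (lam * T' - 1 - ln lam + k + ln m - pi * T ^+ 2).
  rewrite ler_pM2l// (_ : ln (u ^+ 2) = ln T' + - pi * T ^+ 2 + k + ln m); last first.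
    by rewrite e1; ring.
  rewrite mulNr -subr_ge0; move: e2; rewrite -subr_ge0; congr (_ <= _).
  by move: (pi * _) (ln T') (ln lam) (ln m) => z a b c; ring.
rewrite /Fl /xln; move: key; clear; move: (u ^+ 2 * ln _).
by move: (lam ^+ 2 / pi * g ^+ 2) (pi * T ^+ 2) => A B L; lra.
Qed.

(* Transport of the density u^2/m to the Gaussian density w1. *)
Lemma log_sobolev_line (u g : R -> R) (lam : R) : (forall x : R, is_derive x 1 u (g x)) ->
  continuous g -> Cc u -> 0 < lam ->
  J leb (fun x => Fl (u x)) <= lam ^+ 2 / pi * J leb (fun x => g x ^+ 2)
    - (1 + ln lam) * J leb (fun x => u x ^+ 2) + xln (J leb (fun x => u x ^+ 2)).
Proof.
move=> du cg cu l0; have bg := is_derive_bsupp du cu.2.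
have Cg : Cc g by [].
have i1 := Cc_IntR (CcX 1 Cg); have c2 := CcX 1 cu; have i2 := Cc_IntR c2.
have i3 := Cc_IntR (Cc_Fl cu).
set m := J leb (fun x => u x ^+ 2).
have m0 : 0 <= m by apply: J_ge0 => x; exact: sqr_ge0.
have l2 : 0 <= lam ^+ 2 / pi by rewrite divr_ge0 ?sqr_ge0// pi_ge0.
have [me|mn] := eqVneq m 0.
  rewrite me xln0 mulr0 subr0 addr0.
  have [] := @J_ae _ _ _ leb (fun=> 0) (fun x => Fl (u x)).
  - by apply: continuous_measurable_R; exact: (Cc_cts (Cc_Fl cu)).
  - exact: Int0.
  - have := @J_eq0 _ _ _ leb _ i2 (fun x => sqr_ge0 (u x)) me.
    by apply: filterS => x /eqP; rewrite sqrf_eq0 => /eqP ->; rewrite Fl0.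
  move=> _ ->; rewrite J0 mulr_ge0//; apply: J_ge0 => x; exact: sqr_ge0.
have m1 : 0 < m by rewrite lt_def mn.
(* Transporting the whole mass would send the ends of the support to infinity. Only the fraction
   e^(-k) is transported, centred by the offset (1 - e^(-k))/2 in [Y], so that [T] is differentiable
   everywhere; the price is k * m = e. *)
apply/ler_addgt0Pr => e e0; pose k := e / m; have k0 : 0 < k by rewrite divr_gt0.
have ek1 : expR (- k) < 1 by rewrite expR_lt1 oppr_lt0.
have ek0 : 0 < expR (- k) by exact: expR_gt0.
pose P := prim (fun x => u x ^+ 2).
have dP x : is_derive x 1 P (u x ^+ 2) by exact: (is_derive_prim (Cc_cts c2) i2).
pose Y (x : R) : R := (1 - expR (- k)) / 2 + expR (- k) / m * P x.
have Y01 x : 0 < Y x < 1.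
  have /andP[p1 p2] := prim_bounds x i2 (fun x => sqr_ge0 (u x)).
  have : 0 <= P x / m <= 1 by rewrite divr_ge0//= ler_pdivrMr// mul1r.
  rewrite /Y -mulrA (mulrC m^-1); move: (P x / m) => z /andP[z0 z1].
  have : expR (- k) * z <= expR (- k) by rewrite ler_piMr// ltW.
  have : 0 <= expR (- k) * z by rewrite mulr_ge0// ltW.
  by move: (expR _ * z) => w w0 w1; apply/andP; split; lra.
have dY x : is_derive x 1 Y (expR (- k) / m * u x ^+ 2).
  apply: (dE (dD (dcst _ x) (dM (dcst (expR (- k) / m) x) (dP x)))) => //.
  by rewrite mul0r !add0r.
pose T (x : R) : R := quantile (Y x).
pose T' (x : R) : R := (w1 (T x))^-1 * (expR (- k) / m * u x ^+ 2).
have dT x : is_derive x 1 T (T' x) by exact: (dcomp (is_derive_quantile (Y01 x)) (dY x)).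
have cT := is_derive_cts dT.
have cT' : continuous T'.
  apply: ctsM; last by apply: ctsM; [exact: cts_cst|exact: Cc_cts c2].
  have -> : (fun x => (w1 (T x))^-1) = (fun x => expR (pi * (T x ^+ 2))).
    by apply/funext => x; rewrite /w1 -expRN mulNr opprK.
  by apply: cts_exp; apply: ctsM; [exact: cts_cst|exact: ctsX].
pose S' (x : R) : R := 2 * u x * g x * T x + u x ^+ 2 * T' x.
have dS x : is_derive x 1 (fun x : R => u x ^+ 2 * T x) (S' x).
  by apply: (dE (dM (dX 2 (du x)) (dT x))) => //; rewrite /S' expr1.
have c3 : Cc (fun x => 2 * u x * g x * T x).
  by apply: CcM => //; apply: CcMr => //; apply: ctsM; [exact: cts_cst|exact: Cc_cts cu].
have cS : Cc S' by apply: CcD => //; apply: CcM.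
have JS : J leb S' = 0.
  by apply: (J_derive0 dS) => //; [exact: Cc_cts cS|exact: bsupp_mul c2.2].
have z1 := IntZ (lam ^+ 2 / pi) i1; have z2 := IntZ (ln m + k - 1 - ln lam) i2.
have z3 := IntZ lam (Cc_IntR cS); have z12 := IntD z1 z2; have z := IntD z12 z3.
have := J_le i3 z _.
rewrite (JD z12 z3) (JD z1 z2) (JZ _ i1) (JZ _ i2) (JZ _ (Cc_IntR cS)) JS -/m.
have km : k * m = e by rewrite /k divfK.
rewrite /xln; move=> h; apply: le_trans (h _) _ => [x|].
  apply: log_sobolev_pointwise => //.
  by rewrite /T' mulrAC mulVf ?mul1r// gt_eqF// w1_gt0.
by rewrite -km; move: (J leb _) (lam ^+ 2 / pi) (ln m) (ln lam) => a b c d; lra.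
Qed.

End log_sobolev_line.

(** * The logarithmic Sobolev inequality in dimension n *)

Section log_sobolev.
Context (R : realType).
Local Notation leb := (@lebesgue_measure R).
Implicit Types n : nat.

Lemma cts_ln (V : topologicalType) (h : V -> R) : continuous h -> (forall v, 0 < h v) ->
  continuous (fun v => ln (h v)).
Proof. by move=> ch h0 v; apply: continuous_comp; [exact: ch|exact: continuous_ln]. Qed.

(** From ln y <= y - 1 at y = s/f; it serves for relative entropies and as the tangent-line
    inequality of x ln x. *)
Lemma gibbs_pointwise (f s : R) : 0 <= f -> 0 < s -> f * ln s + f - s <= xln f.
Proof.
rewrite le_eqVlt => /orP[/eqP <- s0|f0 s0]; first by rewrite xln0 mul0r !add0r oppr_le0 ltW.
have := ln_le_sub1 (divr_gt0 s0 f0); rewrite ln_div ?posrE// => h.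
have : f * (ln s - ln f) <= f * (s / f - 1) by rewrite ler_pM2l.
rewrite mulrBr mulrBr mulr1 mulrCA divff ?gt_eqF// mulr1 /xln.
by move: (f * ln s) (f * ln f) => a b; lra.
Qed.

Lemma xln_le_add (f s : R) : 0 <= f -> 0 < s -> xln f <= f * ln (f + s).
Proof.
rewrite le_eqVlt => /orP[/eqP <- s0|f0 s0]; first by rewrite xln0 mul0r.
by rewrite /xln ler_pM2l// ler_ln ?posrE ?addr_gt0// lerDl ltW.
Qed.

Lemma continuous_behead n : continuous (@rV_behead R n).
Proof.
apply: cts_eps => x e e0; exists e => // z xz; apply: le_lt_trans xz.
apply: norm_le_coord => // i.
by have := coord_le_norm (x - z) (lift ord0 i); rewrite !mxE.
Qed.

Lemma behead_cons n (a : R) (y : 'rV[R]_n) : rV_behead (rV_cons (a, y)) = y.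
Proof. by apply/rowP => j; rewrite mxE consS. Qed.

(** This is nonnegativity of the entropy of f relative to the product of its marginals divided by
    the mass. *)
Lemma marginals_xln n (f : 'rV[R]_n.+1 -> R) : Cc f -> (forall x, 0 <= f x) ->
  J leb (fun a => xln (J (lebesgue_rV R n) (fun y => f (rV_cons (a, y))))) +
  J (lebesgue_rV R n) (fun y => xln (J leb (fun a => f (rV_cons (a, y))))) <=
  J (lebesgue_rV R n.+1) (fun x => xln (f x)) + xln (J (lebesgue_rV R n.+1) f).
Proof.
move=> cf f0; set m := J _ f.
pose r1 (a : R) : R := J (lebesgue_rV R n) (fun y => f (rV_cons (a, y))).
pose r2 (y : 'rV[R]_n) : R := J leb (fun a => f (rV_cons (a, y))).
have c1 : Cc r1 by exact: Cc_int2. have c2 : Cc r2 by exact: Cc_int1.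
have i1 := Cc_IntR c1; have i2 := Cc_Int c2.
have m1 : J leb r1 = m by rewrite /m J_cons1.
have m2 : J (lebesgue_rV R n) r2 = m by rewrite /m J_cons2.
have r10 a : 0 <= r1 a by apply: J_ge0.
have r20 y : 0 <= r2 y by apply: J_ge0.
have m0 : 0 <= m by apply: J_ge0.
apply/ler_addgt0Pr => d d0; pose e := d / 2; have e0 : 0 < e by rewrite divr_gt0.
(* A small multiple of the Gaussian makes the marginals positive, hence their logarithms continuous;
   the total error is 2 e = d. *)
pose s1 (a : R) : R := r1 a + e * w1 a.
pose s2 (y : 'rV[R]_n) : R := r2 y + e * W y.
have s10 a : 0 < s1 a by rewrite ltr_wpDl// mulr_gt0// w1_gt0.
have s20 y : 0 < s2 y by rewrite ltr_wpDl// mulr_gt0// W_gt0.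
have cs1 : continuous s1.
  by apply: ctsD; [exact: Cc_cts c1|apply: ctsM; [exact: cts_cst|exact: cts_w1]].
have cs2 : continuous s2.
  by apply: ctsD; [exact: Cc_cts c2|apply: ctsM; [exact: cts_cst|exact: cts_W]].
have k1 := IntZ e (@Int_w1 R); have k2 := IntZ e (@Int_W R n).
have is1 : Int leb s1 by exact: IntD.
have is2 : Int (lebesgue_rV R n) s2 by exact: IntD.
have Js1 : J leb s1 = m + e by rewrite (JD i1 k1) m1 (JZ _ (@Int_w1 R)) J_w1 mulr1.
have Js2 : J (lebesgue_rV R n) s2 = m + e.
  by rewrite (JD i2 k2) m2 (JZ _ (@Int_W R n)) J_W mulr1.
have [is12 Js12] := J_prod is1 is2 (fun a => ltW (s10 a)) (fun y => ltW (s20 y)).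
pose c := m + e; have c0 : 0 < c by rewrite ltr_wpDl.
pose S (x : 'rV[R]_n.+1) : R := c^-1 * (s1 (x ord0 ord0) * s2 (rV_behead x)).
have iS : Int (lebesgue_rV R n.+1) S by exact: IntZ.
have JS : J (lebesgue_rV R n.+1) S = c.
  by rewrite JZ// Js12 Js1 Js2 -/c mulrA mulVf ?mul1r// gt_eqF.
pose l1 (x : 'rV[R]_n.+1) : R := f x * ln (s1 (x ord0 ord0)).
pose l2 (x : 'rV[R]_n.+1) : R := f x * ln (s2 (rV_behead x)).
have cl1 : Cc l1.
  apply: CcM => //; apply: cts_ln => //; apply: cts_comp => //; exact: coord_continuous.
have cl2 : Cc l2.
  apply: CcM => //; apply: cts_ln => // x; apply: continuous_comp.
    exact: continuous_behead.
  exact: cs2.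
have Jl1 : J leb (fun a => xln (r1 a)) <= J (lebesgue_rV R n.+1) l1.
  rewrite (J_cons1 cl1); apply: J_le => [||a].
  - by apply: Cc_IntR; exact: Cc_xln.
  - by apply: Cc_IntR; exact: (Cc_int2 cl1).
  rewrite (@J_ext _ _ _ _ _ (fun y : 'rV[R]_n => ln (s1 a) * f (rV_cons (a, y)))).
    rewrite JZ; last by apply: Cc_Int; exact: Cc_slice2.
    by rewrite mulrC; apply: xln_le_add => //; rewrite mulr_gt0// w1_gt0.
  by move=> y; rewrite /l1 cons0 mulrC.
have Jl2 : J (lebesgue_rV R n) (fun y => xln (r2 y)) <= J (lebesgue_rV R n.+1) l2.
  rewrite (J_cons2 cl2); apply: J_le => [||y].
  - by apply: Cc_Int; exact: Cc_xln.
  - by apply: Cc_Int; exact: (Cc_int1 cl2).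
  rewrite (@J_ext _ _ _ leb _ (fun a : R => ln (s2 y) * f (rV_cons (a, y)))).
    rewrite JZ; last by apply: Cc_IntR; exact: Cc_slice1.
    by rewrite mulrC; apply: xln_le_add => //; rewrite mulr_gt0// W_gt0.
  by move=> a; rewrite /l2 behead_cons mulrC.
have cx := Cc_Int (Cc_xln cf); have if_ := Cc_Int cf.
have il1 := Cc_Int cl1; have il2 := Cc_Int cl2.
have z0 := IntZ (1 - ln c) if_; have z1 := IntD il1 il2; have z2 := IntD z1 z0.
have := J_le (IntB z2 iS) cx _; rewrite JB// JD// JD// (JZ _ if_) JS -/m.
have mc : m * ln c <= xln m + e.
  rewrite /xln; move: m0; rewrite le_eqVlt => /orP[/eqP <-|mp].
    by rewrite !mul0r add0r ltW.
  have := ln_le_sub1 (_ : 0 < c / m); rewrite divr_gt0// ln_div ?posrE// => /(_ isT) h.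
  have := ler_wpM2l (ltW mp) h.
  rewrite mulrBr mulrBr mulr1 mulrCA divff ?gt_eqF// mulr1 /c.
  move=> hh; rewrite -lerBlDl; apply: le_trans hh _.
  by rewrite addrAC subrr add0r.
have pw x : l1 x + l2 x + (1 - ln c) * f x - S x <= xln (f x).
  have s0 : 0 < S x by rewrite mulr_gt0 ?invr_gt0// mulr_gt0.
  apply: le_trans (gibbs_pointwise (f0 x) s0).
  rewrite /S lnM ?posrE ?invr_gt0 ?mulr_gt0// lnV ?posrE// lnM ?posrE//.
  by rewrite le_eqVlt; apply/orP; left; apply/eqP; rewrite /l1 /l2; ring.
move=> /(_ pw); move: Jl1 Jl2 mc.
have -> : d = e + e by rewrite /e -splitr.
rewrite mulrBl mul1r (mulrC (ln c)) /r1 /r2 /c.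
by move: (m * ln _) (J _ l1) (J _ l2) => A B C; lra.
Qed.

Definition energy n (g : 'I_n -> 'rV[R]_n -> R) : R :=
  \sum_i J (lebesgue_rV R n) (fun x => g i x ^+ 2).
Definition mass n (u : 'rV[R]_n -> R) : R := J (lebesgue_rV R n) (fun x => u x ^+ 2).
Definition entr n (u : 'rV[R]_n -> R) : R := J (lebesgue_rV R n) (fun x => Fl (u x)).
(** The deficit for C^1 functions of bounded support, the normalisation inside the logarithm being
    moved into [xln (mass u)]. *)
Definition DD n (u : 'rV[R]_n -> R) (g : 'I_n -> 'rV[R]_n -> R) : R :=
  energy g - pi * entr u + pi * xln (mass u) - n%:R * pi * mass u.

Lemma energy_ge0 n (g : 'I_n -> 'rV[R]_n -> R) : 0 <= energy g.
Proof. by apply: sumr_ge0 => i _; apply: J_ge0 => x; exact: sqr_ge0. Qed.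

Lemma mass_ge0 n (u : 'rV[R]_n -> R) : 0 <= mass u.
Proof. by apply: J_ge0 => x; exact: sqr_ge0. Qed.

(** Adding the one-dimensional inequality in the head ([A]) and the induction hypothesis in the tail
    ([B]) counts the entropy of u twice; [marginals_xln] pays for one copy. *)
Lemma log_sobolev n (u : 'rV[R]_n -> R) g lam : C1c u g -> 0 < lam ->
  entr u <= lam ^+ 2 / pi * energy g - n%:R * (1 + ln lam) * mass u + xln (mass u).
Proof.
elim: n u g => [|n IH] u g ug l0.
  have uE (x : 'rV[R]_0) : u x = u 0 by congr u; apply/rowP => -[].
  have one : forall c : R, J (lebesgue_rV R 0) (fun=> c) = c.
    move=> c; rewrite (@J_ext _ _ _ _ _ (fun x : 'rV[R]_0 => c * W x)).
      by rewrite JZ ?J_W ?mulr1//; exact: Int_W.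
    by move=> x; rewrite /W /sqnorm big_ord0 mulr0 expR0 mulr1.
  rewrite /entr /mass /energy big_ord0 mulr0 !mul0r subr0 add0r.
  rewrite (@J_ext _ _ _ _ _ (fun=> Fl (u 0))) ?one; last by move=> x; rewrite uE.
  by rewrite (@J_ext _ _ _ _ _ (fun=> u 0 ^+ 2)) ?one//; move=> x; rewrite uE.
have cu := C1c_Cc ug; have cg i := C1c_Ccd i ug; have [[_ _ dg] _] := ug.
have c2 := CcX 1 cu; have cF := Cc_Fl cu.
have p0 : 0 <= lam ^+ 2 / pi by rewrite divr_ge0 ?sqr_ge0// pi_ge0.
have A : entr u <= lam ^+ 2 / pi * J (lebesgue_rV R n.+1) (fun x => g ord0 x ^+ 2)
    - (1 + ln lam) * mass u
    + J (lebesgue_rV R n) (fun y => xln (J leb (fun a => u (rV_cons (a, y)) ^+ 2))).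
  rewrite /entr /mass (J_cons2 cF) (J_cons2 c2) (J_cons2 (CcX 1 (cg ord0))).
  have k1 := Cc_Int (Cc_int1 (CcX 1 (cg ord0))); have k2 := Cc_Int (Cc_int1 c2).
  have k3 := Cc_Int (Cc_xln (Cc_int1 c2)); have k4 := Cc_Int (Cc_int1 cF).
  have z1 := IntZ (lam ^+ 2 / pi) k1; have z2 := IntZ (1 + ln lam) k2.
  have z3 := IntB z1 z2.
  rewrite -(JZ _ k1) -(JZ _ k2) -(JB z1 z2) -(JD z3 k3); apply: J_le => // [|y].
    exact: IntD.
  apply: log_sobolev_line => //; [|exact: Cc_cts (Cc_slice1 y (cg ord0))|exact: Cc_slice1].
  by move=> a; exact: pd_cons0.
have B : entr u <= lam ^+ 2 / pi *
      (\sum_(j < n) J (lebesgue_rV R n.+1) (fun x => g (lift ord0 j) x ^+ 2))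
    - n%:R * (1 + ln lam) * mass u
    + J leb (fun a => xln (J (lebesgue_rV R n) (fun y => u (rV_cons (a, y)) ^+ 2))).
  rewrite /entr /mass (J_cons1 cF) (J_cons1 c2).
  rewrite (eq_bigr _ (fun j _ => J_cons1 (CcX 1 (cg (lift ord0 j))))).
  have k1 j := Cc_IntR (Cc_int2 (CcX 1 (cg (lift ord0 j)))); have k2 := Cc_IntR (Cc_int2 c2).
  have k3 := Cc_IntR (Cc_xln (Cc_int2 c2)); have k4 := Cc_IntR (Cc_int2 cF).
  have ks := Int_sum k1; rewrite -(J_sum k1).
  have z1 := IntZ (lam ^+ 2 / pi) ks; have z2 := IntZ (n%:R * (1 + ln lam)) k2.
  have z3 := IntB z1 z2.
  rewrite -(JZ _ ks) -(JZ _ k2) -(JB z1 z2) -(JD z3 k3); apply: J_le => // [|a].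
    exact: IntD.
  apply: (IH _ (fun j y => g (lift ord0 j) (rV_cons (a, y)))) => //.
  have [cs bs] := Cc_slice2 a cu; split => //; split => // j.
    exact: Cc_cts (Cc_slice2 a (cg _)).
  exact: pd_consS.
have := marginals_xln c2 (fun x => sqr_ge0 (u x)).
rewrite -/(mass u) -/(entr u) => C; rewrite /energy big_ord_recl -natr1.
move: A B C; move: (J leb _) (J (lebesgue_rV R n) _) (xln _) => a b c.
move: (entr u) (mass u) (ln lam) (lam ^+ 2 / pi) (\sum_i _) (J _ _) (n%:R : R).
by move=> e m l p s t k; lra.
Qed.

Lemma DD_ge0 n (u : 'rV[R]_n -> R) g : C1c u g -> 0 <= DD u g.
Proof.
move=> ug; have := log_sobolev ug ltr01; rewrite ln1 addr0 expr1n mulr1 /DD.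
generalize (xln (mass u)) => x; generalize (mass u) (entr u) (energy g).
have := pi_gt0 R; generalize (@pi R) => p p0 m e E h.
have : p * e <= p * (1 / p * E - n%:R * m + x) by rewrite ler_pM2l.
rewrite (_ : p * (1 / p * E - n%:R * m + x) = E - n%:R * p * m + p * x); first by lra.
by field; rewrite gt_eqF.
Qed.

Lemma mass_gam n (v : 'rV[R]_n -> R) : mass (fun x => v x * gam x) =
  J (lebesgue_rV R n) (fun x => v x ^+ 2 * W x).
Proof. by apply: J_ext => x; rewrite exprMn gam_sq. Qed.

Lemma Fl_gam n (c : R) (x : 'rV[R]_n) :
  Fl (c * gam x) = Fl c * W x - pi * (sqnorm x * (c ^+ 2 * W x)).
Proof.
have [->|c0] := eqVneq c 0; first by rewrite mul0r Fl0 expr0n/= !mul0r !mulr0 subr0.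
rewrite /Fl /xln exprMn gam_sq lnM ?posrE ?W_gt0 ?exprn_even_gt0//.
by rewrite {2}/W expRK; ring.
Qed.

Lemma C1_mul_gam n (v : 'rV[R]_n -> R) h : C1c v h ->
  C1c (fun x => v x * gam x) (fun i x => h i x * gam x + v x * (- pi * x ord0 i * gam x)).
Proof. by move=> vh; exact: (C1cM vh (@C1_gam R n)). Qed.

(* Integrating div (x v^2 W) = 0 removes the terms coming from the gradient of gam. *)
Lemma DD_gam n (v : 'rV[R]_n -> R) h : C1c v h ->
  DD (fun x => v x * gam x) (fun i x => h i x * gam x + v x * (- pi * x ord0 i * gam x)) =
  \sum_i J (lebesgue_rV R n) (fun x => h i x ^+ 2 * W x)
  - pi * J (lebesgue_rV R n) (fun x => Fl (v x) * W x)
  + pi * xln (J (lebesgue_rV R n) (fun x => v x ^+ 2 * W x)).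
Proof.
move=> vh; have cv := C1c_Cc vh; have ch i := C1c_Ccd i vh.
have cc i : continuous (fun x : 'rV[R]_n => x ord0 i) by exact: coord_continuous.
have cW := @cts_W R n.
set m := J _ (fun x => v x ^+ 2 * W x).
have c2 := Cc2W cv; have i2 := Cc_Int c2.
have cx i : Cc (fun x : 'rV[R]_n => x ord0 i ^+ 2 * (v x ^+ 2 * W x)).
  by apply: CcMr => //; exact: ctsX.
have cxh i : Cc (fun x : 'rV[R]_n => x ord0 i * v x * h i x * W x).
  by apply: CcM => //; apply: CcMr => //; apply: ctsM => //; exact: Cc_cts cv.
have E i : J (lebesgue_rV R n) (fun x => (h i x * gam x + v x * (- pi * x ord0 i * gam x)) ^+ 2) =
    J (lebesgue_rV R n) (fun x => h i x ^+ 2 * W x) + pi * m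
    - pi ^+ 2 * J (lebesgue_rV R n) (fun x : 'rV[R]_n => x ord0 i ^+ 2 * (v x ^+ 2 * W x)).
  have k1 := Cc_Int (Cc2W (ch i)); have k2 := Cc_Int (cxh i); have k3 := Cc_Int (cx i).
  have z2 := IntZ (2 * pi) k2; have z3 := IntZ (pi ^+ 2) k3; have z12 := IntB k1 z2.
  rewrite (@J_ext _ _ _ _ _ (fun x : 'rV[R]_n => h i x ^+ 2 * W x
    - 2 * pi * (x ord0 i * v x * h i x * W x) + pi ^+ 2 * (x ord0 i ^+ 2 * (v x ^+ 2 * W x)))); last first.
    by move=> x; rewrite -gam_sq; move: (@pi R) => p; ring.
  rewrite (JD z12 z3) (JB k1 z2) (JZ _ k2) (JZ _ k3).
  have k4 := IntZ 2 k2; have k5 := IntZ (2 * pi) k3; have k45 := IntD i2 k4.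
  have := J_C1c0 i (C1cM (C1cM vh (C1M (C1_coord R i) vh.1)) (@C1_W R n)).
  rewrite (@J_ext _ _ _ _ _ (fun x : 'rV[R]_n => v x ^+ 2 * W x
    + 2 * (x ord0 i * v x * h i x * W x) - 2 * pi * (x ord0 i ^+ 2 * (v x ^+ 2 * W x)))); last first.
    by move=> x; rewrite /= eqxx mulr1n; move: (@pi R) => p; ring.
  rewrite (JB k45 k5) (JD i2 k4) (JZ _ k2) (JZ _ k3) -/m.
  move: (J _ _) (J _ _) (J _ _) => a b c e.
  have -> : m = 2 * pi * b - 2 * c by lra.
  by move: (@pi R) => p; ring.
rewrite /DD /energy (eq_bigr _ (fun i _ => E i)) mass_gam -/m sumrB big_split/=.
rewrite sumr_const card_ord -mulr_sumr -(J_sum (fun i => Cc_Int (cx i))).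
have cs : Cc (fun x : 'rV[R]_n => sqnorm x * (v x ^+ 2 * W x)).
  by apply: CcMr => //; exact: continuous_sqnorm.
have -> : entr (fun x => v x * gam x) = J (lebesgue_rV R n) (fun x => Fl (v x) * W x)
    - pi * J (lebesgue_rV R n) (fun x => sqnorm x * (v x ^+ 2 * W x)).
  have k1 := Cc_Int (CcW (Cc_Fl cv)); have k2 := Cc_Int cs.
  rewrite -(JZ _ k2) -(JB k1 (IntZ pi k2)); apply: J_ext => x.
  exact: Fl_gam.
rewrite (@J_ext _ _ _ _ (fun x => \sum_i _) (fun x : 'rV[R]_n => sqnorm x * (v x ^+ 2 * W x))).
  by rewrite -mulr_natl; move: (J _ _) (J _ _) (\sum_i _) (xln m) (@pi R) => a b c d p; ring.
by move=> x; rewrite /sqnorm mulr_suml.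
Qed.

Lemma log_sobolev_gauss n (v : 'rV[R]_n -> R) h : C1c v h ->
  pi * J (lebesgue_rV R n) (fun x => Fl (v x) * W x)
  - pi * xln (J (lebesgue_rV R n) (fun x => v x ^+ 2 * W x)) <=
  \sum_i J (lebesgue_rV R n) (fun x => h i x ^+ 2 * W x).
Proof. by move=> vh; have := DD_ge0 (C1_mul_gam vh); rewrite (DD_gam vh); lra. Qed.

End log_sobolev.

(** * Truncation to the excess outside [0, 1] and the pointwise entropy bound *)

Section truncation.
Context (R : realType).
Implicit Types (x y s r t a v : R).

Lemma is_derive_piece (f f1 f2 d : R -> R) (c : R) :
  (forall x, x <= c -> f x = f1 x) -> (forall x, c <= x -> f x = f2 x) ->
  (forall x, x <= c -> is_derive x 1 f1 (d x)) ->
  (forall x, c <= x -> is_derive x 1 f2 (d x)) ->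
  forall x, is_derive x 1 f (d x).
Proof.
move=> e1 e2 d1 d2 x; have [xc|cx|->] := ltgtP x c.
- have d1x := d1 x (ltW xc); apply: (near_eq_is_derive (f := f1)) => //.
  by near do (symmetry; apply: e1; apply: ltW); exact: lt_nbhsl.
- have d2x := d2 x (ltW cx); apply: (near_eq_is_derive (f := f2)) => //.
  by near do (symmetry; apply: e2; apply: ltW); exact: lt_nbhsr.
- by apply: (is_derive_glue e1 e2); [exact: d1|exact: d2].
Unshelve. all: by end_near. Qed.

Definition pp x : R := (x + `|x|) / 2.

Lemma pp_le0 x : x <= 0 -> pp x = 0.
Proof. by move=> x0; rewrite /pp ler0_norm// addrN mul0r. Qed.

Lemma pp_ge0 x : 0 <= x -> pp x = x.
Proof. by move=> x0; rewrite /pp ger0_norm//; lra. Qed.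

Lemma cts_pp : continuous pp.
Proof.
apply: ctsM; last exact: cts_cst.
by apply: ctsD; [|apply: cts_norm]; move=> x; exact: cvg_id.
Qed.

Lemma pp0 x : 0 <= pp x.
Proof. by have [/pp_le0 ->|/ltW x0] := leP x 0; rewrite ?pp_ge0. Qed.

(** A C^1 substitute for the positive part: quadratic at 0, with slope in [0, 1], and equal to x - 1
    + 1/(1 + x) for x >= 0. *)
Definition rho x : R := pp x ^+ 2 / (1 + pp x).
Definition drho x : R := 1 - (1 + pp x) ^- 2.

Lemma is_derive_rho x : is_derive x 1 rho (drho x).
Proof.
apply: (@is_derive_piece _ (fun=> 0) (fun x => x ^+ 2 / (1 + x)) _ 0) => {}x x0.
- by rewrite /rho pp_le0// expr0n mul0r.
- by rewrite /rho pp_ge0.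
- apply: (dE (dcst 0 x)) => //.
  by rewrite /drho pp_le0// addr0 expr1n invr1 subrr.
- have x1 : 1 + x != 0 by rewrite gt_eqF// ltr_pwDl.
  apply: (dE (dM (dX 2 (did x)) (@dV R (fun t => 1 + t) x _ x1 (dD (dcst 1 x) (did x))))) => //.
  by rewrite /drho pp_ge0//=; field.
Qed.

Lemma cts_drho : continuous drho.
Proof.
move=> x; apply: cvgB; first exact: cvg_cst.
apply: cvgV; first by rewrite expf_neq0// gt_eqF// ltr_pwDl// pp0.
have c : continuous (fun x : R => (1 + pp x) ^+ 2).
  by apply: ctsX; apply: ctsD; [exact: cts_cst|exact: cts_pp].
exact: c.
Qed.

Lemma drho01 x : 0 <= drho x <= 1.
Proof.
have h := pp0 x; rewrite /drho.
have e0 : 0 < (1 + pp x) ^+ 2 by rewrite exprn_gt0// ltr_pwDl.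
have : 0 < (1 + pp x) ^- 2 by rewrite invr_gt0.
have : (1 + pp x) ^- 2 <= 1 by rewrite invf_le1// exprn_ege1// lerDl.
by move: (_ ^- 2) => z z1 z2; apply/andP; split; lra.
Qed.

(** The smoothed signed excess of v outside [0, 1]. On [0, 1] the Taylor bound Fl v <= 2 (v - 1) + 3
    (v - 1)^2 holds without correction, so nothing has to be cut off there. *)
Definition tru v : R := rho (v - 1) - rho (- v).
Definition dtru v : R := drho (v - 1) + drho (- v).

Lemma is_derive_tru v : is_derive v 1 tru (dtru v).
Proof.
have d1 := @dcomp R rho (fun t => t - 1) v _ _ (is_derive_rho _) (dB (did v) (dcst 1 v)).
have d2 := @dcomp R rho (fun t => - t) v _ _ (is_derive_rho _) (dN (did v)).
apply: (dE (dB d1 d2)) => //.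
by rewrite /dtru; lra.
Qed.

Lemma cts_dtru : continuous dtru.
Proof.
have ci : continuous (fun v : R => v) by move=> v; exact: cvg_id.
apply: ctsD; apply: (cts_comp cts_drho); last exact: ctsN.
by apply: ctsB => //; exact: cts_cst.
Qed.

Lemma rho_le0 x : x <= 0 -> rho x = 0.
Proof. by move=> x0; rewrite /rho pp_le0// expr0n mul0r. Qed.

Lemma drho_le0 x : x <= 0 -> drho x = 0.
Proof. by move=> x0; rewrite /drho pp_le0// addr0 expr1n invr1 subrr. Qed.

Lemma dtru01 v : 0 <= dtru v <= 1.
Proof.
rewrite /dtru; have [v0|v0] := leP v 0.
  by rewrite drho_le0 ?add0r ?drho01//; lra.
by rewrite (drho_le0 (_ : - v <= 0)) ?addr0 ?drho01//; lra.
Qed.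

Lemma rho_ge0E x : 0 <= x -> rho x * (1 + x) = x ^+ 2.
Proof. by move=> x0; rewrite /rho pp_ge0// divfK// gt_eqF// ltr_pwDl. Qed.

Lemma rho_ge0 x : 0 <= rho x.
Proof. by rewrite divr_ge0 ?sqr_ge0// addr_ge0// pp0. Qed.

Lemma rho_le x : 0 <= x -> rho x <= x.
Proof.
move=> x0; have := rho_ge0E x0; have := rho_ge0 x => h1 h2.
have x1 : 0 < 1 + x by lra.
by rewrite -(ler_pM2r x1) h2 mulrDr mulr1 -expr2 lerDr.
Qed.

Lemma tru0 : tru 0 = 0.
Proof. by rewrite /tru sub0r oppr0 !rho_le0 ?subrr//; lra. Qed.

Lemma tru_sq v : tru v ^+ 2 <= (v - 1) ^+ 2.
Proof.
rewrite -ler_sqrt ?sqr_ge0// !sqrtr_sqr /tru.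
have [v0|v0] := leP v 0.
  rewrite rho_le0; last by lra.
  have := rho_le (_ : 0 <= - v); rewrite oppr_ge0 => /(_ v0) h.
  rewrite sub0r normrN ger0_norm ?rho_ge0// ler0_norm; lra.
rewrite (rho_le0 (_ : - v <= 0)) ?subr0; last by lra.
have [v1|v1] := leP v 1; first by rewrite rho_le0 ?normr0//; lra.
by rewrite !ger0_norm ?rho_ge0//; [apply: rho_le|]; lra.
Qed.

(** With r = e^s - 1 the difference of the two sides becomes a function of s with derivative (e^s -
    1)^2; in [ln1_le3] the derivative is (e^s - 1)^3. *)
Lemma ln1_le2 r : -1 < r -> r <= 0 -> ln (1 + r) <= r - r ^+ 2 / 2.
Proof.
move=> r1 r0; have p : 0 < 1 + r by lra.
pose s := ln (1 + r); have es : expR s = 1 + r by rewrite /s lnK ?posrE.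
have s0 : s <= 0 by rewrite /s ln_le0//; lra.
pose f (s : R) : R := s - (expR s - 1) + (expR s - 1) ^+ 2 / 2.
have d (z : R) : is_derive z 1 f ((expR z - 1) ^+ 2).
  have de := dB (dexp (did z)) (dcst 1 z).
  apply: (dE (dD (dB (did z) de) (dM (dX 2 de) (dcst (2^-1) z)))) => //.
  by rewrite /= expr1; field.
have := @derive_ndecr R f _ s 0 s0 (is_derive_cts d) (fun z _ => d z) (fun z _ => sqr_ge0 _).
by rewrite /f expR0 es /s; lra.
Qed.

Lemma ln1_le3 r : 0 <= r -> ln (1 + r) <= r - r ^+ 2 / 2 + r ^+ 3 / 3.
Proof.
move=> r0; have p : 0 < 1 + r by lra.
pose s := ln (1 + r); have es : expR s = 1 + r by rewrite /s lnK ?posrE.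
have s0 : 0 <= s by rewrite /s ln_ge0//; lra.
pose f (s : R) : R := (expR s - 1) - (expR s - 1) ^+ 2 / 2 + (expR s - 1) ^+ 3 / 3 - s.
have d (z : R) : is_derive z 1 f ((expR z - 1) ^+ 3).
  have de := dB (dexp (did z)) (dcst 1 z).
  apply: (dE (dB (dD (dB de (dM (dX 2 de) (dcst (2^-1) z))) (dM (dX 3 de) (dcst (3^-1) z))) (did z))) => //.
  by rewrite /= expr1; field.
have := @derive_ndecr R f _ 0 s s0 (is_derive_cts d) (fun z _ => d z) _.
rewrite /f expR0 es /s => h; have := h _ => {}h; have : forall z, 0 < z < s -> 0 <= (expR z - 1) ^+ 3.
  by move=> z /andP[z0 _]; rewrite exprn_ge0// subr_ge0 -expR0 ler_expR ltW.
by move=> /h; lra.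
Qed.

Lemma FlE v : v != 0 -> Fl v = v ^+ 2 * (2 * ln `|v|).
Proof. by move=> v0; rewrite /Fl /xln ln_sqr. Qed.

Lemma FlN v : Fl (- v) = Fl v. Proof. by rewrite /Fl sqrrN. Qed.

(** Passing from t to a changes the logarithm by at most K, and a^2 - t^2 = O(t) is paired with ln t
    <= t. *)
Lemma Fl_comparable a t (K : R) : 0 < t -> t <= a -> a <= t + 2 -> a <= K * t ->
  Fl a <= Fl t + (4 * (K + 1) + 2 * K ^+ 3) * t ^+ 2.
Proof.
move=> t0 ta a2 aK; have a0 : 0 < a by apply: lt_le_trans ta.
have K1 : 1 <= K by rewrite -(ler_pM2r t0) mul1r (le_trans ta).
have K0 : 0 < K by lra.
rewrite !FlE ?gt_eqF// !gtr0_norm//.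
have la : ln a <= ln t + K.
  have -> : ln a = ln t + ln (a / t) by rewrite ln_div ?posrE// addrC subrK.
  rewrite lerD2l; apply: le_trans (ln_le_sub1 (divr_gt0 a0 t0)) _.
  by have : a / t <= K by [rewrite ler_pdivrMr]; lra.
have lt : ln t <= t by have := ln_le_sub1 t0; lra.
have aa : a ^+ 2 <= K ^+ 2 * t ^+ 2 by rewrite -exprMn ler_pXn2r// ?nnegrE ?mulr_ge0 ?(ltW a0) ?(ltW K0) ?(ltW t0).
have d1 : (a ^+ 2 - t ^+ 2) <= 2 * (K + 1) * t.
  have -> : a ^+ 2 - t ^+ 2 = (a - t) * (a + t) by ring.
  apply: (@le_trans _ _ (2 * (a + t))); first by rewrite ler_wpM2r; lra.
  by rewrite -mulrA ler_wpM2l//; lra.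
have d0 : 0 <= a ^+ 2 - t ^+ 2 by rewrite subr_ge0 ler_pXn2r// nnegrE ltW.
have d2 : (a ^+ 2 - t ^+ 2) * ln t <= 2 * (K + 1) * t ^+ 2.
  apply: (@le_trans _ _ ((a ^+ 2 - t ^+ 2) * t)); first by rewrite ler_wpM2l.
  by rewrite [t ^+ 2 in leRHS]expr2 mulrA ler_wpM2r// ltW.
have d3 : a ^+ 2 * ln a <= a ^+ 2 * (ln t + K) by rewrite ler_wpM2l ?sqr_ge0.
have d4 : K * a ^+ 2 <= K * (K ^+ 2 * t ^+ 2) by rewrite ler_wpM2l// ltW.
move: d2 d3 d4; rewrite (exprS K 2); clear.
move: (ln t) (ln a) (K ^+ 2) => x y k h1 h2 h3; lra.
Qed.

(** The Taylor expansion of [Fl] at 1 with its quadratic coefficient 3 enlarged by 1/10; whatever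
    exceeds it away from 1 is charged to the truncated part. The cases are v < 0, v in [0, 1], and v
    = 1 + r with r above or below 1/60. *)
Lemma tru_bound : exists2 C : R, 0 <= C & forall v,
  Fl v <= 2 * (v - 1) + 3 * (v - 1) ^+ 2 + 10^-1 * (v - 1) ^+ 2 + Fl (tru v) + C * tru v ^+ 2.
Proof.
(* 61^2: for r > 1/60 one has 1 + r <= 61 r, hence (1 + r)^2 <= K r^2 = K t (1 + r). *)
pose K : R := 3721; pose C := 4 * (K + 1) + 2 * K ^+ 3.
have C14 : 28 <= C by rewrite /C /K; lra.
have C0 : 0 <= C by lra.
exists C => // v; have [v0|v0] := ltP v 0.
- have [a va] : exists a, v = - a by exists (- v); rewrite opprK.
  have a0 : 0 < a by lra.
  rewrite va; clear v v0 va.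
  have -> : tru (- a) = - rho a by rewrite /tru rho_le0 ?sub0r ?opprK//; lra.
  rewrite !FlN sqrrN; have e := rho_ge0E (ltW a0).
  have t0 : 0 < rho a by rewrite /rho divr_gt0// ?exprn_gt0 ?ltr_pwDl// pp_ge0// ltW.
  have ta := rho_le (ltW a0); move: e t0 ta; move: (rho a) => t e t0 ta.
  have [a1|a1] := leP a 1.
    have /andP[h1 _] := Fl_bounds t; rewrite gtr0_norm// in h1.
    have h2 : Fl a <= 0.
      by rewrite FlE ?gt_eqF// gtr0_norm// mulr_ge0_le0 ?sqr_ge0// mulr_ge0_le0// ln_le0.
    have : t <= a ^+ 2 by rewrite -e ler_peMr; lra.
    have : 0 <= C * t ^+ 2 by rewrite mulr_ge0// sqr_ge0.
    by have := sqr_ge0 a; move: h1 h2; clear -a0; move: (Fl _) (Fl _) (C * _) => x y z *; nra.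
  have t2 : a <= 2 * t.
    have : a * (1 + a) <= 2 * (t * (1 + a)) by rewrite e; nra.
    by rewrite mulrA ler_pM2r//; lra.
  have := @Fl_comparable a t 2 t0 ta _ t2; rewrite (_ : 4 * (2 + 1) + 2 * 2 ^+ 3 = 28 :> R); last by lra.
  have h1 : a <= t + 2.
    have : a * (1 + a) <= (t + 2) * (1 + a) by rewrite mulrDl e; nra.
    by rewrite ler_pM2r//; lra.
  move=> /(_ h1); have : 28 * t ^+ 2 <= C * t ^+ 2 by rewrite ler_wpM2r ?sqr_ge0.
  have := sqr_ge0 a; clear -a1; move: (Fl _) (Fl _) (C * _) (28 * _) => x y z w *; nra.
have [v1|v1] := leP v 1.
- have -> : tru v = 0 by rewrite /tru !rho_le0 ?subrr//; lra.
  rewrite Fl0 expr0n/= mulr0 !addr0.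
  have [->|vn] := eqVneq v 0; first by rewrite Fl0; lra.
  have vp : 0 < v by rewrite lt_def vn.
  rewrite FlE// gtr0_norm//; have := @ln1_le2 (v - 1) _ _.
  rewrite (_ : 1 + (v - 1) = v); last by ring.
  move=> h; have {}h : ln v <= v - 1 - (v - 1) ^+ 2 / 2 by apply: h; lra.
  have : v ^+ 2 * (2 * ln v) <= v ^+ 2 * (2 * (v - 1 - (v - 1) ^+ 2 / 2)).
    by rewrite ler_wpM2l ?sqr_ge0// ler_wpM2l.
  move=> /le_trans; apply.
  rewrite -subr_ge0 (_ : _ - _ = 10^-1 * (v - 1) ^+ 2 + (v - 1) ^+ 2 * (v - 1) ^+ 2); last by field.
  by rewrite addr_ge0// mulr_ge0 ?sqr_ge0.
pose r := v - 1; have r0 : 0 < r by rewrite /r; lra.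
have vE : v = 1 + r by rewrite /r; ring.
have -> : tru v = rho r by rewrite /tru (rho_le0 (_ : - v <= 0)) ?subr0//; lra.
rewrite -/r vE; have e := rho_ge0E (ltW r0).
have t0 : 0 < rho r by rewrite /rho divr_gt0// ?exprn_gt0 ?ltr_pwDl// pp_ge0// ltW.
have tr := rho_le (ltW r0); move: e t0 tr; move: (rho r) => t e t0 tr.
have r1 : 0 < 1 + r by lra.
clearbody r; clear v v0 v1 vE.
(* For r <= 1/60 the cubic errors 2 r^3 from [A] and 4 r^3 from [B] add up to at most r^2/10. *)
have [rs|rl] := leP r 60^-1; last first.
  have h1 : 1 + r <= t + 2.
    have : (1 + r) * (1 + r) <= (t + 2) * (1 + r) by rewrite [leRHS]mulrDl e; nra.
    by rewrite ler_pM2r.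
  have h2 : 1 + r <= K * t.
    have : (1 + r) * (1 + r) <= K * (t * (1 + r)).
      rewrite e /K; have : 1 + r <= 61 * r by lra.
      by move=> h; apply: le_trans (ler_pM _ _ h h) _; [lra|lra|nra].
    by rewrite mulrA ler_pM2r.
  have := Fl_comparable t0 _ h1 h2; rewrite -/C => h.
  have {}h : Fl (1 + r) <= Fl t + C * t ^+ 2 by apply: h; lra.
  have := sqr_ge0 r; move: h; clear -r0; move: (Fl _) (Fl _) (C * _) => x y z *; nra.
have tr2 : t <= r ^+ 2 by rewrite -e ler_peMr; lra.
have A : Fl (1 + r) <= 2 * r + 3 * r ^+ 2 + 2 * r ^+ 3.
  rewrite FlE ?gt_eqF// gtr0_norm//; have h := ln1_le3 (ltW r0).
  have : (1 + r) ^+ 2 * (2 * ln (1 + r)) <= (1 + r) ^+ 2 * (2 * (r - r ^+ 2 / 2 + r ^+ 3 / 3)).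
    by rewrite ler_wpM2l ?sqr_ge0// ler_wpM2l.
  move=> /le_trans; apply.
  rewrite -subr_ge0 (_ : _ - _ = r ^+ 3 * (4 / 3 - r / 3 - 2 / 3 * r ^+ 2)); last by field.
  rewrite mulr_ge0// ?exprn_ge0 ?(ltW r0)//.
  have : r ^+ 2 <= 60^-1 * 60^-1 by rewrite expr2 ler_pM// ltW.
  by lra.
have B : - Fl t <= 4 * r ^+ 3.
  rewrite FlE ?gt_eqF// gtr0_norm//.
  have h1 : - ln t <= 2 / r.
    have te : t = r ^+ 2 / (1 + r) by rewrite -e mulfK// gt_eqF.
    rewrite te ln_div ?posrE ?exprn_gt0// ln_sqr ?gt_eqF// gtr0_norm//.
    have := ln_le_sub1 (_ : 0 < r^-1); rewrite invr_gt0 lnV ?posrE// => /(_ r0).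
    have := ln_le_sub1 r1; move: (r^-1) (ln r) (ln _) => x y z *; lra.
  have h2 : t ^+ 2 * (2 * - ln t) <= r ^+ 4 * (2 * (2 / r)).
    apply: (@le_trans _ _ (t ^+ 2 * (2 * (2 / r)))).
      by rewrite ler_wpM2l ?sqr_ge0// ler_wpM2l.
    apply: ler_wpM2r; first by rewrite mulr_ge0// divr_ge0// ltW.
    by rewrite (_ : r ^+ 4 = (r ^+ 2) ^+ 2) ?ler_pXn2r ?nnegrE ?sqr_ge0 ?(ltW t0)// -exprM.
  have -> : 4 * r ^+ 3 = r ^+ 4 * (2 * (2 / r)) by field; rewrite gt_eqF.
  by rewrite (_ : - _ = t ^+ 2 * (2 * - ln t))//; ring.
have D : r ^+ 3 <= 60^-1 * r ^+ 2 by rewrite exprS ler_wpM2r ?sqr_ge0.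
have E : 0 <= C * t ^+ 2 by rewrite mulr_ge0// sqr_ge0.
by move: A B D E; clear; move: (Fl _) (Fl _) (C * _) (r ^+ 2) (r ^+ 3) => x y z a b *; lra.
Qed.

End truncation.

(** * Local stability in Gaussian coordinates *)

Section local_stability.
Context (R : realType).
Implicit Types n : nat.

(** The coefficient of m - 1 is 4 - 4/10 from the gap, -(3 + 1/10) from the Taylor bound and 1 from
    m ln m, in total 3/2. The multiples of tau are compensated by -tau ln tau. *)
Let core_arith (N C m X tau T Ft Fv xt xm : R) : 0 <= N ->
  T ^+ 2 <= tau -> 2 * X - 2 * T <= 10^-1 * (m - 1) + 10 * tau ->
  Fv <= (3 + 10^-1) * (m - 1) + Ft + C * tau ->
  m - 1 <= xm -> xt <= - (C + 40 + 2 * N) * tau ->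
  29 / 20 * (m - 1) <= 4 * (m - 2 * X + tau - (1 - T) ^+ 2) - 2 * N * tau
     + (Ft - xt) - Fv + xm + 0 * (m - 1) \/ m < 1.
Proof.
move=> N0 h1 h2 h3 h4 h5; have [m1|] := leP 1 m; last by right.
left; have -> : (1 - T) ^+ 2 = 1 - 2 * T + T ^+ 2 by ring.
by move: h1 h5; move: (T ^+ 2) (N * tau) => t k h1 h5; nra.
Qed.

(** The hypotheses normalise the overlap to 1 and remove the modes of degree 1. With t = tru v, of
    slope in [0, 1] as a function of v, the energies of t and v - t add up to at most that of v; v -
    t is treated by [gap2_all] and t by the logarithmic Sobolev inequality. *)
Lemma stability_core n : exists2 eta : R, 0 < eta & forall (v : 'rV[R]_n -> R) h,
  C1c v h -> J (lebesgue_rV R n) (fun x => v x * W x) = 1 ->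
  (forall i, J (lebesgue_rV R n) (fun x : 'rV[R]_n => x ord0 i * v x * W x) = 0) ->
  J (lebesgue_rV R n) (fun x => v x ^+ 2 * W x) - 1 <= eta ->
  29 / 20 * pi * (J (lebesgue_rV R n) (fun x => v x ^+ 2 * W x) - 1) <=
  \sum_i J (lebesgue_rV R n) (fun x => h i x ^+ 2 * W x)
  - pi * J (lebesgue_rV R n) (fun x => Fl (v x) * W x)
  + pi * xln (J (lebesgue_rV R n) (fun x => v x ^+ 2 * W x)).
Proof.
have [C C0 hC] := @tru_bound R; pose K := C + 40 + 2 * n%:R.
have K0 : 0 <= K by rewrite /K !addr_ge0.
(* Since tau <= m - 1 <= e^(-K), one gets ln tau <= -K, which absorbs all multiples of tau. *)
exists (expR (- K)); first exact: expR_gt0.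
move=> v h vh v1 vx; set m := J _ (fun x => v x ^+ 2 * W x) => me.
have cv := C1c_Cc vh; have ch i := C1c_Ccd i vh.
pose t (x : 'rV[R]_n) : R := tru (v x).
pose th i (x : 'rV[R]_n) : R := dtru (v x) * h i x.
have tth : C1c t th by exact: (C1c_comp (@is_derive_tru R) (@cts_dtru R) (tru0 R) vh).
have ct := C1c_Cc tth; have cth i := C1c_Ccd i tth.
have pph := C1cB vh tth.
set tau := J (lebesgue_rV R n) (fun x => t x ^+ 2 * W x).
set T := J (lebesgue_rV R n) (fun x => t x * W x).
set X := J (lebesgue_rV R n) (fun x => v x * t x * W x).
set Ft := J (lebesgue_rV R n) (fun x => Fl (t x) * W x).
set Fv := J (lebesgue_rV R n) (fun x => Fl (v x) * W x).
have iW := @Int_W R n; have JW1 := @J_W R n.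
have cvt : Cc (fun x => v x * t x) by apply: CcM => //; exact: Cc_cts ct.
have iv := Cc_Int (CcW cv); have iv2 := Cc_Int (Cc2W cv).
have it := Cc_Int (CcW ct); have it2 := Cc_Int (Cc2W ct).
have ivt := Cc_Int (CcW cvt); have iFt := Cc_Int (CcW (Cc_Fl ct)).
have iFv := Cc_Int (CcW (Cc_Fl cv)).
have sgt : Sq (lebesgue_rV R n) (fun x => t x * gam x).
  by apply: Cc_Sq; apply: CcM => //; exact: cts_gam.
have T2 : T ^+ 2 <= tau by exact: sq_J_W.
have tm : tau <= m - 1.
  have z1 := IntZ 2 iv; have z2 := IntB iv2 z1; have z3 := IntD z2 iW.
  have := J_le it2 z3 _; rewrite (JD z2 iW) (JB iv2 z1) (JZ _ iv) v1 JW1 -/m -/tau.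
  move=> H; have : tau <= m - 2 * 1 + 1; last by lra.
  apply: H => x; have := ler_wpM2r (ltW (W_gt0 x)) (tru_sq (v x)).
  by rewrite -/(t x); congr (_ <= _); ring.
(* The weighted mean inequality 2 (v - 1) t <= (v - 1)^2/10 + 10 t^2, integrated. *)
have h2 : 2 * X - 2 * T <= 10^-1 * (m - 1) + 10 * tau.
  have z1 := IntZ 2 ivt; have z2 := IntZ 2 it; have z3 := IntB z1 z2.
  have y1 := IntZ (10^-1) iv2; have y2 := IntZ (10^-1 * 2) iv; have y3 := IntZ (10^-1) iW.
  have y4 := IntZ 10 it2; have y12 := IntB y1 y2; have y123 := IntD y12 y3.
  have y := IntD y123 y4.
  have := J_le z3 y _; rewrite (JB z1 z2) (JZ _ ivt) (JZ _ it) (JD y123 y4) (JD y12 y3).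
  rewrite (JB y1 y2) (JZ _ iv2) (JZ _ iv) (JZ _ iW) (JZ _ it2) v1 JW1 -/m -/tau -/X -/T.
  move=> H; have : 2 * X - 2 * T <= 10^-1 * m - 10^-1 * 2 * 1 + 10^-1 * 1 + 10 * tau; last by lra.
  apply: H => x; move: (t x) (v x) (ltW (W_gt0 x)) => a b w0; rewrite -subr_ge0.
  rewrite (_ : _ - _ = 10^-1 * (b - 1 - 10 * a) ^+ 2 * W x); last by field.
  by rewrite mulr_ge0// mulr_ge0 ?sqr_ge0//; lra.
have h3 : Fv <= (3 + 10^-1) * (m - 1) + Ft + C * tau.
  have y1 := IntZ (3 + 10^-1) iv2; have y2 := IntZ (2 - (3 + 10^-1) * 2) iv.
  have y3 := IntZ (1 + 10^-1) iW; have y4 := IntZ C it2.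
  have y12 := IntD y1 y2; have y123 := IntD y12 y3; have z1 := IntD y123 iFt.
  have := J_le iFv (IntD z1 y4) _.
  rewrite (JD z1 y4) (JD y123 iFt) (JD y12 y3) (JD y1 y2) (JZ _ iv2) (JZ _ iv) (JZ _ iW) (JZ _ it2).
  rewrite v1 JW1 -/m -/tau -/Ft -/Fv.
  move=> H; have : Fv <= (3 + 10^-1) * m + (2 - (3 + 10^-1) * 2) * 1 + (1 + 10^-1) * 1 + Ft + C * tau; last by lra.
  apply: H => x; have := ler_wpM2r (ltW (W_gt0 x)) (hC (v x)).
  rewrite -/(t x); move: (Fl (t x)) (Fl (v x)) (t x) (v x) (W x) => f1 f2 a b w.
  by congr (_ <= _); field.
have h4 : m - 1 <= xln m.
  have m0 : 0 <= m by have := sqr_ge0 T; lra.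
  by have := gibbs_pointwise m0 ltr01; rewrite ln1 mulr0 add0r.
have h5 : xln tau <= - K * tau.
  have t0 : 0 <= tau by apply: le_trans (sqr_ge0 T) T2.
  rewrite /xln mulrC; move: t0; rewrite le_eqVlt => /orP[/eqP <-|tp]; first by rewrite !mulr0.
  rewrite ler_pM2r// -[X in _ <= X]expRK ler_ln ?posrE ?expR_gt0//.
  by lra.
have Et := log_sobolev_gauss tth; rewrite -/tau -/Ft in Et.
have Eg := @gap2_all R n _ _ pph.
have e1 : J (lebesgue_rV R n) (fun x => (v x - t x) ^+ 2 * W x) = m - 2 * X + tau.
  have z1 := IntZ 2 ivt; have z2 := IntB iv2 z1.
  rewrite -(JZ _ ivt) -(JB iv2 z1) -(JD z2 it2); apply: J_ext => x.
  by move: (t x) (v x) (W x) => a b w; ring.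
have e2 : J (lebesgue_rV R n) (fun x => (v x - t x) * W x) = 1 - T.
  by rewrite -v1 -(JB iv it); apply: J_ext => x; rewrite mulrBl.
have e3 i : J (lebesgue_rV R n) (fun x : 'rV[R]_n => x ord0 i * (v x - t x) * W x) =
    - J (lebesgue_rV R n) (fun x : 'rV[R]_n => x ord0 i * t x * W x).
  have k1 := Cc_Int (CcxW i cv); have k2 := Cc_Int (CcxW i ct).
  rewrite -[RHS]add0r -(vx i) -(JB k1 k2); apply: J_ext => x.
  by move: (t x) (v x) (W x) => a b w; ring.
(* The degree-one modes of v vanish, so those of v - t are minus those of t and cost only O(tau). *)
have h6 : 4 * pi ^+ 2 * (\sum_i J (lebesgue_rV R n) (fun x : 'rV[R]_n => x ord0 i * (v x - t x) * W x) ^+ 2)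
    <= pi * (2 * n%:R * tau).
  have : \sum_i J (lebesgue_rV R n) (fun x : 'rV[R]_n => x ord0 i * (v x - t x) * W x) ^+ 2 <=
      \sum_(i < n) tau * (2 * pi)^-1.
    by apply: ler_sum => i _; rewrite e3 sqrrN; exact: sq_J_xW.
  rewrite sumr_const card_ord -mulr_natl; have := pi_gt0 R.
  generalize (@pi R); move=> p p0 hh.
  apply: le_trans (ler_wpM2l _ hh) _; first by rewrite mulr_ge0// exprn_ge0// ltW.
  by rewrite le_eqVlt; apply/orP; left; apply/eqP; field; rewrite gt_eqF.
rewrite e1 e2 in Eg.
have split i : J (lebesgue_rV R n) (fun x => (h i x - th i x) ^+ 2 * W x) +
    J (lebesgue_rV R n) (fun x => th i x ^+ 2 * W x) <=
    J (lebesgue_rV R n) (fun x => h i x ^+ 2 * W x).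
  have k1 := Cc_Int (Cc2W (ch i)); have k2 := Cc_Int (Cc2W (cth i)).
  have k3 := Cc_Int (Cc2W (CcB (ch i) (cth i))).
  rewrite -(JD k3 k2); apply: J_le => // [|x]; first exact: IntD.
  have /andP[d0 d1] := dtru01 (v x).
  rewrite -subr_ge0 /th; move: (dtru (v x)) d0 d1 (ltW (W_gt0 x)) => d d0 d1 w0.
  rewrite (_ : _ - _ = 2 * (d * (1 - d)) * h i x ^+ 2 * W x); last by ring.
  rewrite mulr_ge0// mulr_ge0 ?sqr_ge0//; nra.
have S : \sum_i J (lebesgue_rV R n) (fun x => (h i x - th i x) ^+ 2 * W x) +
    \sum_i J (lebesgue_rV R n) (fun x => th i x ^+ 2 * W x) <=
    \sum_i J (lebesgue_rV R n) (fun x => h i x ^+ 2 * W x).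
  by rewrite -big_split; apply: ler_sum => i _; exact: split.
have [fin|] := @core_arith n%:R C m X tau T Ft Fv (xln tau) (xln m) (ler0n _ _) T2 h2 h3 h4 h5; last first.
  by have := le_trans (sqr_ge0 T) (le_trans T2 tm); lra.
have := ler_wpM2l (pi_ge0 R) fin; rewrite mul0r addr0; move: S Eg Et h6; clear.
move: (\sum_i _) (\sum_i _) (\sum_i _) (\sum_i _) (xln _) (xln _) => a b c d xt xm.
move: ((1 - T) ^+ 2) (pi ^+ 2) => T' pp; move: (@pi R) => p h1 h2 h3 h4; lra.
Qed.

End local_stability.

(** * Overlaps with translated Gaussians and the distance to M *)

Section overlap.
Context (R : realType) (n : nat).
Local Notation mu := (lebesgue_rV R n).
Implicit Types (u v : 'rV[R]_n -> R) (b : 'rV[R]_n).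

Lemma sqnormN b : sqnorm (- b) = sqnorm b.
Proof. by apply: eq_bigr => i _; rewrite mxE sqrrN. Qed.

Lemma cts_shift u b : continuous u -> continuous (fun x : 'rV[R]_n => u (x + b)).
Proof.
move=> cu; apply: cts_eps => x e e0.
have := cu (x + b) => /cvgrPdist_lt/(_ e e0)/nbhs_ballP[d /= d0 h].
by exists d => // z xz; apply: h; rewrite -ball_normE /= opprD addrACA subrr addr0.
Qed.

(** By the parallelogram identity the product is a multiple of [W] centred at the midpoint [c]. *)
Lemma J_gam_gam b b' : Int mu (fun x => gam (x - b) * gam (x - b')) /\
  J mu (fun x => gam (x - b) * gam (x - b')) = expR (- (pi / 4) * sqnorm (b - b')).
Proof.
pose c : 'rV[R]_n := 2^-1 *: (b + b').
have e x : gam (x - b) * gam (x - b') = expR (- (pi / 4) * sqnorm (b - b')) * W (x - c).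
  rewrite /gam /W -!expRD; congr expR.
  have -> : sqnorm (x - b) = \sum_i (x ord0 i - b ord0 i) ^+ 2.
    by apply: eq_bigr => i _; rewrite !mxE.
  have -> : sqnorm (x - b') = \sum_i (x ord0 i - b' ord0 i) ^+ 2.
    by apply: eq_bigr => i _; rewrite !mxE.
  rewrite /sqnorm !mulr_sumr -!big_split/=.
  by apply: eq_bigr => i _; rewrite !mxE; move: (@pi R) (x ord0 i) (b ord0 i) (b' ord0 i) => p y z w; field.
have iW := Int_shift (- c) (@Int_W R n).
split.
  apply: Int_ext (IntZ (expR (- (pi / 4) * sqnorm (b - b'))) iW) => x; exact: esym (e x).
rewrite (@J_ext _ _ _ _ _ (fun x : 'rV[R]_n => expR (- (pi / 4) * sqnorm (b - b')) * W (x - c))) => [|x]; last exact: e.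
by rewrite (JZ _ iW) J_shift ?J_W ?mulr1//; exact: Int_W.
Qed.

Lemma sqnorm0 : sqnorm (0 : 'rV[R]_n) = 0.
Proof. by rewrite /sqnorm big1// => i _; rewrite mxE expr0n. Qed.

Lemma Sq_shift u b : Sq mu u -> Sq mu (fun x => u (x + b)).
Proof.
move=> [mu_ iu]; split; last exact: (Int_shift b iu).
by apply: (measurableT_comp mu_); exact: measurable_add_rV.
Qed.

Lemma mass_shift u b : Sq mu u -> mass (fun x => u (x + b)) = mass u.
Proof. by move=> [_ iu]; exact: (J_shift b iu). Qed.

Lemma Sq_gams b : Sq mu (fun x => gam (x - b)).
Proof. exact: Sq_shift (@Sq_gam R n). Qed.

Lemma mass_gams b : mass (fun x => gam (x - b)) = 1.
Proof. by rewrite (mass_shift (- b) (@Sq_gam R n)) /mass (J_ext _ (@gam_sq R n)) J_W. Qed.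

Lemma massZ c u : Sq mu u -> mass (fun x => c * u x) = c ^+ 2 * mass u.
Proof. by move=> [_ iu]; rewrite /mass -(JZ _ iu); apply: J_ext => x; rewrite exprMn. Qed.

Definition ovl u b : R := J mu (fun x => u x * gam (x - b)).

Lemma Int_ovl u b : Sq mu u -> Int mu (fun x => u x * gam (x - b)).
Proof. by move=> su; apply: Int_mul => //; exact: Sq_gams. Qed.

Lemma ovl_sq u b : Sq mu u -> ovl u b ^+ 2 <= mass u.
Proof. move=> su; apply: le_trans (cauchy_schwarzJ su (Sq_gams b)) _.
by rewrite -/(mass (fun x => gam (x - b))) mass_gams mulr1. Qed.

Definition ov2 u : R := sup [set ovl u b ^+ 2 | b in setT].

Lemma ov2_sup u : Sq mu u -> has_sup [set ovl u b ^+ 2 | b in setT].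
Proof.
move=> su; split; first by exists (ovl u 0 ^+ 2), 0.
by exists (mass u) => _ [b _ <-]; exact: ovl_sq.
Qed.

Lemma ov2_ge u b : Sq mu u -> ovl u b ^+ 2 <= ov2 u.
Proof. by move=> su; apply: ub_le_sup; [exact: (ov2_sup su).2|exists b]. Qed.

Lemma ov2_le u B : Sq mu u -> (forall b, ovl u b ^+ 2 <= B) -> ov2 u <= B.
Proof. by move=> su h; apply: ge_sup; [exact: (ov2_sup su).1|move=> _ [b _ <-]]. Qed.

Lemma ov2_ge0 u : Sq mu u -> 0 <= ov2 u.
Proof. by move=> su; apply: le_trans (ov2_ge 0 su); exact: sqr_ge0. Qed.

(** The squared L^2 distance to M: for a fixed centre b the best amplitude is [ovl u b], which
    leaves mass u - (ovl u b)^2. *)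
Definition d2 u : R := mass u - ov2 u.

Lemma d2_ge0 u : Sq mu u -> 0 <= d2 u.
Proof. by move=> su; rewrite subr_ge0; apply: ov2_le => // b; exact: ovl_sq. Qed.

Lemma d2_le u : Sq mu u -> d2 u <= mass u.
Proof. by move=> su; rewrite gerBl ov2_ge0. Qed.

Lemma ovlZ c u b : Sq mu u -> ovl (fun x => c * u x) b = c * ovl u b.
Proof.
move=> su; rewrite /ovl -(JZ _ (Int_ovl b su)); apply: J_ext => x.
by rewrite mulrA.
Qed.

Lemma ov2Z c u : Sq mu u -> ov2 (fun x => c * u x) = c ^+ 2 * ov2 u.
Proof.
move=> su; apply/eqP; rewrite eq_le; apply/andP; split.
  apply: ov2_le => [|b]; first exact: SqZ.
  by rewrite ovlZ// exprMn ler_wpM2l ?sqr_ge0//; exact: ov2_ge.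
have [->|c0] := eqVneq c 0; first by rewrite expr0n mul0r ov2_ge0//; exact: SqZ.
rewrite -ler_pdivlMl ?exprn_even_gt0//; apply: ov2_le => // b.
rewrite ler_pdivlMl ?exprn_even_gt0// -exprMn -ovlZ//.
by apply: ov2_ge; exact: SqZ.
Qed.

Lemma d2Z c u : Sq mu u -> d2 (fun x => c * u x) = c ^+ 2 * d2 u.
Proof. by move=> su; rewrite /d2 massZ// ov2Z// mulrBr. Qed.

Lemma ovl_shift u b c : Sq mu u -> ovl (fun x => u (x + c)) b = ovl u (b + c).
Proof.
move=> su; rewrite /ovl -(J_shift c (Int_ovl (b + c) su)); apply: J_ext => x.
by rewrite opprD addrA addrAC addrK.
Qed.

Lemma ov2_shift u c : Sq mu u -> ov2 (fun x => u (x + c)) = ov2 u.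
Proof.
move=> su; apply/eqP; rewrite eq_le; apply/andP; split; apply: ov2_le => //.
- exact: Sq_shift.
- by move=> b; rewrite ovl_shift//; exact: ov2_ge.
- move=> b; rewrite -(subrK c b) -ovl_shift//; apply: ov2_ge; exact: Sq_shift.
Qed.

Lemma d2_shift u c : Sq mu u -> d2 (fun x => u (x + c)) = d2 u.
Proof. by move=> su; rewrite /d2 mass_shift// ov2_shift. Qed.

Lemma ovlB u v b : Sq mu u -> Sq mu v -> ovl (fun x => u x - v x) b = ovl u b - ovl v b.
Proof.
move=> su sv; rewrite /ovl -(JB (Int_ovl b su) (Int_ovl b sv)); apply: J_ext => x.
by rewrite mulrBl.
Qed.

(** The square root of [ov2] is a supremum over b of |ovl u b|, each 1-Lipschitz in u for the L^2
    norm. *)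
Lemma sqrt_ov2_le u v : Sq mu u -> Sq mu v ->
  Num.sqrt (ov2 u) <= Num.sqrt (ov2 v) + nrm mu (fun x => u x - v x).
Proof.
move=> su sv; have suv := SqB su sv.
have h0 : 0 <= Num.sqrt (ov2 v) + nrm mu (fun x => u x - v x) by rewrite addr_ge0 ?sqrtr_ge0.
rewrite -[leRHS]ger0_norm// -sqrtr_sqr ler_sqrt ?sqr_ge0//; apply: ov2_le => // b.
rewrite -(real_normK (num_real (ovl u b))) ler_pXn2r ?nnegrE//.
have -> : ovl u b = ovl v b + ovl (fun x => u x - v x) b by rewrite ovlB// addrC subrK.
apply: le_trans (ler_normD _ _) _; apply: lerD.
  by rewrite -sqrtr_sqr ler_sqrt ?ov2_ge0//; exact: ov2_ge.
by rewrite -sqrtr_sqr /nrm ler_sqrt ?mass_ge0//; exact: ovl_sq.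
Qed.

(** Cauchy-Schwarz reduces the claim to the squared distance of two translated Gaussians, which
    [J_gam_gam] evaluates. *)
Lemma cts_ovl u : Sq mu u -> continuous (ovl u).
Proof.
move=> su; apply: (@cts_eps R 'rV[R]_n R) => b e e0.
pose k (z : 'rV[R]_n) : R := mass u * (2 - 2 * expR (- (pi / 4) * sqnorm (b - z))).
have ck : continuous k.
  apply: ctsM; first exact: cts_cst.
  apply: ctsB; first exact: cts_cst.
  apply: ctsM; first exact: cts_cst.
  apply: cts_exp; apply: ctsM; first exact: cts_cst.
  have -> : (fun z => sqnorm (b - z)) = (fun z => sqnorm (z - b)).
    by apply/funext => z; rewrite -sqnormN opprB.
  exact: (@cts_shift (@sqnorm R n) (- b) (@continuous_sqnorm R n)).
have kb : k b = 0 by rewrite /k subrr sqnorm0 mulr0 expR0; ring.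
have := ck b => /cvgrPdist_lt/(_ (e ^+ 2) (exprn_gt0 2 e0)) /nbhs_ballP[d /= d0 hd].
exists d => // z bz; have bz' : ball b d z by rewrite -ball_normE.
have := hd z bz'; rewrite /= kb sub0r normrN => kz.
have sb : Sq mu (fun x => gam (x - b) - gam (x - z)) by apply: SqB; exact: Sq_gams.
have : (ovl u b - ovl u z) ^+ 2 <= k z.
  have := cauchy_schwarzJ su sb.
  rewrite (@J_ext _ _ _ _ _ (fun x : 'rV[R]_n => u x * gam (x - b) - u x * gam (x - z))) => [|x]; last by rewrite mulrBr.
  rewrite (JB (Int_ovl b su) (Int_ovl z su)) -/(ovl u b) -/(ovl u z) => /le_trans; apply.
  rewrite /k /mass ler_wpM2l ?mass_ge0//.
  have [ig jg] := J_gam_gam b z.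
  have i1 := (Sq_gams b).2; have i2 := (Sq_gams z).2.
  have z1 := IntZ 2 ig; have z2 := IntB i1 z1.
  rewrite (@J_ext _ _ _ _ _ (fun x : 'rV[R]_n => gam (x - b) ^+ 2 - 2 * (gam (x - b) * gam (x - z)) + gam (x - z) ^+ 2)) => [|x]; last by ring.
  rewrite (JD z2 i2) (JB i1 z1) (JZ _ ig) jg -/(mass _) -/(mass (fun x => gam (x - z))) !mass_gams.
  by rewrite le_eqVlt; apply/orP; left; apply/eqP; ring.
move=> h; rewrite -(@ltr_pXn2r _ 2)// ?nnegrE ?(ltW e0)// real_normK ?num_real//.
by apply: le_lt_trans h _; apply: le_lt_trans (ler_norm _) kz.
Qed.

Definition out (M : R) (x : 'rV[R]_n) : R := (M < `|x|)%R%:R.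

Lemma out0 M x : `|x| <= M -> out M x = 0.
Proof. by rewrite /out leNgt => /negbTE ->. Qed.

Lemma out01 M x : 0 <= out M x <= 1.
Proof. by rewrite /out; case: ltP => _; rewrite ?lexx ?ler01. Qed.

Lemma measurable_out M : measurable_fun setT (out M).
Proof.
have mA : measurable [set x : 'rV[R]_n | M < `|x|].
  apply: open_measurable_rV; rewrite (_ : [set x | _] = (fun x : 'rV[R]_n => `|x|) @^-1` [set r | M < r])//.
  by apply: open_comp; [move=> x _; exact: norm_continuous|exact: open_gt].
rewrite (_ : out M = \1_[set x : 'rV[R]_n | M < `|x|]); first exact: measurable_indic.
by apply/funext => x; rewrite indicE mem_setE.
Qed.

Lemma Sq_out u M : Sq mu u -> Sq mu (fun x => u x * out M x).
Proof.
move=> su; apply: (Sq_dom _ su).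
  by apply: measurable_funM; [exact: su.1|exact: measurable_out].
by move=> x; have /andP[a0 a1] := out01 M x; rewrite normrM ler_piMr// ger0_norm.
Qed.

Lemma out_sq M x : out M x ^+ 2 = out M x.
Proof. by rewrite /out; case: ltP => _; rewrite ?expr1n// expr0n. Qed.

Lemma mass_out u : Sq mu u -> forall e : R, 0 < e ->
  exists M : R, forall M', M <= M' -> mass (fun x => u x * out M' x) < e.
Proof.
move=> su e e0; have sk k : Sq mu (fun x => u x * out k%:R x) by exact: Sq_out.
have cg : {ae mu, forall x, (u x * out k%:R x) ^+ 2 @[k --> \oo] --> (0 : R)}.
  apply: nearW => x; apply/cvgrPdist_lt => d d0; near=> k.
  have xk : `|x| <= k%:R by near: k; exact: nbhs_infty_ger.
  by rewrite out0// mulr0 expr0n subrr normr0.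
have leg k x : `|(u x * out k%:R x) ^+ 2| <= u x ^+ 2.
  rewrite ger0_norm ?sqr_ge0// exprMn out_sq ler_piMr ?sqr_ge0//.
  by have /andP[] := out01 k%:R x.
have [_ /cvgrPdist_lt/(_ e e0)[k _ /(_ k (leqnn k))]] :=
  dct (fun k => Int_meas (sk k).2) (Int_meas (@Int0 _ _ _ mu)) su.2 cg leg.
rewrite J0 sub0r normrN ger0_norm ?mass_ge0// => h.
exists k%:R => M' kM; apply: le_lt_trans h; apply: J_le => [||x].
- by have [] := Sq_out M' su.
- by have [] := sk k.
- rewrite !exprMn ler_wpM2l ?sqr_ge0// !out_sq /out.
  by case: ltP => // Mx; rewrite (le_lt_trans kM Mx).
Unshelve. all: by end_near. Qed.

(** With u cut at radius M1 and the Gaussian at radius M2, for |b| > M1 + M2 the bulk of u meets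
    only the tail of the translated Gaussian. *)
Lemma ovl_decay u : Sq mu u -> forall e : R, 0 < e ->
  exists M : R, forall b, M < `|b| -> ovl u b ^+ 2 < e.
Proof.
move=> su e e0; pose m := mass u; have m0 : 0 <= m by exact: mass_ge0.
(* The two parts of the overlap have squares at most m d and d, so its square is at most 2 (m + 1) d
   < e. *)
pose d := e / (2 * (m + 1) + 1); have d0 : 0 < d by rewrite divr_gt0// ltr_wpDl// mulr_ge0// addr_ge0.
have [M1 h1] := mass_out su d0; have [M2 h2] := mass_out (@Sq_gam R n) d0.
exists (M1 + M2) => b bM.
pose u2 x := u x * out M1 x; pose u1 x := u x - u2 x.
have s2 : Sq mu u2 by exact: Sq_out.
have s1 : Sq mu u1 by exact: SqB.
pose g1 x := gam (x - b) * out M2 (x - b).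
have sg1 : Sq mu g1 by exact: (Sq_shift (- b) (Sq_out M2 (@Sq_gam R n))).
have mg1 : mass g1 < d.
  by rewrite /g1 (mass_shift (- b) (Sq_out M2 (@Sq_gam R n))); exact: h2.
have e1 : ovl u1 b = J mu (fun x => u1 x * g1 x).
  apply: J_ext => x; rewrite /u1 /u2 /g1 /out.
  case: ltP => xM /=; first by rewrite mulr1 subrr !mul0r.
  rewrite (_ : M2 < `|x - b|) ?mulr1//.
  by have := ler_normB x (x - b); rewrite opprB addrC subrK; lra.
have b1 : ovl u1 b ^+ 2 <= m * d.
  rewrite e1; apply: le_trans (cauchy_schwarzJ s1 sg1) _.
  apply: ler_pM; [exact: mass_ge0|exact: mass_ge0| |exact: ltW].
  apply: J_le => [||x]; [exact: s1.2|exact: su.2|].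
  rewrite /u1 /u2 /out; case: ltP => _ /=; last by rewrite mulr0 subr0.
  by rewrite mulr1 subrr expr0n sqr_ge0.
have b2 : ovl u2 b ^+ 2 <= d.
  by apply: le_trans (ovl_sq b s2) _; apply/ltW/h1.
have -> : ovl u b = ovl u1 b + ovl u2 b.
  by rewrite /u1 ovlB// subrK.
have : e = (2 * (m + 1) + 1) * d by rewrite /d mulrC divfK// gt_eqF// ltr_wpDl// mulr_ge0// addr_ge0.
have := sqr_ge0 (ovl u1 b - ovl u2 b); rewrite sqrrB sqrrD.
move: b1 b2 d0; move: (ovl u1 b ^+ 2) (ovl u2 b ^+ 2) (_ *+ 2) => x y z; lra.
Qed.

(** A positive supremum is approached only in a bounded region, by [ovl_decay], and the overlap is
    continuous there. *)
Lemma ov2_attained u : Sq mu u -> exists b, ovl u b ^+ 2 = ov2 u.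
Proof.
move=> su; have := ov2_ge0 su; rewrite le_eqVlt => /orP[/eqP e|s0].
  by exists 0; apply/eqP; rewrite eq_le ov2_ge//= -e sqr_ge0.
have s20 : 0 < ov2 u / 2 by rewrite divr_gt0.
have [M hM] := ovl_decay su s20; pose A : set 'rV[R]_n := [set x | `|x| <= Num.max M 0].
have A0 : A !=set0 by exists 0; rewrite /A/= normr0 le_max lexx orbT.
have [|c _ hc] := EVT_max_rV A0 (@ball_compact_rV R n _) (f := fun b => ovl u b ^+ 2).
  by apply: continuous_subspaceT; apply: ctsX; exact: cts_ovl.
exists c; apply/eqP; rewrite eq_le ov2_ge//=.
have inA b : ov2 u / 2 <= ovl u b ^+ 2 -> b \in A.
  move=> h; rewrite inE /A/= le_max; apply/orP; left; rewrite leNgt; apply/negP => /hM.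
  by rewrite ltNge h.
have : ov2 u / 2 < ov2 u by lra.
move=> /(sup_gt (ov2_sup su).1) [_ [b0 _ <-] hb0].
have cb0 := hc _ (inA _ (ltW hb0)).
apply: (ov2_le su) => b; have [h|h] := leP (ov2 u / 2) (ovl u b ^+ 2).
  by apply: hc; exact: inA.
by apply: ltW; apply: lt_le_trans h _; apply: le_trans cb0; exact: ltW.
Qed.

End overlap.

(** * Local stability for functions of bounded support *)

Section local_stability_C1c.
Context (R : realType) (n : nat).
Local Notation mu := (lebesgue_rV R n).
Implicit Types (u v : 'rV[R]_n -> R) (g h : 'I_n -> 'rV[R]_n -> R) (b : 'rV[R]_n).

Lemma C1c_Sq u g : C1c u g -> Sq mu u.
Proof. by move=> ug; apply: Cc_Sq; exact: (C1c_Cc ug). Qed.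

Lemma C1c_shift u g b : C1c u g ->
  C1c (fun x => u (x + b)) (fun i (x : 'rV[R]_n) => g i (x + b)).
Proof.
move=> [[cu cg dg] [M hM]]; split; first split.
- exact: cts_shift.
- by move=> i; exact: (@cts_shift R n (g i) b (cg i)).
- by move=> i x; apply: (dE (dg i (x + b))) => // s; rewrite addrAC.
- exists (M + `|b|) => x Mx; apply: hM.
  by have := ler_normB (x + b) b; rewrite addrK; lra.
Qed.

Lemma DD_shift u g b : C1c u g ->
  DD (fun x => u (x + b)) (fun i (x : 'rV[R]_n) => g i (x + b)) = DD u g.
Proof.
move=> ug; rewrite /DD (mass_shift b (C1c_Sq ug)); congr (_ - _ * _ + _ - _).
  by apply: eq_bigr => i _; exact: (J_shift b (Cc_Int (CcX 1 (C1c_Ccd i ug)))).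
exact: (J_shift b (Cc_Int (Cc_Fl (C1c_Cc ug)))).
Qed.

Lemma FlZ (c s : R) : c != 0 -> Fl (c * s) = c ^+ 2 * Fl s + c ^+ 2 * ln (c ^+ 2) * s ^+ 2.
Proof.
move=> c0; have [->|s0] := eqVneq s 0.
  by rewrite mulr0 Fl0 expr0n/= !mulr0 addr0.
rewrite /Fl /xln exprMn lnM ?posrE ?exprn_even_gt0//; ring.
Qed.

Lemma DDZ u g (c : R) : C1c u g -> DD (fun x => c * u x) (fun i x => c * g i x) = c ^+ 2 * DD u g.
Proof.
move=> ug; have su := C1c_Sq ug.
have [->|c0] := eqVneq c 0.
  rewrite expr0n mul0r /DD /energy big1 => [|i _]; last first.
    by rewrite (@J_ext _ _ _ _ _ (fun=> 0)) ?J0// => x; rewrite mul0r expr0n.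
  have -> : entr (fun x => 0 * u x) = 0.
    by rewrite /entr (@J_ext _ _ _ _ _ (fun=> 0)) ?J0// => x; rewrite mul0r Fl0.
  by rewrite massZ// expr0n mul0r xln0 !mulr0 !subr0 addr0.
have c2 : 0 < c ^+ 2 by rewrite exprn_even_gt0.
have iF := Cc_Int (Cc_Fl (C1c_Cc ug)); have iu := su.2.
rewrite /DD massZ// (_ : energy _ = c ^+ 2 * energy g); last first.
  rewrite /energy mulr_sumr; apply: eq_bigr => i _.
  rewrite -(JZ _ (Cc_Int (CcX 1 (C1c_Ccd i ug)))); apply: J_ext => x.
  by rewrite exprMn.
have -> : entr (fun x => c * u x) = c ^+ 2 * entr u + c ^+ 2 * ln (c ^+ 2) * mass u.
  rewrite -(JZ _ iF) -(JZ _ iu) -(JD (IntZ _ iF) (IntZ _ iu)); apply: J_ext => x.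
  exact: FlZ.
have -> : xln (c ^+ 2 * mass u) = c ^+ 2 * xln (mass u) + c ^+ 2 * ln (c ^+ 2) * mass u.
  have := mass_ge0 u; rewrite le_eqVlt => /orP[/eqP <-|m0]; first by rewrite mulr0 xln0 !mulr0 addr0.
  by rewrite /xln lnM ?posrE//; ring.
by move: (xln _) => x; move: (energy g) (entr u) (mass u) (ln _) (@pi R) => E e m l p; ring.
Qed.

(** A uniform bound on the gradient of [gam], which dominates the derivative of the overlap with
    respect to the centre. *)
Lemma xgam_le (z : 'rV[R]_n) i : `|pi * z ord0 i * gam z| <= pi.
Proof.
rewrite normrM normrM (gtr0_norm (pi_gt0 R)) (gtr0_norm (gam_gt0 z)) -mulrA.
rewrite ler_piMr ?pi_ge0//.
have h1 : gam z <= expR (- (z ord0 i ^+ 2)).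
  rewrite ler_expR mulNr lerN2; apply: (@le_trans _ _ (1 * sqnorm z)).
    by rewrite mul1r coord_sq_le_sqnorm.
  by rewrite ler_wpM2r ?sqnorm_ge0// ler_pdivlMr// mul1r pi_ge2.
have h2 : `|z ord0 i| * expR (- (z ord0 i ^+ 2)) <= 1.
  rewrite expRN ler_pdivrMr ?expR_gt0// mul1r.
  apply: le_trans (expR_ge1Dx _); rewrite -(real_normK (num_real (z ord0 i))).
  by have := normr_ge0 (z ord0 i); nra.
by apply: le_trans h2; rewrite ler_wpM2l.
Qed.

(* The first order condition at a maximum of the squared overlap. *)
Lemma ovl_critical u i : Cc u -> ovl u 0 ^+ 2 = ov2 u -> ovl u 0 != 0 ->
  J mu (fun x : 'rV[R]_n => x ord0 i * u x * gam x) = 0.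
Proof.
move=> cu e0 n0; have su := Cc_Sq cu.
pose f (s : R) : R := ovl u (s *: e_ R i).
pose f' (s : R) (y : 'rV[R]_n) : R := u y * (pi * (y - s *: e_ R i) ord0 i * gam (y - s *: e_ R i)).
have d (s : R) y : is_derive s 1 (fun t : R => u y * gam (y - t *: e_ R i)) (f' s y).
  have [_ _ dg] := @C1_gam R n.
  have d1 := @dcomp R (fun t => gam (y + t *: e_ R i)) (fun t => - t) s _ _
    (pd_line y (- s) (dg i)) (dN (did s)).
  apply: (dE (dM (dcst (u y) s) d1)) => [t|]; first by rewrite scaleNr.
  by rewrite /f' mul0r add0r scaleNr; ring.
have iu := Int_abs (Cc_Int cu).
have df (s : R) : is_derive s 1 f (J mu (f' s)).
  apply: (is_derive_J d (G := fun y => pi * `|u y|)).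
  - by move=> s'; exact: (Int_ovl _ su).
  - exact: IntZ.
  - move=> s' y _; rewrite /f' normrM mulrC ler_wpM2r//; exact: xgam_le.
have d2f (s : R) := dX 2 (df s).
have m : is_derive (0 : R) 1 (fun t : R => f t ^+ 2) (0 : R).
  apply: (@derive1_at_max R _ (-1) 1).
  - lra.
  - by move=> t _; have [] := d2f t.
  - by rewrite in_itv/=; apply/andP; split; lra.
  - have e0' : ovl u (0 *: e_ R i) ^+ 2 = ov2 u by rewrite scale0r.
    move=> t _; apply: (le_trans (ov2_ge (t *: e_ R i) su)).
    by rewrite -e0'; exact: lexx.
have fz : f 0 = ovl u 0 by rewrite /f scale0r.
have := @derive_val _ _ _ _ _ _ _ (d2f 0); rewrite (@derive_val _ _ _ _ _ _ _ m) /=.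
rewrite expr1 fz => /esym/eqP; rewrite mulf_eq0 mulf_eq0 (negPf n0) pnatr_eq0/=.
rewrite /f' (@J_ext _ _ _ _ _ (fun y : 'rV[R]_n => pi * (y ord0 i * u y * gam y))).
  rewrite JZ; first by rewrite mulf_eq0 (negPf (pi_neq0 R)) => /eqP.
  apply: Cc_Int; apply: CcM; last exact: cts_gam.
  by apply: (CcMr cu); exact: coord_continuous.
by move=> y; rewrite scale0r subr0; ring.
Qed.

(** Translate the optimal centre b to 0 and divide by the overlap: v = u1/gam has mean 1, and the
    first-order condition at b removes its degree-one modes, as [stability_core] requires. *)
Lemma local_stability : exists2 eta : R, 0 < eta & forall u g, C1c u g ->
  d2 u <= eta * ov2 u -> 29 / 20 * pi * d2 u <= DD u g.
Proof.
have [eta eta0 H] := stability_core R n; exists eta => // u g ug due.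
have su := C1c_Sq ug; have p0 := pi_gt0 R.
have := ov2_ge0 su; rewrite le_eqVlt => /orP[/eqP o0|o0].
  (* With zero overlap the hypothesis forces d2 u <= 0. *)
  apply: (@le_trans _ _ 0); last exact: DD_ge0.
  rewrite -o0 mulr0 in due; rewrite mulr_ge0_le0// mulr_ge0//; lra.
have [b hb] := ov2_attained su; set s := ovl u b in hb.
have s0 : s != 0 by rewrite -sqrf_eq0 hb gt_eqF.
have s2 : 0 < s ^+ 2 by rewrite exprn_even_gt0.
pose u1 x := s^-1 * u (x + b); pose g1 i (x : 'rV[R]_n) := s^-1 * g i (x + b).
have ug1 : C1c u1 g1 by exact: (C1cZ _ (C1c_shift b ug)).
have su1 := C1c_Sq ug1; have sub := Sq_shift b su.
pose k := fun (x : 'rV[R]_n) => expR (pi / 2 * sqnorm x).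
have kg x : k x * gam x = 1 by rewrite /k /gam -expRD mulNr subrr expR0.
have vh := C1cM ug1 (C1_gauss n (pi / 2)); rewrite -/k in vh.
set v := fun x => _ in vh; set h := fun i x => _ in vh.
have vg x : v x * gam x = u1 x by rewrite /v -mulrA kg mulr1.
have vW x : v x * W x = u1 x * gam x by rewrite -gam_sq expr2 mulrA vg.
have v2 x : v x ^+ 2 * W x = u1 x ^+ 2 by rewrite -gam_sq -exprMn vg.
have o1 : ovl u1 0 = 1.
  by rewrite /u1 ovlZ// ovl_shift// add0r -/s mulVf.
have m1 : mass u1 = (s ^+ 2)^-1 * mass u by rewrite /u1 massZ// mass_shift// exprVn.
have ov1 : ov2 u1 = 1 by rewrite /u1 ov2Z// ov2_shift// -hb exprVn mulVf// gt_eqF.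
have j1 : J mu (fun x => v x * W x) = 1.
  by rewrite -o1; apply: J_ext => x; rewrite vW subr0.
have j2 : J mu (fun x => v x ^+ 2 * W x) = mass u1 by apply: J_ext => x; rewrite v2.
have jx i : J mu (fun x : 'rV[R]_n => x ord0 i * v x * W x) = 0.
  have := @ovl_critical u1 i (C1c_Cc ug1); rewrite o1 ov1 expr1n => /(_ erefl (oner_neq0 R)) <-.
  by apply: J_ext => x; rewrite -mulrA vW mulrA.
have dm : mass u1 - 1 = (s ^+ 2)^-1 * d2 u.
  by rewrite m1 /d2 -hb mulrBr mulVf// gt_eqF.
have := H v h vh j1 jx; rewrite j2 dm => HH.
have {}HH := HH _; have le : (s ^+ 2)^-1 * d2 u <= eta.
  by rewrite ler_pdivrMl// mulrC hb.
have {HH le} := HH le; rewrite -j2 -(DD_gam vh).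
have -> : DD (fun x => v x * gam x) (fun i x => h i x * gam x + v x * (- pi * x ord0 i * gam x)) = DD u1 g1.
  congr DD; first by apply/funext => x; rewrite vg.
  apply/funext => i; apply/funext => x; rewrite /v /h.
  have -> : (g1 i x * k x + u1 x * (2 * (pi / 2) * x ord0 i * k x)) * gam x
     + u1 x * k x * (- pi * x ord0 i * gam x) = g1 i x * (k x * gam x).
    by move: (@pi R) => p; field.
  by rewrite kg mulr1.
rewrite (DDZ _ (C1c_shift b ug)) (DD_shift b ug) exprVn mulrCA ler_pM2l// invr_gt0.
by rewrite s2.
Qed.

End local_stability_C1c.

(** * Cut-off angles and the binary entropy *)

Section ramp.
Context (R : realType).
Implicit Types (x y s t p l : R).

Definition clamp t : R := pp t - pp (t - 1).
Definition ramp t : R := 3 * clamp t ^+ 2 - 2 * clamp t ^+ 3.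
Definition dramp t : R := 6 * clamp t * (1 - clamp t).

Lemma clamp_le0 t : t <= 0 -> clamp t = 0.
Proof. by move=> t0; rewrite /clamp !pp_le0 ?subrr//; lra. Qed.

Lemma clamp_ge1 t : 1 <= t -> clamp t = 1.
Proof. by move=> t1; rewrite /clamp !pp_ge0//; lra. Qed.

Lemma clamp_le1 t : t <= 1 -> clamp t = pp t.
Proof. by move=> t1; rewrite /clamp (pp_le0 (_ : t - 1 <= 0)) ?subr0//; lra. Qed.

Lemma clamp01 t : 0 <= clamp t <= 1.
Proof.
have [t0|t0] := leP t 0; first by rewrite clamp_le0// lexx ler01.
have [t1|t1] := leP 1 t; first by rewrite clamp_ge1// lexx ler01.
by rewrite clamp_le1 ?pp_ge0 ?(ltW t0) ?(ltW t1).
Qed.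

Lemma is_derive_ramp t : is_derive t 1 ramp (dramp t).
Proof.
pose f1 (t : R) : R := 3 * pp t ^+ 2 - 2 * pp t ^+ 3.
have d1 s : is_derive s 1 f1 (6 * pp s * (1 - pp s)).
  apply: (@is_derive_piece _ _ (fun=> 0) (fun s => 3 * s ^+ 2 - 2 * s ^+ 3) (fun s => 6 * pp s * (1 - pp s)) 0) => {}s s0.
  - by rewrite /f1 pp_le0// !expr0n/= !mulr0 subrr.
  - by rewrite /f1 pp_ge0.
  - by apply: (dE (dcst 0 s)) => //; rewrite pp_le0// mulr0 mul0r.
  - have h := dB (dM (dcst 3 s) (dX 2 (did s))) (dM (dcst 2 s) (dX 3 (did s))).
    by apply: (dE h) => //=; rewrite pp_ge0//; ring.
apply: (@is_derive_piece _ _ f1 (fun=> 1) dramp 1) => {}t t1.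
- by rewrite /ramp /f1 clamp_le1.
- by rewrite /ramp clamp_ge1// !expr1n; ring.
- by rewrite /dramp clamp_le1.
- by apply: (dE (dcst 1 t)) => //; rewrite /dramp clamp_ge1// subrr mulr0.
Qed.

Lemma cts_clamp : continuous clamp.
Proof.
apply: ctsB; first exact: cts_pp.
apply: (cts_comp (@cts_pp R)); apply: ctsB; last exact: cts_cst.
by move=> t; exact: cvg_id.
Qed.

Lemma cts_dramp : continuous dramp.
Proof.
apply: ctsM; first by apply: ctsM; [exact: cts_cst|exact: cts_clamp].
by apply: ctsB; [exact: cts_cst|exact: cts_clamp].
Qed.

Lemma ramp_le0 t : t <= 0 -> ramp t = 0.
Proof. by move=> t0; rewrite /ramp clamp_le0// !expr0n/= !mulr0 subrr. Qed.

Lemma ramp_ge1 t : 1 <= t -> ramp t = 1.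
Proof. by move=> t1; rewrite /ramp clamp_ge1// !expr1n; ring. Qed.

Lemma dramp_sq t : dramp t ^+ 2 <= 4.
Proof.
have /andP[c0 c1] := clamp01 t; rewrite /dramp; move: (clamp t) c0 c1 => c c0 c1.
have h1 : 0 <= 6 * c * (1 - c) by rewrite !mulr_ge0//; lra.
have h2 : 6 * c * (1 - c) <= 2 by have := sqr_ge0 (c - 2^-1); lra.
rewrite (_ : 4 = 2 ^+ 2 :> R); last by ring.
by rewrite ler_pXn2r ?nnegrE.
Qed.

Lemma dramp_out t : t <= 0 \/ 1 <= t -> dramp t = 0.
Proof.
by rewrite /dramp => -[t0|t1]; [rewrite clamp_le0// mulr0 mul0r|rewrite clamp_ge1// subrr mulr0].
Qed.

(** The cut-offs used for splitting are the cosine and the sine of this angle: their squares sum to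
    1, and their squared derivatives sum to the square of [dangle], which lives in a slab of width
    l. *)
Definition angle p l s : R := pi / 2 * ramp ((s - p) / l).
Definition dangle p l s : R := pi / 2 * (dramp ((s - p) / l) / l).

Lemma is_derive_angle p l s : is_derive s 1 (angle p l) (dangle p l s).
Proof.
have d1 : is_derive s 1 (fun s : R => (s - p) / l) (l^-1).
  apply: (dE (dM (dB (did s) (dcst p s)) (dcst l^-1 s))) => //.
  by rewrite subr0 mul1r mulr0 addr0.
have d2 := @dcomp R ramp (fun s : R => (s - p) / l) s _ _ (is_derive_ramp _) d1.
by apply: (dE (dM (dcst (pi / 2) s) d2)) => //; rewrite mul0r add0r.
Qed.

Lemma cts_dangle p l : continuous (dangle p l).
Proof.
apply: ctsM; first exact: cts_cst.
apply: ctsM; last exact: cts_cst.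
apply: (cts_comp cts_dramp); apply: ctsM; last exact: cts_cst.
by apply: ctsB; [move=> s; exact: cvg_id|exact: cts_cst].
Qed.

Lemma angle_le p l s : 0 < l -> s <= p -> angle p l s = 0.
Proof.
by move=> l0 sp; rewrite /angle ramp_le0 ?mulr0// pmulr_lle0 ?invr_gt0// subr_le0.
Qed.

Lemma angle_ge p l s : 0 < l -> p + l <= s -> angle p l s = pi / 2.
Proof.
by move=> l0 sp; rewrite /angle ramp_ge1 ?mulr1// ler_pdivlMr// mul1r lerBrDl.
Qed.

Lemma dangle_out p l s : 0 < l -> s <= p \/ p + l <= s -> dangle p l s = 0.
Proof.
move=> l0 h; rewrite /dangle dramp_out ?mul0r ?mulr0//.
case: h => h; first by left; rewrite pmulr_lle0 ?invr_gt0// subr_le0.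
by right; rewrite ler_pdivlMr// mul1r lerBrDl.
Qed.

(** The ramp has slope at most 2, and pi/2 < 2. *)
Lemma dangle_sq p l s : dangle p l s ^+ 2 <= 16 / l ^+ 2.
Proof.
rewrite /dangle mulrA exprMn exprVn; apply: ler_wpM2r; first by rewrite invr_ge0 sqr_ge0.
rewrite exprMn (_ : 16 = 4 * 4); last by ring.
apply: ler_pM; rewrite ?sqr_ge0 ?dramp_sq//.
rewrite (_ : 4 = 2 ^+ 2 :> R); last by ring.
by rewrite ler_pXn2r ?nnegrE ?divr_ge0 ?pi_ge0// ltW// pihalf_lt2.
Qed.

(** The lower bound is Gibbs against (1/2, 1/2). For x <= y, x ln x <= -x ln 2 because x <= 1/2, and
    y ln y <= -x ln 2 is convexity along y = 2x * 1/2 + (1 - 2x) * 1, obtained by combining tangent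
    inequalities at y with these weights. *)
Lemma neg_entropy_bounds x y : 0 <= x -> 0 <= y -> x + y = 1 ->
  - ln 2 <= xln x + xln y /\ xln x + xln y <= - (2 * ln 2 * Num.min x y).
Proof.
move=> x0 y0 xy; have l2 : 0 <= ln (2 : R) by rewrite ln_ge0//; lra.
have lV : ln (2^-1 : R) = - ln 2 by rewrite lnV ?posrE.
split.
  have h1 := gibbs_pointwise x0 (_ : 0 < (2^-1 : R)); have h2 := gibbs_pointwise y0 (_ : 0 < (2^-1 : R)).
  have h : 0 < (2^-1 : R) by rewrite invr_gt0.
  have := h1 h; have := h2 h; rewrite lV; have -> : y = 1 - x by lra.
  by lra.
wlog xley : x y x0 y0 xy / x <= y.
  move=> H; have [h|h] := leP x y; first by have := H x y x0 y0 xy h; rewrite (min_idPl h).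
  have := H y x y0 x0 _ (ltW h); rewrite addrC (addrC (xln y)) => /(_ xy).
  by rewrite (min_idPl (ltW h)).
rewrite (min_idPl xley).
have h1 : xln x <= - (x * ln 2).
  move: x0; rewrite le_eqVlt => /orP[/eqP <-|xp]; first by rewrite xln0 mul0r oppr0.
  by rewrite /xln -mulrN ler_pM2l// -lV ler_ln ?posrE ?invr_gt0//; lra.
have yp : 0 < y by lra.
have k1 := gibbs_pointwise (_ : 0 <= 1) yp; have k2 := gibbs_pointwise (_ : 0 <= (2^-1 : R)) yp.
have := k1 ler01; have {k1 k2} := k2 (_ : 0 <= 2^-1).
rewrite invr_ge0 => /(_ (ler0n _ _)); rewrite /xln lV ln1 mulr0 => k2 k1.
have k3 : 2 * x * (2^-1 * ln y + 2^-1 - y) <= 2 * x * (2^-1 * - ln 2).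
  by rewrite ler_wpM2l// mulr_ge0.
have k4 : (1 - 2 * x) * (1 * ln y + 1 - y) <= 0.
  by rewrite mulr_ge0_le0//; lra.
have k5 : y * ln y <= - (x * ln 2).
  move: k3 k4; have -> : y = 1 - x by lra.
  by move: (ln _) (ln _) => a b; lra.
by move: h1 k5; rewrite /xln; move: (x * ln x) (y * ln y) (ln 2) => a b c; lra.
Qed.

End ramp.

(** * Splitting a function along a slab *)

Section splitting.
Context (R : realType) (n : nat).
Local Notation mu := (lebesgue_rV R n).
Implicit Types (u v : 'rV[R]_n -> R) (g h : 'I_n -> 'rV[R]_n -> R) (b : 'rV[R]_n).
Implicit Types (p l : R) (i : 'I_n).

Lemma FlM (c s : R) : Fl (c * s) = c ^+ 2 * Fl s + Fl c * s ^+ 2.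
Proof.
have [->|c0] := eqVneq c 0; first by rewrite mul0r Fl0 expr0n/= !mul0r addr0.
by rewrite FlZ.
Qed.

Definition slab i p l (x : 'rV[R]_n) : R := ((p < x ord0 i)%R && (x ord0 i < p + l)%R)%:R.
Definition lowS i p (x : 'rV[R]_n) : R := (x ord0 i <= p)%R%:R.
Definition upS i p (x : 'rV[R]_n) : R := (p <= x ord0 i)%R%:R.

Lemma measurable_coord_pred i (P : set R) : measurable (P : set (measurableTypeR R)) ->
  measurable_fun setT (fun x : 'rV[R]_n => (x ord0 i \in P)%:R : R).
Proof.
move=> mP; have mA : measurable [set x : 'rV[R]_n | P (x ord0 i)].
  by have := @measurable_rV_coord R n i measurableT _ mP; rewrite setTI.
rewrite (_ : (fun x => _) = \1_[set x : 'rV[R]_n | P (x ord0 i)]); first exact: measurable_indic.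
by apply/funext => x; rewrite indicE; congr (_%:R); apply/idP/idP; rewrite !inE.
Qed.

Lemma measurable_slab i p l : measurable_fun setT (slab i p l).
Proof.
have := @measurable_coord_pred i `]p, (p + l)[%classic (measurable_itv _).
by congr measurable_fun; apply/funext => x; rewrite mem_setE in_itv.
Qed.

Lemma measurable_lowS i p : measurable_fun setT (lowS i p).
Proof.
have := @measurable_coord_pred i `]-oo, p]%classic (measurable_itv _).
by congr measurable_fun; apply/funext => x; rewrite mem_setE in_itv.
Qed.

Lemma measurable_upS i p : measurable_fun setT (upS i p).
Proof.
have := @measurable_coord_pred i `[p, +oo[%classic (measurable_itv _).
by congr measurable_fun; apply/funext => x; rewrite mem_setE in_itv/= andbT.
Qed.

Lemma Int_cut u (k : 'rV[R]_n -> R) : Sq mu u -> measurable_fun setT k ->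
  (forall x, 0 <= k x <= 1) -> Int mu (fun x => u x ^+ 2 * k x).
Proof.
move=> su mk k01; apply: (Int_dom _ su.2).
  by apply: measurable_funM => //; exact: Int_meas su.2.
move=> x; have /andP[k0 k1] := k01 x.
have h : 0 <= u x ^+ 2 * k x by rewrite mulr_ge0 ?sqr_ge0.
by rewrite ger0_norm// ler_piMr ?sqr_ge0.
Qed.

Lemma bool01 (c : bool) : 0 <= (c%:R : R) <= 1.
Proof. by case: c; rewrite ?lexx ?ler01. Qed.

(** The IMS localisation formula: as xi^2 + eta^2 = 1, the gradient cross terms cancel and only the
    squared gradients of the cut-offs remain. The entropy costs the binary entropy of xi^2, at most
    ln 2 and zero where one cut-off vanishes. Both costs are carried by [k]. *)
Lemma split_DD u g (xi eta : 'rV[R]_n -> R) dxi deta (k : 'rV[R]_n -> R) (K : R) :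
  C1c u g -> C1 xi dxi -> C1 eta deta ->
  (forall x, xi x ^+ 2 + eta x ^+ 2 = 1) ->
  (forall i x, xi x * dxi i x + eta x * deta i x = 0) ->
  measurable_fun setT k -> (forall x, 0 <= k x <= 1) ->
  (forall x, \sum_i (dxi i x ^+ 2 + deta i x ^+ 2) <= K * k x) ->
  (forall x, k x = 0 -> xi x = 0 \/ eta x = 0) -> (forall x, k x = 0 \/ k x = 1) ->
  DD (fun x => xi x * u x) (fun i x => dxi i x * u x + xi x * g i x) +
  DD (fun x => eta x * u x) (fun i x => deta i x * u x + eta x * g i x) +
  pi * (xln (mass u) - xln (mass (fun x => xi x * u x)) - xln (mass (fun x => eta x * u x)))
  <= DD u g + (K + pi * ln 2) * J mu (fun x => u x ^+ 2 * k x).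
Proof.
move=> ug cx ce xe1 xe0 mk k01 hK k0 kk.
have cu := C1c_Cc ug; have cg i := C1c_Ccd i ug; have su := C1c_Sq ug.
have [cxi cdxi _] := cx; have [ceta cdeta _] := ce.
have ik := Int_cut su mk k01.
have Cx : Cc (fun x => xi x * u x) by exact: CcMr.
have Ce : Cc (fun x => eta x * u x) by exact: CcMr.
have M : mass (fun x => xi x * u x) + mass (fun x => eta x * u x) = mass u.
  rewrite /mass -(JD (Cc_Int (CcX 1 Cx)) (Cc_Int (CcX 1 Ce))); apply: J_ext => x.
  by rewrite !exprMn -mulrDl xe1 mul1r.
have En : energy (fun i x => dxi i x * u x + xi x * g i x) +
    energy (fun i x => deta i x * u x + eta x * g i x) <=
    energy g + K * J mu (fun x => u x ^+ 2 * k x).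
  have c1 i : Cc (fun x => dxi i x * u x + xi x * g i x) by apply: CcD; exact: CcMr.
  have c2 i : Cc (fun x => deta i x * u x + eta x * g i x) by apply: CcD; exact: CcMr.
  have i1 i := Cc_Int (CcX 1 (c1 i)); have i2 i := Cc_Int (CcX 1 (c2 i)).
  have i3 i := Cc_Int (CcX 1 (cg i)).
  rewrite /energy -(J_sum i1) -(J_sum i2) -(J_sum i3) -(JZ _ ik).
  have s1 := Int_sum i1; have s2 := Int_sum i2; have s3 := Int_sum i3; have s4 := IntZ K ik.
  rewrite -(JD s1 s2) -(JD s3 s4); apply: J_le => [||x]; [exact: IntD|exact: IntD|].
  have -> : \sum_i (dxi i x * u x + xi x * g i x) ^+ 2 + \sum_i (deta i x * u x + eta x * g i x) ^+ 2
     = \sum_i g i x ^+ 2 + u x ^+ 2 * (\sum_i (dxi i x ^+ 2 + deta i x ^+ 2)).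
    rewrite mulr_sumr -!big_split/=; apply: eq_bigr => i _.
    have : (xi x ^+ 2 + eta x ^+ 2) * g i x ^+ 2 + 2 * u x * g i x * (xi x * dxi i x + eta x * deta i x) = g i x ^+ 2.
      by rewrite xe1 xe0 mulr0 addr0 mul1r.
    by move=> <-; ring.
  by rewrite lerD2l mulrCA ler_wpM2l ?sqr_ge0.
have Ent : entr u <= entr (fun x => xi x * u x) + entr (fun x => eta x * u x)
    + ln 2 * J mu (fun x => u x ^+ 2 * k x).
  have i1 := Cc_Int (Cc_Fl Cx); have i2 := Cc_Int (Cc_Fl Ce); have i3 := IntZ (ln 2) ik.
  have i12 := IntD i1 i2.
  rewrite -(JZ _ ik) -(JD i1 i2) -(JD i12 i3); apply: J_le => [||x].
  - exact: Cc_Int (Cc_Fl cu).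
  - exact: IntD.
  rewrite !FlM; have [b1 _] := neg_entropy_bounds (sqr_ge0 (xi x)) (sqr_ge0 (eta x)) (xe1 x).
  have -> : xi x ^+ 2 * Fl (u x) + Fl (xi x) * u x ^+ 2 + (eta x ^+ 2 * Fl (u x) + Fl (eta x) * u x ^+ 2)
     = (xi x ^+ 2 + eta x ^+ 2) * Fl (u x) + u x ^+ 2 * (Fl (xi x) + Fl (eta x)) by ring.
  rewrite xe1 mul1r -addrA lerDl mulrCA -mulrDr mulr_ge0 ?sqr_ge0//.
  case: (kk x) => [/[dup] kx0 ->|->]; last first.
    by rewrite mulr1; move: b1; rewrite /Fl; move: (xln _) (xln _) (ln _) => a b c; lra.
  have := xe1 x; case: (k0 x kx0) => ->; rewrite expr0n/= ?add0r ?addr0 => e1;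
    by rewrite mulr0 /Fl expr0n/= e1 xln0 /xln ln1 mulr0 !addr0.
rewrite /DD -M; move: En Ent (ler_wpM2l (pi_ge0 R) Ent).
rewrite !mulrDr; generalize (@pi R) => P.
move: (energy _) (energy _) (energy _) (entr _) (entr _) (entr _) (xln _) (xln _) (xln _).
move: (mass _) (mass _) (J _ _) (ln 2) (n%:R : R) => m1 m2 j l2 N e1 e2 e3 f1 f2 f3 x1 x2 x3 h1 h2 h3.
lra.
Qed.

(** Where phi is nonzero, either x is in the slab, which has small mass, or |x i - b i| >= l/2, and
    then gam (x - b) <= (2/l) |x i - b i| gam (x - b), of L^2 norm at most 1/l. *)
Lemma ovl_cut_bound u (phi : 'rV[R]_n -> R) i p l b : Sq mu u -> mass u = 1 -> 0 < l ->
  continuous phi -> (forall x, `|phi x| <= 2) ->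
  (forall x, phi x != 0 -> slab i p l x = 1 \/ l / 2 <= `|x ord0 i - b ord0 i|) ->
  `|ovl (fun x => phi x * u x) b| <= 2 * Num.sqrt (J mu (fun x => u x ^+ 2 * slab i p l x)) + 2 / l.
Proof.
move=> su u1 l0 cphi phi2 hphi.
have s01 x : 0 <= slab i p l x <= 1 by exact: bool01.
have mphi := continuous_measurable_rV cphi.
have sphi : Sq mu (fun x => phi x * u x).
  apply: (Sq_dom _ (SqZ 2 su)); first by apply: measurable_funM => //; exact: su.1.
  by move=> x; rewrite !normrM (ger0_norm (ler0n R 2)) ler_wpM2r.
have sabs (f : 'rV[R]_n -> R) : Sq mu f -> Sq mu (fun x => `|f x|).
  move=> sf; apply: (Sq_dom _ sf); last by move=> x; rewrite normr_id.
  exact: (measurableT_comp (@normr_measurable R setT) sf.1).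
have ss : Sq mu (fun x => u x * slab i p l x).
  apply: (Sq_dom _ su); first by apply: measurable_funM; [exact: su.1|exact: measurable_slab].
  by move=> x; have /andP[a0 a1] := s01 x; rewrite normrM (ger0_norm a0) ler_piMr.
have sxg : Sq mu (fun x : 'rV[R]_n => (x - b) ord0 i * gam (x - b)).
  exact: (@Sq_shift R n (fun x => x ord0 i * gam x) (- b) (@Sq_xgam R n i)).
have sg := Sq_gams b.
have i1 := IntZ 2 (Int_mul (sabs _ ss) sg).
have i2 := IntZ (4 / l) (Int_mul (sabs _ su) (sabs _ sxg)).
apply: le_trans (J_abs (Int_ovl b sphi)) _.
apply: (@le_trans _ _ (J mu (fun x => 2 * (`|u x * slab i p l x| * gam (x - b)) +
    4 / l * (`|u x| * `|(x - b) ord0 i * gam (x - b)|)))).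
  apply: J_le => [||x]; [exact: Int_abs (Int_ovl b sphi)|exact: IntD|].
  have g0 := gam_gt0 (x - b); have G0 := ltW g0; have l4 : 0 <= 4 / l by rewrite divr_ge0// ltW.
  have A1 : 0 <= `|u x| * `|slab i p l x| * gam (x - b) by rewrite mulr_ge0// mulr_ge0.
  have A2 : 0 <= `|u x| * (`|(x - b) ord0 i| * gam (x - b)) by rewrite mulr_ge0// mulr_ge0.
  rewrite !normrM !(gtr0_norm g0).
  have [ph0|ph0] := eqVneq (phi x) 0.
    by rewrite ph0 normr0 !mul0r; apply: addr_ge0; rewrite mulr_ge0.
  case: (hphi x ph0) => h.
    apply: (@le_trans _ _ (2 * (`|u x| * `|slab i p l x| * gam (x - b)))).
      by rewrite h normr1 mulr1 -mulrA ler_wpM2r// mulr_ge0.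
    by rewrite lerDl mulr_ge0.
  apply: (@le_trans _ _ (4 / l * (`|u x| * (`|(x - b) ord0 i| * gam (x - b))))); last first.
    by rewrite lerDr mulr_ge0.
  have -> : (x - b) ord0 i = x ord0 i - b ord0 i by rewrite !mxE.
  have ug0 : 0 <= `|u x| * gam (x - b) by rewrite mulr_ge0.
  have -> : 4 / l * (`|u x| * (`|x ord0 i - b ord0 i| * gam (x - b))) =
      4 / l * `|x ord0 i - b ord0 i| * (`|u x| * gam (x - b)) by ring.
  rewrite -mulrA; apply: ler_wpM2r => //.
  apply: le_trans (phi2 x) _; rewrite mulrAC ler_pdivlMr//.
  by move: h; move: (`|_ - _|) => z h; lra.
rewrite (JD i1 i2) (JZ _ (Int_mul (sabs _ ss) sg)) (JZ _ (Int_mul (sabs _ su) (sabs _ sxg))).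
apply: lerD.
  rewrite ler_wpM2l//; apply: le_trans (ler_norm _) _.
  apply: le_trans (J_mul_le (sabs _ ss) sg) _.
  rewrite /nrm -/(mass (fun x => gam (x - b))) mass_gams sqrtr1 mulr1 le_eqVlt; apply/orP; left.
  apply/eqP; congr Num.sqrt; apply: J_ext => x.
  by rewrite real_normK ?num_real// exprMn /slab; case: (_ && _); rewrite ?expr1n// expr0n.
have h1 : J mu (fun x => `|u x| * `|(x - b) ord0 i * gam (x - b)|) <= 2^-1.
  apply: le_trans (ler_norm _) _; apply: le_trans (J_mul_le (sabs _ su) (sabs _ sxg)) _.
  rewrite /nrm (@J_ext _ _ _ mu _ (fun x => u x ^+ 2)) => [|x]; last by rewrite real_normK ?num_real.
  rewrite -/(mass u) u1 sqrtr1 mul1r.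
  rewrite (@J_ext _ _ _ mu _ (fun x : 'rV[R]_n => (fun y : 'rV[R]_n => y ord0 i ^+ 2 * W y) (x - b))) => [|x].
    rewrite (J_shift (- b) (J_xW R i).1) (J_xW R i).2.
    rewrite -[2^-1]ger0_norm ?invr_ge0// -sqrtr_sqr ler_sqrt ?sqr_ge0//.
    rewrite expr2 invfM; have := pi_ge2 R => p2.
    by rewrite ler_pM2l ?invr_gt0// lef_pV2 ?posrE// pi_gt0.
  by rewrite real_normK ?num_real// exprMn gam_sq.
apply: le_trans (ler_wpM2l _ h1) _; first by rewrite divr_ge0// ltW.
by rewrite mulrAC (_ : 4 * 2^-1 = 2)//; field.
Qed.

(** For each centre b either 1 - chi or chi is almost invisible to the Gaussian at b, so the overlap
    of chi u is close to that of u or to 0. Squaring costs 2 r d + d^2 <= 3 d. *)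
Lemma ov2_cut_bound u (chi : 'rV[R]_n -> R) i p l d : Sq mu u -> mass u = 1 -> 0 < l ->
  continuous chi -> (forall x, `|chi x| <= 1) ->
  (forall b, (forall x, 1 - chi x != 0 -> slab i p l x = 1 \/ l / 2 <= `|x ord0 i - b ord0 i|) \/
    (forall x, chi x != 0 -> slab i p l x = 1 \/ l / 2 <= `|x ord0 i - b ord0 i|)) ->
  2 * Num.sqrt (J mu (fun x => u x ^+ 2 * slab i p l x)) + 2 / l <= d -> d <= 1 ->
  ov2 (fun x => chi x * u x) <= ov2 u + 3 * d.
Proof.
move=> su u1 l0 cc c1 hb hd d1.
have schi : Sq mu (fun x => chi x * u x).
  apply: (Sq_dom _ su); first by apply: measurable_funM; [exact: continuous_measurable_rV|exact: su.1].
  by move=> x; rewrite normrM ler_piMl.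
have d0 : 0 <= d by apply: le_trans hd; rewrite addr_ge0 ?mulr_ge0 ?sqrtr_ge0 ?invr_ge0 ?(ltW l0).
have o0 := ov2_ge0 su; have o1 : ov2 u <= 1 by apply: ov2_le => // b; rewrite -u1; exact: ovl_sq.
pose r := Num.sqrt (ov2 u); have r0 : 0 <= r by exact: sqrtr_ge0.
have r2 : r ^+ 2 = ov2 u by rewrite sqr_sqrtr.
have r1 : r <= 1 by rewrite -sqrtr1 ler_sqrt.
apply: ov2_le => // b.
have ub : `|ovl u b| <= r by rewrite -sqrtr_sqr ler_sqrt//; exact: ov2_ge.
have : `|ovl (fun x => chi x * u x) b| <= r + d.
  case: (hb b) => h; last first.
    apply: le_trans (ovl_cut_bound su u1 l0 cc _ h) _; first by move=> x; have := c1 x; lra.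
    by apply: le_trans hd _; rewrite lerDr.
  have c1c : continuous (fun x => 1 - chi x) by apply: ctsB => //; exact: cts_cst.
  have b1 := ovl_cut_bound su u1 l0 c1c (_ : forall x, _ <= 2) h.
  have {}b1 := b1 (fun x => le_trans (ler_normB 1 (chi x)) _).
  have {}b1 := b1 (fun x => _ : `|1| + `|chi x| <= 2).
  have : `|ovl (fun x => (1 - chi x) * u x) b| <= d.
    apply: le_trans (b1 _) hd => x; rewrite normr1; have := c1 x; lra.
  have -> : ovl (fun x => chi x * u x) b = ovl u b - ovl (fun x => (1 - chi x) * u x) b.
    rewrite -ovlB//.
      by congr (ovl _ b); apply/funext => x; ring.
    rewrite (_ : (fun x => _) = (fun x => u x - chi x * u x)); first exact: SqB.
    by apply/funext => x; ring.
  by move=> h'; apply: le_trans (ler_normB _ _) _; exact: lerD.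
move=> h; rewrite -(real_normK (num_real (ovl _ _))).
apply: (@le_trans _ _ ((r + d) ^+ 2)); first by rewrite ler_pXn2r ?nnegrE ?addr_ge0.
rewrite sqrrD r2 -addrA lerD2l mulr2n.
have : r * d <= d by rewrite ler_piMl.
have : d ^+ 2 <= d by rewrite expr2 ler_piMl.
by move: (r * d) (d ^+ 2) => x y; lra.
Qed.

Lemma C1cMl u g (k : 'rV[R]_n -> R) dk : C1c u g -> C1 k dk ->
  C1c (fun x => k x * u x) (fun i x => dk i x * u x + k x * g i x).
Proof.
move=> ug ck; apply: C1c_ext (C1cM ug ck) => [x|i x]; first by rewrite mulrC.
by rewrite addrC mulrC (mulrC (g i x)).
Qed.

(** The lighter half is bounded by its mass, the heavier one by the overlap of u up to 12 s. *)
Let omin_arith (o ox oy a b s : R) : ox <= a -> oy <= b -> ox <= o + 3 * (4 * s) ->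
  oy <= o + 3 * (4 * s) -> ox + oy <= o + Num.min a b + 12 * s.
Proof. by case: (leP a b) => _ h1 h2 h3 h4; lra. Qed.

(** Adding the inequalities q d2 <= DD for the two halves and comparing with near-optimality of u
    leaves (2 P l2 - q) m bounded by a multiple of s; the factor 12 q + 17 + P l2 collects the
    errors. *)
Let dichotomy_arith (q P l2 a b m s o ox oy e D Dx Dy sm xa xb : R) :
  0 <= q -> 0 <= l2 -> 0 <= P -> 0 <= a -> 0 <= b -> a + b = 1 ->
  xa + xb <= - (2 * l2 * m) -> ox + oy <= o + m + 12 * s ->
  Dx + Dy + P * (- xa - xb) <= D + (16 * s ^+ 2 + P * l2) * sm ->
  D <= q * (1 - o) + s ^+ 2 -> q * (a - ox) <= Dx -> q * (b - oy) <= Dy ->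
  s ^+ 2 <= s * 4^-1 -> 0 <= sm -> sm <= s ^+ 2 ->
  s * (12 * q + 17 + P * l2) <= (2 * P * l2 - q) * e ->
  (2 * P * l2 - q) * m <= (2 * P * l2 - q) * e.
Proof.
move=> q0 l0 P0 a0 b0 ab h1 h2 h3 h4 h5 h6 ss sm0 sms h7; apply: le_trans h7.
have s2 := sqr_ge0 s.
have g1 : P * (xa + xb) <= P * - (2 * l2 * m) by rewrite ler_wpM2l.
have g2 : q * (ox + oy) <= q * (o + m + 12 * s) by rewrite ler_wpM2l.
have sb : s ^+ 2 <= 4^-1 * 4^-1.
  have s0 : 0 <= s by lra.
  have [s4|s4] := leP s 4^-1; first by rewrite expr2 ler_pM.
  have : s * (s - 4^-1) <= 0 by move: ss; rewrite expr2; lra.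
  by rewrite pmulr_rle0; lra.
have g3 : (16 * s ^+ 2 + P * l2) * sm <= (1 + P * l2) * s ^+ 2.
  apply: ler_pM; [|exact: sm0|lra|exact: sms].
  by apply: addr_ge0; apply: mulr_ge0.
have g4 : P * l2 * s ^+ 2 <= P * l2 * (s * 4^-1) by rewrite ler_wpM2l// mulr_ge0.
have Pl : 0 <= P * l2 * s by rewrite !mulr_ge0//; lra.
have bE : b = 1 - a by lra.
move: g1 g2 g3 g4 h3 h4 h5 h6 ss s2 Pl; rewrite bE; clear; move: (s ^+ 2) => S g1 g2 g3 g4 h3 h4 h5 h6 ss s2 Pl; lra.
Qed.

(* With too little mass on a slab, splitting there would make u nearly optimal
   for both halves, and gain the mixing entropy 2 pi ln 2 min(a, b). *)
Lemma dichotomy (q e : R) : 0 <= q -> q < 2 * pi * ln 2 -> 0 < e ->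
  (forall w h, C1c w h -> q * d2 w <= DD w h) ->
  exists2 s : R, 0 < s & forall u g i p, C1c u g -> mass u = 1 -> DD u g <= q * d2 u + s ^+ 2 ->
  J mu (fun x => u x ^+ 2 * slab i p s^-1 x) <= s ^+ 2 ->
  J mu (fun x => u x ^+ 2 * lowS i p x) <= e \/
  J mu (fun x => u x ^+ 2 * upS i (p + s^-1) x) <= e.
Proof.
move=> q0 qQ e0 Hq; pose k := 2 * pi * ln 2 - q; have k0 : 0 < k by rewrite subr_gt0.
have l20 : 0 <= ln (2 : R) by rewrite ln_ge0//; lra.
pose K := 12 * q + 17 + pi * ln 2.
have K0 : 0 < K by rewrite /K; have := mulr_ge0 (pi_ge0 R) l20; lra.
(* The slab has width 1/s and mass at most s^2, so all errors are O(s). The bound 1/4 keeps the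
   overlap error 4 s below 1, and s K <= k e concludes. *)
pose s := Num.min (4^-1) (k * e / K).
have s0 : 0 < s.
  by rewrite lt_min; apply/andP; split; [lra|rewrite divr_gt0// mulr_gt0].
have s1 : s <= 4^-1 by rewrite ge_min lexx.
have sK : s * K <= k * e by rewrite -ler_pdivlMr// ge_min lexx orbT.
exists s => // u g i p ug u1 DDu sl; pose l := s^-1.
have l0 : 0 < l by rewrite invr_gt0.
have su := C1c_Sq ug.
pose xi (x : 'rV[R]_n) : R := cos (angle p l (x ord0 i)).
pose eta (x : 'rV[R]_n) : R := sin (angle p l (x ord0 i)).
pose dxi (j : 'I_n) (x : 'rV[R]_n) : R := - sin (angle p l (x ord0 i)) * dangle p l (x ord0 i) * (j == i)%:R.
pose deta (j : 'I_n) (x : 'rV[R]_n) : R := cos (angle p l (x ord0 i)) * dangle p l (x ord0 i) * (j == i)%:R.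
have cang : continuous (angle p l) by exact: is_derive_cts (is_derive_angle p l).
have cx : C1 xi dxi.
  have := @C1_comp R n (fun s => cos (angle p l s)) (fun s => - sin (angle p l s) * dangle p l s) _ _ _ _ (C1_coord R i).
  apply => [z|].
    exact: (@dcomp R cos (angle p l) z _ _ (is_derive_cos _) (is_derive_angle p l z)).
  apply: ctsM; last exact: cts_dangle.
  by apply: ctsN; apply: (cts_comp (@continuous_sin R)).
have ce : C1 eta deta.
  have := @C1_comp R n (fun s => sin (angle p l s)) (fun s => cos (angle p l s) * dangle p l s) _ _ _ _ (C1_coord R i).
  apply => [z|].
    exact: (@dcomp R sin (angle p l) z _ _ (is_derive_sin _) (is_derive_angle p l z)).
  apply: ctsM; last exact: cts_dangle.
  by apply: (cts_comp (@continuous_cos R)).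
have xe x : xi x ^+ 2 + eta x ^+ 2 = 1 by exact: cos2Dsin2.
have xilow (x : 'rV[R]_n) : x ord0 i <= p -> xi x = 1 /\ eta x = 0.
  by move=> h; rewrite /xi /eta angle_le// cos0 sin0.
have xiup (x : 'rV[R]_n) : p + l <= x ord0 i -> xi x = 0 /\ eta x = 1.
  by move=> h; rewrite /xi /eta angle_ge// cos_pihalf sin_pihalf.
have slabP (x : 'rV[R]_n) : [\/ x ord0 i <= p, slab i p l x = 1 | p + l <= x ord0 i].
  rewrite /slab; case: (leP (x ord0 i) p) => h1; first by constructor 1.
  by case: (ltP (x ord0 i) (p + l)) => h2; [constructor 2|constructor 3].
have slab0 (x : 'rV[R]_n) : slab i p l x = 0 -> x ord0 i <= p \/ p + l <= x ord0 i.
  move=> h0; case: (slabP x) => h; [by left| |by right].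
  by move: h; rewrite h0 => /eqP; rewrite eq_sym oner_eq0.
set sm := J mu (fun x => u x ^+ 2 * slab i p l x) in sl.
have xe0 j x : xi x * dxi j x + eta x * deta j x = 0.
  by rewrite /xi /eta /dxi /deta; ring.
have hK x : \sum_j (dxi j x ^+ 2 + deta j x ^+ 2) <= 16 / l ^+ 2 * slab i p l x.
  rewrite (bigD1 i)//= big1 ?addr0 => [|j ji]; last first.
    by rewrite /dxi /deta (negPf ji) !mulr0 expr0n addr0.
  have -> : dxi i x ^+ 2 + deta i x ^+ 2 = dangle p l (x ord0 i) ^+ 2.
    by rewrite /dxi /deta eqxx !mulr1 !exprMn sqrrN -mulrDl sin2cos2 subrK mul1r.
  have [k1|k0'] : slab i p l x = 1 \/ slab i p l x = 0 by rewrite /slab; case: (_ && _); [left|right].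
    by rewrite k1 mulr1 dangle_sq.
  by rewrite k0' mulr0 dangle_out ?expr0n//; exact: slab0.
have hz x : slab i p l x = 0 -> xi x = 0 \/ eta x = 0.
  by move=> /slab0[/xilow[]|/xiup[]]; [right|left].
have h01 x : slab i p l x = 0 \/ slab i p l x = 1.
  by rewrite /slab; case: (_ && _); [right|left].
have split := split_DD ug cx ce xe xe0 (measurable_slab i p l) (fun x => bool01 _) hK hz h01.
rewrite -/sm in split.
have xi1 x : `|xi x| <= 1.
  rewrite -(@ler_pXn2r _ 2)// ?nnegrE// expr1n real_normK ?num_real//.
  by have := xe x; have := sqr_ge0 (eta x); lra.
have eta1 x : `|eta x| <= 1.
  rewrite -(@ler_pXn2r _ 2)// ?nnegrE// expr1n real_normK ?num_real//.
  by have := xe x; have := sqr_ge0 (xi x); lra.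
have hd : 2 * Num.sqrt sm + 2 / l <= 4 * s.
  have : Num.sqrt sm <= s by rewrite -(ger0_norm (ltW s0)) -sqrtr_sqr ler_sqrt ?sqr_ge0.
  by rewrite /l invrK; lra.
have d1 : 4 * s <= 1 by lra.
(* A centre below the middle of the slab is at distance at least l/2 from everything beyond the
   slab; [far'] is the mirror case. *)
have far (x b : 'rV[R]_n) : b ord0 i <= p + l / 2 -> p < x ord0 i -> slab i p l x = 1 \/ l / 2 <= `|x ord0 i - b ord0 i|.
  move=> h1 h2; case: (slabP x) => h; [by move: h2; rewrite ltNge h|by left|right].
  by rewrite (le_trans _ (ler_norm _))//; lra.
have far' (x b : 'rV[R]_n) : p + l / 2 <= b ord0 i -> x ord0 i < p + l -> slab i p l x = 1 \/ l / 2 <= `|x ord0 i - b ord0 i|.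
  move=> h1 h2; case: (slabP x) => h; [right|by left|by move: h2; rewrite ltNge h].
  by rewrite distrC (le_trans _ (ler_norm _))//; lra.
have oxi : ov2 (fun x => xi x * u x) <= ov2 u + 3 * (4 * s).
  apply: (ov2_cut_bound su u1 l0 _ xi1 _ hd d1); first by case: cx.
  move=> b; have [h|h] := leP (b ord0 i) (p + l / 2); [left|right] => x hx.
    by apply: far => //; rewrite ltNge; apply/negP => /xilow[e1 _]; move: hx; rewrite e1 subrr eqxx.
  by apply: far' (ltW h) _; rewrite ltNge; apply/negP => /xiup[e1 _]; move: hx; rewrite e1 eqxx.
have oeta : ov2 (fun x => eta x * u x) <= ov2 u + 3 * (4 * s).
  apply: (ov2_cut_bound su u1 l0 _ eta1 _ hd d1); first by case: ce.
  move=> b; have [h|h] := leP (b ord0 i) (p + l / 2); [right|left] => x hx.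
    by apply: far => //; rewrite ltNge; apply/negP => /xilow[_ e1]; move: hx; rewrite e1 eqxx.
  by apply: far' (ltW h) _; rewrite ltNge; apply/negP => /xiup[_ e1]; move: hx; rewrite e1 subrr eqxx.
have Cx := C1cMl ug cx; have Ce := C1cMl ug ce.
have Dx := Hq _ _ Cx; have De := Hq _ _ Ce.
set a := mass (fun x => xi x * u x) in split; set b := mass (fun x => eta x * u x) in split.
have ab : a + b = 1.
  rewrite -u1 /a /b /mass -(JD (C1c_Sq Cx).2 (C1c_Sq Ce).2); apply: J_ext => x.
  by rewrite !exprMn -mulrDl xe mul1r.
have a0 : 0 <= a by exact: mass_ge0.
have b0 : 0 <= b by exact: mass_ge0.
have [_ hab] := neg_entropy_bounds a0 b0 ab.
have oa := d2_ge0 (C1c_Sq Cx); have ob := d2_ge0 (C1c_Sq Ce).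
have mink : Num.min a b <= e.
  have omin : ov2 (fun x => xi x * u x) + ov2 (fun x => eta x * u x) <= ov2 u + Num.min a b + 12 * s.
    rewrite /d2 -/a subr_ge0 in oa; rewrite /d2 -/b subr_ge0 in ob.
    exact: omin_arith oa ob oxi oeta.
  have l16 : 16 / l ^+ 2 = 16 * s ^+ 2 by rewrite /l exprVn invrK.
  rewrite l16 u1 /xln ln1 mulr0 sub0r -/(xln a) -/(xln b) in split.
  rewrite /d2 u1 in DDu; rewrite /d2 -/a in Dx; rewrite /d2 -/b in De.
  have ss : s ^+ 2 <= s * 4^-1 by rewrite expr2 ler_wpM2l// ltW.
  have sm0 : 0 <= sm.
    by apply: J_ge0 => x; rewrite mulr_ge0 ?sqr_ge0//; have /andP[] := bool01 ((p < x ord0 i) && (x ord0 i < p + l)).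
  rewrite -(ler_pM2l k0).
  apply: (dichotomy_arith q0 l20 (pi_ge0 R) a0 b0 ab hab omin split DDu Dx De ss sm0 sl sK).
have la : J mu (fun x => u x ^+ 2 * lowS i p x) <= a.
  apply: J_le => [||x]; [apply: Int_cut => //; [exact: measurable_lowS|by move=> x; exact: bool01]|exact: (C1c_Sq Cx).2|].
  rewrite /lowS exprMn; case: (leP (x ord0 i) p) => h /=; last by rewrite mulr0; apply: mulr_ge0; exact: sqr_ge0.
  by rewrite (xilow x h).1 expr1n mul1r mulr1.
have lb : J mu (fun x => u x ^+ 2 * upS i (p + l) x) <= b.
  apply: J_le => [||x]; [apply: Int_cut => //; [exact: measurable_upS|by move=> x; exact: bool01]|exact: (C1c_Sq Ce).2|].
  rewrite /upS exprMn; case: (leP (p + l) (x ord0 i)) => h /=; last by rewrite mulr0; apply: mulr_ge0; exact: sqr_ge0.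
  by rewrite (xiup x h).2 expr1n mul1r mulr1.
by move: mink; rewrite ge_min => /orP[h|h]; [left|right]; [exact: le_trans la h|exact: le_trans lb h].
Qed.

End splitting.

(** * Tightness up to translation *)

Section tightness.
Context (R : realType) (n : nat).
Local Notation mu := (lebesgue_rV R n).
Implicit Types (u v : 'rV[R]_n -> R) (g h : 'I_n -> 'rV[R]_n -> R) (b : 'rV[R]_n).
Implicit Types (p l z : R) (i : 'I_n) (k K : nat).

Definition lowM u i p : R := J mu (fun x => u x ^+ 2 * lowS i p x).
Definition upM u i p : R := J mu (fun x => u x ^+ 2 * upS i p x).

Lemma Int_low u i p : Sq mu u -> Int mu (fun x => u x ^+ 2 * lowS i p x).
Proof. by move=> su; apply: Int_cut => //; [exact: measurable_lowS|move=> x; exact: bool01]. Qed.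

Lemma Int_up u i p : Sq mu u -> Int mu (fun x => u x ^+ 2 * upS i p x).
Proof. by move=> su; apply: Int_cut => //; [exact: measurable_upS|move=> x; exact: bool01]. Qed.

Lemma Int_slab u i p l : Sq mu u -> Int mu (fun x => u x ^+ 2 * slab i p l x).
Proof. by move=> su; apply: Int_cut => //; [exact: measurable_slab|move=> x; exact: bool01]. Qed.

Lemma lowM_mono u i p p' : Sq mu u -> p <= p' -> lowM u i p <= lowM u i p'.
Proof.
move=> su pp; apply: J_le => [||x]; [exact: Int_low|exact: Int_low|].
rewrite ler_wpM2l ?sqr_ge0// /lowS; case: (leP (x ord0 i) p) => h /=.
  by rewrite (le_trans h pp).
by have /andP[] := @bool01 R (x ord0 i <= p').
Qed.

Lemma upM_mono u i p p' : Sq mu u -> p <= p' -> upM u i p' <= upM u i p.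
Proof.
move=> su pp; apply: J_le => [||x]; [exact: Int_up|exact: Int_up|].
rewrite ler_wpM2l ?sqr_ge0// /upS; case: (leP p' (x ord0 i)) => h /=.
  by rewrite (le_trans pp h).
by have /andP[] := @bool01 R (p <= x ord0 i).
Qed.

Lemma lowM_upM u i p : Sq mu u -> mass u <= lowM u i p + upM u i p.
Proof.
move=> su; rewrite -(JD (Int_low i p su) (Int_up i p su)); apply: J_le => [||x].
- exact: su.2.
- by apply: IntD; [exact: Int_low|exact: Int_up].
rewrite -mulrDr -[leLHS]mulr1 ler_wpM2l ?sqr_ge0// /lowS /upS.
by case: (leP (x ord0 i) p) => h /=; [rewrite lerDl ler0n|rewrite (ltW h) add0r].
Qed.

Lemma sum_slabs i p l K (x : 'rV[R]_n) : 0 <= l ->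
  \sum_(k < K) slab i (p + k%:R * l) l x <= (x ord0 i < p + K%:R * l)%R%:R.
Proof.
move=> l0; elim: K => [|K IH]; first by rewrite big_ord0.
rewrite big_ord_recr/= -natr1 mulrDl mul1r addrA.
rewrite /slab in IH *; case: (ltP (p + K%:R * l) (x ord0 i)) => h1 /=.
  rewrite -[leRHS]add0r; apply: lerD => //; apply: le_trans IH _.
  by rewrite ltNge (ltW h1).
rewrite addr0; apply: le_trans IH _; case: (ltP (x ord0 i) (p + K%:R * l)) => h2 /=.
  by rewrite (lt_le_trans h2)// lerDl.
exact: ler0n.
Qed.

(** Pigeonhole: K disjoint slabs share a total mass 1 < K s. *)
Lemma light_slab u i p l (s : R) K : Sq mu u -> mass u = 1 -> 0 <= l -> 1 < K%:R * s ->
  exists2 k : nat, (k < K)%N & J mu (fun x => u x ^+ 2 * slab i (p + k%:R * l) l x) <= s.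
Proof.
move=> su u1 l0 Ks; apply: contrapT => H.
have hk (k : 'I_K) : s <= J mu (fun x => u x ^+ 2 * slab i (p + k%:R * l) l x).
  by rewrite leNgt; apply/negP => h; apply: H; exists k => //; exact: ltW.
have : K%:R * s <= 1.
  have : \sum_(k < K) s <= \sum_(k < K) J mu (fun x => u x ^+ 2 * slab i (p + k%:R * l) l x).
    by apply: ler_sum => k _; exact: hk.
  rewrite sumr_const card_ord mulr_natl => /le_trans; apply.
  have ii (k : 'I_K) := @Int_slab u i (p + k%:R * l) l su.
  rewrite -(J_sum ii); apply: (@le_trans _ _ (mass u)); last by rewrite u1.
  apply: J_le => [||x]; [exact: (Int_sum ii)|exact: su.2|].
  rewrite -mulr_sumr ler_piMr ?sqr_ge0//; apply: le_trans (sum_slabs _ _ _ _ l0) _.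
  by have /andP[] := @bool01 R (x ord0 i < p + K%:R * l).
by rewrite leNgt Ks.
Qed.

(** The supremum of the set [S] is approached only to within 1, whence an approximate median given
    as a pair z, z + 1. *)
Lemma median u i : Cc u -> mass u = 1 -> exists z, lowM u i z <= 2^-1 /\ 2^-1 < lowM u i (z + 1).
Proof.
move=> cu u1; have su := Cc_Sq cu; have [M M0 hM] := bsupp_pos cu.2.
pose S : set R := [set z | lowM u i z <= 2^-1].
have S0 : S (- M - 1).
  rewrite /S/= /lowM (@J_ext _ _ _ mu _ (fun=> 0)) ?J0 ?invr_ge0// => x.
  rewrite /lowS; case: (leP (x ord0 i) (- M - 1)) => h /=; last by rewrite mulr0.
  rewrite hM ?expr0n ?mul0r//; apply: lt_le_trans (coord_le_norm x i).
  by rewrite ltr_normr; apply/orP; right; lra.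
have Sub : has_sup S.
  split; first by exists (- M - 1).
  exists M => z; rewrite /S/= leNgt => h; rewrite leNgt; apply/negP => Mz; move/negP: h; apply.
  rewrite /lowM (@J_ext _ _ _ mu _ (fun x => u x ^+ 2)) -?/(mass u) ?u1; first by lra.
  move=> x; rewrite /lowS; case: (leP (x ord0 i) z) => h /=; first by rewrite mulr1.
  rewrite hM ?expr0n ?mul0r//; apply: lt_le_trans (coord_le_norm x i).
  by rewrite ltr_normr; apply/orP; left; lra.
have [z Sz zs] : exists2 z, S z & sup S - 1 < z.
  by apply: (sup_gt Sub.1); lra.
exists z; split => //; rewrite ltNge; apply/negP => h.
have : z + 1 <= sup S by apply: ub_le_sup => //; exact: Sub.2.
by lra.
Qed.

(** In each coordinate there is a light slab below z and another above z + 1. By [dichotomy] one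
    side of each is almost empty, and it must be the outer side, because z and z + 1 enclose a
    median. *)
Lemma tightness (q e : R) : 0 <= q -> q < 2 * pi * ln 2 -> 0 < e ->
  (forall (w : 'rV[R]_n -> R) h, C1c w h -> q * d2 w <= DD w h) ->
  exists s M : R, 0 < s /\ forall u g, C1c u g -> mass u = 1 -> DD u g <= q * d2 u + s ^+ 2 ->
  exists z : 'rV[R]_n, mass (fun x => u (x + z) * out M x) <= e.
Proof.
(* Each coordinate loses at most 2 d, in total 2 n d <= e; d <= 1/4 is what contradicts the median
   if the inner side were the empty one. *)
move=> q0 qQ e0 Hq; pose d := Num.min (4^-1) (e / (2 * n%:R + 1)).
have n0 : 0 < 2 * n%:R + 1 :> R by rewrite ltr_wpDl// mulr_ge0.
have d0 : 0 < d by rewrite lt_min; apply/andP; split; [lra|exact: divr_gt0].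
have d4 : d <= 4^-1 by rewrite ge_min lexx.
have de : d * (2 * n%:R + 1) <= e by rewrite -ler_pdivlMr// ge_min lexx orbT.
have [s s0 hs] := dichotomy q0 qQ d0 Hq.
have s2 : 0 < s ^+ 2 by exact: exprn_gt0.
pose K := Num.bound (s ^+ 2)^-1; have Ks : 1 < K%:R * s ^+ 2.
  by rewrite -ltr_pdivrMr// mul1r /K archi_boundP// invr_ge0 ltW.
pose l := s^-1; have l0 : 0 < l by rewrite invr_gt0.
have Kl : 0 <= K%:R * l by rewrite mulr_ge0// ltW.
exists s, (1 + K%:R * l); split => // u g ug u1 DDu; have su := C1c_Sq ug.
have key i : exists z, lowM u i (z - K%:R * l) <= d /\ upM u i (z + 1 + K%:R * l) <= d.
  have [z [z1 z2]] := median i (C1c_Cc ug) u1; exists z; split.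
    have [k kK hk] := light_slab i (z - K%:R * l) su u1 (ltW l0) Ks.
    have kl : k%:R * l <= K%:R * l by rewrite ler_wpM2r ?(ltW l0)// ler_nat ltnW.
    have kl1 : (k.+1)%:R * l <= K%:R * l by rewrite ler_wpM2r ?(ltW l0)// ler_nat.
    have k0 : 0 <= k%:R * l by rewrite mulr_ge0// ltW.
    case: (hs _ _ _ _ ug u1 DDu hk) => h.
      by apply: le_trans h; apply: lowM_mono => //; rewrite lerDl.
    have : upM u i z <= d.
      apply: le_trans h; apply: upM_mono => //; rewrite -/l.
      by move: kl1; rewrite -natr1 mulrDl mul1r; move: (k%:R * l) (K%:R * l) => a b; lra.
    by have := lowM_upM i z su; rewrite u1; lra.
  have [k kK hk] := light_slab i (z + 1) su u1 (ltW l0) Ks.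
  have kl1 : (k.+1)%:R * l <= K%:R * l by rewrite ler_wpM2r ?(ltW l0)// ler_nat.
  have k0 : 0 <= k%:R * l by rewrite mulr_ge0// ltW.
  case: (hs _ _ _ _ ug u1 DDu hk) => h.
    have : lowM u i (z + 1) <= d by apply: le_trans h; apply: lowM_mono => //; rewrite lerDl.
    by lra.
  apply: le_trans h; apply: upM_mono => //; rewrite -/l.
  by move: kl1; rewrite -natr1 mulrDl mul1r; move: (k%:R * l) (K%:R * l) => a b; lra.
have [zf hz] := choice key; pose z : 'rV[R]_n := \row_i zf i; exists z.
(* Outside the ball in the sup norm some coordinate leaves its window, so the sum of the [c i] is at
   least 1 there. *)
pose c i x := lowS i (zf i - K%:R * l) x + upS i (zf i + 1 + K%:R * l) x.
have ic i : Int mu (fun x => u x ^+ 2 * c i x).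
  have := IntD (Int_low i (zf i - K%:R * l) su) (Int_up i (zf i + 1 + K%:R * l) su).
  by apply: Int_ext => x; rewrite mulrDr.
have Jc i : J mu (fun x => u x ^+ 2 * c i x) <= d + d.
  rewrite (@J_ext _ _ _ mu _ (fun x => u x ^+ 2 * lowS i (zf i - K%:R * l) x +
    u x ^+ 2 * upS i (zf i + 1 + K%:R * l) x)); last by move=> x; rewrite mulrDr.
  rewrite (JD (Int_low i _ su) (Int_up i _ su)); have [h1 h2] := hz i.
  exact: lerD h1 h2.
have c0 i x : 0 <= c i x by rewrite addr_ge0// ler0n.
apply: (@le_trans _ _ (J mu (fun x => \sum_i (u x ^+ 2 * c i x)))).
  rewrite -(J_shift z (Int_sum ic)); apply: J_le => [||x].
  - exact: (Sq_out _ (Sq_shift z su)).2.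
  - exact: (Int_shift z (Int_sum ic)).
  rewrite exprMn out_sq -mulr_sumr ler_wpM2l ?sqr_ge0//.
  have [xM|xM] := leP `|x| (1 + K%:R * l).
    by rewrite out0//; apply: sumr_ge0 => i _; exact: c0.
  have [i hi] : exists i, 1 + K%:R * l < `|x ord0 i|.
    apply: contrapT => H; move: xM; rewrite ltNge => /negP; apply.
    apply: norm_le_coord => [|i]; first by lra.
    by rewrite leNgt; apply/negP => h; apply: H; exists i.
  rewrite (bigD1 i)//=; apply: le_trans (_ : 1 <= _).
    by have /andP[] := out01 (1 + K%:R * l) x.
  rewrite -[leLHS]addr0; apply: lerD; last by apply: sumr_ge0 => j _; exact: c0.
  rewrite /c /lowS /upS !mxE; move: hi; rewrite ltr_normr => /orP[h|h].
    rewrite (_ : zf i + 1 + K%:R * l <= x ord0 i + zf i); last by lra.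
    by rewrite lerDr ler0n.
  rewrite (_ : x ord0 i + zf i <= zf i - K%:R * l); last by lra.
  by rewrite lerDl ler0n.
rewrite (J_sum ic); apply: (@le_trans _ _ (\sum_(i < n) (d + d))).
  by apply: ler_sum => i _; exact: Jc.
rewrite sumr_const card_ord -mulr_natl; apply: le_trans de.
by rewrite -subr_ge0 (_ : _ - _ = d); [exact: ltW|ring].
Qed.

End tightness.

(** * Mollification and L^2 translation estimates *)

Section mollification.
Context (R : realType) (n : nat).
Local Notation mu := (lebesgue_rV R n).
Implicit Types (u v rho : 'rV[R]_n -> R) (g h : 'I_n -> 'rV[R]_n -> R).

Definition mollifier rho := [/\ Cc rho, (forall x, 0 <= rho x) & J mu rho = 1].
(** Convolution with the reflected kernel; the form u (x + y) exposes the translates of u. *)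
Definition mol rho u (x : 'rV[R]_n) : R := J mu (fun y => u (x + y) * rho y).

Lemma Sq_shiftl u x : Sq mu u -> Sq mu (fun y => u (x + y)).
Proof.
move=> su; rewrite (_ : (fun y => u (x + y)) = (fun y => u (y + x))); first exact: Sq_shift.
by apply/funext => y; rewrite addrC.
Qed.

Lemma Int_mol rho u x : Cc rho -> Sq mu u -> Int mu (fun y => u (x + y) * rho y).
Proof. by move=> cr su; apply: Int_mul; [exact: Sq_shiftl|exact: Cc_Sq]. Qed.

Lemma molE rho u x : Cc rho -> Sq mu u -> mol rho u x = J mu (fun y => u y * rho (y - x)).
Proof.
move=> cr su; rewrite /mol -(J_shift (- x) (Int_mol x cr su)); apply: J_ext => y.
by rewrite addrCA subrr addr0.
Qed.

(** Uniform continuity on a box of finite measure that, for |x - x'| < 1, contains the supports of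
    both translates up to a common shift. *)
Lemma Cc_equicontinuous rho : Cc rho -> forall e : R, 0 < e -> exists2 d : R, 0 < d &
  forall x x', `|x - x'| < d -> nrm mu (fun y => rho (y - x) - rho (y - x')) <= e.
Proof.
move=> cr e e0; have [M M0 hM] := bsupp_pos cr.2.
pose b : 'rV[R]_n -> R := \1_(@box R n (M + 1)); have ib : Int mu b by exact: Int_box.
pose V := J mu b; have V0 : 0 <= V by apply: J_ge0 => y; rewrite /b indicE ler0n.
pose e' := e / Num.sqrt (V + 1).
have V1 : 0 < Num.sqrt (V + 1) by rewrite sqrtr_gt0 ltr_wpDl.
have e'0 : 0 < e' by exact: divr_gt0.
have [d d0 hd] := Cc_unif (@ball_compact_rV R n) cr e'0.
exists (Num.min d 1); first by rewrite lt_min d0 ltr01.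
move=> x x'; rewrite lt_min => /andP[xd x1].
have s1 : Sq mu (fun y => rho (y - x) - rho (y - x')).
  by apply: SqB; apply: Sq_shift; exact: Cc_Sq.
rewrite -[leRHS]ger0_norm ?(ltW e0)// -sqrtr_sqr /nrm ler_sqrt ?sqr_ge0//.
rewrite -(J_shift x s1.2).
have ib2 := IntZ (e' ^+ 2) ib.
apply: (@le_trans _ _ (J mu (fun y => e' ^+ 2 * b y))).
  apply: J_le => // [|y]; first exact: (Int_shift x s1.2).
  rewrite addrK; have [yM|yM] := leP `|y| (M + 1).
    rewrite /b indic_boxE// mulr1 -(real_normK (num_real (_ - _))).
    rewrite ler_pXn2r ?nnegrE ?(ltW e'0)// ltW//; apply: hd.
    rewrite (_ : y - _ = - (x - x')) ?normrN//.
    by apply/rowP => i; rewrite !mxE; ring.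
  rewrite (hM y); last by apply: lt_trans yM; rewrite ltrDl.
  rewrite (hM (y + x - x')); last first.
    have := ler_normB (y + x - x') (x - x').
    rewrite (_ : y + x - x' - (x - x') = y); first by lra.
    by apply/rowP => i; rewrite !mxE; ring.
  rewrite subrr expr0n; apply: mulr_ge0; first exact: sqr_ge0.
  by rewrite /b indicE ler0n.
rewrite (JZ _ ib) -/V /e' exprMn exprVn sqr_sqrtr ?addr_ge0//.
rewrite -mulrA ler_piMr ?sqr_ge0// ler_pdivrMl ?ltr_wpDl//.
by rewrite mulr1 lerDl.
Qed.

(** The modulus depends on rho only and is uniform on the unit ball of L^2, as the Arzela-Ascoli
    argument requires. *)
Lemma mol_equicontinuous rho : Cc rho -> forall e : R, 0 < e -> exists2 d : R, 0 < d &
  forall u x x', Sq mu u -> mass u <= 1 -> `|x - x'| < d -> `|mol rho u x - mol rho u x'| <= e.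
Proof.
move=> cr e e0; have [d d0 hd] := Cc_equicontinuous cr e0; exists d => // u x x' su u1 xd.
have s1 (z : 'rV[R]_n) : Sq mu (fun y => rho (y - z)) by apply: Sq_shift; exact: Cc_Sq.
rewrite !molE// -JB; try exact: Int_mul.
rewrite (@J_ext _ _ _ mu _ (fun y => u y * (rho (y - x) - rho (y - x')))) => [|y]; last by rewrite mulrBr.
apply: le_trans (J_mul_le su (SqB (s1 x) (s1 x'))) _.
rewrite -[leRHS]mul1r; apply: ler_pM; rewrite ?sqrtr_ge0//; last exact: hd.
by rewrite -sqrtr1 /nrm ler_sqrt.
Qed.

Lemma continuous_mol rho u : Cc rho -> Sq mu u -> continuous (mol rho u).
Proof.
move=> cr su; apply: (@cts_eps R 'rV[R]_n R) => x e e0.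
have N0 : 0 < nrm mu u + 1 by rewrite ltr_wpDl// sqrtr_ge0.
have [d d0 hd] := Cc_equicontinuous cr (divr_gt0 (divr_gt0 e0 (ltr0n _ 2)) N0).
exists d => // z xz; have s1 (z' : 'rV[R]_n) : Sq mu (fun y => rho (y - z')) by apply: Sq_shift; exact: Cc_Sq.
rewrite !molE// -JB; try exact: Int_mul.
rewrite (@J_ext _ _ _ mu _ (fun y => u y * (rho (y - x) - rho (y - z)))) => [|y]; last by rewrite mulrBr.
apply: le_lt_trans (J_mul_le su (SqB (s1 x) (s1 z))) _.
apply: (@le_lt_trans _ _ ((nrm mu u + 1) * (e / 2 / (nrm mu u + 1)))).
  by apply: ler_pM; rewrite ?sqrtr_ge0 ?lerDl//; exact: hd.
by rewrite mulrC divfK ?gt_eqF//; lra.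
Qed.

Lemma mol_bound rho u x : Cc rho -> Sq mu u -> `|mol rho u x| <= nrm mu u * nrm mu rho.
Proof.
move=> cr su; apply: le_trans (J_mul_le (Sq_shiftl x su) (Cc_Sq cr)) _.
rewrite le_eqVlt; apply/orP; left; apply/eqP; congr (Num.sqrt _ * _).
rewrite -(J_shift x su.2); apply: J_ext => y; by rewrite addrC.
Qed.

Lemma Sq_sqrt rho u : Cc rho -> (forall x, 0 <= rho x) -> Sq mu u ->
  Sq mu (fun y => u y * Num.sqrt (rho y)).
Proof.
move=> cr r0 su; have [C C0 hC] := Cc_bounded (@ball_compact_rV R n) cr.
have cR : Cc (fun y => Num.sqrt (rho y)).
  by apply: (Cc_comp (@sqrt_continuous R) _ cr); rewrite sqrtr0.
apply: (Sq_dom _ (SqZ (Num.sqrt C) su)).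
  by apply: measurable_funM; [exact: su.1|exact: (Cc_Sq cR).1].
move=> y; rewrite normrM normrM mulrC ler_wpM2r// !ger0_norm ?sqrtr_ge0//.
by rewrite ler_sqrt ?(ltW C0)//; apply: le_trans (ler_norm _) (hC y).
Qed.

(* Jensen's inequality for the probability density rho, then Tonelli. *)
Lemma jensen_mass (k : 'rV[R]_n -> 'rV[R]_n -> R) rho (B : R) : mollifier rho -> 0 <= B ->
  measurable_fun setT (fun p : 'rV[R]_n * 'rV[R]_n => k p.1 p.2) ->
  (forall x, Sq mu (fun y => k x y * Num.sqrt (rho y))) ->
  (forall y, rho y != 0 -> Int mu (fun x => k x y ^+ 2) /\ J mu (fun x => k x y ^+ 2) <= B) ->
  measurable_fun setT (fun x => J mu (fun y => k x y * rho y)) ->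
  Sq mu (fun x => J mu (fun y => k x y * rho y)) /\
  mass (fun x => J mu (fun y => k x y * rho y)) <= B.
Proof.
move=> [cr r0 r1] B0 mk sk hk mj.
pose r x := Num.sqrt (rho x).
have ir := Cc_Int cr; have mr := Int_meas ir.
have cR : Cc r by apply: (Cc_comp (@sqrt_continuous R) _ cr); rewrite sqrtr0.
have r2 x : r x ^+ 2 = rho x by rewrite sqr_sqrtr.
have sr : Sq mu r by exact: Cc_Sq.
have skr : forall x, Sq mu (fun y => k x y * r y) by exact: sk.
have ikr x : Int mu (fun y => k x y ^+ 2 * rho y).
  by have := (skr x).2; apply: Int_ext => y; rewrite exprMn r2.
have jen x : J mu (fun y => k x y * rho y) ^+ 2 <= J mu (fun y => k x y ^+ 2 * rho y).
  have := cauchy_schwarzJ (skr x) sr.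
  rewrite (@J_ext _ _ _ mu (fun y => k x y * r y * r y) (fun y => k x y * rho y)) => [|y]; last by rewrite -r2 expr2 mulrA.
  rewrite (@J_ext _ _ _ mu (fun y => (k x y * r y) ^+ 2) (fun y => k x y ^+ 2 * rho y)) => [|y]; last by rewrite exprMn r2.
  by rewrite (@J_ext _ _ _ mu (fun y => r y ^+ 2) rho)// r1 mulr1.
pose f (p : 'rV[R]_n * 'rV[R]_n) := (k p.1 p.2 ^+ 2 * rho p.2)%:E.
have f0 p : (0 <= f p)%E by rewrite lee_fin mulr_ge0// sqr_ge0.
have mf : measurable_fun setT f.
  apply/measurable_EFinP; apply: measurable_funM; first exact: measurable_funX.
  by apply: (measurableT_comp mr); exact: measurable_snd.
have le : (\int[mu]_x (J mu (fun y => k x y * rho y) ^+ 2)%:E <= B%:E)%E.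
  apply: (@le_trans _ _ (\int[mu]_x \int[mu]_y f (x, y))%E).
    apply: ge0_le_integral => //=.
    - by move=> x _; rewrite lee_fin sqr_ge0.
    - by apply/measurable_EFinP; exact: measurable_funX.
    - exact: measurable_fun_fubini_tonelli_F.
    - by move=> x _; rewrite /f/= JE// lee_fin.
  rewrite fubini_tonelli//; apply: (@le_trans _ _ (\int[mu]_y (B * rho y)%:E)%E).
    apply: ge0_le_integral => //=.
    - by move=> y _; exact: integral_ge0.
    - exact: measurable_fun_fubini_tonelli_G.
    - by apply/measurable_EFinP; exact: measurable_funM.
    - move=> y _; rewrite /f/=; have [->|ry] := eqVneq (rho y) 0.
        by under eq_integral do rewrite mulr0; rewrite integral0 mulr0.
      have [iy jy] := hk y ry.
      under eq_integral do rewrite mulrC; rewrite JE; last exact: IntZ.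
      by rewrite JZ// lee_fin mulrC ler_wpM2r.
  by rewrite JE ?JZ// ?r1 ?mulr1//; exact: IntZ.
have [i j] := Int_ge0 (measurable_funX 2 mj) (fun x => sqr_ge0 _) le.
by split.
Qed.

Lemma measurable_add2 : measurable_fun setT (fun p : 'rV[R]_n * 'rV[R]_n => p.1 + p.2).
Proof.
apply: measurable_fun_rV => i; under eq_fun do rewrite mxE.
apply: measurable_funD.
  by apply: (measurableT_comp (measurable_rV_coord i)); exact: measurable_fst.
by apply: (measurableT_comp (measurable_rV_coord i)); exact: measurable_snd.
Qed.

Lemma Sq_mol rho u : mollifier rho -> Sq mu u -> Sq mu (mol rho u) /\ mass (mol rho u) <= mass u.
Proof.
move=> mr su; have [cr r0 _] := mr.
apply: (@jensen_mass (fun x y => u (x + y)) rho (mass u)) => //.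
- exact: mass_ge0.
- by apply: (measurableT_comp su.1); exact: measurable_add2.
- by move=> x; apply: Sq_sqrt => //; exact: Sq_shiftl.
- by move=> y _; split; [exact: (Sq_shift y su).2|rewrite (J_shift y su.2)].
- by apply: continuous_measurable_rV; exact: continuous_mol.
Qed.

Lemma lip_of_derive (f df : R -> R) (K : R) : (forall t : R, is_derive t 1 f (df t)) ->
  (forall t, `|df t| <= K) -> forall a b, `|f b - f a| <= K * `|b - a|.
Proof.
move=> d dK a b; wlog ab : a b / a <= b.
  move=> H; have [h|h] := leP a b; first exact: H.
  by rewrite distrC (distrC b); apply: H; exact: ltW.
have d1 (t : R) : is_derive t 1 (fun t => f t + K * t) (df t + K).
  by apply: (dE (dD (d t) (dM (dcst K t) (did t)))) => //; rewrite mul0r add0r mulr1.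
have d2 (t : R) : is_derive t 1 (fun t => K * t - f t) (K - df t).
  by apply: (dE (dB (dM (dcst K t) (did t)) (d t))) => //; rewrite mul0r add0r mulr1.
have h1 := @derive_ndecr R _ _ a b ab (is_derive_cts d1) (fun t _ => d1 t).
have h2 := @derive_ndecr R _ _ a b ab (is_derive_cts d2) (fun t _ => d2 t).
have k1 : f a + K * a <= f b + K * b.
  by apply: h1 => t _; have := dK t; rewrite ler_norml => /andP[]; lra.
have k2 : K * a - f a <= K * b - f b.
  by apply: h2 => t _; have := dK t; rewrite ler_norml => /andP[]; lra.
rewrite (ger0_norm (_ : 0 <= b - a)) ?subr_ge0// ler_norml mulrBr.
by apply/andP; split; lra.
Qed.

(** A continuous cut-off, used to localise functions that are C^1 and square integrable without
    bounded support. *)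
Definition kap (M : R) (x : 'rV[R]_n) : R := clamp (M + 1 - `|x|).

Lemma kap1 M x : `|x| <= M -> kap M x = 1.
Proof. by move=> h; rewrite /kap clamp_ge1//; lra. Qed.

Lemma Cc_kap M : Cc (kap M).
Proof.
split; last by exists (M + 1) => x h; rewrite /kap clamp_le0//; lra.
apply: (cts_comp (@cts_clamp R)); apply: ctsB; first exact: cts_cst.
by move=> x; exact: norm_continuous.
Qed.

Lemma kap01 M x : 0 <= kap M x <= 1. Proof. exact: clamp01. Qed.

Lemma cts_bounded_ball u M : continuous u -> exists2 C : R, 0 < C & forall x, `|x| <= M -> `|u x| <= C.
Proof.
move=> cu; have [C C0 hC] := Cc_bounded (@ball_compact_rV R n) (CcM (Cc_kap M) cu).
by exists C => // x xM; have := hC x; rewrite kap1// mul1r.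
Qed.

Lemma kap_limit u (B : R) : measurable_fun setT u ->
  (forall k, Int mu (fun x => kap k%:R x * u x ^+ 2)) ->
  (forall k, J mu (fun x => kap k%:R x * u x ^+ 2) <= B) -> Sq mu u /\ mass u <= B.
Proof.
move=> mu_ ik jk.
have [] := @fatouJ _ _ _ mu (fun k x => kap k%:R x * u x ^+ 2) (fun x => u x ^+ 2) B ik.
- by move=> k x; rewrite mulr_ge0 ?sqr_ge0//; have /andP[] := kap01 k%:R x.
- by move=> x; exact: sqr_ge0.
- exact: measurable_funX.
- apply: nearW => x; apply/cvgrPdist_lt => d d0; near=> k.
  have xk : `|x| <= k%:R by near: k; exact: nbhs_infty_ger.
  by rewrite kap1// mul1r subrr normr0.
- by apply: nearW => k; exact: jk.
by move=> i j; split.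
Unshelve. all: by end_near. Qed.

(** Duality: with w the localised increment, t -> J (u (x + t e_i) w) is Lipschitz with constant nrm
    (g i) * nrm w, and from 0 to s it grows by A = J (kp w0^2) >= (nrm w)^2. Hence A <= |s| nrm (g
    i) sqrt A, and [kap_limit] removes the cut-off. *)
Lemma translate_coord u g i (s : R) : C1 u g -> Sq mu u -> Sq mu (g i) ->
  nrm mu (fun x => u (x + s *: e_ R i) - u x) <= `|s| * nrm mu (g i).
Proof.
move=> [cu cg dg] su sg; pose w0 x := u (x + s *: e_ R i) - u x.
have sw0 : Sq mu w0 by apply: SqB => //; exact: Sq_shift.
have cw0 : continuous w0 by apply: ctsB => //; exact: cts_shift.
have st (f : 'rV[R]_n -> R) t : Sq mu f -> Sq mu (fun x => f (x + t *: e_ R i)).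
  by move=> sf; exact: Sq_shift.
rewrite -[leRHS]ger0_norm ?mulr_ge0 ?sqrtr_ge0// -sqrtr_sqr /nrm ler_sqrt ?sqr_ge0//.
have ik k : Int mu (fun x => kap k%:R x * w0 x ^+ 2).
  by apply: Cc_Int; apply: CcM; [exact: Cc_kap|exact: ctsX].
apply: (kap_limit sw0.1 ik _).2 => k.
pose kp := kap k%:R; pose w x := kp x * w0 x.
have cw : Cc w by apply: CcM => //; exact: Cc_kap.
have sw := Cc_Sq cw; have iw := Cc_Int cw; have [M M0 hM] := bsupp_pos cw.2.
pose phi (t : R) : R := J mu (fun x => u (x + t *: e_ R i) * w x).
pose dphi (t : R) : R := J mu (fun x => g i (x + t *: e_ R i) * w x).
have d (t : R) : is_derive t 1 phi (dphi t).
  have [C C0 hC] := cts_bounded_ball (M + `|t| + 1) (cg i).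
  apply: (@is_derive_J R _ _ mu (fun t x => u (x + t *: e_ R i) * w x)
    (fun t x => g i (x + t *: e_ R i) * w x) (fun x => C * `|w x|)).
  - move=> r y; apply: (dE (dM (pd_line y r (dg i)) (dcst (w y) r))) => //.
    by rewrite mulr0 addr0.
  - by move=> r; apply: Int_mul => //; exact: st.
  - by apply: IntZ; exact: Int_abs.
  - move=> r y rt; rewrite normrM; have [yM|yM] := leP `|y| M; last by rewrite hM// normr0 !mulr0.
    rewrite ler_wpM2r//; apply: hC; apply: le_trans (ler_normD _ _) _.
    rewrite normrZ -addrA; apply: lerD => //; have h1 := e_norm R i.
    have h2 : `|r| <= `|t| + 1 by have := ler_normD t (r - t); rewrite addrC subrK; lra.
    by apply: le_trans h2; rewrite ler_piMr.
have B t : `|dphi t| <= nrm mu (g i) * nrm mu w.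
  apply: le_trans (J_mul_le (st _ t sg) sw) _.
  by rewrite {1}/nrm (J_shift _ sg.2).
have := lip_of_derive d B 0 s; rewrite subr0 => lip.
have e1 : phi s - phi 0 = J mu (fun x => kp x * w0 x ^+ 2).
  rewrite /phi -JB; [|by apply: Int_mul => //; exact: st|by apply: Int_mul => //; exact: st].
  by apply: J_ext => x; rewrite scale0r addr0 /w /w0; ring.
have nw : nrm mu w <= Num.sqrt (J mu (fun x => kp x * w0 x ^+ 2)).
  apply: ler_wsqrtr; apply: J_le => [||x]; [exact: sw.2|exact: ik|].
  rewrite /w exprMn ler_wpM2r ?sqr_ge0//; have /andP[k0 k1] := kap01 k%:R x.
  by rewrite expr2 ler_piMl.
set A := J mu _ in e1 nw *; have A0 : 0 <= A.
  by apply: J_ge0 => x; rewrite mulr_ge0 ?sqr_ge0//; have /andP[] := kap01 k%:R x.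
have AA : A = Num.sqrt A ^+ 2 by rewrite sqr_sqrtr.
move: lip; rewrite e1 ger0_norm// => lip; rewrite AA.
have r0 := sqrtr_ge0 A; rewrite {1}AA in lip.
have G0 : 0 <= nrm mu (g i) by exact: sqrtr_ge0.
have h : Num.sqrt A ^+ 2 <= `|s| * nrm mu (g i) * Num.sqrt A.
  apply: le_trans lip _; rewrite mulrAC (mulrC (nrm mu (g i))) ler_wpM2l// mulr_ge0//.
move: r0; rewrite le_eqVlt => /orP[/eqP <-|r0]; first by rewrite expr0n sqr_ge0.
rewrite expr2 ler_pM2r// in h.
by rewrite ler_pXn2r ?nnegrE ?(ltW r0)// mulr_ge0.
Qed.

(** The displacement is made one coordinate at a time. *)
Lemma translate_norm u g (y : 'rV[R]_n) : C1 u g -> Sq mu u -> (forall i, Sq mu (g i)) ->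
  nrm mu (fun x => u (x + y) - u x) <= `|y| * \sum_i nrm mu (g i).
Proof.
move=> ug su sg.
have key (s : seq 'I_n) : nrm mu (fun x => u (x + \sum_(i <- s) y ord0 i *: e_ R i) - u x) <=
    \sum_(i <- s) `|y ord0 i| * nrm mu (g i).
  elim: s => [|i s IH].
    rewrite !big_nil /nrm (@J_ext _ _ _ mu _ (fun=> 0)) ?J0 ?sqrtr0// => x.
    by rewrite addr0 subrr expr0n.
  rewrite !big_cons; set z := \sum_(j <- s) _ in IH *.
  have sz (z' : 'rV[R]_n) : Sq mu (fun x => u (x + z')) by exact: Sq_shift.
  have -> : (fun x => u (x + (y ord0 i *: e_ R i + z)) - u x) =
      (fun x => u (x + z + y ord0 i *: e_ R i) - u x).
    by apply/funext => x; rewrite addrAC addrA.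
  apply: le_trans (@nrm_tri _ _ _ mu _ (fun x => u (x + z)) u _ (sz z) su) _.
    by rewrite (_ : (fun x => _) = (fun x => u (x + (z + y ord0 i *: e_ R i)))); [exact: sz|apply/funext => x; rewrite addrA].
  apply: lerD => //.
  apply: le_trans (translate_coord (y ord0 i) ug su (sg i)); rewrite le_eqVlt; apply/orP; left; apply/eqP.
  congr Num.sqrt; have s1 := SqB (sz (y ord0 i *: e_ R i)) su.
  by rewrite -(J_shift z s1.2); apply: J_ext => x; rewrite addrAC.
have := key (index_enum _); rewrite -(_ : y = \sum_i y ord0 i *: e_ R i); last first.
  by rewrite {1}[y]row_sum_delta.
move=> /le_trans; apply; rewrite mulr_sumr; apply: ler_sum => i _.
by rewrite ler_wpM2r ?sqrtr_ge0// coord_le_norm.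
Qed.

Lemma mol_close rho u g (e : R) : mollifier rho -> C1 u g -> Sq mu u -> (forall i, Sq mu (g i)) ->
  0 <= e -> (forall y, rho y != 0 -> `|y| <= e) ->
  nrm mu (fun x => mol rho u x - u x) <= e * \sum_i nrm mu (g i).
Proof.
move=> mr ug su sg e0 re; have [cr r0 r1] := mr; have [cu _ _] := ug.
set G := \sum_i _; have G0 : 0 <= G by apply: sumr_ge0 => i _; exact: sqrtr_ge0.
have sr : Sq mu (fun y => Num.sqrt (rho y)).
  by apply: Cc_Sq; apply: (Cc_comp (@sqrt_continuous R) _ cr); rewrite sqrtr0.
have E : (fun x => mol rho u x - u x) = (fun x => J mu (fun y => (u (x + y) - u x) * rho y)).
  apply/funext => x; rewrite -[X in _ - X]mulr1 -r1 -(JZ _ (Cc_Int cr)) -JB.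
  - by apply: J_ext => y; rewrite mulrBl.
  - exact: Int_mol.
  - by apply: IntZ; exact: Cc_Int.
have [] := @jensen_mass (fun x y => u (x + y) - u x) rho ((e * G) ^+ 2) mr (sqr_ge0 _).
- apply: measurable_funB; first exact: (measurableT_comp su.1 measurable_add2).
  by apply: (measurableT_comp su.1); exact: measurable_fst.
- move=> x; rewrite (_ : (fun y => _) = (fun y => u (x + y) * Num.sqrt (rho y) - u x * Num.sqrt (rho y))).
    by apply: SqB; [apply: Sq_sqrt => //; exact: Sq_shiftl|exact: SqZ].
  by apply/funext => y; rewrite mulrBl.
- move=> y ry; have s1 : Sq mu (fun x => u (x + y) - u x) by apply: SqB => //; exact: Sq_shift.
  split; first exact: s1.2.
  rewrite -nrm_sq ler_pXn2r ?nnegrE ?sqrtr_ge0 ?mulr_ge0//.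
  apply: le_trans (translate_norm y ug su sg) _; rewrite ler_wpM2r//; exact: re.
- rewrite -E; apply: continuous_measurable_rV; apply: ctsB => //; exact: continuous_mol.
rewrite -E => s le; rewrite -[leRHS]ger0_norm ?mulr_ge0// -sqrtr_sqr.
exact: ler_wsqrtr.
Qed.

End mollification.

(** * Completeness of L^2 *)

Section L2_complete.
Context d (T : measurableType d) (R : realType) (mu : {measure set T -> \bar R}).
Implicit Types (f g h : T -> R).

Lemma ndecr_bounded_ae (t : nat -> T -> R) (B : R) : (forall k, Int mu (t k)) ->
  (forall k x, 0 <= t k x) -> (forall x, nondecreasing_seq (t^~ x)) ->
  (forall k, J mu (t k) <= B) -> {ae mu, forall x, exists M : R, forall k, t k x <= M}.
Proof.
move=> it t0 nt tB.
pose F x : \bar R := limn (fun k => (t k x)%:E).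
have nF x : nondecreasing_seq (fun k => (t k x)%:E).
  by move=> i j ij; rewrite lee_fin nt.
have cF x : (fun k => (t k x)%:E) @ \oo --> F x.
  exact: ereal_nondecreasing_is_cvgn.
have mt k : measurable_fun setT (fun x => (t k x)%:E).
  by apply/measurable_EFinP; exact: Int_meas.
have F0 x : (0 <= F x)%E.
  by apply: lime_ge; [exact: ereal_nondecreasing_is_cvgn|apply: nearW => k; rewrite lee_fin].
have iF : mu.-integrable setT F.
  apply/integrableP; split.
    by apply: (emeasurable_fun_cvg (fun k x => (t k x)%:E)) => // x _; exact: cF.
  rewrite (_ : (fun x => _) = F); last by apply/funext => x; rewrite gee0_abs.
  have -> : (\int[mu]_x F x = limn (fun k => \int[mu]_x (t k x)%:E))%E.
    by apply: monotone_convergence => // k x _; rewrite lee_fin.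
  apply: (@le_lt_trans _ _ B%:E); last exact: ltry.
  apply: lime_le.
    apply: ereal_nondecreasing_is_cvgn => i j ij; rewrite !JE// lee_fin.
    by apply: J_le => // x; exact: nt.
  by apply: nearW => k; rewrite JE// lee_fin.
have := integrable_ae measurableT iF; apply: filterS => x /(_ I) fx.
exists (fine (F x)) => k; rewrite -lee_fin fineK//.
have -> : F x = ereal_sup (range (fun k => (t k x)%:E)).
  by apply/cvg_lim => //; exact: ereal_nondecreasing_cvgn.
by apply: ereal_sup_ubound; exists k.
Qed.

(** Multiplying by the indicator of a measurable conull set gives convergence everywhere, hence a
    measurable limit. *)
Lemma ae_cvg_modification (f : nat -> T -> R) : (forall k, measurable_fun setT (f k)) ->
  {ae mu, forall x, cvgn (f^~ x)} ->
  exists2 F : T -> R, measurable_fun setT F & {ae mu, forall x, f k x @[k --> \oo] --> F x}.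
Proof.
move=> mf [A [mA A0 hA]].
pose c (x : T) : R := \1_(~` A) x.
have mc : measurable_fun setT c by apply: measurable_indic; exact: measurableC.
have cvx x : cvgn (fun k => f k x * c x).
  rewrite /c indicE; have [xA|xA] := boolP (x \in ~` A).
    under eq_fun do rewrite mulr1; apply: contrapT => H.
    by move/set_mem : xA; apply; apply: hA.
  under eq_fun do rewrite mulr0; exact: is_cvg_cst.
exists (fun x => limn (fun k => f k x * c x)).
  apply: (@measurable_fun_cvg _ T R setT (fun k x => f k x * c x)) => [k|x _]; last exact: cvx.
  exact: measurable_funM.
exists A; split => // x /= H; apply: contrapT => xA; apply: H.
have := cvx x; rewrite /c indicE mem_set// => /cvg_ex[l]; under eq_fun do rewrite mulr1.
by move=> hl; rewrite (cvg_lim _ hl).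
Qed.

Lemma nrm_sum (d_ : nat -> T -> R) k : (forall j, Sq mu (d_ j)) ->
  Sq mu (fun x => \sum_(0 <= j < k) d_ j x) /\
  nrm mu (fun x => \sum_(0 <= j < k) d_ j x) <= \sum_(0 <= j < k) nrm mu (d_ j).
Proof.
move=> sd; elim: k => [|k [IH1 IH2]].
  have -> : (fun x => \sum_(0 <= j < 0) d_ j x) = fun=> 0 by apply/funext => x; rewrite big_nil.
  split; last by rewrite big_nil /nrm (@J_ext _ _ _ mu _ (fun=> 0)) ?J0 ?sqrtr0// => x; rewrite expr0n.
  by split => //; apply: Int_ext (Int0 mu) => x; rewrite expr0n.
have -> : (fun x => \sum_(0 <= j < k.+1) d_ j x) = fun x => \sum_(0 <= j < k) d_ j x + d_ k x.
  by apply/funext => x; rewrite big_nat_recr.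
split; first exact: SqD.
by rewrite big_nat_recr//=; apply: le_trans (nrmD IH1 (sd k)) _; rewrite lerD2r.
Qed.

Lemma Sq_abs f : Sq mu f -> Sq mu (fun x => `|f x|).
Proof.
move=> sf; apply: (Sq_dom _ sf); last by move=> x; rewrite normr_id.
exact: (measurableT_comp (@normr_measurable R setT) sf.1).
Qed.

Lemma nrm_abs f : nrm mu (fun x => `|f x|) = nrm mu f.
Proof. by congr Num.sqrt; apply: J_ext => x; rewrite real_normK ?num_real. Qed.

(** The partial sums of |f (k + 1) - f k| have norm at most 2, so they are bounded almost
    everywhere. *)
Lemma fast_cauchy_ae (f : nat -> T -> R) : (forall k, Sq mu (f k)) ->
  (forall k, nrm mu (fun x => f k.+1 x - f k x) <= 2^-1 ^+ k) ->
  {ae mu, forall x, cvgn (f^~ x)}.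
Proof.
move=> sf hf; pose e k x := f k.+1 x - f k x.
have se k : Sq mu (e k) by exact: SqB.
pose S k x := \sum_(0 <= j < k) `|e j x|.
have S0 k x : 0 <= S k x by apply: sumr_ge0.
have hS k : Sq mu (S k) /\ nrm mu (S k) <= 2.
  have [s1 s2] := @nrm_sum (fun j x => `|e j x|) k (fun j => Sq_abs (se j)).
  split => //; apply: le_trans s2 _.
  apply: (@le_trans _ _ (\sum_(0 <= j < k) 2^-1 ^+ j)).
    by apply: ler_sum => j _; rewrite nrm_abs; exact: hf.
  have : \sum_(0 <= j < k) 2^-1 ^+ j = 2 - 2 * (2^-1) ^+ k :> R.
    elim: (k) => [|m IH]; first by rewrite big_nil expr0; ring.
    by rewrite big_nat_recr//= IH exprS; field.
  by move=> ->; rewrite gerBl mulr_ge0// exprn_ge0// invr_ge0.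
have nS x : nondecreasing_seq (S^~ x).
  move=> i j ij; rewrite /S (big_cat_nat _ ij)//= lerDl; exact: sumr_ge0.
have := @ndecr_bounded_ae (fun k x => S k x ^+ 2) 4 (fun k => (hS k).1.2) (fun k x => sqr_ge0 _).
have H1 x : nondecreasing_seq (fun k => S k x ^+ 2).
  by move=> i j ij; rewrite ler_pXn2r ?nnegrE//; exact: nS.
have H2 k : J mu (fun x => S k x ^+ 2) <= 4.
  rewrite -nrm_sq (_ : 4 = 2 ^+ 2 :> R); last by ring.
  by rewrite ler_pXn2r ?nnegrE ?nrm_ge0//; exact: (hS k).2.
move=> /(_ H1 H2); apply: filterS => x [M hM].
have cS : cvgn (S^~ x).
  apply: nondecreasing_is_cvgn; first exact: nS.
  exists (M + 1) => _ [k _ <-]; have := hM k; have := sqr_ge0 (S k x - 2^-1).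
  by rewrite sqrrB; move: (S k x) => s; lra.
have ce : cvgn (series (e^~ x)) by apply: normed_cvg; exact: cS.
have -> : f^~ x = (fun k => f 0%N x + series (e^~ x) k).
  apply/funext => k; rewrite seriesEnat /e /= telescope_sumr//; ring.
by apply: is_cvgD => //; exact: is_cvg_cst.
Qed.

Lemma fatou_nrm (f_ : nat -> T -> R) f (B : R) : 0 <= B -> (forall k, Sq mu (f_ k)) -> measurable_fun setT f ->
  {ae mu, forall x, f_ k x @[k --> \oo] --> f x} ->
  (\forall k \near \oo, nrm mu (f_ k) <= B) -> Sq mu f /\ nrm mu f <= B.
Proof.
move=> B0 sf mf cf hB.
have [] := @fatouJ _ _ _ mu (fun k x => f_ k x ^+ 2) (fun x => f x ^+ 2) (B ^+ 2) (fun k => (sf k).2).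
- by move=> k x; exact: sqr_ge0.
- by move=> x; exact: sqr_ge0.
- exact: measurable_funX.
- apply: filterS cf => x cx; under eq_fun do rewrite expr2; rewrite expr2; exact: cvgM.
- apply: filterS hB => k hk; rewrite -nrm_sq ler_pXn2r ?nnegrE ?nrm_ge0//.
move=> i j; split => //; rewrite -[leRHS]ger0_norm// -sqrtr_sqr; exact: ler_wsqrtr.
Qed.

(** The limit comes with an almost everywhere convergent subsequence; j <= s j is all that later
    arguments ask of its indices. *)
Lemma L2_complete (f : nat -> T -> R) : (forall k, Sq mu (f k)) ->
  (forall e : R, 0 < e -> exists K, forall k l, (K <= k)%N -> (K <= l)%N ->
    nrm mu (fun x => f k x - f l x) <= e) ->
  exists (F : T -> R) (s : nat -> nat), [/\ Sq mu F, forall j, (j <= s j)%N,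
    {ae mu, forall x, f (s j) x @[j --> \oo] --> F x} &
    forall e : R, 0 < e -> exists K, forall k, (K <= k)%N -> nrm mu (fun x => f k x - F x) <= e].
Proof.
move=> sf cf.
have /choice[K hK] : forall j, exists K, forall k l, (K <= k)%N -> (K <= l)%N ->
    nrm mu (fun x => f k x - f l x) <= 2^-1 ^+ j.
  by move=> j; apply: cf; rewrite exprn_gt0// invr_gt0.
pose s := fix s j := if j is j'.+1 then maxn (s j').+1 (K j) else K 0%N.
have sK j : (K j <= s j)%N by case: j => //= j; rewrite leq_maxr.
have ss j : (s j < s j.+1)%N by rewrite /= leq_maxl.
have sj j : (j <= s j)%N by elim: j => // j /leq_ltn_trans; apply.
have cs := @fast_cauchy_ae (f \o s) (fun k => sf _).
have {}cs : {ae mu, forall x, cvgn (fun k => f (s k) x)}.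
  by apply: cs => j; apply: (hK j); [exact: leq_trans (sK j) (ltnW (ss j))|exact: sK].
have [F mF cF] := ae_cvg_modification (fun k => (sf (s k)).1) cs.
have key (e : R) : 0 < e -> exists K, forall k, (K <= k)%N ->
    Sq mu (fun x => f k x - F x) /\ nrm mu (fun x => f k x - F x) <= e.
  move=> e0; have [L hL] := cf e e0; exists L => k Lk.
  apply: (@fatou_nrm (fun j x => f k x - f (s j) x)) => //.
  - exact: ltW.
  - by move=> j; exact: SqB.
  - by apply: measurable_funB => //; exact: (sf k).1.
  - by apply: filterS cF => x cx; apply: cvgB => //; exact: cvg_cst.
  - by exists L => // j Lj; apply: hL => //; exact: leq_trans (sj j).
exists F, s; split => //.
- have [L hL] := key 1 ltr01; have [h _] := hL L (leqnn L).
  rewrite (_ : F = fun x => f L x - (f L x - F x)); first exact: SqB.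
  by apply/funext => x; ring.
- by move=> e e0; have [L hL] := key e e0; exists L => k Lk; have [] := hL k Lk.
Qed.

End L2_complete.

(** * Explicit test functions *)

Section smooth_functions.
Context (R : realType) (n : nat).
Local Notation mu := (lebesgue_rV R n).
Implicit Types (f g : 'rV[R]_n -> R) (k : nat) (t c : R).

(** The functions t^(-k) e^(-1/t), extended by 0: the derivative of each is a combination of two
    others of the family. *)
Definition flat k t : R := if 0 < t then t^-1 ^+ k * expR (- t^-1) else 0.

Lemma flat_le0 k t : t <= 0 -> flat k t = 0.
Proof. by rewrite /flat leNgt => /negbTE ->. Qed.

Lemma expn_le_expR k t : 0 <= t -> t ^+ k <= k%:R ^+ k * expR t.
Proof.
case: k => [|k] t0; first by rewrite !expr0 mul1r -expR0 ler_expR.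
have k0 : (k.+1%:R : R) != 0 by rewrite pnatr_eq0.
have -> : expR t = expR (t / k.+1%:R) ^+ k.+1.
  by rewrite -expRM_natl -mulr_natl mulrC divfK.
rewrite -exprMn ler_pXn2r ?nnegrE ?mulr_ge0 ?expR_ge0//.
have := expR_ge1Dx (t / k.+1%:R) => h.
by rewrite -[leLHS](divfK k0) mulrC ler_wpM2l//; apply: le_trans h; rewrite lerDr.
Qed.

(** Vanishing to any order m at 0; m = 2 yields the derivative at 0. *)
Lemma flat_bound k m t : `|flat k t| <= ((m + k)%N%:R ^+ (m + k)) * `|t| ^+ m.
Proof.
have [t0|t0] := leP t 0.
  by rewrite flat_le0// normr0 mulr_ge0 ?exprn_ge0.
rewrite /flat t0 ger0_norm ?mulr_ge0 ?expR_ge0 ?exprn_ge0 ?invr_ge0 ?(ltW t0)//.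
rewrite ger0_norm ?(ltW t0)//.
have t1 : 0 <= t^-1 by rewrite invr_ge0 ltW.
have := expn_le_expR (m + k) t1; rewrite exprD -ler_pdivrMr ?expR_gt0//.
have tm : 0 < t ^+ m by exact: exprn_gt0.
rewrite -(ler_pM2r tm) -expRN => /(le_trans _); apply.
have -> : t^-1 ^+ m * t^-1 ^+ k * expR (- t^-1) * t ^+ m = (t^-1 * t) ^+ m * (t^-1 ^+ k * expR (- t^-1)).
  by rewrite exprMn; ring.
by rewrite mulVf ?gt_eqF// expr1n mul1r.
Qed.

Lemma is_derive_flat k t : is_derive t 1 (flat k) (flat k.+2 t - k%:R * flat k.+1 t).
Proof.
have [t0|t0|->] := ltgtP t 0.
- rewrite !flat_le0 ?(ltW t0)// mulr0 subrr.
  apply: (@near_eq_is_derive _ _ _ (fun=> 0)).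
  near=> s; rewrite flat_le0//; apply: ltW; near: s; exact: lt_nbhsl.
- apply: (@near_eq_is_derive _ _ _ (fun t : R => t^-1 ^+ k * expR (- t^-1))).
    near=> s; rewrite /flat (_ : 0 < s)//; near: s; exact: lt_nbhsr.
  have dv := dV (lt0r_neq0 t0) (did t).
  have := dM (dX k dv) (dexp (dN dv)); move/dE; apply => //.
  rewrite /flat t0; move: (expR _) => E; rewrite -!exprVn.
  case: k => [|k]; first by rewrite !mul0r subr0 !expr0; ring.
  by rewrite /= !exprS; ring.
- rewrite !flat_le0// mulr0 subrr.
  have lim : h^-1 *: (flat k (h + 0) - flat k 0) @[h --> (0 : R)^'] --> (0 : R).
    pose C : R := (2 + k)%N%:R ^+ (2 + k) + 1.
    have C0 : 0 < C by rewrite ltr_wpDl// exprn_ge0.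
    apply/cvgrPdist_lt => e e0; near=> h; rewrite sub0r normrN addr0 (flat_le0 k (lexx 0)) subr0.
    rewrite /GRing.scale/= normrM normfV.
    have h0 : 0 < `|h| by rewrite normr_gt0; near: h; exact: nbhs_dnbhs_neq.
    rewrite mulrC ltr_pdivrMr//; apply: le_lt_trans (flat_bound k 2 h) _.
    apply: (@le_lt_trans _ _ (C * `|h| * `|h|)).
      by rewrite -mulrA -expr2 ler_wpM2r ?sqr_ge0// /C lerDl.
    rewrite ltr_pM2r// -ltr_pdivlMl// mulrC.
    near: h; apply: dnbhs0_lt; exact: divr_gt0.
  have lim' : h^-1 *: ((flat k \o shift 0) (h *: (1 : R)) - flat k 0) @[h --> (0 : R)^'] --> (0 : R).
    by under eq_fun do rewrite /= [_%:A]mulr1.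
  by split; [apply/cvg_ex; exists 0|exact: cvg_lim].
Unshelve. all: by end_near. Qed.

(** A syntactic class closed under partial derivatives, so that [smooth] follows by induction on the
    list of derivatives, and rich enough to approximate indicators of boxes. *)
Inductive Sm : ('rV[R]_n -> R) -> Prop :=
| Sm_cst c : Sm (fun=> c)
| Sm_flat k c t i : Sm (fun x => flat k (c * x ord0 i + t))
| SmD f g : Sm f -> Sm g -> Sm (fun x => f x + g x)
| SmM f g : Sm f -> Sm g -> Sm (fun x => f x * g x).

Lemma Sm_derive f : Sm f -> exists2 g : 'I_n -> 'rV[R]_n -> R, C1 f g & forall i, Sm (g i).
Proof.
elim=> [c|k c t j|{}f g Sf [df cf Sdf] Sg [dg cg Sdg]|{}f g Sf [df cf Sdf] Sg [dg cg Sdg]].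
- by exists (fun _ _ => 0); [exact: C1_cst|move=> i; exact: Sm_cst].
- exists (fun i x => (flat k.+2 (c * x ord0 j + t) - k%:R * flat k.+1 (c * x ord0 j + t)) * (c * (i == j)%:R)).
    have cl : C1 (fun x : 'rV[R]_n => c * x ord0 j + t) (fun i _ => c * (i == j)%:R).
      have := C1D (C1Z c (C1_coord R j)) (C1_cst n t); apply: C1_ext => // i x /=.
      by rewrite addr0.
    have cF m : continuous (flat m) by exact: is_derive_cts (is_derive_flat m).
    have := C1_comp (is_derive_flat k) _ cl; apply.
    by apply: ctsB => //; apply: ctsM => //; exact: cts_cst.
  move=> i; apply: SmM; last exact: Sm_cst.
  rewrite (_ : (fun x => _) = fun x : 'rV[R]_n => flat k.+2 (c * x ord0 j + t) + (- k%:R) * flat k.+1 (c * x ord0 j + t)).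
    by apply: SmD; [exact: Sm_flat|apply: SmM; [exact: Sm_cst|exact: Sm_flat]].
  by apply/funext => x; rewrite mulNr.
- exists (fun i x => df i x + dg i x); first exact: C1D.
  by move=> i; exact: SmD.
- have := C1M cf cg => h; eexists; first exact: h.
  by move=> i /=; apply: SmD; exact: SmM.
Qed.

Lemma pd_partial i f (g : 'rV[R]_n -> R) x : is_derive (0 : R) 1 (fun s : R => f (x + s *: e_ R i)) (g x) ->
  derivable f x (delta_mx ord0 i) /\ partial i f x = g x.
Proof.
move=> d; have cv := is_derive_cvg d; move: cv.
under eq_fun do rewrite addr0 scale0r addr0 (addrC x).
move=> cv; split; [by apply/cvg_ex; exists (g x)|exact: (cvg_lim (@norm_hausdorff _ _) cv)].
Qed.

Lemma partial_pd i f : (forall x, derivable f x (delta_mx ord0 i)) -> pd i f (partial i f).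
Proof.
move=> df x; have /cvg_ex[l hl] := df x.
have lE : partial i f x = l by exact: (cvg_lim (@norm_hausdorff _ _) hl).
have hl' : h^-1 *: (((fun s : R => f (x + s *: e_ R i)) \o shift 0) (h *: (1 : R)) - f (x + 0 *: e_ R i)) @[h --> (0 : R)^'] --> l.
  under eq_fun do rewrite /= [_%:A]mulr1 addr0 scale0r addr0 (addrC x); exact: hl.
rewrite lE; split; [by apply/cvg_ex; exists l|exact: cvg_lim hl'].
Qed.

Lemma C1_partial f (g : 'I_n -> 'rV[R]_n -> R) : C1 f g -> forall i, partial i f = g i.
Proof. by move=> [_ _ d] i; apply/funext => x; have [] := pd_partial (d i x). Qed.

Lemma Sm_smooth f : Sm f -> smooth f.
Proof.
move=> Sf s; have : Sm (foldr (@partial R n) f s).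
  elim: s => //= i s /Sm_derive[g cg Sg].
  by rewrite (C1_partial cg).
move=> /Sm_derive[g cg Sg]; split; first by have [] := cg.
by move=> i x; have [_ _ d] := cg; have [] := pd_partial (d i x).
Qed.

Lemma Sm_test f : Sm f -> bsupp f -> test_function f.
Proof.
move=> Sf [M hM]; split; first exact: Sm_smooth.
apply: (subclosed_compact _ (@ball_compact_rV R n M)); first exact: closed_closure.
have cl : closed [set x : 'rV[R]_n | `|x| <= M].
  apply: compact_closed; [exact: norm_hausdorff|exact: ball_compact_rV].
rewrite ((closure_id _).1 cl); apply: closureS => x /= fx.
by rewrite leNgt; apply/negP => /hM /eqP; apply/negP.
Qed.

Lemma test_C1c f : test_function f -> C1c f (fun i => partial i f).
Proof.
move=> [sf cf]; split; first split.
- by have [] := sf [::].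
- by move=> i; have [] := sf [:: i].
- by move=> i; apply: partial_pd => x; have [_] := sf [::]; exact.
- have [M [_ hM]] := compact_bounded cf; exists (M + 1) => x Mx.
  apply: contrapT => /eqP fx; have := hM (M + 1) (_ : M < M + 1); rewrite ltrDl => /(_ ltr01 x).
  by move=> /(_ (@subset_closure _ [set x | f x != 0] x fx)); rewrite /= leNgt Mx.
Qed.

Lemma flat01 t : 0 <= flat 0 t <= 1.
Proof.
rewrite /flat; case: ltP => t0; last by rewrite lexx ler01.
by rewrite expr0 mul1r expR_ge0 -expR0 ler_expR oppr_le0 invr_ge0 ltW.
Qed.

Definition obox (a b : 'rV[R]_n) : set 'rV[R]_n :=
  [set x | forall i, (a ord0 i < x ord0 i < b ord0 i)%R].

(** A smooth function vanishing off the open box, which tends to the indicator of that box as k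
    grows. *)
Definition bumpf k (a b x : 'rV[R]_n) : R :=
  \prod_i (flat 0 (k.+1%:R * x ord0 i + - (k.+1%:R * a ord0 i)) *
    flat 0 (- k.+1%:R * x ord0 i + k.+1%:R * b ord0 i)).

Lemma bumpf01 k a b x : 0 <= bumpf k a b x <= 1.
Proof.
have h i : 0 <= flat 0 (k.+1%:R * x ord0 i + - (k.+1%:R * a ord0 i)) *
    flat 0 (- k.+1%:R * x ord0 i + k.+1%:R * b ord0 i) <= 1.
  have /andP[u0 u1] := flat01 (k.+1%:R * x ord0 i + - (k.+1%:R * a ord0 i)).
  have /andP[v0 v1] := flat01 (- k.+1%:R * x ord0 i + k.+1%:R * b ord0 i).
  by rewrite mulr_ge0// mulr_ile1.
by rewrite /bumpf prodr_ge0 ?prodr_ile1// => i _; have /andP[] := h i.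
Qed.

Lemma Sm_bumpf k a b : Sm (bumpf k a b).
Proof.
rewrite /bumpf; elim: (index_enum _) => [|i s IH].
  by under eq_fun do rewrite big_nil; exact: Sm_cst.
under eq_fun do rewrite big_cons; apply: SmM => //.
by apply: SmM; exact: Sm_flat.
Qed.

Lemma bumpf_out k a b x : ~ obox a b x -> bumpf k a b x = 0.
Proof.
move=> /existsNP[i xi]; rewrite /bumpf (bigD1 i)//=.
have k0 : 0 < k.+1%:R :> R by [].
have [h|h] := leP (x ord0 i) (a ord0 i).
  by rewrite flat_le0 ?mul0r// subr_le0 ler_pM2l.
rewrite mulrAC (@flat_le0 0 (_ + k.+1%:R * _)) ?mulr0//.
rewrite mulNr addrC subr_le0 ler_pM2l// leNgt; apply/negP => h'; apply: xi.
by rewrite h h'.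
Qed.

Lemma obox_norm a b x : obox a b x -> `|x| <= Num.max `|a| `|b|.
Proof.
move=> h; apply: norm_le_coord => [|i]; first by rewrite le_max normr_ge0.
have /andP[h1 h2] := h i; have := coord_le_norm a i; have := coord_le_norm b i.
rewrite !ler_norml => /andP[_ k1] /andP[k2 _].
rewrite le_max lerNl; apply/andP; split; last by rewrite (le_trans _ k1) ?(ltW h2) ?orbT.
by rewrite le_max; apply/orP; left; lra.
Qed.

Lemma bsupp_bumpf k a b : bsupp (bumpf k a b).
Proof.
exists (Num.max `|a| `|b|) => x hx.
by apply: bumpf_out => /obox_norm; rewrite leNgt hx.
Qed.

Lemma cvg_flat t : flat 0 (k.+1%:R * t) @[k --> \oo] --> ((0 < t)%R%:R : R).
Proof.
have [t0|t0] := ltP 0 t; last first.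
  by under eq_fun => k do rewrite flat_le0 ?mulr_ge0_le0//; exact: cvg_cst.
under eq_fun => k do rewrite /flat mulr_gt0// expr0 mul1r invfM.
suff : expR (- (k.+1%:R^-1 * t^-1)) @[k --> \oo] --> expR (- (0 * t^-1)) by rewrite mul0r oppr0 expR0.
apply: continuous_cvg; first exact: continuous_expR.
by apply: cvgN; apply: cvgM; [exact: cvg_harmonic|exact: cvg_cst].
Qed.

Lemma cvg_bumpf a b x : bumpf k a b x @[k --> \oo] --> (\1_(obox a b) x : R).
Proof.
rewrite indicE; have [xo|xo] := boolP (x \in obox a b); last first.
  rewrite (_ : (fun k => bumpf k a b x) = fun=> 0); first exact: cvg_cst.
  by apply/funext => k; apply: bumpf_out => h; move/negP : xo; apply; exact/mem_set.
move/set_mem : xo => xo.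
suff : bumpf k a b x @[k --> \oo] --> (\prod_(i : 'I_n) 1 : R) by rewrite big1_eq.
rewrite /bumpf; elim: (index_enum _) => [|i s IH].
  by rewrite big_nil; under eq_fun do rewrite big_nil; exact: cvg_cst.
rewrite big_cons; under eq_fun do rewrite big_cons; apply: cvgM => //.
have /andP[h1 h2] := xo i.
suff : flat 0 (k.+1%:R * x ord0 i + - (k.+1%:R * a ord0 i)) *
    flat 0 (- k.+1%:R * x ord0 i + k.+1%:R * b ord0 i) @[k --> \oo] --> ((true%:R : R) * (true%:R : R)).
  by rewrite mulr1.
apply: cvgM.
  have := @cvg_flat (x ord0 i - a ord0 i); rewrite subr_gt0 h1.
  by under eq_fun do rewrite mulrBr.
have := @cvg_flat (b ord0 i - x ord0 i); rewrite subr_gt0 h2.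
by under eq_fun do rewrite mulrBr addrC -mulNr.
Qed.

End smooth_functions.

Lemma cvg_constant (R : realType) (a : nat -> R) (c l : R) :
  a @ \oo --> l -> (forall k, a k = c) -> l = c.
Proof.
move=> al ac; have e : a = fun=> c by exact/funext.
rewrite e in al; apply/esym; have h : (fun=> c) @ \oo --> c by exact: cvg_cst.
by rewrite -(cvg_lim (@norm_hausdorff _ _) al) (cvg_lim (@norm_hausdorff _ _) h).
Qed.

(** * Functions with zero integral on a generating family *)

Section fundamental_lemma.
Context d (T : measurableType d) (R : realType) (mu : {measure set T -> \bar R}).
Implicit Types (f g h : T -> R).

Lemma Int_cutset f A : measurable A -> Int mu f -> Int mu (fun x => f x * \1_A x).
Proof.
move=> mA iF; apply: Int_dom (Int_abs iF) _ => [|x].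
  by apply: measurable_funM; [exact: Int_meas iF|exact: measurable_indic].
rewrite indicE; case: (_ \in _); rewrite ?mulr1// mulr0 normr0; exact: normr_ge0.
Qed.

(** The measurable sets over which f has zero integral form a Dynkin system, and [G] is stable under
    intersection. *)
Lemma J_generator f (G : set (set T)) : Int mu f -> measurable `<=` <<s G >> ->
  G `<=` measurable -> setI_closed G -> J mu f = 0 ->
  (forall A, G A -> J mu (fun x => f x * \1_A x) = 0) ->
  forall A, measurable A -> J mu (fun x => f x * \1_A x) = 0.
Proof.
move=> iF mG Gm GI f0 fG.
suff sub : <<d G >> `<=` [set A | measurable A /\ J mu (fun x => f x * \1_A x) = 0].
  by move=> A /mG; rewrite -setI_closed_g_dynkin_g_sigma_algebra// => /sub[].
apply: smallest_sub; last by move=> A GA; split; [exact: Gm|exact: fG].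
split.
- split; first exact: measurableT.
  by rewrite -[RHS]f0; apply: J_ext => x; rewrite indicT mulr1.
- move=> A [mA A0]; split; first exact: measurableC.
  rewrite (@J_ext _ _ _ mu _ (fun x => f x - f x * \1_A x)) => [|x].
    by rewrite JB ?A0 ?f0 ?subr0//; exact: Int_cutset.
  by rewrite !indicE in_setC; case: (_ \in _); rewrite /= ?mulr1 ?mulr0 ?subrr ?subr0.
- move=> F tF FF; have mF k : measurable (F k) by have [] := FF k.
  have mU : measurable (\bigcup_k F k) by exact: bigcup_measurable.
  split => //.
  have JU k : J mu (fun x => f x * \1_(\big[setU/set0]_(i < k) F i) x) = 0.
    elim: k => [|k IH].
      rewrite (@J_ext _ _ _ mu _ (fun=> 0)) ?J0// => x; rewrite big_ord0 indicE in_set0 mulr0//.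
    rewrite (@J_ext _ _ _ mu _ (fun x => f x * \1_(\big[setU/set0]_(i < k) F i) x + f x * \1_(F k) x)) => [|x].
      rewrite JD ?IH ?add0r; [by have [] := FF k|apply: Int_cutset => //|exact: Int_cutset].
      by apply: bigsetU_measurable.
    rewrite big_ord_recr/= -mulrDr !indicE in_setU; congr (_ * _).
    have [h1|] := boolP (x \in F k); last by rewrite orbF addr0.
    have [h2|] := boolP (x \in \big[setU/set0]_(i < k) F i); last by rewrite add0r.
    exfalso; move/set_mem : h2; rewrite -bigcup_mkord => -[j jk Fj].
    move/trivIsetP : tF => /(_ j k I I); rewrite (ltn_eqF jk) => /(_ isT) e.
    suff : (F j `&` F k) x by rewrite e.
    by split => //; exact: set_mem h1.
  have cv : {ae mu, forall x, f x * \1_(\big[setU/set0]_(i < k) F i) x @[k --> \oo] --> f x * \1_(\bigcup_k F k) x}.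
    apply: nearW => x; apply: cvgM; first exact: cvg_cst.
    rewrite !indicE; have [h|h] := boolP (x \in \bigcup_k F k).
      move/set_mem : h => -[j _ Fj]; apply: cvg_near_cst; exists j.+1 => // k jk.
      by rewrite indicE mem_set// -bigcup_mkord; exists j.
    apply: cvg_near_cst; apply: nearW => k; rewrite indicE; case: (boolP (x \in _)) => // /set_mem.
    rewrite -bigcup_mkord => -[j _ Fj]; case/negP : h; apply/mem_set; by exists j.
  have [] := dct _ _ (Int_abs iF) cv.
  - by move=> k; apply: Int_meas; apply: Int_cutset => //; exact: bigsetU_measurable.
  - by apply: Int_meas; exact: Int_cutset.
  - move=> k x; rewrite indicE; case: (_ \in _); rewrite ?mulr1// mulr0 normr0; exact: normr_ge0.
  by move=> _ /cvg_constant; exact.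
Qed.

Lemma ae_eq0_of_J f : Int mu f -> (forall A, measurable A -> J mu (fun x => f x * \1_A x) = 0) ->
  {ae mu, forall x, f x = 0}.
Proof.
move=> iF h; have mf := Int_meas iF.
pose A := [set x | 0 <= f x]; pose B := [set x | f x <= 0].
have mA : measurable A.
  have := mf measurableT _ (measurable_itv `[0, +oo[); rewrite setTI; congr measurable.
  by apply/seteqP; split => x; rewrite /A /= in_itv/= andbT.
have mB : measurable B.
  by have := mf measurableT _ (measurable_itv `]-oo, 0]); rewrite setTI.
have hA := J_eq0 (Int_cutset mA iF) _ (h A mA).
have hB := J_eq0 (IntN (Int_cutset mB iF)) _ _.
have {}hA := hA (fun x => _ : 0 <= f x * \1_A x).
have {}hA : {ae mu, forall x, f x * \1_A x = 0}.
  apply: hA => x; rewrite indicE; have [/set_mem xA|_] := boolP (x \in A); last by rewrite mulr0.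
  by rewrite mulr1.
have {}hB : {ae mu, forall x, - (f x * \1_B x) = 0}.
  apply: hB => [x|]; last by rewrite JN ?h ?oppr0//; exact: Int_cutset.
  rewrite indicE; have [/set_mem xB|_] := boolP (x \in B); last by rewrite mulr0 oppr0.
  by rewrite mulr1 oppr_ge0.
apply: filterS2 hA hB => x; have [x0|x0] := leP 0 (f x).
  by rewrite indicE mem_set// mulr1.
have xB : x \in B by apply/mem_set; exact: ltW.
by move=> _ /eqP; rewrite (indicE _ B) xB mulr1 oppr_eq0 => /eqP.
Qed.

End fundamental_lemma.

(** * The fundamental lemma of the calculus of variations *)

Section test_function_duality.
Context (R : realType) (n : nat).
Local Notation mu := (lebesgue_rV R n).
Implicit Types (h : 'rV[R]_n -> R) (a b : 'rV[R]_n).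

Lemma obox_measurable a b : measurable (obox a b).
Proof.
rewrite (_ : obox a b = \bigcap_(i in [set: 'I_n]) ((fun x : 'rV[R]_n =>
    x ord0 i : measurableTypeR R) @^-1` `]a ord0 i, b ord0 i[%classic)).
  apply: fin_bigcap_measurable => // i _; rewrite -[X in measurable X]setTI.
  by apply: measurable_rV_coord => //; exact: measurable_itv.
by apply/seteqP; split=> x /= h i => [_|]; have := h i; rewrite /= in_itv/= // => ->.
Qed.

Lemma oboxI a b a' b' : obox a b `&` obox a' b' =
  obox (\row_i Num.max (a ord0 i) (a' ord0 i)) (\row_i Num.min (b ord0 i) (b' ord0 i)).
Proof.
apply/seteqP; split=> x /=.
  by move=> [h1 h2] i; rewrite !mxE gt_max lt_min; have /andP[-> ->] := h1 i; have /andP[-> ->] := h2 i.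
move=> h; split=> i; have := h i; rewrite !mxE gt_max lt_min => /andP[/andP[h1 h2] /andP[h3 h4]]; exact/andP.
Qed.

Lemma obox_generates : measurable `<=` <<s [set A : set 'rV[R]_n | exists a b, A = obox a b] >>.
Proof.
apply: smallest_sub; first exact: smallest_sigma_algebra.
move=> A; rewrite -bigcup_seq => -[i _ [B mB <-]]; rewrite setTI.
pose G := [set A : set 'rV[R]_n | exists a b, A = obox a b].
pose E := [set B : set (measurableTypeR R) | <<s G >> ((fun x : 'rV[R]_n => x ord0 i : R) @^-1` B)].
suff : measurable `<=` E by move=> /(_ B mB).
rewrite RGenOpens.measurableE.
have [sT sC sU] := @smallest_sigma_algebra _ setT G.
apply: smallest_sub.
  split.
  - by rewrite /E/= preimage_set0; exact: sT.
  - by move=> C EC; rewrite /E/= setTD -preimage_setC -setTD; exact: sC.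
  - by move=> F EF; rewrite /E/= preimage_bigcup; exact: sU.
move=> _ [p [q ->]]; rewrite /E/=.
rewrite (_ : _ @^-1` _ = \bigcup_k obox
  (\row_j if j == i then p else - k%:R) (\row_j if j == i then q else k%:R)).
  by apply: sU => k; apply: sub_gen_smallest; eexists; eexists; reflexivity.
apply/seteqP; split=> x /=; last first.
  by move=> [k _ /(_ i)]; rewrite !mxE eqxx in_itv.
rewrite in_itv/= => h; exists (Num.bound `|x|) => // j; rewrite !mxE.
case: eqP => [->//|_]; rewrite -ltr_norml; apply: le_lt_trans (coord_le_norm x j) _.
exact: archi_boundP.
Qed.

Lemma Sq_indic_box (M : R) : Sq mu (\1_(@box R n M)).
Proof.
have [mB fB] := lebesgue_rV_box n M; split; first exact: measurable_indic.
apply: Int_ext (Int_indic mB fB) => x; rewrite indicE; case: (_ \in _); rewrite ?expr1n// expr0n//.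
Qed.

(** By dominated convergence along [bumpf], h has zero integral over every open box, and open boxes
    generate. As h is only square integrable, it is first restricted to the bounded boxes [K m]. *)
Lemma fundamental_lemma h : Sq mu h ->
  (forall phi, Sm phi -> bsupp phi -> J mu (fun x => h x * phi x) = 0) ->
  {ae mu, forall x, h x = 0}.
Proof.
move=> sh hphi.
have ib M := Int_mul sh (Sq_indic_box M).
have Jb a b : J mu (fun x => h x * \1_(obox a b) x) = 0.
  pose M := Num.max `|a| `|b|.
  have cv : {ae mu, forall x, h x * bumpf k a b x @[k --> \oo] --> h x * \1_(obox a b) x}.
    by apply: nearW => x; apply: cvgM; [exact: cvg_cst|exact: cvg_bumpf].
  have mb k : measurable_fun setT (bumpf k a b).
    by apply: continuous_measurable_rV; have [g [cf _ _] _] := Sm_derive (Sm_bumpf k a b).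
  have [] := dct _ _ (Int_abs (ib M)) cv.
  - by move=> k; apply: measurable_funM => //; exact: sh.1.
  - by apply: measurable_funM; [exact: sh.1|apply: measurable_indic; exact: obox_measurable].
  - move=> k x; rewrite !normrM; have [xo|xo] := pselect (obox a b x).
      rewrite indic_boxE ?obox_norm// normr1 mulr1 ler_piMr//.
      by have /andP[b0 b1] := bumpf01 k a b x; rewrite ger0_norm.
    by rewrite bumpf_out// normr0 mulr0 mulr_ge0.
  by move=> _ /cvg_constant; apply => k; apply: hphi; [exact: Sm_bumpf|exact: bsupp_bumpf].
pose K (m : nat) : set 'rV[R]_n := obox (const_mx (- m%:R)) (const_mx (m%:R : R)).
have sK m : Int mu (fun x => h x * \1_(K m) x).
  apply: (Int_dom _ (Int_abs (ib m%:R))).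
    by apply: measurable_funM; [exact: sh.1|apply: measurable_indic; exact: obox_measurable].
  move=> x; rewrite !normrM ler_wpM2l// !indicE.
  have [/set_mem xK|_] := boolP (x \in K m); last by rewrite normr0.
  rewrite (_ : x \in box m%:R)//; apply/mem_set => i.
  by have := xK i; rewrite !mxE /= in_itv/= => /andP[/ltW -> /ltW ->].
have aeK m : {ae mu, forall x, h x * \1_(K m) x = 0}.
  apply: (ae_eq0_of_J (sK m)).
  apply: (J_generator (sK m) obox_generates).
  - by move=> _ [a [b ->]]; exact: obox_measurable.
  - by move=> _ _ [a [b ->]] [a' [b' ->]]; rewrite oboxI; eexists; eexists; reflexivity.
  - exact: Jb.
  - move=> _ [a [b ->]]; rewrite -[RHS](Jb (\row_i Num.max (- m%:R) (a ord0 i)) (\row_i Num.min m%:R (b ord0 i))).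
    apply: J_ext => x; rewrite -mulrA; congr (_ * _).
    have := @oboxI (const_mx (- m%:R)) (const_mx m%:R) a b; rewrite -/(K m) => e.
    rewrite -[\1_(K m) x * _]/((\1_(K m) \* \1_(obox a b)) x) -indicI e.
    by congr (\1_(obox _ _) x); apply/rowP => i; rewrite !mxE.
move/ae_foralln : aeK; apply: filterS => x H.
have := H (Num.bound `|x|); rewrite indicE mem_set ?mulr1// => i; rewrite !mxE -ltr_norml.
by apply: le_lt_trans (coord_le_norm x i) _; exact: archi_boundP.
Qed.

End test_function_duality.

(** * Density by orthogonal projection *)

Section density.
Context d (T : measurableType d) (R : realType) (mu : {measure set T -> \bar R}).
Implicit Types (f g h : T -> R).

Lemma nrm_parallelogram (p h k : T -> R) : Sq mu p -> Sq mu h -> Sq mu k ->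
  nrm mu (fun x => p x - h x) ^+ 2 + 4 * nrm mu (fun x => k x - 2^-1 * (p x + h x)) ^+ 2 =
  2 * nrm mu (fun x => k x - p x) ^+ 2 + 2 * nrm mu (fun x => k x - h x) ^+ 2.
Proof.
move=> sp sh sk; rewrite !nrm_sq.
have s1 := SqB sp sh; have s2 := SqB sk (SqZ 2^-1 (SqD sp sh)).
have s3 := SqB sk sp; have s4 := SqB sk sh.
rewrite -!(JZ _ s2.2) -!(JZ _ s3.2) -!(JZ _ s4.2).
rewrite -(JD s1.2 (IntZ 4 s2.2)) -(JD (IntZ 2 s3.2) (IntZ 2 s4.2)).
by apply: J_ext => x; field.
Qed.

Lemma nrm_le_eps f (e : R) : 0 <= e -> (forall d, 0 < d -> nrm mu f <= e + d) -> nrm mu f <= e.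
Proof. by move=> e0 h; rewrite leNgt; apply/negP => lt; have := h ((nrm mu f - e) / 2); lra. Qed.

Lemma nrm_ae0 f : measurable_fun setT f -> {ae mu, forall x, f x = 0} -> nrm mu f = 0.
Proof.
move=> mf f0; have f20 : {ae mu, forall x, 0 = f x ^+ 2} by apply: filterS f0 => x ->; rewrite expr0n.
by have [_ e] := J_ae (measurable_funX 2 mf) (Int0 mu) f20; rewrite /nrm e J0 sqrtr0.
Qed.

(* The near-minimisers of the distance from h to V are Cauchy, and their limit
   p is such that h - p is orthogonal to V. *)
Lemma dense_of_orthogonal (V : (T -> R) -> Prop) : V (fun=> 0) -> (forall f, V f -> Sq mu f) ->
  (forall f g c, V f -> V g -> V (fun x => f x + c * g x)) ->
  (forall h, Sq mu h -> (forall f, V f -> J mu (fun x => h x * f x) = 0) ->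
    {ae mu, forall x, h x = 0}) ->
  forall h (e : R), Sq mu h -> 0 < e -> exists2 f, V f & nrm mu (fun x => h x - f x) <= e.
Proof.
move=> V0 VS VD Vo h e sh e0.
pose S : set R := [set r | exists2 f, V f & r = nrm mu (fun x => h x - f x) ^+ 2].
have iS : has_inf S.
  split; first by exists (nrm mu (fun x => h x - 0) ^+ 2), (fun=> 0).
  by exists 0 => _ [f _ ->]; exact: sqr_ge0.
pose D := inf S.
have DP f : V f -> D <= nrm mu (fun x => h x - f x) ^+ 2.
  by move=> Vf; apply: ge_inf; [exact: iS.2|exists f].
have D0 : 0 <= D by apply: lb_le_inf; [exact: iS.1|move=> _ [f _ ->]; exact: sqr_ge0].
have /choice[p hp] (k : nat) : exists f, V f /\ nrm mu (fun x => h x - f x) ^+ 2 < D + k.+1%:R^-1.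
  have k0 : 0 < k.+1%:R^-1 :> R by rewrite invr_gt0.
  by have [_ [f Vf ->] lt] := inf_adherent k0 iS; exists f.
have sp k : Sq mu (p k) by apply: VS; have [] := hp k.
have mid k l : V (fun x => 2^-1 * (p k x + p l x)).
  have := VD _ _ (2^-1) (VD _ _ (2^-1) V0 (hp k).1) (hp l).1.
  by congr V; apply/funext => x; ring.
have cau k l : nrm mu (fun x => p k x - p l x) ^+ 2 <= 2 * k.+1%:R^-1 + 2 * l.+1%:R^-1.
  have := nrm_parallelogram (sp k) (sp l) sh; have := DP _ (mid k l).
  have [_] := hp k; have [_] := hp l; move: (_ ^+ 2) (_ ^+ 2) (_ ^+ 2) (_ ^+ 2) => a b c m.
  by move: (_^-1) (_^-1) => x y; lra.
have inv_lt (r : R) : 0 < r -> exists K, forall k, (K <= k)%N -> k.+1%:R^-1 < r.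
  move=> r0; exists (Num.bound r^-1) => k Kk; rewrite invf_plt ?posrE//.
  apply: lt_le_trans (_ : (Num.bound r^-1)%:R <= _); last by rewrite ler_nat ltnW.
  by apply: archi_boundP; rewrite invr_ge0 ltW.
have [q sq hq] : exists2 q, Sq mu q & forall e : R, 0 < e -> exists K, forall k, (K <= k)%N -> nrm mu (fun x => p k x - q x) <= e.
  have [|q [_ [sq _ _ hq]]] := L2_complete sp; last by exists q.
  move=> r r0; have [K hK] := inv_lt (r ^+ 2 / 4) (divr_gt0 (exprn_gt0 2 r0) (ltr0n _ 4)).
  exists K => k l Kk Kl; rewrite -(@ler_pXn2r _ 2)// ?nnegrE ?nrm_ge0 ?(ltW r0)//.
  apply: le_trans (cau k l) _; have := hK k Kk; have := hK l Kl.
  by move: (r ^+ 2) (l.+1%:R^-1) (k.+1%:R^-1) => a b c; lra.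
pose s := Num.sqrt D; have s0 : 0 <= s by exact: sqrtr_ge0.
have s2 : s ^+ 2 = D by rewrite sqr_sqrtr.
have shq := SqB sh sq.
have near_q (r : R) : 0 < r -> exists k, nrm mu (fun x => h x - p k x) <= s + r /\ nrm mu (fun x => p k x - q x) <= r.
  move=> r0; have [K1 h1] := hq r r0; have [K2 h2] := inv_lt _ (exprn_gt0 2 r0).
  exists (maxn K1 K2); split; last by apply: h1; exact: leq_maxl.
  rewrite -(@ler_pXn2r _ 2)// ?nnegrE ?nrm_ge0 ?addr_ge0 ?(ltW r0)//.
  apply: le_trans (ltW (hp _).2) _; have := h2 _ (leq_maxr K1 K2); rewrite sqrrD s2.
  have := mulr_ge0 s0 (ltW r0); move: (r ^+ 2) (s * r) (_^-1) => a b c; lra.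
have up : nrm mu (fun x => h x - q x) <= s.
  apply: nrm_le_eps => // r r0; have r20 : 0 < r / 2 by rewrite divr_gt0.
  have [k [k1 k2]] := near_q _ r20; have := nrm_tri sh (sp k) sq; lra.
have low f t : V f -> s <= nrm mu (fun x => h x - q x + t * f x).
  move=> Vf; have sf := VS f Vf; have sfq := SqD shq (SqZ t sf).
  rewrite leNgt; apply/negP => lt; set m := nrm mu _ in lt.
  have r0 : 0 < (s - m) / 2 by lra.
  have [k [_ k2]] := near_q _ r0.
  have VV := VD _ _ (- t) (hp k).1 Vf.
  have := DP _ VV; rewrite -s2 ler_pXn2r ?nnegrE ?nrm_ge0// => le.
  have := nrmD sfq (SqB sq (sp k)); rewrite -/m (nrmC _ q).
  rewrite (_ : (fun x => h x - q x + t * f x + (q x - p k x)) = fun x => h x - (p k x + - t * f x)); last first.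
    by apply/funext => x; ring.
  by lra.
have orth f : V f -> J mu (fun x => (h x - q x) * f x) = 0.
  move=> Vf; have sf := VS f Vf.
  (* h - q has least norm among the h - q + t f, so the quadratic in t has nonnegative increment;
     its constant term is 0, and so is the discriminant bound. *)
  have : J mu (fun x => (h x - q x) * f x) ^+ 2 <= 0 * J mu (fun x => f x ^+ 2).
    apply: quad_disc => t; have := low f t Vf => le.
    have : nrm mu (fun x => h x - q x) ^+ 2 <= nrm mu (fun x => h x - q x + t * f x) ^+ 2.
      by rewrite ler_pXn2r ?nnegrE ?nrm_ge0//; exact: le_trans le.
    by rewrite !nrm_sq J_sqD//; lra.
  by rewrite mul0r => le; apply/eqP; rewrite -sqrf_eq0 eq_le le sqr_ge0.
have ae0 := Vo _ shq orth.
have n0 : nrm mu (fun x => h x - q x) = 0.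
  exact: nrm_ae0 shq.1 ae0.
have [k [_ k2]] := near_q e e0; exists (p k); first exact: (hp k).1.
by have := nrm_tri sh sq (sp k); rewrite n0 (nrmC _ q); lra.
Qed.

End density.

(** * Mollification in L^2 and weak derivatives *)

Section mollify_L2.
Context (R : realType) (n : nat).
Local Notation mu := (lebesgue_rV R n).
Implicit Types (u h phi rho : 'rV[R]_n -> R) (g : 'I_n -> 'rV[R]_n -> R).

Lemma Sm_Sq phi : Sm phi -> bsupp phi -> Sq mu phi.
Proof.
by move=> Sp bp; have [g cg _] := Sm_derive Sp; apply: Cc_Sq; split => //; have [] := cg.
Qed.

Lemma Sm_dense h (e : R) : Sq mu h -> 0 < e ->
  exists2 phi, (Sm phi /\ bsupp phi) & nrm mu (fun x => h x - phi x) <= e.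
Proof.
move=> sh e0; apply: (@dense_of_orthogonal _ _ _ mu (fun phi => Sm phi /\ bsupp phi)) => //.
- by split; [exact: Sm_cst|exists 0].
- by move=> f [Sf bf]; exact: Sm_Sq.
- move=> f g c [Sf bf] [Sg bg]; split; first by apply: SmD => //; apply: SmM => //; exact: Sm_cst.
  by apply: bsuppD => //; have [M hM] := bg; exists M => x /hM ->; rewrite mulr0.
- by move=> {}h {}sh H; apply: fundamental_lemma => // phi Sp bp; exact: H.
Qed.

(** Allows a bump to be normalised: it is positive on a cube of positive measure, so its integral is
    nonzero. *)
Lemma lebesgue_obox (r : R) : 0 < r ->
  lebesgue_rV R n (obox (const_mx (- r)) (const_mx r)) != 0%E.
Proof.
move=> r0; rewrite (_ : obox _ _ = [set x : 'rV[R]_n | forall i, `]- r, r[%classic (x ord0 i)]).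
  rewrite (lebesgue_rV_prod (A := fun=> `]- r, r[%classic))//.
  rewrite (_ : (\prod_(i < n) _)%E = (\prod_(i < n) (r + r))%:E).
    rewrite eqe prodf_seq_neq0; apply/allP => i _ /=; lra.
  elim/big_ind2 : _ => // [x1 x2 y1 y2 -> ->|i _]; first by rewrite EFinM.
  by rewrite lebesgue_measure_itv /= lte_fin (_ : - r < r) ?EFinN ?oppeK//; lra.
by apply/seteqP; split=> x /= h i; have := h i; rewrite !mxE in_itv.
Qed.

Lemma smooth_mollifier (r : R) : 0 < r -> exists2 rho : 'rV[R]_n -> R, mollifier rho &
  Sm rho /\ forall y, rho y != 0 -> `|y| <= r.
Proof.
move=> r0; pose b : 'rV[R]_n -> R := bumpf 0 (const_mx (- r)) (const_mx r).
have Sb : Sm b by exact: Sm_bumpf.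
have [db [cb _ _] _] := Sm_derive Sb.
have Cb : Cc b by split => //; exact: bsupp_bumpf.
have ib := Cc_Int Cb; have b0 x : 0 <= b x by have /andP[] := bumpf01 0 (const_mx (- r)) (const_mx r) x.
have bpos x : obox (const_mx (- r)) (const_mx r) x -> 0 < b x.
  move=> h; rewrite /b /bumpf; apply: prodr_gt0 => i _; have := h i; rewrite !mxE => /andP[h1 h2].
  have F (t : R) : 0 < t -> 0 < flat 0 t by move=> t0; rewrite /flat t0 expr0 mul1r expR_gt0.
  by apply: mulr_gt0; apply: F; lra.
have Jb : J mu b != 0.
  apply/eqP => Jb0; have [A [mA A0 hA]] := J_eq0 ib b0 Jb0.
  have := lebesgue_obox r0; apply/negP/negPn; rewrite -measure_le0 -A0.
  apply: le_measure; rewrite ?inE//; first exact: obox_measurable.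
  by move=> x /bpos h; apply: hA => /= h0; rewrite h0 ltxx in h.
have Jp : 0 < J mu b by rewrite lt_neqAle eq_sym Jb J_ge0.
exists (fun x => (J mu b)^-1 * b x); first split.
- exact: CcZ.
- by move=> x; rewrite mulr_ge0// invr_ge0 ltW.
- by rewrite JZ// mulVf.
- split; first by apply: SmM => //; exact: Sm_cst.
  move=> y; rewrite mulf_eq0 negb_or => /andP[_ by0]; apply: contrapT => /negP; rewrite -ltNge => h.
  move/eqP : by0; apply; apply: bumpf_out => /obox_norm; apply/negP; rewrite -ltNge gt_max.
  have N (c : R) : `|const_mx c : 'rV[R]_n| <= `|c| by apply: norm_le_coord => // i; rewrite mxE.
  by rewrite !(le_lt_trans (N _))// ?normrN gtr0_norm.
Qed.

Lemma molB rho u h : mollifier rho -> Sq mu u -> Sq mu h ->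
  (fun x => mol rho u x - mol rho h x) = mol rho (fun x => u x - h x).
Proof.
move=> [cr _ _] su sh; apply/funext => x; rewrite -JB; try exact: Int_mol.
by apply: J_ext => y; rewrite mulrBl.
Qed.

Lemma nrm_mol rho u : mollifier rho -> Sq mu u -> nrm mu (mol rho u) <= nrm mu u.
Proof. by move=> mr su; apply: ler_wsqrtr; have [] := Sq_mol mr su. Qed.

(** The radius depends on h alone and serves every mollifier: h is approximated by a smooth
    function, for which [mol_close] gives a rate. *)
Lemma mol_cvg h (e : R) : Sq mu h -> 0 < e -> exists2 r : R, 0 < r & forall rho, mollifier rho ->
  (forall y, rho y != 0 -> `|y| <= r) -> nrm mu (fun x => mol rho h x - h x) <= e.
Proof.
move=> sh e0; have e4 : 0 < e / 4 by rewrite divr_gt0.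
have [phi [Sp bp] hphi] := Sm_dense sh e4; have sp := Sm_Sq Sp bp.
have [g cg Sg] := Sm_derive Sp.
have sg i : Sq mu (g i) by apply: Cc_Sq; exact: (@C1c_Ccd R n phi g i).
pose G := \sum_i nrm mu (g i); have G0 : 0 <= G by apply: sumr_ge0 => i _; exact: nrm_ge0.
pose r := e / 4 / (G + 1); have r0 : 0 < r by rewrite divr_gt0// ltr_wpDl.
exists r => // rho mr hr; have [cr _ _] := mr.
have sm u := (@Sq_mol R n rho u mr).
have h1 : nrm mu (fun x => mol rho h x - mol rho phi x) <= e / 4.
  by rewrite molB//; apply: le_trans (nrm_mol mr (SqB sh sp)) _.
have h2 : nrm mu (fun x => mol rho phi x - phi x) <= e / 4.
  apply: le_trans (mol_close mr cg sp sg (ltW r0) hr) _; rewrite -/G /r mulrAC ler_pdivrMr ?ltr_wpDl//.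
  by rewrite ler_wpM2l ?(ltW e4)// lerDl.
have k1 := nrm_tri (sm _ sh).1 (sm _ sp).1 sh; have k2 := nrm_tri (sm _ sp).1 sp sh.
rewrite (nrmC _ phi h) in k2; move: h1 h2 k1 k2 hphi.
by move: (nrm _ _) (nrm _ _) (nrm _ _) (nrm _ _) => a b c d; lra.
Qed.

Lemma Sm_shift phi (b : 'rV[R]_n) : Sm phi -> Sm (fun y => phi (y + b)).
Proof.
elim=> [c|k c t i|f g _ IH1 _ IH2|f g _ IH1 _ IH2]; [exact: Sm_cst| |exact: SmD|exact: SmM].
have := @Sm_flat R n k c (c * b ord0 i + t) i; congr Sm; apply/funext => x.
by rewrite mxE mulrDr addrA.
Qed.

(** A weak derivative tested only against the class [Sm]; it is linked with [is_weak_partial] at the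
    end. *)
Definition weakp i u (g : 'rV[R]_n -> R) := forall phi, Sm phi -> bsupp phi ->
  J mu (fun x => u x * partial i phi x) = - J mu (fun x => g x * phi x).

Lemma bsupp_shift u (b : 'rV[R]_n) : bsupp u -> bsupp (fun y => u (y + b)).
Proof.
move=> [M hM]; exists (M + `|b|) => y My; apply: hM.
by have := ler_normB (y + b) b; rewrite addrK; lra.
Qed.

(** Differentiation under the integral puts the derivative on rho; the weak identity with the test
    function rho (y - x) moves it to u. *)
Lemma pd_mol rho u i (g : 'rV[R]_n -> R) : Sm rho -> bsupp rho -> Sq mu u -> Sq mu g -> weakp i u g ->
  pd i (mol rho u) (mol rho g).
Proof.
move=> Sr br su sg w x; have [dr cdr Sdr] := Sm_derive Sr.
have cr : Cc rho by split => //; have [] := cdr.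
have C1r : C1c rho dr by [].
have cdi := C1c_Ccd i C1r; have [M M0 hM] := bsupp_pos cdi.2.
have [C C0 hC] := Cc_bounded (@ball_compact_rV R n) cdi.
have [_ _ dd] := cdr.
pose f' (s : R) (y : 'rV[R]_n) : R := u y * - dr i (y - x - s *: e_ R i).
have E : (fun s : R => mol rho u (x + s *: e_ R i)) = (fun s => J mu (fun y => u y * rho (y - x - s *: e_ R i))).
  by apply/funext => s; rewrite (molE _ cr su); apply: J_ext => y; rewrite opprD addrA.
have D : is_derive (0 : R) 1 (fun s : R => mol rho u (x + s *: e_ R i)) (J mu (f' 0)).
  rewrite E; pose B := M + 1 + `|x|.
  apply: (is_derive_J (f := fun s y => u y * rho (y - x - s *: e_ R i)) (f' := f')
    (G := fun y => C * (`|u y| * \1_(@box R n B) y))).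
  - move=> s y; have d1 := @dcomp R (fun t => rho (y - x + t *: e_ R i)) (fun t => - t) s _ _
      (pd_line (y - x) (- s) (dd i)) (dN (did s)).
    apply: (dE (dM (dcst (u y) s) d1)) => [t|]; first by rewrite scaleNr.
    by rewrite /f' mul0r add0r scaleNr; ring.
  - move=> s; apply: (Int_mul su).
    rewrite (_ : (fun y => _) = (fun y => rho (y + (- x - s *: e_ R i)))).
      by apply: Sq_shift; exact: Cc_Sq.
    by apply/funext => y; rewrite addrA.
  - by apply: IntZ; apply: Int_mul; [exact: Sq_abs|exact: Sq_indic_box].
  - move=> s y; rewrite subr0 => s1; rewrite /f' normrM normrN.
    have [yB|yB] := leP `|y| B.
      by rewrite indic_boxE// mulr1 mulrC ler_wpM2r.
    rewrite hM ?normr0 ?mulr0.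
      by rewrite mulr_ge0 ?(ltW C0)// mulr_ge0// indicE.
    have h1 : `|s *: e_ R i| <= 1.
      by rewrite normrZ; apply: mulr_ile1 => //; [exact: ltW|exact: e_norm].
    have := ler_normB y x; have := ler_normB (y - x) (s *: e_ R i).
    have := ler_normB (y - x - s *: e_ R i + s *: e_ R i) (- x).
    have := ler_normD (y - x - s *: e_ R i) (s *: e_ R i).
    rewrite subrK opprK subrK normrN; rewrite /B in yB; lra.
have -> : mol rho g x = J mu (f' 0); last exact: D.
have Srx := Sm_shift (- x) Sr; have brx := bsupp_shift (- x) br.
have := w _ Srx brx; rewrite molE// => e; apply: oppr_inj; rewrite -e -JN.
  apply: J_ext => y; rewrite /f' scale0r subr0 mulrN opprK; congr (_ * _).
  have [d cd _] := Sm_derive Srx; rewrite (C1_partial cd).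
  have [_ _ dx] := cd; have h1 := dx i y; have h2 := dd i (y - x).
  rewrite -(@derive_val _ _ _ _ _ _ _ h1) -(@derive_val _ _ _ _ _ _ _ h2).
  rewrite (_ : (fun s : R => rho (y + s *: e_ R i - x)) = (fun s : R => rho (y - x + s *: e_ R i)))//.
  by apply/funext => s; rewrite addrAC.
apply: (Int_mul su); rewrite (_ : (fun y => _) = (fun y => - 1 * dr i (y + - x))).
  by apply: SqZ; apply: Sq_shift; exact: Cc_Sq.
by apply/funext => y; rewrite scale0r subr0 mulN1r.
Qed.

Lemma C1_mol rho u g : Sm rho -> bsupp rho -> Sq mu u -> (forall i, Sq mu (g i)) ->
  (forall i, weakp i u (g i)) -> C1 (mol rho u) (fun i => mol rho (g i)).
Proof.
move=> Sr br su sg w; have [dr [cr _ _] _] := Sm_derive Sr.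
split; [exact: continuous_mol|by move=> i; exact: continuous_mol|].
by move=> i; exact: pd_mol.
Qed.

Lemma weakp_unique i u (g1 g2 : 'rV[R]_n -> R) : Sq mu g1 -> Sq mu g2 -> weakp i u g1 -> weakp i u g2 ->
  {ae mu, forall x, g1 x = g2 x}.
Proof.
move=> s1 s2 w1 w2; have := @fundamental_lemma R n _ (SqB s1 s2).
have H phi : Sm phi -> bsupp phi -> J mu (fun x => (g1 x - g2 x) * phi x) = 0.
  move=> Sp bp; have sp := Sm_Sq Sp bp; have i1 := Int_mul s1 sp; have i2 := Int_mul s2 sp.
  rewrite (@J_ext _ _ _ mu _ (fun x => g1 x * phi x - g2 x * phi x)) => [|x]; last by rewrite mulrBl.
  by rewrite JB// -[X in X - _]opprK -(w1 _ Sp bp) (w2 _ Sp bp); ring.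
by move=> /(_ H); apply: filterS => x /eqP; rewrite subr_eq0 => /eqP.
Qed.

End mollify_L2.

(** * Splitting the entropy integrand *)

Section positive_entropy.
Context (R : realType).
Implicit Types s t y c : R.

(* Fl = PP - Phi splits the entropy into a part with good growth bounds and a
   bounded part carrying the tails. *)
Definition PP s : R := s ^+ 2 * ln (1 + s ^+ 2).
Definition Phi s : R := PP s - Fl s.

Lemma sq1_gt0 s : 0 < 1 + s ^+ 2. Proof. by rewrite ltr_wpDr// sqr_ge0. Qed.

Lemma PP_ge0 s : 0 <= PP s.
Proof. by rewrite /PP mulr_ge0 ?sqr_ge0// ln_ge0// lerDl sqr_ge0. Qed.

Lemma PP0 : PP 0 = 0. Proof. by rewrite /PP expr0n mul0r. Qed.
Lemma Phi0 : Phi 0 = 0. Proof. by rewrite /Phi PP0 Fl0 subrr. Qed.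

Lemma cts_PP : continuous PP.
Proof.
have c2 : continuous (fun s : R => s ^+ 2) by apply: ctsX => s; exact: cvg_id.
apply: ctsM => //; apply: cts_ln => [|s]; last exact: sq1_gt0.
by apply: ctsD => //; exact: cts_cst.
Qed.

Lemma cts_Phi : continuous Phi.
Proof. by apply: ctsB; [exact: cts_PP|exact: cts_Fl]. Qed.

Lemma PhiE s : Phi s = s ^+ 2 * (ln (1 + s ^+ 2) - ln (s ^+ 2)).
Proof. by rewrite /Phi /PP /Fl /xln mulrBr. Qed.

Lemma ln_ratio s t : 0 < s -> 0 < t -> ln s - ln t <= s / t - 1.
Proof. by move=> s0 t0; rewrite -ln_div ?posrE//; apply: ln_le_sub1; exact: divr_gt0. Qed.

Lemma Phi01 s : 0 <= Phi s <= 1.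
Proof.
have [->|s0] := eqVneq s 0; first by rewrite Phi0 lexx ler01.
have t0 : 0 < s ^+ 2 by rewrite exprn_even_gt0.
rewrite PhiE; apply/andP; split.
  by rewrite mulr_ge0 ?(ltW t0)// subr_ge0 ler_ln ?posrE ?sq1_gt0// lerDr.
have := ln_ratio (sq1_gt0 s) t0; move: (s ^+ 2) t0 (ln _) (ln _) => t t0 a b h.
have -> : 1 = t * ((1 + t) / t - 1) by field; rewrite gt_eqF.
by rewrite ler_pM2l.
Qed.

(* The function t ln (1 + 1/t) is nondecreasing. *)
Lemma Phi_mono c s : 0 <= c <= 1 -> Phi (c * s) <= Phi s.
Proof.
move=> /andP[c0 c1]; have [->|s0] := eqVneq s 0; first by rewrite mulr0.
move: c0; rewrite le_eqVlt => /orP[/eqP <-|c0].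
  by rewrite mul0r Phi0; have /andP[] := Phi01 s.
have t0 : 0 < s ^+ 2 by rewrite exprn_even_gt0.
have l0 : 0 < c ^+ 2 by rewrite exprn_gt0.
have l1 : c ^+ 2 <= 1 by rewrite expr_le1// ltW.
rewrite !PhiE exprMn; move: (s ^+ 2) (c ^+ 2) t0 l0 l1 => t l t0 l0 l1.
have t1 : 0 < 1 + t by lra.
have lt0 : 0 < l * t by exact: mulr_gt0.
have lt1 : 0 < 1 + l * t by lra.
(* Two instances of ln y <= y - 1, taken with weights l and 1 - l: their right sides (1 - l)/(1 + t)
   and -(1 - l)/(1 + t) cancel. *)
have h1 := @ln_ratio ((1 + l * t) * t) (l * t * (1 + t)) (mulr_gt0 lt1 t0) (mulr_gt0 lt0 t1).
have h2 := ln_ratio t0 t1.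
rewrite !lnM ?posrE// in h1; rewrite lnM ?posrE//.
have e1 : l * ((1 + l * t) * t / (l * t * (1 + t)) - 1) = (1 - l) / (1 + t).
  by field; rewrite !gt_eqF.
have e2 : t / (1 + t) - 1 = - (1 + t)^-1 by field; rewrite gt_eqF.
have k1 := ler_wpM2l (ltW l0) h1; rewrite e1 in k1.
have k2 : (1 - l) * (ln t - ln (1 + t)) <= (1 - l) * - (1 + t)^-1.
  by apply: ler_wpM2l; [lra|rewrite -e2].
rewrite (mulrC l) -mulrA ler_pM2l//.
rewrite (mulrC l t) in k1; move: k1 k2; move: (ln l) (ln t) (ln (1 + t)) (ln (1 + t * l)) ((1 + t)^-1) => a b d e z; lra.
Qed.

(** Like y at infinity and like y^3 at 0, with bounded derivative: Fl (psi y) keeps the growth of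
    y^2 ln y^2 at infinity, and its negative part near 0 is O(y^2). The logarithmic Sobolev
    inequality for psi (u) thus controls [PP]. *)
Definition psi y : R := y ^+ 3 / (1 + y ^+ 2).
Definition dpsi y : R := (3 * y ^+ 2 + y ^+ 4) / (1 + y ^+ 2) ^+ 2.

Lemma is_derive_psi y : is_derive y 1 psi (dpsi y).
Proof.
have n0 : 1 + y ^+ 2 != 0 by rewrite gt_eqF ?sq1_gt0.
have := dM (dX 3 (did y)) (@dV _ (fun t => 1 + t ^+ 2) _ _ n0 (dD (dcst 1 y) (dX 2 (did y)))); move/dE; apply => //.
rewrite /dpsi /=; field; exact: n0.
Qed.

Lemma cts_dpsi : continuous dpsi.
Proof.
have c (k : nat) : continuous (fun s : R => s ^+ k) by apply: ctsX => s; exact: cvg_id.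
apply: ctsM.
  by apply: ctsD => //; apply: ctsM => //; exact: cts_cst.
move=> y; apply: cvgV; first by rewrite expf_neq0// gt_eqF// sq1_gt0.
by move: y; apply: (@ctsX R R 2 (fun s : R => 1 + s ^+ 2)); apply: ctsD => //; exact: cts_cst.
Qed.

Lemma dpsi_sq y : dpsi y ^+ 2 <= 2.
Proof.
have h0 : 0 <= dpsi y.
  rewrite /dpsi; apply: divr_ge0; last exact: sqr_ge0.
  by apply: addr_ge0; [apply: mulr_ge0 => //; exact: sqr_ge0|exact: exprn_even_ge0].
have h1 : dpsi y <= 9 / 8.
  rewrite /dpsi ler_pdivrMr ?exprn_gt0 ?sq1_gt0//.
  rewrite (_ : y ^+ 4 = (y ^+ 2) ^+ 2); last by rewrite -exprM.
  have := sqr_ge0 (y ^+ 2 - 3); move: (y ^+ 2) => t; lra.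
apply: (@le_trans _ _ ((9 / 8) ^+ 2)); first by rewrite ler_pXn2r ?nnegrE//; lra.
lra.
Qed.

Lemma psi0 : psi 0 = 0. Proof. by rewrite /psi expr0n mul0r. Qed.

Lemma psi_sq y : psi y ^+ 2 <= y ^+ 2.
Proof.
rewrite /psi exprMn exprVn ler_pdivrMr ?exprn_gt0 ?sq1_gt0//.
rewrite -exprM (exprM y 2 3); have := sqr_ge0 y; move: (y ^+ 2) => t t0; nra.
Qed.

(** With t = y^2 and r = t/(1 + t), (psi y)^2 = t r^2, and ln (1 + t) has to be compared with r^2 ln
    (t r^2) + 5. For t <= 1, r <= t keeps r^2 (1/t - 1) below 1; for t > 1, (1 - r^2) t <= 2. *)
Lemma PP_le_psi y : PP y <= Fl (psi y) + 5 * y ^+ 2.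
Proof.
have [->|y0] := eqVneq y 0; first by rewrite PP0 psi0 Fl0 expr0n mulr0 addr0.
have t0 : 0 < y ^+ 2 by rewrite exprn_even_gt0.
rewrite /PP /Fl /xln.
have -> : psi y ^+ 2 = y ^+ 2 * (y ^+ 2 / (1 + y ^+ 2)) ^+ 2.
  by rewrite /psi; field; rewrite gt_eqF// sq1_gt0.
move: (y ^+ 2) t0 => t t0; set r := t / (1 + t).
have t1 : 0 < 1 + t by lra.
have r0 : 0 < r by exact: divr_gt0.
have r2 : 0 < r ^+ 2 by exact: exprn_gt0.
rewrite lnM ?posrE// lnXn// mulr2n -mulrA.
suff : ln (1 + t) <= r ^+ 2 * (ln t + (ln r + ln r)) + 5.
  by move=> /(ler_wpM2l (ltW t0)); congr (_ <= _); ring.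
have r1 : r <= 1 by rewrite ler_pdivrMr// mul1r; lra.
have rt : r <= t by rewrite ler_pdivrMr//; nra.
have hr : - r <= r ^+ 2 * ln r.
  have := ln_ratio (@ltr01 R) r0; rewrite ln1 sub0r => h.
  have := ler_wpM2l (ltW r2) h; rewrite (_ : r ^+ 2 * (1 / r - 1) = r - r ^+ 2); last by field; rewrite gt_eqF.
  by rewrite mulrN; lra.
have key : ln (1 + t) <= r ^+ 2 * ln t + 3; last by rewrite !mulrDr; lra.
have [tl|tg] := leP t 1.
  have h1 := ln_le_sub1 t1; have := ln_ratio (@ltr01 R) t0; rewrite ln1 sub0r => h2.
  have := ler_wpM2l (ltW r2) h2; rewrite mulrN => h3.
  have : r ^+ 2 * (1 / t - 1) <= 1; last by lra.
  apply: (@le_trans _ _ (t ^+ 2 * (1 / t - 1))).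
    apply: ler_wpM2r; first by rewrite subr_ge0 ler_pdivlMr// mul1r.
    by rewrite ler_pXn2r ?nnegrE ?(ltW r0) ?(ltW t0).
  by rewrite (_ : t ^+ 2 * (1 / t - 1) = t - t ^+ 2); [nra|field; rewrite gt_eqF].
have h1 := ln_ratio t1 t0; have h2 := ln_le_sub1 t0.
have e : (1 + t) / t - 1 = t^-1 by field; rewrite gt_eqF.
have i1 : t^-1 <= 1 by rewrite invf_le1// ltW.
have r21 : r ^+ 2 <= 1 by rewrite expr_le1// ltW.
have h3 : (1 - r ^+ 2) * ln t <= (1 - r ^+ 2) * t.
  by apply: ler_wpM2l; [rewrite subr_ge0|lra].
have h4 : (1 - r ^+ 2) * t <= 2.
  have -> : (1 - r ^+ 2) * t = (t + 2 * t ^+ 2) / (1 + t) ^+ 2 by rewrite /r; field; rewrite gt_eqF.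
  by rewrite ler_pdivrMr ?exprn_gt0//; nra.
move: h3; rewrite mulrBl mul1r; rewrite e in h1; move: (ln t) (ln (1 + t)) h1 h4 i1 => a b; lra.
Qed.

Lemma PP_scale c y : 1 <= c -> PP (c * y) <= c ^+ 2 * (PP y + 2 * ln c * y ^+ 2).
Proof.
move=> c1; have c0 : 0 < c by lra.
have c2 : 1 <= c ^+ 2 by exact: exprn_ege1.
have e : PP (c * y) = c ^+ 2 * (y ^+ 2 * ln (1 + c ^+ 2 * y ^+ 2)) by rewrite /PP exprMn mulrA.
rewrite e /PP; apply: ler_wpM2l; first exact: sqr_ge0.
have -> : y ^+ 2 * ln (1 + y ^+ 2) + 2 * ln c * y ^+ 2 = y ^+ 2 * (ln (1 + y ^+ 2) + ln (c ^+ 2)).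
  by rewrite lnXn// mulr2n; ring.
rewrite ler_wpM2l ?sqr_ge0// -lnM ?posrE ?sq1_gt0 ?exprn_gt0//.
have h : 1 + c ^+ 2 * y ^+ 2 <= (1 + y ^+ 2) * c ^+ 2 by rewrite mulrDl mul1r mulrC lerD2r.
by rewrite ler_ln ?posrE ?mulr_gt0 ?sq1_gt0 ?exprn_gt0// ltr_wpDr// mulr_ge0 ?sqr_ge0// ltW// exprn_gt0.
Qed.

Lemma PP_norm s t : `|s| <= `|t| -> PP s <= PP t.
Proof.
move=> h; have h2 : s ^+ 2 <= t ^+ 2 by rewrite -(real_normK (num_real s)) -(real_normK (num_real t)) ler_pXn2r ?nnegrE.
rewrite /PP; apply: ler_pM; rewrite ?sqr_ge0//; first by rewrite ln_ge0// lerDl sqr_ge0.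
by rewrite ler_ln ?posrE ?sq1_gt0// lerD2l.
Qed.

(** If |w| <= k |a| then |a + w| <= (1 + k) |a|; otherwise |a + w| <= (1 + 1/k) |w|. Either way one
    of the two terms suffices. *)
Lemma PP_add (k a w : R) : 0 < k ->
  PP (a + w) <= (1 + k) ^+ 2 * (PP a + 2 * k * a ^+ 2) +
    (1 + k^-1) ^+ 2 * (PP w + 2 * ln (1 + k^-1) * w ^+ 2).
Proof.
move=> k0; have ki : 0 < k^-1 by rewrite invr_gt0.
have l0 : 0 <= ln (1 + k^-1) by rewrite ln_ge0// lerDl ltW.
have A0 : 0 <= (1 + k) ^+ 2 * (PP a + 2 * k * a ^+ 2).
  by rewrite mulr_ge0 ?sqr_ge0// addr_ge0 ?PP_ge0// mulr_ge0 ?sqr_ge0// mulr_ge0// ltW.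
have B0 : 0 <= (1 + k^-1) ^+ 2 * (PP w + 2 * ln (1 + k^-1) * w ^+ 2).
  by rewrite mulr_ge0 ?sqr_ge0// addr_ge0 ?PP_ge0// mulr_ge0 ?sqr_ge0// mulr_ge0.
have [h|h] := leP `|w| (k * `|a|).
  rewrite -[leLHS]addr0; apply: lerD => //.
  apply: (@le_trans _ _ (PP ((1 + k) * a))).
    apply: PP_norm; apply: le_trans (ler_normD _ _) _.
    by rewrite normrM (ger0_norm (_ : 0 <= 1 + k)); lra.
  apply: le_trans (PP_scale a _) _; first by lra.
  rewrite ler_wpM2l ?sqr_ge0// lerD2l ler_wpM2r ?sqr_ge0// ler_wpM2l//.
  by have := @ln_le_sub1 R (1 + k) (_ : 0 < 1 + k); lra.
rewrite -[leLHS]add0r; apply: lerD => //.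
apply: (@le_trans _ _ (PP ((1 + k^-1) * w))); last by apply: PP_scale; lra.
apply: PP_norm; apply: le_trans (ler_normD _ _) _.
rewrite normrM (ger0_norm (_ : 0 <= 1 + k^-1)); last by lra.
by rewrite mulrDl mul1r addrC lerD2l ler_pdivlMl// ltW.
Qed.

End positive_entropy.

(** * Smallness of the superquadratic entropy for small mass *)

Section positive_entropy_small.
Context (R : realType) (n : nat).
Local Notation mu := (lebesgue_rV R n).
Implicit Types (u : 'rV[R]_n -> R) (g : 'I_n -> 'rV[R]_n -> R).

Lemma Cc_PP u : Cc u -> Cc (fun x => PP (u x)).
Proof. by apply: Cc_comp; [exact: cts_PP|exact: PP0]. Qed.

Lemma Cc_Phi u : Cc u -> Cc (fun x => Phi (u x)).
Proof. by apply: Cc_comp; [exact: cts_Phi|exact: Phi0]. Qed.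

Lemma entr_split u : Cc u -> entr u = J mu (fun x => PP (u x)) - J mu (fun x => Phi (u x)).
Proof.
move=> cu; rewrite -JB; [|exact: Cc_Int (Cc_PP cu)|exact: Cc_Int (Cc_Phi cu)].
by apply: J_ext => x; rewrite /Phi; ring.
Qed.

(** In the logarithmic Sobolev inequality for psi (u), lam is taken small enough for the energy term
    to be at most e/2; then the mass is taken small enough to absorb the lam-dependent term, and x
    ln x <= 0 for masses up to 1. *)
Lemma small_PP (B e : R) : 0 <= B -> 0 < e -> exists2 d : R, 0 < d & forall u g, C1c u g ->
  energy g <= B -> mass u <= d -> J mu (fun x => PP (u x)) <= e.
Proof.
move=> B0 e0; have p0 := pi_gt0 R.
pose l2 := e * pi / (4 * (B + 1)); have l20 : 0 < l2 by rewrite divr_gt0 ?mulr_gt0// ltr_wpDl.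
pose l := Num.sqrt l2; have l0 : 0 < l by rewrite sqrtr_gt0.
have ll : l ^+ 2 = l2 by rewrite sqr_sqrtr// ltW.
pose K := n%:R * `|1 + ln l| + 5; have K0 : 0 < K by rewrite ltr_wpDl// mulr_ge0.
pose d := Num.min 1 (e / (2 * K)).
have d0 : 0 < d by rewrite lt_min ltr01 divr_gt0// mulr_gt0.
exists d => // u g ug gB ud.
have cu := C1c_Cc ug; have cg i := C1c_Ccd i ug.
have vh := C1c_comp (@is_derive_psi R) (@cts_dpsi R) (psi0 R) ug.
have := log_sobolev vh l0; set v := (fun x => psi (u x)) in vh *; set h := (fun i x => _) in vh *.
have cv := C1c_Cc vh; have chh i := C1c_Ccd i vh.
have Eh : energy h <= 2 * energy g.
  rewrite /energy mulr_sumr; apply: ler_sum => i _.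
  have i1 := Cc_Int (CcX 1 (cg i)); rewrite -(JZ _ i1); apply: J_le => [||x]; [exact: Cc_Int (CcX 1 (chh i))|exact: IntZ|].
  by rewrite /h exprMn ler_wpM2r ?sqr_ge0// dpsi_sq.
have mv : mass v <= mass u.
  apply: J_le => [||x]; [exact: Cc_Int (CcX 1 cv)|exact: Cc_Int (CcX 1 cu)|exact: psi_sq].
have mv0 := mass_ge0 v.
have d1 : d <= 1 by rewrite ge_min lexx.
have dK : d * K <= e / 2.
  have : d <= e / (2 * K) by rewrite ge_min lexx orbT.
  by rewrite ler_pdivlMr ?mulr_gt0//; lra.
have xl : xln (mass v) <= 0.
  by rewrite /xln mulr_ge0_le0// ln_le0//; lra.
have P : J mu (fun x => PP (u x)) <= entr v + 5 * mass u.
  have i1 := Cc_Int (Cc_Fl cv); have i2 := Cc_Int (CcX 1 cu).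
  rewrite -(JZ _ i2) -(JD i1 (IntZ 5 i2)); apply: J_le => [||x]; [exact: Cc_Int (Cc_PP cu)|exact: IntD i1 (IntZ 5 i2)|exact: PP_le_psi].
have h1 : l ^+ 2 / pi * energy h <= e / 2.
  apply: (@le_trans _ _ (l2 / pi * (2 * (B + 1)))).
    rewrite ll; apply: ler_wpM2l; first by rewrite divr_ge0 ?ltW.
    by move: Eh gB; clear; lra.
  rewrite le_eqVlt; apply/orP; left; apply/eqP; rewrite /l2.
  have B1 : B + 1 != 0 by rewrite gt_eqF// ltr_wpDl.
  move: (pi_neq0 R); generalize (@pi R) => P' P0; field; by rewrite P0 B1.
have h2 : - (n%:R * (1 + ln l) * mass v) <= n%:R * `|1 + ln l| * d.
  apply: (@le_trans _ _ (n%:R * `|1 + ln l| * mass v)).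
    rewrite -mulNr ler_wpM2r// -mulrN ler_wpM2l//.
    by rewrite -normrN ler_norm.
  by apply: ler_wpM2l; [rewrite mulr_ge0|exact: le_trans mv ud].
move=> ls; have : d * K = n%:R * `|1 + ln l| * d + 5 * d by rewrite /K; ring.
move: ls; move: (l ^+ 2 / pi * energy h) (n%:R * (1 + ln l) * mass v) (n%:R * `|1 + ln l| * d) (xln _) h1 h2 xl P => a b c x.
by move: (entr _) (d * K) dK => f g'; lra.
Qed.

End positive_entropy_small.

(** * Convergence in L^2 *)

Section L2_convergence.
Context d (T : measurableType d) (R : realType) (mu : {measure set T -> \bar R}).
Implicit Types (f g h : T -> R).

Definition L2cvg (f_ : nat -> T -> R) f := forall e : R, 0 < e ->
  exists K, forall k, (K <= k)%N -> nrm mu (fun x => f_ k x - f x) <= e.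

Lemma nrm_le f g : Sq mu f -> Sq mu g -> (forall x, `|f x| <= `|g x|) -> nrm mu f <= nrm mu g.
Proof.
move=> sf sg h; apply: ler_wsqrtr; apply: J_le => [||x]; [exact: sf.2|exact: sg.2|].
by rewrite -(real_normK (num_real (f x))) -(real_normK (num_real (g x))) ler_pXn2r ?nnegrE.
Qed.

Lemma nrm_eq0 f : Sq mu f -> nrm mu f = 0 -> {ae mu, forall x, f x = 0}.
Proof.
move=> sf n0; have J2 : J mu (fun x => f x ^+ 2) = 0 by rewrite -nrm_sq n0 expr0n.
have := J_eq0 sf.2 (fun x => sqr_ge0 _) J2; apply: filterS => x /eqP.
by rewrite sqrf_eq0 => /eqP.
Qed.

Lemma L2cvg_cauchy (f_ : nat -> T -> R) f : (forall k, Sq mu (f_ k)) -> Sq mu f -> L2cvg f_ f ->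
  forall e : R, 0 < e -> exists K, forall k l, (K <= k)%N -> (K <= l)%N ->
    nrm mu (fun x => f_ k x - f_ l x) <= e.
Proof.
move=> sf_ sf cf e e0; have [K hK] := cf (e / 2) (divr_gt0 e0 (ltr0n _ 2)).
exists K => k l Kk Kl; apply: le_trans (nrm_tri (sf_ k) sf (sf_ l)) _.
have := hK k Kk; have := hK l Kl; rewrite (nrmC _ (f_ l)).
by move: (nrm _ _) (nrm _ _) => a b; lra.
Qed.

Lemma L2cvg_ae (f_ : nat -> T -> R) f : (forall k, Sq mu (f_ k)) -> Sq mu f -> L2cvg f_ f ->
  exists2 s : nat -> nat, (forall j, (j <= s j)%N) &
    {ae mu, forall x, f_ (s j) x @[j --> \oo] --> f x}.
Proof.
move=> sf_ sf cf; have [F [s [sF hs cF kF]]] := L2_complete sf_ (L2cvg_cauchy sf_ sf cf).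
exists s => //; have F0 : nrm mu (fun x => F x - f x) = 0.
  apply/eqP; rewrite eq_le nrm_ge0 andbT; apply: nrm_le_eps => // e e0.
  have e2 : 0 < e / 2 by rewrite divr_gt0.
  have [K1 h1] := cf _ e2; have [K2 h2] := kF _ e2; pose k := maxn K1 K2.
  apply: le_trans (nrm_tri sF (sf_ k) sf) _; rewrite (nrmC _ F).
  have := h1 k (leq_maxl _ _); have := h2 k (leq_maxr _ _).
  by move: (nrm _ _) (nrm _ _) => a b; lra.
apply: filterS2 cF (nrm_eq0 (SqB sF sf) F0) => x cx /eqP.
by rewrite subr_eq0 => /eqP <-.
Qed.

Lemma L2cvg_sub (f_ : nat -> T -> R) f (s : nat -> nat) : (forall j, (j <= s j)%N) -> L2cvg f_ f -> L2cvg (fun j => f_ (s j)) f.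
Proof.
move=> hs cf e e0; have [K hK] := cf e e0; exists K => k Kk.
by apply: hK; exact: leq_trans (hs k).
Qed.

Lemma cvg_of_dist (a : nat -> R) (l : R) : (forall e : R, 0 < e -> exists K, forall k, (K <= k)%N ->
  `|a k - l| <= e) -> a @ \oo --> l.
Proof.
move=> h; apply/cvgrPdist_le => e e0; have [K hK] := h e e0.
by exists K => // k /= Kk; rewrite distrC; exact: hK.
Qed.

Lemma nrm_cvg (f_ : nat -> T -> R) f : (forall k, Sq mu (f_ k)) -> Sq mu f -> L2cvg f_ f ->
  nrm mu (f_ k) @[k --> \oo] --> nrm mu f.
Proof.
move=> sf_ sf cf; apply: cvg_of_dist => e e0; have [K hK] := cf e e0; exists K => k Kk.
by apply: le_trans (nrm_dist (sf_ k) sf) (hK k Kk).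
Qed.

Lemma Jsq_cvg (f_ : nat -> T -> R) f : (forall k, Sq mu (f_ k)) -> Sq mu f -> L2cvg f_ f ->
  J mu (fun x => f_ k x ^+ 2) @[k --> \oo] --> J mu (fun x => f x ^+ 2).
Proof.
move=> sf_ sf cf; under eq_fun do rewrite -nrm_sq expr2; rewrite -nrm_sq expr2.
by apply: cvgM; exact: nrm_cvg.
Qed.

End L2_convergence.

(** * Limits in the stability inequality and smooth cut-offs *)

Section L2_limits.
Context (R : realType) (n : nat).
Local Notation mu := (lebesgue_rV R n).
Implicit Types (u f : 'rV[R]_n -> R) (g : 'I_n -> 'rV[R]_n -> R).

Lemma mass_cvg (f_ : nat -> 'rV[R]_n -> R) f : (forall k, Sq mu (f_ k)) -> Sq mu f -> L2cvg mu f_ f ->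
  mass (f_ k) @[k --> \oo] --> mass f.
Proof. exact: Jsq_cvg. Qed.

Lemma ov2_cvg (f_ : nat -> 'rV[R]_n -> R) f : (forall k, Sq mu (f_ k)) -> Sq mu f -> L2cvg mu f_ f ->
  ov2 (f_ k) @[k --> \oo] --> ov2 f.
Proof.
move=> sf_ sf cf.
have sE h : Sq mu h -> ov2 h = Num.sqrt (ov2 h) * Num.sqrt (ov2 h).
  by move=> sh; rewrite -expr2 sqr_sqrtr// ov2_ge0.
rewrite (sE f sf); under eq_fun => k do rewrite (sE _ (sf_ k)).
have c : Num.sqrt (ov2 (f_ k)) @[k --> \oo] --> Num.sqrt (ov2 f).
  apply: cvg_of_dist => e e0; have [K hK] := cf e e0; exists K => k Kk.
  have := hK k Kk; have := sqrt_ov2_le (sf_ k) sf; have := sqrt_ov2_le sf (sf_ k).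
  rewrite (nrmC _ f); move: (Num.sqrt _) (Num.sqrt _) (nrm _ _) => a b c.
  by rewrite ler_norml => h1 h2 h3; apply/andP; split; lra.
exact: cvgM.
Qed.

Lemma d2_cvg (f_ : nat -> 'rV[R]_n -> R) f : (forall k, Sq mu (f_ k)) -> Sq mu f -> L2cvg mu f_ f ->
  d2 (f_ k) @[k --> \oo] --> d2 f.
Proof. by move=> sf_ sf cf; apply: cvgB; [exact: mass_cvg|exact: ov2_cvg]. Qed.

(** The inequality is written as an upper bound for the integral of [PP], the only term that is
    merely lower semicontinuous (Fatou); all others converge. *)
Lemma limit_step (q : R) (f_ : nat -> 'rV[R]_n -> R) f (A_ : nat -> R) (A : R) : (forall k, Sq mu (f_ k)) -> Sq mu f ->
  L2cvg mu f_ f -> {ae mu, forall x, f_ k x @[k --> \oo] --> f x} ->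
  (forall k, Int mu (fun x => PP (f_ k x))) ->
  (forall k, pi * J mu (fun x => PP (f_ k x)) <=
    A_ k + pi * xln (mass (f_ k)) - n%:R * pi * mass (f_ k) - q * d2 (f_ k)) ->
  A_ @ \oo --> A ->
  Int mu (fun x => PP (f x)) /\
  pi * J mu (fun x => PP (f x)) <= A + pi * xln (mass f) - n%:R * pi * mass f - q * d2 f.
Proof.
move=> sf_ sf cf af iP hP cA; have p0 := pi_gt0 R.
set B := A + _ - _ - _; pose B_ k := A_ k + pi * xln (mass (f_ k)) - n%:R * pi * mass (f_ k) - q * d2 (f_ k).
have cB : B_ @ \oo --> B.
  have cm := mass_cvg sf_ sf cf.
  apply: cvgB; last by apply: cvgM; [exact: cvg_cst|exact: d2_cvg].
  apply: cvgB; last by apply: cvgM; [exact: cvg_cst|].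
  apply: cvgD => //; apply: cvgM; first exact: cvg_cst.
  by apply: (continuous_cvg _ (@cts_xln R (mass f))).
have mP : measurable_fun setT (fun x => PP (f x)).
  by apply: measurableT_comp sf.1; apply: continuous_measurable_R; exact: cts_PP.
have cPP : {ae mu, forall x, PP (f_ k x) @[k --> \oo] --> PP (f x)}.
  by apply: filterS af => x cx; apply: (continuous_cvg _ (@cts_PP R (f x))).
have key e : 0 < e -> Int mu (fun x => PP (f x)) /\ J mu (fun x => PP (f x)) <= (B + e) / pi.
  move=> e0; apply: (@fatouJ _ _ _ mu (fun k x => PP (f_ k x))) => //.
  - by move=> k x; exact: PP_ge0.
  - by move=> x; exact: PP_ge0.
  have : \forall k \near \oo, B_ k <= B + e by apply: (cvgr_le _ cB); rewrite ltrDl.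
  by apply: filterS => k hk; rewrite ler_pdivlMr// mulrC; exact: le_trans (hP k) hk.
split; first by have [] := key 1 ltr01.
rewrite -/B leNgt; apply/negP => lt.
have := key ((pi * J mu (fun x => PP (f x)) - B) / 2); rewrite ler_pdivlMr//.
have h0 : 0 < (pi * J mu (fun x => PP (f x)) - B) / 2 by lra.
by move=> /(_ h0)[_]; rewrite mulrC; lra.
Qed.

(** Built on the Euclidean square norm, which is C^1: it is 1 where sqnorm x <= r^2 and 0 where
    sqnorm x >= 2 r^2. *)
Definition chi (r : R) (x : 'rV[R]_n) : R := 1 - ramp (r ^- 2 * sqnorm x - 1).
Definition dchi (r : R) (i : 'I_n) (x : 'rV[R]_n) : R :=
  - (dramp (r ^- 2 * sqnorm x - 1) * (r ^- 2 * (2 * x ord0 i))).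

Lemma C1_chi r : C1 (chi r) (dchi r).
Proof.
have c1 := C1B (C1Z (r ^- 2) (C1_sqnorm R n)) (C1_cst n 1).
have := C1B (C1_cst n 1) (C1_comp (@is_derive_ramp R) (@cts_dramp R) c1).
apply: C1_ext => // i x; rewrite /dchi sub0r subr0.
by [].
Qed.

Lemma ramp01 (t : R) : 0 <= ramp t <= 1.
Proof.
have /andP[c0 c1] := clamp01 t; rewrite /ramp; move: (clamp t) c0 c1 => c c0 c1.
have h2 : 0 <= c ^+ 2 by exact: sqr_ge0.
have h3 : 0 <= c ^+ 2 * (1 - c) by apply: mulr_ge0 => //; lra.
have h4 : 0 <= (1 - c) ^+ 2 * (1 + 2 * c) by apply: mulr_ge0; [exact: sqr_ge0|lra].
apply/andP; split; first by rewrite (_ : _ - _ = c ^+ 2 + 2 * (c ^+ 2 * (1 - c))); [lra|ring].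
by rewrite -subr_ge0 (_ : _ - _ = (1 - c) ^+ 2 * (1 + 2 * c))//; ring.
Qed.

Lemma chi01 r x : 0 <= chi r x <= 1.
Proof. by have /andP[h0 h1] := ramp01 (r ^- 2 * sqnorm x - 1); rewrite /chi; apply/andP; split; lra. Qed.

Lemma chi1 r x : 0 < r -> sqnorm x <= r ^+ 2 -> chi r x = 1.
Proof.
move=> r0 h; rewrite /chi ramp_le0 ?subr0// subr_le0 mulrC ler_pdivrMr ?exprn_gt0//.
by rewrite mul1r.
Qed.

Lemma bsupp_chi r : 0 < r -> bsupp (chi r).
Proof.
move=> r0; exists (2 * r) => x xr; rewrite /chi ramp_ge1 ?subrr//.
rewrite lerBrDl mulrC ler_pdivlMr ?exprn_gt0//; apply: le_trans (norm_sq_le_sqnorm x).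
apply: (@le_trans _ _ ((2 * r) ^+ 2)).
  by rewrite exprMn ler_wpM2r ?sqr_ge0//; lra.
by rewrite ler_pXn2r ?nnegrE ?mulr_ge0 ?(ltW r0)// ltW.
Qed.

Lemma dchi_le r i x : 0 < r -> `|dchi r i x| <= 8 / r.
Proof.
move=> r0; have r2 : 0 < r ^+ 2 by exact: exprn_gt0.
have [h|h] := leP (sqnorm x) (4 * r ^+ 2); last first.
  rewrite /dchi dramp_out ?mul0r ?oppr0 ?normr0 ?divr_ge0 ?(ltW r0)//; right.
  by rewrite lerBrDl mulrC ler_pdivlMr//; lra.
have xi : `|x ord0 i| <= 2 * r.
  rewrite -(@ler_pXn2r _ 2)// ?nnegrE ?mulr_ge0 ?(ltW r0)// real_normK ?num_real//.
  by apply: le_trans (coord_sq_le_sqnorm x i) _; rewrite exprMn; lra.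
have dr : `|dramp (r ^- 2 * sqnorm x - 1)| <= 2.
  rewrite -(@ler_pXn2r _ 2)// ?nnegrE// real_normK ?num_real//.
  by apply: le_trans (dramp_sq _) _; lra.
rewrite /dchi normrN; move: (dramp _) dr => a ha.
have ri : 0 <= r ^- 2 by rewrite invr_ge0 ltW.
have -> : `|a * (r ^- 2 * (2 * x ord0 i))| = `|a| * (r ^- 2 * (2 * `|x ord0 i|)).
  by rewrite !normrM (ger0_norm ri) (ger0_norm (ler0n R 2)).
apply: (@le_trans _ _ (2 * (r ^- 2 * (2 * (2 * r))))).
  apply: ler_pM => //; first by rewrite !mulr_ge0.
  by apply: ler_wpM2l => //; apply: ler_wpM2l.
by rewrite le_eqVlt; apply/orP; left; apply/eqP; field; rewrite gt_eqF.
Qed.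

(** u is divided by a K so large that [small_PP] applies with bound 1, and [PP_scale] returns to
    u. *)
Lemma bounded_PP (B M : R) : 0 <= B -> 0 <= M -> exists2 C : R, 0 <= C & forall u g, C1c u g ->
  energy g <= B -> mass u <= M -> J mu (fun x => PP (u x)) <= C.
Proof.
move=> B0 M0; have [d d0 hd] := @small_PP R n B 1 B0 ltr01.
pose K := 1 + M / d; have K1 : 1 <= K by rewrite lerDl divr_ge0// ltW.
have K0 : 0 < K by lra.
exists (K ^+ 2 * (1 + 2 * ln K * M)).
  by rewrite mulr_ge0 ?sqr_ge0// addr_ge0// mulr_ge0// mulr_ge0// ln_ge0.
move=> u g ug gB uM; have wh := C1cZ K^-1 ug; set w := (fun x => K^-1 * u x) in wh.
have su := C1c_Sq ug; have cw := C1c_Cc wh; have cu := C1c_Cc ug.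
have Ki : K^-1 ^+ 2 <= 1 by rewrite expr_le1 ?invr_ge0 ?(ltW K0)// invf_le1.
have mw : mass w = K^-1 ^+ 2 * mass u by rewrite massZ.
have h1 : J mu (fun x => PP (w x)) <= 1.
  apply: (hd _ _ wh).
    apply: le_trans gB; apply: ler_sum => i _; have cg := C1c_Ccd i ug.
    apply: J_le => [||x]; [exact: Cc_Int (CcX 1 (CcZ _ cg))|exact: Cc_Int (CcX 1 cg)|].
    by rewrite exprMn ler_piMl ?sqr_ge0.
  rewrite mw; apply: (@le_trans _ _ (K^-1 * M)).
    apply: ler_pM; rewrite ?sqr_ge0 ?mass_ge0// expr2 ler_piMl ?invr_ge0 ?(ltW K0)//.
    by rewrite invf_le1.
  rewrite ler_pdivrMl// /K mulrDl mul1r divfK ?gt_eqF// lerDr ltW//.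
have h2 : mass w <= M.
  by rewrite mw; apply: le_trans uM; rewrite ler_piMl ?mass_ge0.
have i1 := Cc_Int (Cc_PP cw); have i2 := IntZ (2 * ln K) (Cc_Int (CcX 1 cw)).
have i3 := IntZ (K ^+ 2) (IntD i1 i2).
apply: (@le_trans _ _ (J mu (fun x => K ^+ 2 * (PP (w x) + 2 * ln K * w x ^+ 2)))).
  apply: J_le => [||x]; [exact: Cc_Int (Cc_PP cu)|exact: i3|].
  have e : u x = K * w x by rewrite /w mulrA divff ?mul1r// gt_eqF.
  by rewrite e; exact: PP_scale.
rewrite (JZ _ (IntD i1 i2)) (JD i1 i2) (JZ _ (Cc_Int (CcX 1 cw))) ler_wpM2l ?sqr_ge0//.
by apply: lerD => //; rewrite ler_wpM2l// mulr_ge0// ln_ge0.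
Qed.

End L2_limits.

(** * The stability inequality for weakly differentiable functions *)

Section weak_lower_bound.
Context (R : realType) (n : nat).
Local Notation mu := (lebesgue_rV R n).
Implicit Types (u f : 'rV[R]_n -> R) (g h : 'I_n -> 'rV[R]_n -> R).

Definition stab (q : R) := forall (w : 'rV[R]_n -> R) h, C1c w h -> q * d2 w <= DD w h.

Lemma mol_seq u : Sq mu u -> exists2 rho : nat -> 'rV[R]_n -> R,
  (forall k, mollifier (rho k) /\ Sm (rho k)) & L2cvg mu (fun k => mol (rho k) u) u.
Proof.
move=> su; have /choice[rho hr] (k : nat) : exists rho : 'rV[R]_n -> R, [/\ mollifier rho, Sm rho &
    nrm mu (fun x => mol rho u x - u x) <= k.+1%:R^-1].
  have [|r r0 hr] := @mol_cvg R n u k.+1%:R^-1 su; first by rewrite invr_gt0.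
  by have [rho mr [Sr hrr]] := smooth_mollifier n r0; exists rho; split => //; exact: hr.
exists rho; first by move=> k; have [] := hr k.
move=> e e0; exists (Num.bound e^-1) => k Kk; have [_ _] := hr k; move=> /le_trans; apply.
rewrite invf_ple ?posrE//; apply: le_trans (_ : (Num.bound e^-1)%:R <= _); last by rewrite ler_nat ltnW.
by apply: ltW; apply: archi_boundP; rewrite invr_ge0 ltW.
Qed.

Lemma mollifier_bsupp (rho : 'rV[R]_n -> R) : mollifier rho -> bsupp rho.
Proof. by case=> -[]. Qed.

Lemma Sq_chi r u : Sq mu u -> Sq mu (fun x => chi r x * u x).
Proof.
move=> su; apply: (Sq_dom _ su).
  apply: measurable_funM su.1; apply: continuous_measurable_rV.
  by have [] := C1_chi n r.
move=> x; have /andP[c0 c1] := chi01 r x.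
by rewrite normrM ger0_norm// ler_piMl.
Qed.

Lemma measurable_Phi u : measurable_fun setT u -> measurable_fun setT (fun x => Phi (u x)).
Proof. by move=> mv; apply: measurableT_comp mv; apply: continuous_measurable_R; exact: cts_Phi. Qed.

(** For fixed r, chi r times mollifications of u are admissible and converge. Their supports are
    uniformly bounded, so [Phi] passes by dominated convergence and [PP] by Fatou. [E] bounds their
    energies, 8/r being the slope of the cut-off. The last clause carries over any bound on [PP]
    valid for C^1 functions of bounded support. *)
Lemma chi_step q r u g : 0 < r -> stab q -> Sq mu u -> (forall i, Sq mu (g i)) ->
  (forall i, weakp i u (g i)) ->
  let f x := chi r x * u x in
  let E := \sum_i (8 / r * nrm mu u + nrm mu (g i)) ^+ 2 in
  [/\ Int mu (fun x => PP (f x)),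
      pi * J mu (fun x => PP (f x)) <= E + pi * J mu (fun x => Phi (f x)) +
        pi * xln (mass f) - n%:R * pi * mass f - q * d2 f &
      forall C, (forall v h, C1c v h -> energy h <= E -> mass v <= mass u ->
        J mu (fun x => PP (v x)) <= C) -> J mu (fun x => PP (f x)) <= C].
Proof.
move=> r0 Hq su sg w f E; have [rho hr cP] := mol_seq su.
have mr k : mollifier (rho k) by have [] := hr k.
have sP k : Sq mu (mol (rho k) u) := (Sq_mol (mr k) su).1.
have [s hs aP] := L2cvg_ae sP su cP.
pose P k := mol (rho (s k)) u; have cP' : L2cvg mu P u by exact: (L2cvg_sub hs cP).
have C1P k : C1 (P k) (fun i => mol (rho (s k)) (g i)).
  by apply: C1_mol => //; [have [] := hr (s k)|exact: mollifier_bsupp].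
pose f_ k x := chi r x * P k x.
pose h_ k i x := dchi r i x * P k x + chi r x * mol (rho (s k)) (g i) x.
have C1f k : C1c (f_ k) (h_ k).
  by split; [exact: C1M (C1_chi n r) (C1P k)|apply: bsupp_mul; exact: bsupp_chi].
have sf_ k : Sq mu (f_ k) by exact: C1c_Sq (C1f k).
have sf : Sq mu f by exact: Sq_chi.
have cf : L2cvg mu f_ f.
  move=> e e0; have [K hK] := cP' e e0; exists K => k Kk; apply: le_trans (hK k Kk).
  apply: nrm_le => [||x]; [exact: SqB|by apply: SqB => //; exact: sP|].
  rewrite /f_ /f -mulrBr normrM; have /andP[c0 c1] := chi01 r x.
  by rewrite ger0_norm// ler_piMl.
have af : {ae mu, forall x, f_ k x @[k --> \oo] --> f x}.
  by apply: filterS aP => x cx; apply: cvgM => //; exact: cvg_cst.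
have E_ k : energy (h_ k) <= E.
  rewrite /energy; apply: ler_sum => i _; rewrite -nrm_sq.
  have r8 : 0 <= 8 / r by rewrite divr_ge0// ltW.
  rewrite ler_pXn2r ?nnegrE ?addr_ge0 ?(mulr_ge0 r8) ?nrm_ge0//.
  have sm := (Sq_mol (mr (s k)) (sg i)).1.
  have hd x : `|dchi r i x * P k x| <= `|8 / r * P k x|.
    by rewrite normrM [leRHS]normrM (ger0_norm r8) ler_wpM2r// dchi_le.
  have s1 : Sq mu (fun x => dchi r i x * P k x).
    apply: (Sq_dom _ (SqZ (8 / r) (sP (s k)))).
      apply: measurable_funM (sP (s k)).1; apply: continuous_measurable_rV.
      by have [_ c _] := C1_chi n r; exact: c.
    exact: hd.
  have s2 := Sq_chi r sm.
  apply: le_trans (nrmD s1 s2) _; apply: lerD.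
    apply: (@le_trans _ _ (nrm mu (fun x => 8 / r * P k x))).
      apply: nrm_le => [||x]; [exact: s1|by apply: SqZ; exact: sP|].
      exact: hd.
    rewrite /nrm (@J_ext _ _ _ mu _ (fun x => (8 / r) ^+ 2 * P k x ^+ 2)) => [|x]; last by rewrite exprMn.
    rewrite JZ; last exact: (sP (s k)).2.
    rewrite sqrtrM ?sqr_ge0// sqrtr_sqr ger0_norm// ler_wpM2l//.
    exact: (nrm_mol (mr (s k)) su).
  apply: le_trans (nrm_mol (mr (s k)) (sg i)).
  apply: nrm_le => // x; have /andP[c0 c1] := chi01 r x.
  by rewrite normrM ger0_norm// ler_piMl.
have iP k := Cc_Int (Cc_PP (C1c_Cc (C1f k))).
have iPh k := Cc_Int (Cc_Phi (C1c_Cc (C1f k))).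
have cPh : J mu (fun x => Phi (f_ k x)) @[k --> \oo] --> J mu (fun x => Phi (f x)).
  have [M hM] := bsupp_chi n r0.
  apply: (dct (g := \1_(@box R n M)) _ _ _ _ _).2.
  - by move=> k; apply: measurable_Phi; exact: (sf_ k).1.
  - by apply: measurable_Phi; exact: sf.1.
  - have [mB fB] := @lebesgue_rV_box R n M; exact: Int_indic.
  - by apply: filterS af => x cx; apply: (continuous_cvg _ (@cts_Phi R (f x))).
  - move=> k x; have /andP[p0 p1] := Phi01 (f_ k x); rewrite ger0_norm//.
    have [xM|xM] := leP `|x| M; first by rewrite indic_boxE.
    by rewrite /f_ hM// mul0r Phi0 indicE.
have main k : pi * J mu (fun x => PP (f_ k x)) <= E + pi * J mu (fun x => Phi (f_ k x)) +
    pi * xln (mass (f_ k)) - n%:R * pi * mass (f_ k) - q * d2 (f_ k).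
  have := Hq _ _ (C1f k); rewrite /DD entr_split; last exact: C1c_Cc (C1f k).
  have := E_ k; move: (q * d2 (f_ k)) (energy (h_ k)) (n%:R * pi * mass (f_ k)) => a b c.
  by rewrite mulrBr; move: (pi * xln _) (pi * J _ _) (pi * J _ _) => x y z; lra.
have cA : E + pi * J mu (fun x => Phi (f_ k x)) @[k --> \oo] --> E + pi * J mu (fun x => Phi (f x)).
  by apply: cvgD; [exact: cvg_cst|apply: cvgM => //; exact: cvg_cst].
have [j1 j2] := limit_step sf_ sf cf af iP main cA.
split => // C hC.
apply: (fatouJ (f_ := fun k x => PP (f_ k x)) (B := C) _ _ _ _ _ _).2 => //.
- by move=> k x; exact: PP_ge0.
- by move=> x; exact: PP_ge0.
- exact: Int_meas j1.
- by apply: filterS af => x cx; apply: (continuous_cvg _ (@cts_PP R (f x))).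
apply: nearW => k; apply: (hC _ _ (C1f k) (E_ k)).
apply: le_trans (Sq_mol (mr (s k)) su).2; apply: J_le => [||x]; [exact: (sf_ k).2|exact: (sP (s k)).2|].
rewrite /f_ exprMn ler_piMl ?sqr_ge0// expr_le1 //; by have /andP[] := chi01 r x.
Qed.

Lemma chi_cvg u : Sq mu u -> L2cvg mu (fun k x => chi k.+1%:R x * u x) u /\
  forall x, chi k.+1%:R x * u x @[k --> \oo] --> u x.
Proof.
move=> su; have px x : chi k.+1%:R x * u x @[k --> \oo] --> u x.
  apply: cvg_near_cst; near=> k; rewrite chi1 ?mul1r//.
  have h : sqnorm x + 1 <= k.+1%:R by near: k; apply: filterS (nbhs_infty_ger (sqnorm x + 1)) => k /le_trans; apply; rewrite ler_nat.
  apply: (@le_trans _ _ k.+1%:R); first by lra.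
  by rewrite expr2 ler_peMr ?ler1n.
split => // e e0.
have dm k x : `|(chi k.+1%:R x * u x - u x) ^+ 2| <= u x ^+ 2.
  rewrite ger0_norm ?sqr_ge0// -[X in _ - X]mul1r -mulrBl exprMn ler_piMl ?sqr_ge0//.
  by have /andP[c0 c1] := chi01 k.+1%:R x; rewrite -sqrrN opprB expr_le1//; lra.
have sk k : Sq mu (fun x => chi k.+1%:R x * u x - u x) by apply: SqB => //; exact: Sq_chi.
have cv : {ae mu, forall x, (chi k.+1%:R x * u x - u x) ^+ 2 @[k --> \oo] --> (0 : R)}.
  apply: nearW => x; have h : chi k.+1%:R x * u x - u x @[k --> \oo] --> (0 : R).
    by rewrite -(subrr (u x)); apply: cvgB => //; exact: cvg_cst.
  under eq_fun do rewrite expr2; rewrite -(mulr0 (0 : R)); exact: cvgM.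
have [_ /cvgrPdist_le/(_ (e ^+ 2) (exprn_gt0 2 e0))[K _ hK]] :=
  dct (fun k => Int_meas (sk k).2) (Int_meas (@Int0 _ _ _ mu)) su.2 cv dm.
exists K => k Kk; have := hK k Kk; rewrite J0 sub0r normrN -nrm_sq ger0_norm ?sqr_ge0//.
by rewrite ler_pXn2r ?nnegrE ?nrm_ge0// ltW.
Unshelve. all: by end_near. Qed.

(** The radius in [chi_step] tends to infinity. [PP] is integrable by [bounded_PP]; [Phi] is handled
    by [Phi_mono], which compares the cut-off function with u, once its integral is finite. If it is
    infinite the entropy is minus infinity and the case is settled separately. *)
Lemma stab_weak q u g : stab q -> Sq mu u -> (forall i, Sq mu (g i)) ->
  (forall i, weakp i u (g i)) ->
  Int mu (fun x => PP (u x)) /\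
  (Int mu (fun x => Phi (u x)) ->
    q * d2 u <= energy g - pi * (J mu (fun x => PP (u x)) - J mu (fun x => Phi (u x))) +
      pi * xln (mass u) - n%:R * pi * mass u).
Proof.
move=> Hq su sg w; have [cu au] := chi_cvg su.
have cae : {ae mu, forall x, chi k.+1%:R x * u x @[k --> \oo] --> u x} by apply: nearW => x; exact: au.
pose E k := \sum_i (8 / k.+1%:R * nrm mu u + nrm mu (g i)) ^+ 2.
have st k := @chi_step q k.+1%:R u g (ltr0Sn _ _) Hq su sg w.
have sf k : Sq mu (fun x => chi k.+1%:R x * u x) by exact: Sq_chi.
have iP k : Int mu (fun x => PP (chi k.+1%:R x * u x)) by have [] := st k.
have E0 k : E k <= E 0%N.
  apply: ler_sum => i _; rewrite ler_pXn2r ?nnegrE ?addr_ge0 ?mulr_ge0 ?nrm_ge0//.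
  rewrite lerD2r ler_wpM2r ?nrm_ge0// ler_wpM2l// lef_pV2 ?posrE// ler_nat//.
have EE : 0 <= E 0%N by apply: sumr_ge0 => i _; exact: sqr_ge0.
have [C C0 hC] := bounded_PP n EE (mass_ge0 u).
have iPP : Int mu (fun x => PP (u x)).
  apply: (fatouJ (f_ := fun k x => PP (chi k.+1%:R x * u x)) (B := C) _ _ _ _ _ _).1 => //.
  - by move=> k x; exact: PP_ge0.
  - by move=> x; exact: PP_ge0.
  - by apply: measurableT_comp su.1; apply: continuous_measurable_R; exact: cts_PP.
  - by apply: filterS cae => x cx; apply: (continuous_cvg _ (@cts_PP R (u x))).
  apply: nearW => k; have [_ _] := st k; apply => v h vh hE hm; apply: (hC _ _ vh) => //.
  exact: le_trans hE (E0 k).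
split => // iPh; have iPhk k : Int mu (fun x => Phi (chi k.+1%:R x * u x)).
  apply: (Int_dom _ iPh); first by apply: measurable_Phi; exact: (sf k).1.
  move=> x; have /andP[p0 _] := Phi01 (chi k.+1%:R x * u x); rewrite ger0_norm//.
  by apply: Phi_mono; exact: chi01.
have main k : pi * J mu (fun x => PP (chi k.+1%:R x * u x)) <= E k + pi * J mu (fun x => Phi (u x)) +
    pi * xln (mass (fun x => chi k.+1%:R x * u x)) - n%:R * pi * mass (fun x => chi k.+1%:R x * u x) -
    q * d2 (fun x => chi k.+1%:R x * u x).
  have [_ /le_trans le _] := st k; apply: le; rewrite !lerD2r lerD2l ler_wpM2l ?pi_ge0//.
  by apply: J_le => // x; apply: Phi_mono; exact: chi01.
have cE : E k + pi * J mu (fun x => Phi (u x)) @[k --> \oo] --> energy g + pi * J mu (fun x => Phi (u x)).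
  apply: cvgD; last exact: cvg_cst.
  pose G (t : R) : R := \sum_i (8 * t * nrm mu u + nrm mu (g i)) ^+ 2.
  have cG : continuous G.
    apply: ctsS => i; apply: ctsX; apply: ctsD; last exact: cts_cst.
    apply: ctsM; last exact: cts_cst.
    by apply: ctsM; [exact: cts_cst|move=> t; exact: cvg_id].
  have -> : energy g = G 0.
    by apply: eq_bigr => i _; rewrite mulr0 mul0r add0r nrm_sq.
  have -> : E = fun k => G (k.+1%:R^-1) by [].
  by apply: continuous_cvg; [exact: cG|exact: cvg_harmonic].
have [_ h] := limit_step sf su cu cae iP main cE.
by move: h; move: (q * d2 u) (n%:R * pi * mass u) => a b; rewrite mulrBr; move: (pi * J _ _) (pi * J _ _) (pi * xln _) => *; lra.
Qed.

End weak_lower_bound.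

(** * Rellich compactness through ultrafilters *)

Lemma ultra_bounded_limit (R : realType) (U : set_system nat) (a : nat -> R) (C : R) : UltraFilter U ->
  (forall k, `|a k| <= C) ->
  exists p, forall e : R, 0 < e -> U [set k | `|a k - p| <= e].
Proof.
move=> UU aC; have FU : ProperFilter (a @ U) by exact: fmap_proper_filter.
have [|p [_ clp]] := @segment_compact R (- C) C (a @ U) FU.
  by rewrite /fmap/=; apply: filterE => k /=; rewrite in_itv/= -ler_norml.
exists p => e e0; have [//|nU] := in_ultra_setVsetC [set k | `|a k - p| <= e] UU.
have [] := clp (~` [set y | `|y - p| <= e]) (ball p e).
- by rewrite /fmap/=; apply: filterS nU => k.
- exact: nbhsx_ballx.
by move=> y [/= ny]; rewrite /ball/= distrC => /ltW.
Qed.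

Section compactness.
Context (R : realType) (n : nat).
Local Notation mu := (lebesgue_rV R n).
Implicit Types (u f : 'rV[R]_n -> R) (g h : 'I_n -> 'rV[R]_n -> R).

(** Arzela-Ascoli with an ultrafilter in place of diagonal extraction: bounded values converge at
    every point, and equicontinuity with compactness of the ball makes the convergence uniform. *)
Lemma ultra_equicontinuous (U : set_system nat) (P : nat -> 'rV[R]_n -> R) (C M : R) : UltraFilter U ->
  (forall k x, `|P k x| <= C) ->
  (forall e : R, 0 < e -> exists2 d : R, 0 < d &
    forall k x x', `|x - x'| < d -> `|P k x - P k x'| <= e) ->
  forall e : R, 0 < e -> exists2 A, U A & forall k l x, A k -> A l -> `|x| <= M -> `|P k x - P l x| <= e.
Proof.
move=> UU PC Peq e e0; have UF : ProperFilter U by exact: ultra_proper.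
have /choice[p hp] x := @ultra_bounded_limit R U (P^~ x) C UU (fun k => PC k x).
pose r := e / 10; have r0 : 0 < r by rewrite divr_gt0.
have [d d0 hd] := Peq r r0.
have lim x x' : `|x - x'| < d -> `|p x - p x'| <= 3 * r.
  move=> xd; have [k [/= k1 k2]] := filter_ex (filterI (hp x r r0) (hp x' r r0)).
  have k3 := hd k x x' xd; move: k1 k2 k3; rewrite !ler_norml.
  by move=> /andP[a1 a2] /andP[b1 b2] /andP[c1 c2]; apply/andP; split; lra.
have [/(_ (@ball_compact_rV R n M)) H _] := @compact_near_coveringP _ [set x : 'rV[R]_n | `|x| <= M].
exists [set k | [set x : 'rV[R]_n | `|x| <= M] `<=` (fun x => `|P k x - p x| <= e / 2)].
  apply: (H nat U (fun k x => `|P k x - p x| <= e / 2)) => x _.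
  exists (ball x d, [set k | `|P k x - p x| <= r]).
    by split => /=; [exact: nbhsx_ballx|exact: hp].
  move=> -[z k] /= [xz kx]; rewrite -ball_normE /= in xz.
  have h1 := hd k x z xz; have h2 := lim x z xz; rewrite /r in h1 h2 kx.
  by move: h1 h2 kx; rewrite !ler_norml => /andP[a1 a2] /andP[b1 b2] /andP[c1 c2]; apply/andP; split; lra.
move=> k l x /= /(_ x) h1 /(_ x) h2 xM; have := h1 xM; have := h2 xM.
by rewrite !ler_norml => /andP[a1 a2] /andP[b1 b2]; apply/andP; split; lra.
Qed.

Lemma nrmZ f (c : R) : 0 <= c -> Sq mu f -> nrm mu (fun x => c * f x) = c * nrm mu f.
Proof.
move=> c0 sf; rewrite -[in RHS](ger0_norm c0) -sqrtr_sqr -sqrtrM ?sqr_ge0// -(JZ _ sf.2).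
by congr Num.sqrt; apply: J_ext => x; rewrite exprMn.
Qed.

Lemma nrm_out_box f (M e' : R) : Sq mu f -> 0 <= e' -> (forall x, `|x| <= M -> `|f x| <= e') ->
  nrm mu f <= nrm mu (fun x => f x * out M x) + e' * nrm mu (\1_(@box R n M)).
Proof.
move=> sf e0 hf; have so := Sq_out M sf; have sb := Sq_indic_box n M.
have E : f =1 (fun x => f x * out M x + f x * (1 - out M x)) by move=> x; ring.
have si : Sq mu (fun x => f x * (1 - out M x)).
  by rewrite (_ : (fun x => _) = (fun x => f x - f x * out M x)); [exact: SqB|apply/funext => x; ring].
rewrite (nrm_ext _ E); apply: le_trans (nrmD so si) _; rewrite lerD2l.
apply: (@le_trans _ _ (nrm mu (fun x => e' * \1_(@box R n M) x))).
  apply: nrm_le => [||x]; [exact: si|exact: SqZ|].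
  rewrite !normrM (ger0_norm e0); have [xM|xM] := leP `|x| M.
    by rewrite out0// subr0 normr1 mulr1 indic_boxE// normr1 mulr1; exact: hf.
  by rewrite /out xM subrr normr0 mulr0 mulr_ge0.
by rewrite nrmZ.
Qed.

Lemma C1c_translate_close (rho : 'rV[R]_n -> R) u g (r B : R) : mollifier rho -> C1c u g -> 0 <= r ->
  (forall y, rho y != 0 -> `|y| <= r) -> 0 <= B -> energy g <= B ->
  nrm mu (fun x => mol rho u x - u x) <= r * (n%:R * Num.sqrt B).
Proof.
move=> mr ug r0 hr B0 gB; have sg i : Sq mu (g i) by apply: Cc_Sq; exact: (C1c_Ccd i ug).
apply: le_trans (mol_close mr ug.1 (C1c_Sq ug) sg r0 hr) _; rewrite ler_wpM2l//.
apply: (@le_trans _ _ (\sum_(i < n) Num.sqrt B)); last by rewrite sumr_const card_ord mulr_natl.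
apply: ler_sum => i _; apply: ler_wsqrtr; apply: le_trans gB.
by rewrite /energy (bigD1 i)//= lerDl; apply: sumr_ge0 => j _; apply: J_ge0 => x; exact: sqr_ge0.
Qed.

(** Each v k is close to its mollification by the energy bound, uniformly in k; the mollifications
    are equicontinuous, hence uniformly Cauchy on a ball, and tightness controls the outside. *)
Lemma ultra_cauchy (U : set_system nat) (v : nat -> 'rV[R]_n -> R) (g : nat -> 'I_n -> 'rV[R]_n -> R) (B : R) :
  UltraFilter U -> \oo `<=` U -> 0 <= B ->
  (forall k, C1c (v k) (g k)) -> (forall k, energy (g k) <= B) -> (forall k, mass (v k) <= 1) ->
  (forall e : R, 0 < e -> exists M K, forall k, (K <= k)%N -> mass (fun x => v k x * out M x) <= e) ->
  forall e : R, 0 < e -> exists2 A, U A & forall k l, A k -> A l ->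
    nrm mu (fun x => v k x - v l x) <= e /\ `|energy (g k) - energy (g l)| <= e.
Proof.
move=> UU oU B0 vg gB v1 tight e e0; have UF : ProperFilter U by exact: ultra_proper.
(* Seven errors of size d: two from mollification, four outside the ball of radius M and one
   inside. *)
pose d := e / 8; have d0 : 0 < d by rewrite divr_gt0.
have [M [K hK]] := tight _ (exprn_gt0 2 d0).
pose r := d / (n%:R * Num.sqrt B + 1).
have nB : 0 <= n%:R * Num.sqrt B by rewrite mulr_ge0// sqrtr_ge0.
have r0 : 0 < r by rewrite divr_gt0// ltr_wpDl.
have [rho mr [Sr hr]] := smooth_mollifier n r0; have [cr _ _] := mr.
have sv k := C1c_Sq (vg k).
pose P k := mol rho (v k); have sP k : Sq mu (P k) := (Sq_mol mr (sv k)).1.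
have Pv k : nrm mu (fun x => P k x - v k x) <= d.
  apply: le_trans (C1c_translate_close mr (vg k) (ltW r0) hr B0 (gB k)) _.
  by rewrite /r mulrAC ler_pdivrMr ?ltr_wpDl// ler_wpM2l ?(ltW d0)// lerDl.
have PC k x : `|P k x| <= nrm mu rho.
  apply: le_trans (mol_bound x cr (sv k)) _; rewrite ler_piMl ?nrm_ge0//.
  by rewrite -sqrtr1 /nrm ler_wsqrtr//; exact: v1.
have Peq (e' : R) : 0 < e' -> exists2 d' : R, 0 < d' & forall k x x', `|x - x'| < d' -> `|P k x - P k x'| <= e'.
  move=> e'0; have [d' d'0 hd'] := mol_equicontinuous cr e'0; exists d' => // k x x'.
  by apply: hd' => //; exact: v1.
pose V := nrm mu (\1_(@box R n M)); have V0 : 0 <= V by exact: nrm_ge0.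
pose e' := d / (V + 1); have e'0 : 0 < e' by rewrite divr_gt0// ltr_wpDl.
have [A UA hA] := ultra_equicontinuous M UU PC Peq e'0.
have EB k : `|energy (g k)| <= B by rewrite ger0_norm ?energy_ge0.
have [p hp] := ultra_bounded_limit UU EB.
have e2 : 0 < e / 2 by rewrite divr_gt0.
have Ap := hp _ e2.
exists (A `&` [set k | (K <= k)%N] `&` [set k | `|energy (g k) - p| <= e / 2]).
  by apply: filterI => //; apply: filterI => //; apply: oU; exists K.
move=> k l [[Ak /= Kk] Ek] [[Al /= Kl] El]; split; last first.
  by move: Ek El; rewrite !ler_norml => /andP[a1 a2] /andP[b1 b2]; apply/andP; split; lra.
have outd j : (K <= j)%N -> nrm mu (fun x => v j x * out M x) <= d.
  by move=> Kj; rewrite -[leRHS]ger0_norm ?(ltW d0)// -sqrtr_sqr; apply: ler_wsqrtr; exact: hK.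
have sPP := SqB (sP k) (sP l).
have h1 := nrm_out_box sPP (ltW e'0) (fun x => hA k l x Ak Al).
have h2 : e' * V <= d by rewrite /e' mulrAC ler_pdivrMr ?ltr_wpDl// ler_wpM2l ?(ltW d0)// lerDl.
have so j := Sq_out M (sv j); have sPo j := Sq_out M (sP j).
have Po j : (K <= j)%N -> nrm mu (fun x => P j x * out M x) <= d + d.
  move=> Kj; have := nrmB (sPo j) (so j); move/le_trans; apply; apply: lerD; first exact: outd.
  apply: le_trans (Pv j); have s1 := SqB (sP j) (sv j).
  apply: nrm_le => [||x]; [exact: SqB|exact: s1|].
  rewrite -mulrBl normrM; have /andP[a0 a1] := out01 M x.
  by rewrite (ger0_norm a0) ler_piMr.
have h3 : nrm mu (fun x => (P k x - P l x) * out M x) <= 4 * d.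
  rewrite (nrm_ext _ (fun x => mulrBl (out M x) (P k x) (P l x))).
  have := nrmD (sPo k) (SqN (sPo l)); rewrite nrmN; have := Po k Kk; have := Po l Kl.
  by move: (nrm _ _) (nrm _ _) (nrm _ _) => a b c; lra.
have t1 := nrm_tri (sv k) (sP k) (sv l); have t2 := nrm_tri (sP k) (sP l) (sv l).
rewrite (nrmC _ (v k) (P k)) in t1.
have := Pv k; have := Pv l; move: t1 t2 h1 h2 h3; rewrite -/V.
move: (nrm _ _) (nrm _ _) (nrm _ _) (nrm _ _) (nrm _ _) (nrm _ _) (e' * V).
by rewrite /d => *; lra.
Qed.

(** A sequence is recovered from the ultrafilter by choosing s j >= j in the intersection of the
    first sets [A i]. The energies are made to converge along it too. *)
Lemma rellich (v : nat -> 'rV[R]_n -> R) (g : nat -> 'I_n -> 'rV[R]_n -> R) (B : R) : 0 <= B ->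
  (forall k, C1c (v k) (g k)) -> (forall k, energy (g k) <= B) -> (forall k, mass (v k) <= 1) ->
  (forall e : R, 0 < e -> exists M K, forall k, (K <= k)%N -> mass (fun x => v k x * out M x) <= e) ->
  exists (s : nat -> nat) u (L : R), [/\ forall j, (j <= s j)%N, Sq mu u,
    L2cvg mu (fun j => v (s j)) u & energy (g (s j)) @[j --> \oo] --> L].
Proof.
move=> B0 vg gB v1 tight; have [U [UU oU]] := @ultraFilterLemma nat \oo _.
have UF : ProperFilter U by exact: ultra_proper.
have inv0 (j : nat) : 0 < j.+1%:R^-1 :> R by rewrite invr_gt0.
have /choice[A hA] (j : nat) : exists A : set nat, U A /\ forall k l, A k -> A l ->
    nrm mu (fun x => v k x - v l x) <= j.+1%:R^-1 /\ `|energy (g k) - energy (g l)| <= j.+1%:R^-1.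
  by have [A UA h] := ultra_cauchy UU oU B0 vg gB v1 tight (inv0 j); exists A.
pose C := fix C j := if j is j'.+1 then C j' `&` A j'.+1 else A 0%N.
have UC j : U (C j) by elim: j => [|j IH]; [exact: (hA 0%N).1|apply: filterI IH _; exact: (hA j.+1).1].
have CA j i : (i <= j)%N -> C j `<=` A i.
  elim: j => [|j IH]; first by rewrite leqn0 => /eqP ->.
  by rewrite leq_eqVlt => /orP[/eqP -> x []//|]; rewrite ltnS => /IH h x [/h].
have /choice[s hs] (j : nat) : exists k, C j k /\ (j <= k)%N.
  have Uj : U [set k | (j <= k)%N] by apply: oU; exists j.
  by have [k [h1 h2]] := filter_ex (filterI (UC j) Uj); exists k.
have cau (e : R) : 0 < e -> exists K, forall k l, (K <= k)%N -> (K <= l)%N ->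
    nrm mu (fun x => v (s k) x - v (s l) x) <= e /\ `|energy (g (s k)) - energy (g (s l))| <= e.
  move=> e0; exists (Num.bound e^-1) => k l Kk Kl.
  have be : (Num.bound e^-1).+1%:R^-1 <= e.
    rewrite invf_ple ?posrE//; apply: le_trans (_ : (Num.bound e^-1)%:R <= _); last by rewrite ler_nat.
    by apply: ltW; apply: archi_boundP; rewrite invr_ge0 ltW.
  have [|h1 h2] := (hA (Num.bound e^-1)).2 (s k) (s l) (CA _ _ Kk _ (hs k).1); first exact: (CA _ _ Kl _ (hs l).1).
  by split; [exact: le_trans h1 be|exact: le_trans h2 be].
have sv k : Sq mu (v (s k)) by exact: C1c_Sq (vg (s k)).
have [|u [t [su _ _ cu]]] := L2_complete sv.
  by move=> e e0; have [K hK] := cau e e0; exists K => k l Kk Kl; exact: (hK k l Kk Kl).1.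
have cE : cvgn (fun j => energy (g (s j))).
  apply/cauchy_cvgP; apply: cauchy_exP => e e0.
  have [K hK] := cau (e / 2) (divr_gt0 e0 (ltr0n _ 2)); exists (energy (g (s K))).
  rewrite /fmap /=; exists K => // k /= Kk; rewrite -ball_normE /=.
  by have := (hK K k (leqnn K) Kk).2; lra.
have /cvg_ex[L hL] := cE.
by exists s, u, L; split => // j; exact: (hs j).2.
Qed.

End compactness.

Lemma cvg_seq_unique (R : realType) (a : nat -> R) (l l' : R) :
  a @ \oo --> l -> a @ \oo --> l' -> l = l'.
Proof.
by move=> h h'; rewrite -(cvg_lim (@norm_hausdorff _ _) h) (cvg_lim (@norm_hausdorff _ _) h').
Qed.

Lemma cvg_seq_le (R : realType) (a b : nat -> R) (l l' : R) :
  a @ \oo --> l -> b @ \oo --> l' -> (forall k, a k <= b k) -> l <= l'.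
Proof.
by move=> ca cb ab; apply: (ler_cvg_to ca cb); exact: nearW.
Qed.

(** * Limits of gradients and of the entropy *)

Section weak_limits.
Context (R : realType) (n : nat).
Local Notation mu := (lebesgue_rV R n).
Implicit Types (u f phi : 'rV[R]_n -> R) (g h : 'I_n -> 'rV[R]_n -> R).

Lemma J_mul_cvg (f_ : nat -> 'rV[R]_n -> R) f phi : (forall k, Sq mu (f_ k)) -> Sq mu f -> Sq mu phi ->
  L2cvg mu f_ f -> J mu (fun x => f_ k x * phi x) @[k --> \oo] --> J mu (fun x => f x * phi x).
Proof.
move=> sf_ sf sp cf; apply: cvg_of_dist => e e0.
have N0 : 0 < nrm mu phi + 1 by rewrite ltr_wpDl// nrm_ge0.
have [K hK] := cf _ (divr_gt0 e0 N0); exists K => k Kk.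
rewrite -JB; try exact: Int_mul.
rewrite (@J_ext _ _ _ mu _ (fun x => (f_ k x - f x) * phi x)) => [|x]; last by rewrite mulrBl.
apply: le_trans (J_mul_le (SqB (sf_ k) sf) sp) _.
apply: (@le_trans _ _ (e / (nrm mu phi + 1) * (nrm mu phi + 1))); last by rewrite divfK// gt_eqF.
by apply: ler_pM; rewrite ?nrm_ge0 ?lerDl//; exact: hK.
Qed.

Lemma C1_weakp i u g : C1 u g -> weakp i u (g i).
Proof.
move=> ug phi Sp bp; have [d cd _] := Sm_derive Sp; rewrite (C1_partial cd).
have pd_ : C1c phi d by []; have cp := C1c_Cc pd_; have cdp := C1c_Ccd i pd_.
have [cu cg _] := ug.
have := J_C1c0 i (C1cM pd_ ug); rewrite JD; [|by apply: Cc_Int; exact: CcM|by apply: Cc_Int; exact: CcM].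
move=> /eqP; rewrite addr_eq0 => /eqP e.
rewrite (@J_ext _ _ _ mu _ (fun x => d i x * u x)) => [|x]; last by rewrite mulrC.
by rewrite e; congr (- _); apply: J_ext => x; rewrite mulrC.
Qed.

Lemma weakp_limit i (w_ h_ : nat -> 'rV[R]_n -> R) u (h : 'rV[R]_n -> R) :
  (forall k, Sq mu (w_ k)) -> (forall k, Sq mu (h_ k)) -> Sq mu u -> Sq mu h ->
  L2cvg mu w_ u -> L2cvg mu h_ h -> (forall k, weakp i (w_ k) (h_ k)) -> weakp i u h.
Proof.
move=> sw sh su sh0 cw ch wk phi Sp bp; have [d cd Sd] := Sm_derive Sp.
have sp := Sm_Sq Sp bp; have spd : Sq mu (partial i phi).
  by rewrite (C1_partial cd); apply: Cc_Sq; exact: (@C1c_Ccd R n phi d i).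
have c1 := J_mul_cvg sw su spd cw; have c2 := J_mul_cvg sh sh0 sp ch.
have e : (fun k => J mu (fun x => w_ k x * partial i phi x)) = (fun k => - J mu (fun x => h_ k x * phi x)).
  by apply/funext => k; exact: wk.
rewrite e in c1; apply: (cvg_seq_unique c1); exact: cvgN.
Qed.

Lemma energy_parallelogram (p h : 'I_n -> 'rV[R]_n -> R) : (forall i, Sq mu (p i)) -> (forall i, Sq mu (h i)) ->
  energy (fun i x => p i x - h i x) + 4 * energy (fun i x => 2^-1 * (p i x + h i x)) =
  2 * energy p + 2 * energy h.
Proof.
move=> sp sh; rewrite /energy !mulr_sumr -!big_split/=; apply: eq_bigr => i _.
have s1 := SqB (sp i) (sh i); have s2 := SqZ 2^-1 (SqD (sp i) (sh i)).
rewrite -(JZ _ s2.2) -(JZ _ (sp i).2) -(JZ _ (sh i).2).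
rewrite -(JD s1.2 (IntZ 4 s2.2)) -(JD (IntZ 2 (sp i).2) (IntZ 2 (sh i).2)).
by apply: J_ext => x; field.
Qed.

Lemma nrm_le_energy i g : nrm mu (g i) ^+ 2 <= energy g.
Proof.
rewrite nrm_sq /energy (bigD1 i)//= lerDl; apply: sumr_ge0 => j _.
by apply: J_ge0 => x; exact: sqr_ge0.
Qed.

(* The gradients of near-minimisers of the energy among the C1c functions close
   to u are Cauchy by the parallelogram identity. *)
Lemma weak_gradient_limit (v : nat -> 'rV[R]_n -> R) (g_ : nat -> 'I_n -> 'rV[R]_n -> R) u (L : R) :
  (forall k, C1c (v k) (g_ k)) -> Sq mu u -> L2cvg mu v u -> energy (g_ k) @[k --> \oo] --> L ->
  exists g, [/\ forall i, Sq mu (g i), forall i, weakp i u (g i) & energy g <= L].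
Proof.
move=> vg su cv cE.
have inv0 (j : nat) : 0 < j.+1%:R^-1 :> R by rewrite invr_gt0.
pose S m : set R := [set r | exists w h, [/\ C1c w h, nrm mu (fun x => w x - u x) <= m.+1%:R^-1 & r = energy h]].
have SL m (d : R) : 0 < d -> exists2 r, S m r & r <= L + d.
  move=> d0; have [K1 h1] := cv _ (inv0 m).
  have /cvgrPdist_le/(_ d d0)[K2 _ h2] := cE.
  exists (energy (g_ (maxn K1 K2))).
    by exists (v (maxn K1 K2)), (g_ (maxn K1 K2)); split => //; apply: h1; exact: leq_maxl.
  have := h2 _ (leq_maxr K1 K2); rewrite ler_norml => /andP[h _]; lra.
have iS m : has_inf (S m).
  split; first by have [r Sr _] := SL m 1 ltr01; exists r.
  by exists 0 => _ [w [h [_ _ ->]]]; exact: energy_ge0.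
(* The least energy among functions within 1/(m + 1) of u; the supremum [s] of these values is the
   relaxed energy of u and is at most L. *)
pose e m := inf (S m).
have eL m : e m <= L.
  rewrite leNgt; apply/negP => lt; have [|r Sr] := SL m ((e m - L) / 2); first by rewrite divr_gt0// subr_gt0.
  by have : e m <= r by [apply: ge_inf; [exact: (iS m).2|]]; lra.
have sE : has_sup (range e) by split; [exists (e 0%N), 0%N|exists L => _ [m _ <-]].
pose s := sup (range e).
have es m : e m <= s by apply: ub_le_sup; [exact: sE.2|exists m].
have sL : s <= L by apply: ge_sup; [exact: sE.1|move=> _ [m _ <-]].
have eP m w h : C1c w h -> nrm mu (fun x => w x - u x) <= m.+1%:R^-1 -> e m <= energy h.
  by move=> wh wu; apply: ge_inf; [exact: (iS m).2|exists w, h].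
have /choice[W hW] (m : nat) : exists wh : ('rV[R]_n -> R) * ('I_n -> 'rV[R]_n -> R),
    [/\ C1c wh.1 wh.2, nrm mu (fun x => wh.1 x - u x) <= m.+1%:R^-1 & energy wh.2 < e m + m.+1%:R^-1].
  by have [_ [w [h [wh wu ->]]] lt] := inf_adherent (inv0 m) (iS m); exists (w, h).
pose w m := (W m).1; pose h m := (W m).2.
have wh m : C1c (w m) (h m) by have [] := hW m.
have sw m := C1c_Sq (wh m); have shi m i : Sq mu (h m i) by apply: Cc_Sq; exact: (C1c_Ccd i (wh m)).
have mono (m l : nat) : (m <= l)%N -> l.+1%:R^-1 <= m.+1%:R^-1 :> R.
  by move=> ml; rewrite lef_pV2 ?posrE// ler_nat.
have key (d : R) : 0 < d -> exists K, forall m l, (K <= m)%N -> (K <= l)%N ->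
    energy (fun i x => h m i x - h l i x) <= d.
  move=> d0; have d8 : 0 < d / 8 by rewrite divr_gt0.
  have [_ [K1 _ <-] hK1] := sup_adherent d8 sE; rewrite -/s in hK1.
  pose K2 := Num.bound (d / 8)^-1; exists (maxn K1 K2) => m l Km Kl.
  have small k : (maxn K1 K2 <= k)%N -> k.+1%:R^-1 <= d / 8.
    move=> Kk; rewrite invf_ple ?posrE//; apply: le_trans (_ : K2%:R <= _).
      by apply: ltW; apply: archi_boundP; rewrite invr_ge0 ltW.
    by rewrite ler_nat; apply: leqW; apply: leq_trans Kk; exact: leq_maxr.
  have near k : (maxn K1 K2 <= k)%N -> nrm mu (fun x => w k x - u x) <= K1.+1%:R^-1.
    move=> Kk; have [_ wu _] := hW k; apply: le_trans wu _; apply: mono.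
    by apply: leq_trans Kk; exact: leq_maxl.
  have up k : (maxn K1 K2 <= k)%N -> energy (h k) <= s + d / 8.
    by move=> Kk; have [_ _ lt] := hW k; apply: le_trans (ltW lt) _; apply: lerD; [exact: es|exact: small].
  have mid : C1c (fun x => 2^-1 * (w m x + w l x)) (fun i x => 2^-1 * (h m i x + h l i x)).
    by exact: (C1cZ 2^-1 (C1cD (wh m) (wh l))).
  have midu : nrm mu (fun x => 2^-1 * (w m x + w l x) - u x) <= K1.+1%:R^-1.
    have s1 := SqB (sw m) su; have s2 := SqB (sw l) su.
    rewrite (@nrm_ext _ _ _ mu _ (fun x => 2^-1 * (w m x - u x) + 2^-1 * (w l x - u x))) => [|x]; last by field.
    apply: le_trans (nrmD (SqZ _ s1) (SqZ _ s2)) _; rewrite !nrmZ ?invr_ge0//.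
    by have := near m Km; have := near l Kl; move: (nrm _ _) (nrm _ _) (_.+1%:R^-1) => a b c; lra.
  have := energy_parallelogram (shi m) (shi l).
  have := eP _ _ _ mid midu; have := up m Km; have := up l Kl; move: hK1.
  by move: (energy (h m)) (energy (h l)) (energy _) (energy _) => a b c c'; lra.
have /choice[g hg] (i : 'I_n) : exists gi, Sq mu gi /\ L2cvg mu (fun m => h m i) gi.
  have [|gi [t [sgi _ _ cgi]]] := L2_complete (fun m => shi m i); last by exists gi.
  move=> d d0; have [K hK] := key _ (exprn_gt0 2 d0); exists K => m l Km Kl.
  rewrite -(@ler_pXn2r _ 2)// ?nnegrE ?nrm_ge0 ?(ltW d0)//.
  exact: le_trans (nrm_le_energy i _) (hK m l Km Kl).
have cw : L2cvg mu w u.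
  move=> d d0; exists (Num.bound d^-1) => k Kk; have [_ wu _] := hW k; apply: le_trans wu _.
  rewrite invf_ple ?posrE//; apply: le_trans (_ : (Num.bound d^-1)%:R <= _); last by rewrite ler_nat ltnW.
  by apply: ltW; apply: archi_boundP; rewrite invr_ge0 ltW.
exists g; split => [i|i|]; first by have [] := hg i.
  apply: (@weakp_limit i w (fun m => h m i)) => //; try by have [] := hg i.
  by move=> k; exact: C1_weakp (wh k).1.
have cEh : energy (h m) @[m --> \oo] --> energy g.
  rewrite /energy; elim: (index_enum _) => [|i r IH].
    by rewrite big_nil; under eq_fun do rewrite big_nil; exact: cvg_cst.
  rewrite big_cons; under eq_fun do rewrite big_cons; apply: cvgD => //.
  have [sgi cgi] := hg i; by apply: Jsq_cvg => // k; exact: shi.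
have cL : L + m.+1%:R^-1 @[m --> \oo] --> L + 0 by apply: cvgD; [exact: cvg_cst|exact: cvg_harmonic].
rewrite -[L]addr0; apply: (cvg_seq_le cEh cL) => m.
by have [_ _ lt] := hW m; apply: le_trans (ltW lt) _; rewrite lerD2r.
Qed.

(* PP(v_k - u) is small by Fatou along PP(v_k - v_l), then PP_add. *)
Lemma PP_limit (v : nat -> 'rV[R]_n -> R) (g_ : nat -> 'I_n -> 'rV[R]_n -> R) u (B : R) : 0 <= B ->
  (forall k, C1c (v k) (g_ k)) -> (forall k, energy (g_ k) <= B) -> Sq mu u -> L2cvg mu v u ->
  Int mu (fun x => PP (u x)) /\
  forall e : R, 0 < e -> exists K, forall k, (K <= k)%N ->
    J mu (fun x => PP (v k x)) <= J mu (fun x => PP (u x)) + e.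
Proof.
move=> B0 vg gB su cv; have sv k := C1c_Sq (vg k).
have [s hs av] := L2cvg_ae sv su cv.
have mPP f : measurable_fun setT f -> measurable_fun setT (fun x : 'rV[R]_n => PP (f x)).
  by move=> mf; apply: measurableT_comp mf; apply: continuous_measurable_R; exact: cts_PP.
have fat (f_ : nat -> 'rV[R]_n -> R) f (C : R) : (forall j, Int mu (fun x => PP (f_ j x))) ->
    measurable_fun setT f -> {ae mu, forall x, f_ j x @[j --> \oo] --> f x} ->
    (\forall j \near \oo, J mu (fun x => PP (f_ j x)) <= C) ->
    Int mu (fun x => PP (f x)) /\ J mu (fun x => PP (f x)) <= C.
  move=> iP mf cf; apply: fatouJ => //.
  - by move=> k x; exact: PP_ge0.
  - by move=> x; exact: PP_ge0.
  - exact: mPP.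
  - by apply: filterS cf => x cx; apply: (continuous_cvg _ (@cts_PP R (f x))).
have iv k : Int mu (fun x => PP (v k x)) by exact: Cc_Int (Cc_PP (C1c_Cc (vg k))).
have ivv k l : Int mu (fun x => PP (v k x - v l x)).
  by exact: Cc_Int (Cc_PP (C1c_Cc (C1cB (vg k) (vg l)))).
have Evv k l : energy (fun i x => g_ k i x - g_ l i x) <= 4 * B.
  have sg j i : Sq mu (g_ j i) by apply: Cc_Sq; exact: (C1c_Ccd i (vg j)).
  have := energy_parallelogram (sg k) (sg l); have := gB k; have := gB l.
  have := energy_ge0 (fun i x => 2^-1 * (g_ k i x + g_ l i x)).
  by move: (energy _) (energy _) (energy _) (energy _) => a b c d; lra.
have massE f : mass f = nrm mu f ^+ 2 by rewrite nrm_sq.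
have iu : Int mu (fun x => PP (u x)).
  have [K1 h1] := cv 1 ltr01.
  have [C C0 hC] := bounded_PP n B0 (sqr_ge0 (nrm mu u + 1)).
  apply: (fat (fun j => v (s j)) u C _ su.1 av _).1 => //.
  exists K1 => // j /= Kj; apply: (hC _ _ (vg (s j)) (gB _)).
  rewrite massE ler_pXn2r ?nnegrE ?addr_ge0 ?nrm_ge0//.
  apply: le_trans (nrmB (sv _) su) _; rewrite lerD2l; apply: h1; exact: leq_trans (hs j).
have small (e : R) : 0 < e -> exists K, forall k, (K <= k)%N ->
    Int mu (fun x => PP (v k x - u x)) /\ J mu (fun x => PP (v k x - u x)) <= e.
  move=> e0; have [d d0 hd] := @small_PP R n (4 * B) e (mulr_ge0 (ler0n _ 4) B0) e0.
  have sd : 0 < Num.sqrt d by rewrite sqrtr_gt0.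
  have [K hK] := L2cvg_cauchy sv su cv sd; exists K => k Kk.
  apply: (fat (fun j x => v k x - v (s j) x)) => //.
  - by apply: measurable_funB; [exact: (sv k).1|exact: su.1].
  - by apply: filterS av => x cx; apply: cvgB => //; exact: cvg_cst.
  exists K => // j /= Kj; apply: (hd _ _ (C1cB (vg k) (vg (s j)))); first exact: Evv.
  rewrite massE -(sqr_sqrtr (ltW d0)) ler_pXn2r ?nnegrE ?nrm_ge0 ?sqrtr_ge0//.
  by apply: hK => //; exact: leq_trans (hs j).
split => // e e0; set P := J mu (fun x => PP (u x)).
have P0 : 0 <= P by apply: J_ge0 => x; exact: PP_ge0.
have m0 := mass_ge0 u; set m := mass u in m0.
(* For k0 <= 1, (1 + k0)^2 (P + 2 k0 m) <= P + k0 (3 P + 8 m), whence this choice. *)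
pose D := 3 * P + 8 * m + 1; have D0 : 0 < D by rewrite ltr_wpDl// addr_ge0// mulr_ge0.
pose k0 := Num.min 1 (e / (2 * D)).
have k00 : 0 < k0 by rewrite lt_min ltr01 divr_gt0// mulr_gt0.
have k01 : k0 <= 1 by rewrite ge_min lexx.
have k0D : k0 * D <= e / 2.
  have : k0 <= e / (2 * D) by rewrite ge_min lexx orbT.
  by rewrite ler_pdivlMr ?mulr_gt0//; lra.
have main : (1 + k0) ^+ 2 * (P + 2 * k0 * m) <= P + e / 2.
  have a1 : (1 + k0) ^+ 2 <= 1 + 3 * k0 by rewrite sqrrD expr1n mul1r mulr2n; have := ler_piMl (ltW k00) k01; rewrite -expr2; lra.
  have a2 : 0 <= P + 2 * k0 * m by rewrite addr_ge0// mulr_ge0// mulr_ge0// ltW.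
  apply: le_trans (ler_wpM2r a2 a1) _; apply: le_trans (_ : P + k0 * D <= _); last by lra.
  have b1 : k0 * (k0 * m) <= k0 * m by apply: ler_piMl => //; rewrite mulr_ge0// ltW.
  rewrite /D -subr_ge0 (_ : _ - _ = 6 * (k0 * m - k0 * (k0 * m)) + k0); last by ring.
  by have := ltW k00; lra.
pose KK := (1 + k0^-1) ^+ 2; pose l := 2 * ln (1 + k0^-1).
have ki : 0 < k0^-1 by rewrite invr_gt0.
have l0 : 0 <= l by rewrite mulr_ge0// ln_ge0// lerDl ltW.
have KK0 : 0 < KK by rewrite exprn_gt0// ltr_wpDr// ltW.
pose e1 := e / (4 * KK * (l + 1)).
have l1 : 0 < l + 1 by lra.
have e10 : 0 < e1 by apply: divr_gt0 => //; apply: mulr_gt0 => //; apply: mulr_gt0.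
have [K1 h1] := small e1 e10; have se1 : 0 < Num.sqrt e1 by rewrite sqrtr_gt0.
have [K2 h2] := cv _ se1; exists (maxn K1 K2) => k Kk.
have [iw jw] := h1 k (leq_trans (leq_maxl _ _) Kk).
have mw : mass (fun x => v k x - u x) <= e1.
  rewrite massE -(sqr_sqrtr (ltW e10)) ler_pXn2r ?nnegrE ?nrm_ge0 ?sqrtr_ge0//.
  by apply: h2; exact: leq_trans (leq_maxr _ _) Kk.
have sw := SqB (sv k) su.
have i1 := IntD iu (IntZ (2 * k0) su.2); have i2 := IntD iw (IntZ l sw.2).
have i3 := IntZ ((1 + k0) ^+ 2) i1; have i4 := IntZ KK i2.
apply: (@le_trans _ _ (J mu (fun x => (1 + k0) ^+ 2 * (PP (u x) + 2 * k0 * u x ^+ 2) +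
    KK * (PP (v k x - u x) + l * (v k x - u x) ^+ 2)))).
  apply: J_le => [||x]; [exact: iv|exact: IntD i3 i4|].
  by have := PP_add (u x) (v k x - u x) k00; rewrite addrC subrK.
rewrite (JD i3 i4) (JZ _ i1) (JZ _ i2) (JD iu (IntZ _ su.2)) (JD iw (IntZ _ sw.2)) (JZ _ su.2) (JZ _ sw.2).
rewrite -/P -/(mass u) -/m -/(mass (fun x => v k x - u x)).
have : KK * (J mu (fun x => PP (v k x - u x)) + l * mass (fun x => v k x - u x)) <= KK * (e1 + l * e1).
  by rewrite ler_wpM2l ?(ltW KK0)//; apply: lerD => //; rewrite ler_wpM2l.
have -> : KK * (e1 + l * e1) = e / 4 by rewrite /e1; field; rewrite !gt_eqF.
by move: main; move: (KK * _) ((1 + k0) ^+ 2 * _) => a b; lra.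
Qed.

End weak_limits.

(** * Existence of a minimiser *)

Section minimizer.
Context (R : realType) (n : nat).
Local Notation mu := (lebesgue_rV R n).
Implicit Types (u f : 'rV[R]_n -> R) (g h : 'I_n -> 'rV[R]_n -> R) (z : 'rV[R]_n).

(** (1 + 29/320)^8 exceeds 2, barely; this is what puts the local constant 29/20 pi above 2 pi ln
    2. *)
Lemma ln2_lt : 2 * ln 2 < 29 / 20 :> R.
Proof.
have : ln 2 < 29 / 40 :> R; last by lra.
rewrite -[ltRHS]expRK ltr_ln ?posrE ?expR_gt0//.
have -> : expR (29 / 40) = expR (29 / 320) ^+ 8 :> R by rewrite -expRM_natl; congr expR; field.
apply: (@lt_le_trans _ _ ((1 + 29 / 320) ^+ 8)).
  by rewrite (exprM _ 2 4) (exprM _ 2 2); lra.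
have h : 0 <= 1 + 29 / 320 :> R by lra.
by rewrite ler_pXn2r ?nnegrE ?expR_ge0// expR_ge1Dx.
Qed.

(** With lam^2 = 1/2 the logarithmic Sobolev inequality leaves half of the energy to be bounded by
    the deficit. *)
Lemma energy_bound : exists2 C : R, 0 <= C & forall u g, C1c u g -> mass u = 1 ->
  energy g <= 2 * DD u g + C.
Proof.
have p0 := pi_gt0 R; pose l : R := Num.sqrt 2^-1.
have l0 : 0 < l by rewrite sqrtr_gt0 invr_gt0.
pose K : R := n%:R * pi + `|pi * (n%:R * (1 + ln l))|.
exists (2 * K).
  by rewrite mulr_ge0// addr_ge0// mulr_ge0// ltW.
move=> u g ug u1; have := log_sobolev ug l0.
rewrite /DD u1 /xln ln1 mulr0 mulr1 mulr1 addr0 sqr_sqrtr ?invr_ge0// => le.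
have := ler_wpM2l (ltW p0) le; rewrite mulrBr.
have -> : pi * (2^-1 / pi * energy g) = 2^-1 * energy g by rewrite mulrA mulrCA divff ?mulr1// gt_eqF.
have := ler_norm (- (pi * (n%:R * (1 + ln l)))); rewrite normrN /K mulr0 addr0.
by move: (pi * entr u) (pi * (n%:R * (1 + ln l))) (n%:R * pi) => a b c; lra.
Qed.

Lemma mass_out_shift u z (M : R) : Sq mu u ->
  mass (fun x => u (x + z) * out M x) = J mu (fun x => u x ^+ 2 * out M (x - z)).
Proof.
move=> su; have so := Sq_out M (Sq_shift z su).
rewrite /mass -(J_shift (- z) so.2); apply: J_ext => x.
by rewrite exprMn out_sq subrK.
Qed.

Lemma Int_out_shift u z (M : R) : Sq mu u -> Int mu (fun x => u x ^+ 2 * out M (x - z)).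
Proof.
move=> su; have := Int_shift (- z) (Sq_out M (Sq_shift z su)).2.
by apply: Int_ext => x; rewrite exprMn out_sq subrK.
Qed.

(** Two balls, each carrying at least 3/4 of the mass, cannot be disjoint. *)
Lemma centers_close u z z' (M M' : R) : Sq mu u -> mass u = 1 ->
  mass (fun x => u (x + z) * out M x) <= 4^-1 ->
  mass (fun x => u (x + z') * out M' x) <= 4^-1 -> `|z - z'| <= M + M'.
Proof.
move=> su u1 h1 h2; rewrite leNgt; apply/negP => lt.
rewrite (mass_out_shift _ _ su) in h1; rewrite (mass_out_shift _ _ su) in h2.
have i1 := Int_out_shift z M su; have i2 := Int_out_shift z' M' su.
suff : mass u <= J mu (fun x => u x ^+ 2 * out M (x - z)) + J mu (fun x => u x ^+ 2 * out M' (x - z')).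
  by rewrite u1; move: h1 h2; move: (J _ _) (J _ _) => a b; lra.
rewrite -(JD i1 i2); apply: J_le => [||x]; [exact: su.2|exact: IntD|].
rewrite -mulrDr -[leLHS]mulr1 ler_wpM2l ?sqr_ge0//.
have /andP[a0 _] := out01 M (x - z); have /andP[b0 _] := out01 M' (x - z').
have [h|h] := leP `|x - z| M; last first.
  by rewrite {1}/out h lerDl.
rewrite {2}/out (_ : M' < `|x - z'|) ?lerDr//.
have := ler_normB (x - z') (x - z); rewrite (_ : x - z' - (x - z) = z - z'); last first.
  by apply/rowP => i; rewrite !mxE; ring.
by lra.
Qed.

(** The centre found by [tightness] depends on e. Comparison with the centre found for 1/4 makes one
    sequence of centres work for all e, at the price of a larger radius. *)
Lemma recenter u z z' (M M0 e : R) : Sq mu u -> mass u = 1 ->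
  mass (fun x => u (x + z) * out M0 x) <= 4^-1 ->
  mass (fun x => u (x + z') * out M x) <= e -> e <= 4^-1 ->
  mass (fun x => u (x + z) * out (M + (M0 + M)) x) <= e.
Proof.
move=> su u1 h0 h e4; have zz := centers_close su u1 h0 (le_trans h e4).
apply: le_trans h; rewrite !mass_out_shift//; apply: J_le => [||x].
- exact: Int_out_shift.
- exact: Int_out_shift.
rewrite ler_wpM2l ?sqr_ge0//; have [xM|xM] := leP `|x - z| (M + (M0 + M)).
  by rewrite out0//; have /andP[] := out01 M (x - z').
have := ler_normB (x - z') (z - z'); rewrite (_ : x - z' - (z - z') = x - z); last first.
  by apply/rowP => i; rewrite !mxE; ring.
move=> tri; rewrite {2}/out (_ : M < `|x - z'|); last by lra.
by have /andP[] := out01 (M + (M0 + M)) (x - z).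
Qed.

(** A function that violates stability has positive mass and distance because its deficit is
    nonnegative; it is then normalised by homogeneity. *)
Lemma near_optimal (q : R) : 0 <= q -> ~ stab n q -> exists u g,
  [/\ C1c u g, mass u = 1, 0 < d2 u & DD u g <= q * d2 u].
Proof.
move=> q0 /existsNP[w /existsNP[h /not_implyP[wh /negP]]]; rewrite -ltNge => lt.
have sw := C1c_Sq wh; have D0 := DD_ge0 wh.
have m0 : 0 < mass w.
  rewrite lt_neqAle mass_ge0 andbT eq_sym; apply/eqP => m0.
  have := d2_le sw; rewrite m0 => d0; have : q * d2 w <= 0 by rewrite mulr_ge0_le0.
  by lra.
pose c := (Num.sqrt (mass w))^-1; have c2 : c ^+ 2 = (mass w)^-1 by rewrite exprVn sqr_sqrtr ?ltW.
exists (fun x => c * w x), (fun i x => c * h i x); split; first exact: C1cZ.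
  by rewrite massZ// c2 mulVf// gt_eqF.
  rewrite d2Z// c2 mulr_gt0 ?invr_gt0// lt_neqAle d2_ge0// andbT eq_sym; apply/eqP => d0.
  by rewrite d0 mulr0 in lt; lra.
by rewrite DDZ// d2Z// mulrCA ler_wpM2l ?sqr_ge0// ltW.
Qed.

Lemma minimizer_exists (q : R) : 0 <= q -> q < 2 * pi * ln 2 -> stab n q ->
  (forall q', q < q' -> ~ stab n q') -> exists u g,
  [/\ Sq mu u, forall i, Sq mu (g i), forall i, weakp i u (g i) & 0 < d2 u] /\
  [/\ Int mu (fun x => PP (u x)), Int mu (fun x => Phi (u x)) &
  energy g - pi * (J mu (fun x => PP (u x)) - J mu (fun x => Phi (u x))) +
    pi * xln (mass u) - n%:R * pi * mass u <= q * d2 u].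
Proof.
move=> q0 qQ Hq Hmax; have p0 := pi_gt0 R.
have inv0 (j : nat) : 0 < j.+1%:R^-1 :> R by rewrite invr_gt0.
have inv_le (r : R) : 0 < r -> exists K, forall k, (K <= k)%N -> k.+1%:R^-1 <= r.
  move=> r0; exists (Num.bound r^-1) => k Kk; rewrite invf_ple ?posrE//.
  apply: le_trans (_ : (Num.bound r^-1)%:R <= _); last by rewrite ler_nat ltnW.
  by apply: ltW; apply: archi_boundP; rewrite invr_ge0 ltW.
have /choice[U hU] (k : nat) : exists ug : ('rV[R]_n -> R) * ('I_n -> 'rV[R]_n -> R),
    [/\ C1c ug.1 ug.2, mass ug.1 = 1, 0 < d2 ug.1 & DD ug.1 ug.2 <= (q + k.+1%:R^-1) * d2 ug.1].
  have qk : q < q + k.+1%:R^-1 by rewrite ltrDl.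
  by have [u [g h]] := near_optimal (le_trans q0 (ltW qk)) (Hmax _ qk); exists (u, g).
pose u k := (U k).1; pose g k := (U k).2.
have ug k : C1c (u k) (g k) by have [] := hU k.
have u1 k : mass (u k) = 1 by have [] := hU k.
have su k := C1c_Sq (ug k).
have dle k : d2 (u k) <= 1 by rewrite -(u1 k); exact: d2_le.
have Dq k : DD (u k) (g k) <= q * d2 (u k) + k.+1%:R^-1.
  have [_ _ _] := hU k; move/le_trans; apply; rewrite mulrDl lerD2l.
  by apply: ler_piMr; [exact: ltW|exact: dle].
have q4 : 0 < 4^-1 :> R by rewrite invr_gt0.
(* Centres fixed once and for all, at level 1/4. *)
have [s0 [M0 [s00 ht0]]] := tightness q0 qQ q4 Hq.
have [K0 hK0] := inv_le _ (exprn_gt0 2 s00).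
have /choice[z hz] (k : nat) : exists z, (K0 <= k)%N -> mass (fun x => u k (x + z) * out M0 x) <= 4^-1.
  have [Kk|Kk] := leqP K0 k; last by exists 0.
  have [|z hz] := ht0 _ _ (ug k) (u1 k); last by exists z.
  by apply: le_trans (Dq k) _; rewrite lerD2l; exact: hK0.
pose v k x := u k (x + z k); pose h k i (x : 'rV[R]_n) := g k i (x + z k).
have vh k : C1c (v k) (h k) by exact: C1c_shift.
have v1 k : mass (v k) = 1 by rewrite -(u1 k); exact: mass_shift.
have vd k : d2 (v k) = d2 (u k) by exact: d2_shift.
have vD k : DD (v k) (h k) = DD (u k) (g k) by exact: DD_shift.
have sv k := C1c_Sq (vh k).
have tight (e : R) : 0 < e -> exists M K, forall k, (K <= k)%N -> mass (fun x => v k x * out M x) <= e.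
  move=> e0; pose e' := Num.min e 4^-1.
  have e'0 : 0 < e' by rewrite lt_min e0 invr_gt0/=.
  have [s [M [s_0 ht]]] := tightness q0 qQ e'0 Hq.
  have [K hK] := inv_le _ (exprn_gt0 2 s_0).
  exists (M + (M0 + M)), (maxn K0 K) => k Kk.
  have [|z' hz'] := ht _ _ (ug k) (u1 k).
    by apply: le_trans (Dq k) _; rewrite lerD2l; apply: hK; exact: leq_trans (leq_maxr _ _) Kk.
  have e'4 : e' <= 4^-1 by rewrite ge_min lexx orbT.
  apply: le_trans (recenter (su k) (u1 k) (hz k (leq_trans (leq_maxl _ _) Kk)) hz' e'4) _.
  by rewrite ge_min lexx.
have [C C0 hC] := energy_bound; pose B := 2 * (q + 1) + C.
have B0 : 0 <= B by rewrite addr_ge0// mulr_ge0// addr_ge0.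
have hB k : energy (h k) <= B.
  apply: le_trans (hC _ _ (vh k) (v1 k)) _; rewrite vD lerD2r ler_wpM2l//.
  apply: le_trans (Dq k) _; apply: lerD; first by rewrite ler_piMr.
  by rewrite invf_le1// ler1n.
have v1' k : mass (v k) <= 1 by rewrite v1.
have [t [w [L [ht sw cw cE]]]] := rellich B0 vh hB v1' tight.
have svt k := sv (t k).
have w1 : mass w = 1 by exact: cvg_constant (mass_cvg svt sw cw) (fun k => v1 (t k)).
have cd := d2_cvg svt sw cw.
have [iP hP] := PP_limit B0 (fun k => vh (t k)) (fun k => hB (t k)) sw cw.
have [gw [sgw wgw Egw]] := weak_gradient_limit (fun k => vh (t k)) sw cw cE.
exists w, gw; split.
  (* If d2 became small compared with the overlap, [local_stability] would force a quotient of at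
     least 29/20 pi, above q + 1/(k + 1) for large k. So d2 stays above eta/(1 + eta), and so does
     its limit. *)
  split => //; have [eta eta0 hloc] := local_stability R n.
  have q29 : q < 29 / 20 * pi.
    apply: lt_le_trans qQ _; rewrite mulrAC ler_pM2r// ltW//; exact: ln2_lt.
  have q2 : 0 < (29 / 20 * pi - q) / 2 by rewrite divr_gt0// subr_gt0.
  have [K hK] := inv_le _ q2.
  have dlow k : (K <= k)%N -> eta / (1 + eta) <= d2 (v (t k)).
    move=> Kk; have tk : (K <= t k)%N by exact: leq_trans (ht k).
    have [_ _ dpos DD1] := hU (t k); rewrite -/(u (t k)) -/(g (t k)) in dpos DD1.
    rewrite vd ler_pdivrMr ?ltr_wpDr ?(ltW eta0)//.
    have [le|lt] := leP (d2 (u (t k))) (eta * ov2 (u (t k))); last first.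
      by move: lt; rewrite /d2 u1; move: (ov2 _) => o; lra.
    exfalso; have h1 := hloc _ _ (ug (t k)) le; have h2 := le_trans h1 DD1.
    by move: h2; rewrite ler_pM2r//; have := hK _ tk; move: (_.+1%:R^-1) => x; lra.
  apply: (@lt_le_trans _ _ (eta / (1 + eta))); first by rewrite divr_gt0// ltr_wpDr// ltW.
  by apply: (cvgr_to_ge cd); exists K.
pose P := J mu (fun x => PP (w x)).
(* Near-optimality solved for the [Phi] term: Fatou bounds it below in the limit, and [PP_limit]
   bounds the [PP] term above, so both semicontinuities point the right way. *)
pose a_ k := q * d2 (v (t k)) + (t k).+1%:R^-1 + n%:R * pi - energy (h (t k)).
pose a := q * d2 w + 0 + n%:R * pi - L.
have ca : a_ @ \oo --> a.
  apply: cvgB => //; apply: cvgD; last exact: cvg_cst.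
  apply: cvgD; first by apply: cvgM => //; exact: cvg_cst.
  apply: cvg_of_dist => e e0; have [K hK] := inv_le e e0; exists K => k Kk.
  by rewrite subr0 ger0_norm ?(ltW (inv0 _))//; apply: hK; exact: leq_trans (ht k).
have [r hr aw] := L2cvg_ae svt sw cw.
have Phik k : pi * J mu (fun x => Phi (v (t k) x)) <= a_ k + pi * J mu (fun x => PP (v (t k) x)).
  have := Dq (t k); rewrite -vD -vd /DD entr_split; last exact: C1c_Cc (vh (t k)).
  rewrite v1 /xln ln1 mulr0 mulr0 mulr1 addr0 mulrBr /a_.
  by move: (pi * J _ _) (pi * J _ _) (q * d2 _) (energy _) (_.+1%:R^-1) => x y b c d; lra.
have fat (e : R) : 0 < e -> Int mu (fun x => Phi (w x)) /\ J mu (fun x => Phi (w x)) <= (a + pi * P + e) / pi.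
  move=> e0; apply: (@fatouJ _ _ _ mu (fun j x => Phi (v (t (r j)) x))).
  - by move=> k; exact: Cc_Int (Cc_Phi (C1c_Cc (vh _))).
  - by move=> k x; have /andP[] := Phi01 (v (t (r k)) x).
  - by move=> x; have /andP[] := Phi01 (w x).
  - by apply: measurable_Phi; exact: sw.1.
  - by apply: filterS aw => x cx; apply: (continuous_cvg _ (@cts_Phi R (w x))).
  have e2 : 0 < e / 2 by rewrite divr_gt0.
  have [K1 h1] := hP (e / 2 / pi) (divr_gt0 e2 p0).
  have [K2 _ h2] : \forall k \near \oo, a_ k <= a + e / 2 by apply: (cvgr_le _ ca); rewrite ltrDl.
  exists (maxn K1 K2) => // j /= Kj; have rj := leq_trans Kj (hr j).
  rewrite ler_pdivlMr// mulrC; apply: le_trans (Phik (r j)) _.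
  have := ler_wpM2l (ltW p0) (h1 _ (leq_trans (leq_maxl _ _) rj)).
  have := h2 _ (leq_trans (leq_maxr _ _) rj).
  rewrite -/P mulrDr (_ : pi * (e / 2 / pi) = e / 2); last by rewrite mulrC divfK// gt_eqF.
  by rewrite /=; move: (pi * J _ _) (pi * P) (a_ _) => x y b; lra.
split => //; first by have [] := fat 1 ltr01.
rewrite w1 /xln ln1 mulr0 mulr0 mulr1 addr0 leNgt; apply/negP => lt.
set X := energy gw - _ - _ in lt.
have [|_] := fat ((X - q * d2 w) / 2); first by rewrite divr_gt0// subr_gt0.
rewrite ler_pdivlMr// mulrC; move: lt; rewrite /X (mulrBr pi) -/P /a; move: Egw.
by move: (energy gw) (pi * P) (pi * J _ _) (q * d2 w) (n%:R * pi) => b c d e f; lra.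
Qed.

End minimizer.

(** * Two distant Gaussians and the strict inequality *)

Section two_bumps.
Context (R : realType) (n : nat) (i0 : 'I_n).
Local Notation mu := (lebesgue_rV R n).
Implicit Types (x b : 'rV[R]_n) (t r s : R).

(** By symmetry t >= 0. With y = pi/4 (t - be)^2 and c = e^(-pi be^2), the sum is e^(-y) (1 + c
    e^(pi be (be - t))). If be (be - t) <= 1 the last exponential is at most e^pi; otherwise that
    product is at most y, and e^(-y) (1 + y) <= 1. *)
Lemma two_bumps_line (be t : R) : 3 <= be ->
  expR (- (pi / 4) * (t - be) ^+ 2) + expR (- (pi / 4) * (t + be) ^+ 2) <=
  1 + expR pi * expR (- pi * be ^+ 2).
Proof.
move=> b3; have p2 := pi_ge2 R; have b0 : 0 < be by lra.
wlog t0 : t / 0 <= t.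
  move=> H; have [h|h] := leP 0 t; first exact: H.
  have := H (- t) (_ : 0 <= - t); rewrite addrC -opprD sqrrN (addrC (- t)) -(opprB t) sqrrN.
  by apply; lra.
set c := expR (- pi * be ^+ 2); pose y : R := pi / 4 * (t - be) ^+ 2.
have y0 : 0 <= y by rewrite mulr_ge0 ?sqr_ge0// divr_ge0// ltW// pi_gt0.
have q'E : expR (- (pi / 4) * (t + be) ^+ 2) = c * expR (pi * be * (be - t)) * expR (- y).
  by rewrite /c /y -!expRD; congr expR; move: (@pi R) => p; field.
have pE : expR (- (pi / 4) * (t - be) ^+ 2) = expR (- y) by rewrite /y mulNr.
have c0 : 0 < c by exact: expR_gt0.
have y1 : expR (- y) <= 1 by rewrite -expR0 ler_expR oppr_le0.
rewrite q'E pE; have [h|h] := leP (be * (be - t)) 1.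
  apply: lerD => //; apply: (@le_trans _ _ (c * expR (pi * be * (be - t)))).
    by rewrite ler_piMr// mulr_ge0 ?expR_ge0// ltW.
  rewrite mulrC ler_wpM2r ?(ltW c0)// ler_expR -mulrA.
  by rewrite -[leRHS]mulr1 ler_wpM2l// ltW// pi_gt0.
suff le : c * expR (pi * be * (be - t)) <= y.
  rewrite -[X in X + _]mul1r -mulrDl; apply: (@le_trans _ _ 1); last first.
    by rewrite lerDl mulr_ge0 ?expR_ge0// ltW.
  rewrite expRN ler_pdivrMr ?expR_gt0// mul1r.
  by apply: le_trans (expR_ge1Dx y); rewrite lerD2l.
have tb : t < be by nra.
have cE : c * expR (pi * be * (be - t)) = expR (- (pi * be * t)).
  by rewrite /c -expRD; congr expR; ring.
(* For t >= be/2 the left side is at most e^(-z) with z = pi be^2/2, while be - t >= 1/be gives y >=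
   pi/(4 be^2). For t < be/2 it is at most 1, while y >= 9/8. *)
rewrite cE; have [h2|h2] := leP (be / 2) t.
  pose z : R := pi * be ^+ 2 / 2.
  have z0 : 0 < z by rewrite divr_gt0// mulr_gt0 ?exprn_gt0// pi_gt0.
  apply: (@le_trans _ _ (expR (- z))).
    rewrite ler_expR lerN2 /z expr2 mulrA -mulrA; apply: ler_wpM2l => //.
    by rewrite mulr_ge0 ?(ltW b0)// ltW// pi_gt0.
  have ez : z ^+ 2 / 4 <= expR z.
    have -> : expR z = expR (z / 2) ^+ 2 by rewrite -expRM_natl; congr expR; field.
    have : (z / 2) ^+ 2 <= expR (z / 2) ^+ 2; last by congr (_ <= _); field.
    have z2' : 0 <= z / 2 by lra.
    rewrite ler_pXn2r ?nnegrE ?expR_ge0//.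
    by apply: le_trans (expR_ge1Dx _); rewrite lerDr.
  rewrite expRN; apply: (@le_trans _ _ (z ^+ 2 / 4)^-1).
    by rewrite lef_pV2 ?posrE ?expR_gt0// divr_gt0// exprn_gt0.
  apply: (@le_trans _ _ (pi / (4 * be ^+ 2))); last first.
    have hb : be^-1 <= be - t by rewrite -[be^-1]mul1r ler_pdivrMr// mulrC ltW.
    rewrite /y invfM mulrA; apply: ler_wpM2l; first by rewrite divr_ge0// ltW// pi_gt0.
    rewrite -exprVn -(sqrrN (t - be)) opprB ler_pXn2r ?nnegrE ?invr_ge0 ?(ltW b0)//; lra.
  have z2 : 0 < z ^+ 2 / 4 by rewrite divr_gt0// exprn_gt0.
  have b2 : 0 < 4 * be ^+ 2 by rewrite mulr_gt0// exprn_gt0.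
  rewrite -[leLHS]mul1r ler_pdivrMr//.
  have p8 : 8 <= pi ^+ 3 :> R.
    have -> : 8 = 2 ^+ 3 :> R by ring.
    by rewrite ler_pXn2r ?nnegrE ?pi_ge0.
  have b9 : 9 <= be ^+ 2.
    have -> : 9 = 3 ^+ 2 :> R by ring.
    by rewrite ler_pXn2r ?nnegrE ?(ltW b0).
  have -> : pi / (4 * be ^+ 2) * (z ^+ 2 / 4) = pi ^+ 3 * be ^+ 2 / 64.
    by rewrite /z; move: (@pi R) => p; field; rewrite gt_eqF.
  have : 8 * 9 <= pi ^+ 3 * be ^+ 2 by apply: ler_pM.
  by move: (pi ^+ 3 * be ^+ 2) => w; lra.
apply: (@le_trans _ _ 1).
  by rewrite -expR0 ler_expR oppr_le0 mulr_ge0// mulr_ge0 ?(ltW b0)// pi_ge0.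
rewrite /y; have hs : (be / 2) ^+ 2 <= (t - be) ^+ 2.
  by rewrite -(sqrrN (t - be)) opprB ler_pXn2r ?nnegrE ?divr_ge0 ?(ltW b0)//; lra.
have : 2 / 4 * (3 / 2) ^+ 2 <= pi / 4 * (t - be) ^+ 2; last by lra.
apply: ler_pM; rewrite ?sqr_ge0//; first by rewrite ler_pM2r.
by apply: le_trans hs; rewrite ler_pXn2r ?nnegrE ?divr_ge0 ?(ltW b0)// ler_pM2r.
Qed.

Definition ctr (be : R) : 'rV[R]_n := be *: e_ R i0.

Lemma ctr_coord be j : ctr be ord0 j = be * (j == i0)%:R.
Proof. by rewrite !mxE eqxx eq_sym. Qed.

Lemma sqnorm_ctr be : sqnorm (ctr be) = be ^+ 2.
Proof.
rewrite /sqnorm (bigD1 i0)//= big1 ?addr0 => [|j ji]; last by rewrite ctr_coord (negPf ji) mulr0 expr0n.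
by rewrite ctr_coord eqxx mulr1.
Qed.

Lemma sqnormD_ctr be x : sqnorm (x - ctr be) = sqnorm x - 2 * be * x ord0 i0 + be ^+ 2.
Proof.
have -> : sqnorm (x - ctr be) = sqnorm x - 2 * (\sum_j x ord0 j * ctr be ord0 j) + sqnorm (ctr be).
  rewrite /sqnorm mulr_sumr -sumrB -big_split/=; apply: eq_bigr => j _.
  by rewrite mxE [(- ctr be) _ _]mxE; ring.
rewrite sqnorm_ctr (bigD1 i0)//= big1 ?addr0 => [|j ji]; last by rewrite ctr_coord (negPf ji) !mulr0.
by rewrite ctr_coord eqxx mulr1; ring.
Qed.

Definition twob (be : R) x : R := gam (x - ctr be) + gam (x - ctr (- be)).

(** Coordinates of the centre other than i0 only decrease both overlaps, so the one-dimensional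
    bound applies. *)
Lemma ov2_twob be : 3 <= be -> ov2 (twob be) <= (1 + expR pi * expR (- pi * be ^+ 2)) ^+ 2.
Proof.
move=> b3; have s1 := Sq_gams (ctr be); have s2 := Sq_gams (ctr (- be)).
apply: ov2_le => [|b]; first exact: SqD.
have [i1 j1] := J_gam_gam (ctr be) b; have [i2 j2] := J_gam_gam (ctr (- be)) b.
have e : ovl (twob be) b = expR (- (pi / 4) * sqnorm (ctr be - b)) + expR (- (pi / 4) * sqnorm (ctr (- be) - b)).
  by rewrite -j1 -j2 -(JD i1 i2); apply: J_ext => x; rewrite /twob mulrDl.
have h (s : R) : expR (- (pi / 4) * sqnorm (ctr s - b)) <= expR (- (pi / 4) * (b ord0 i0 - s) ^+ 2).
  rewrite ler_expR ler_wnM2l ?oppr_le0 ?divr_ge0 ?pi_ge0//.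
  apply: le_trans (coord_sq_le_sqnorm _ i0); rewrite mxE [(- b) _ _]mxE ctr_coord eqxx mulr1.
  by rewrite -sqrrN opprB.
rewrite e ler_pXn2r ?nnegrE ?addr_ge0 ?mulr_ge0 ?expR_ge0//.
apply: le_trans (two_bumps_line (b ord0 i0) b3); apply: lerD; first exact: h.
by have := h (- be); rewrite opprK.
Qed.

Lemma C1_shift (u : 'rV[R]_n -> R) g b : C1 u g ->
  C1 (fun x => u (x + b)) (fun i (x : 'rV[R]_n) => g i (x + b)).
Proof.
move=> [cu cg dg]; split.
- exact: cts_shift.
- by move=> i; exact: (@cts_shift R n (g i) b (cg i)).
- by move=> i x; apply: (dE (dg i (x + b))) => // s; rewrite addrAC.
Qed.

Lemma Int_sqnormW : Int mu (fun x => sqnorm x * W x) /\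
  J mu (fun x => sqnorm x * W x) = n%:R / (2 * pi).
Proof.
have ix i := (@J_xW R n i).1.
have e x : sqnorm x * W x = \sum_i x ord0 i ^+ 2 * W x by rewrite /sqnorm mulr_suml.
split; first by apply: Int_ext (Int_sum ix) => x; rewrite e.
rewrite (J_ext _ e) (J_sum ix) (eq_bigr (fun=> (2 * pi)^-1)) => [|i _]; last exact: (J_xW R i).2.
by rewrite sumr_const card_ord -[LHS]mulr_natl.
Qed.

(** The first absolute moment along i0; its positivity produces the gain of order be e^(-pi be^2) in
    the entropy. *)
Definition kappa : R := J mu (fun x : 'rV[R]_n => `|x ord0 i0| * W x).

Lemma Int_kappa : Int mu (fun x : 'rV[R]_n => `|x ord0 i0| * W x).
Proof.
have i1 := (@J_xW R n i0).1; have i2 := @Int_W R n.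
have cc : continuous (fun x : 'rV[R]_n => `|x ord0 i0| * W x).
  by apply: ctsM; [apply: cts_norm; exact: coord_continuous|exact: cts_W].
apply: (Int_dom _ (IntD i1 i2)); first exact: continuous_measurable_rV.
move=> x; have w0 := W_gt0 x; rewrite ger0_norm; last by rewrite mulr_ge0// ltW.
rewrite (_ : _ + _ = (x ord0 i0 ^+ 2 + 1) * W x); last by rewrite mulrDl mul1r.
rewrite ler_pM2r// -[X in _ <= X + _](real_normK (num_real _)).
have := normr_ge0 (x ord0 i0); move: `|x ord0 i0| => a a0.
by have := sqr_ge0 (a - 1); move: a a0; clear => a a0 h; lra.
Qed.

Lemma kappa_gt0 : 0 < kappa.
Proof.
have k0 : 0 <= kappa by apply: J_ge0 => x; rewrite mulr_ge0// ltW// W_gt0.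
rewrite lt_neqAle k0 andbT eq_sym; apply/eqP => k00.
have h0 (x : 'rV[R]_n) : 0 <= `|x ord0 i0| * W x by rewrite mulr_ge0// ltW// W_gt0.
have ae0 := J_eq0 Int_kappa h0 k00.
have ae1 : {ae mu, forall x : 'rV[R]_n, 0 = x ord0 i0 ^+ 2 * W x}.
  apply: filterS ae0 => x /eqP; rewrite mulf_eq0 normr_eq0 (gt_eqF (W_gt0 x)) orbF => /eqP ->.
  by rewrite expr0n mul0r.
have [_] := J_ae (Int_meas (@J_xW R n i0).1) (Int0 mu) ae1; rewrite (J_xW R i0).2 J0.
by move/eqP; rewrite gt_eqF// invr_gt0 mulr_gt0// pi_gt0.
Qed.

(** A lower bound for (A + B)^2 ln (A + B)^2: the terms A^2 and B^2 receive their own logarithms,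
    the cross term 2 A B the larger of the two, which is their mean plus [d]. *)
Let Fl_lower_arith (A B la lb lu d : R) : 0 <= A -> 0 <= B -> la <= lu -> lb <= lu ->
  `|la - lb| = 2 * d -> A ^+ 2 * la + B ^+ 2 * lb + 2 * (A * B) * ((la + lb) / 2 + d) <= (A + B) ^+ 2 * lu.
Proof.
move=> A0 B0 h1 h2 h3; have h4 : (la + lb) / 2 + d <= lu.
  by move: h3; case: (leP lb la) => h; [rewrite ger0_norm ?subr_ge0//|rewrite ltr0_norm ?subr_lt0//]; lra.
have k1 : A ^+ 2 * la <= A ^+ 2 * lu by rewrite ler_wpM2l ?sqr_ge0.
have k2 : B ^+ 2 * lb <= B ^+ 2 * lu by rewrite ler_wpM2l ?sqr_ge0.
have k3 : 2 * (A * B) * ((la + lb) / 2 + d) <= 2 * (A * B) * lu.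
  by rewrite ler_wpM2l// mulr_ge0// mulr_ge0.
rewrite (_ : (A + B) ^+ 2 * lu = A ^+ 2 * lu + B ^+ 2 * lu + 2 * (A * B) * lu); last by ring.
by apply: lerD => //; exact: lerD.
Qed.

(** The terms in N cancel because m = 2 + 2 c. What remains is of order c, except for the gain 4 p^2
    be c k, which wins for large be. *)
Let strict_arith (p l c K k be m o xl V d N : R) : 0 < p -> 0 <= l -> 0 < c -> c <= 1 -> 1 <= K ->
  m = 2 + 2 * c -> o <= (1 + K * c) ^+ 2 -> xl <= m * (l + c) ->
  4 + 2 * l + 2 * l + 2 * l * (2 * K + K ^+ 2) < 4 * p * k * be ->
  V <= 2 * N * p + 2 * p * N * c - 4 * p ^+ 2 * be * c * k + p * xl - N * p * m ->
  V < 2 * p * l * (m - o).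
Proof.
move=> p0 l0 c0 c1 K1 mE ho hx hb hV; apply: le_lt_trans hV _.
have a1 : p * xl <= p * (m * (l + c)) by rewrite ler_pM2l.
have a2 : p * c * (4 + 2 * l + 2 * l + 2 * l * (2 * K + K ^+ 2)) < p * c * (4 * p * k * be).
  by rewrite ltr_pM2l// mulr_gt0.
have pl0 : 0 <= 2 * p * l by apply: mulr_ge0 => //; apply: mulr_ge0 => //; exact: ltW.
have a3 : 2 * p * l * o <= 2 * p * l * (1 + K * c) ^+ 2 by apply: ler_wpM2l.
have a4 : 2 * p * l * (K ^+ 2 * (c * c)) <= 2 * p * l * (K ^+ 2 * c).
  by apply: ler_wpM2l => //; apply: ler_wpM2l; [exact: sqr_ge0|rewrite ler_piMl// ltW].
have a5 : p * (c * c) <= p * c by rewrite ler_pM2l// ler_piMl// ltW.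
have a6 : 0 <= p * l * c by rewrite !mulr_ge0// ltW.
clear -a1 a2 a3 a4 a5 a6 mE; subst m; lra.
Qed.

(** The cross term A B is the multiple c of [W], so energy and mass are explicit. The contributions
    of order be^2 c to energy and entropy cancel, and the absolute first moment leaves a gain of
    order be c. *)
Lemma two_bumps_strict : exists u g, [/\ Sq mu u, forall i, Sq mu (g i), forall i, weakp i u (g i) &
  Int mu (fun x => Phi (u x)) /\
  energy g - pi * (J mu (fun x => PP (u x)) - J mu (fun x => Phi (u x))) +
    pi * xln (mass u) - n%:R * pi * mass u < 2 * pi * ln 2 * d2 u].
Proof.
have p0 := pi_gt0 R; have k0 := kappa_gt0; pose l : R := ln 2; pose K : R := expR pi.
have l0 : 0 <= l by rewrite ln_ge0// ler1n.
have K1 : 1 <= K by rewrite /K -expR0 ler_expR ltW.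
(* [M] is the threshold of [strict_arith], and [be] is chosen so that 4 pi kappa be exceeds it. *)
pose M := 4 + 2 * l + 2 * l + 2 * l * (2 * K + K ^+ 2).
pose be := 3 + `|M| / (4 * pi * kappa) + 1.
have pk0 : 0 < 4 * pi * kappa by rewrite !mulr_gt0.
have b3 : 3 <= be by rewrite /be -addrA lerDl addr_ge0// divr_ge0// ltW.
have be0 : 0 <= be by apply: le_trans b3; exact: ler0n.
have bM : M < 4 * pi * kappa * be.
  rewrite /be mulrDr mulrDr mulrCA divff ?gt_eqF// !mulr1.
  by have := ler_norm M; move: pk0; clear; move: (4 * pi * kappa) => a; lra.
pose c : R := expR (- pi * be ^+ 2).
have c0 : 0 < c by exact: expR_gt0.
have c1 : c <= 1 by rewrite /c -expR0 ler_expR mulNr oppr_le0 mulr_ge0 ?sqr_ge0// ltW.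
pose A x : R := gam (x - ctr be); pose B x : R := gam (x - ctr (- be)).
have A0 x : 0 < A x by exact: gam_gt0.
have B0 x : 0 < B x by exact: gam_gt0.
have AB x : A x * B x = c * W x.
  rewrite /A /B /c /gam /W -!expRD !sqnormD_ctr; congr expR.
  by move: (sqnorm x) (x ord0 i0) (@pi R) => s t p; field.
pose u := twob be; pose g j x := - pi * (x - ctr be) ord0 j * A x + - pi * (x - ctr (- be)) ord0 j * B x.
have cug : C1 u g := C1D (C1_shift (- ctr be) (C1_gam R n)) (C1_shift (- ctr (- be)) (C1_gam R n)).
have sA : Sq mu A := Sq_gams (ctr be); have sB : Sq mu B := Sq_gams (ctr (- be)).
have su : Sq mu u := SqD sA sB.
pose S1 x := sqnorm (x - ctr be) * W (x - ctr be).
pose S2 x := sqnorm (x - ctr (- be)) * W (x - ctr (- be)).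
have [iS jS] := Int_sqnormW.
have iS1 : Int mu S1 := Int_shift (- ctr be) iS.
have iS2 : Int mu S2 := Int_shift (- ctr (- be)) iS.
have jS1 : J mu S1 = n%:R / (2 * pi) by rewrite -jS; exact: (J_shift (- ctr be) iS).
have jS2 : J mu S2 = n%:R / (2 * pi) by rewrite -jS; exact: (J_shift (- ctr (- be)) iS).
have iW := @Int_W R n; have jW := @J_W R n; have ik := Int_kappa.
pose XW (x : 'rV[R]_n) := sqnorm x * W x.
pose comb (a1 a2 a3 a4 : R) x := a1 * (S1 x + S2 x) + a2 * XW x + a3 * W x + a4 * (`|x ord0 i0| * W x).
have icomb a1 a2 a3 a4 : Int mu (comb a1 a2 a3 a4).
  by apply: IntD; [apply: IntD; [apply: IntD|]|]; apply: IntZ => //; exact: IntD.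
have jcomb a1 a2 a3 a4 : J mu (comb a1 a2 a3 a4) =
    (2 * a1 + a2) * (n%:R / (2 * pi)) + a3 + a4 * kappa.
  have i12 := IntD iS1 iS2.
  rewrite /comb (JD (IntD (IntD (IntZ a1 i12) (IntZ a2 iS)) (IntZ a3 iW)) (IntZ a4 ik)).
  rewrite (JD (IntD (IntZ a1 i12) (IntZ a2 iS)) (IntZ a3 iW)) (JD (IntZ a1 i12) (IntZ a2 iS)).
  rewrite (JZ _ i12) (JZ _ iS) (JZ _ iW) (JZ _ ik) (JD iS1 iS2) jS1 jS2 jS jW -/kappa.
  by move: (n%:R / (2 * pi)) kappa; clear => y z; ring.
have sg_ x : \sum_j g j x ^+ 2 = comb (pi ^+ 2) (2 * pi ^+ 2 * c) (- (2 * pi ^+ 2 * c * be ^+ 2)) 0 x.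
  transitivity (\sum_j (pi ^+ 2 * ((x - ctr be) ord0 j ^+ 2 * A x ^+ 2 + (x - ctr (- be)) ord0 j ^+ 2 * B x ^+ 2)
     + 2 * pi ^+ 2 * (A x * B x) * (x ord0 j ^+ 2 - ctr be ord0 j ^+ 2))).
    apply: eq_bigr => j _; have -> : (x - ctr be) ord0 j = x ord0 j - ctr be ord0 j by rewrite !mxE.
    have -> : (x - ctr (- be)) ord0 j = x ord0 j + ctr be ord0 j by rewrite !mxE mulNr opprK.
    rewrite /g; have -> : (x - ctr be) ord0 j = x ord0 j - ctr be ord0 j by rewrite !mxE.
    have -> : (x - ctr (- be)) ord0 j = x ord0 j + ctr be ord0 j by rewrite !mxE mulNr opprK.
    by move: (x ord0 j) (ctr be ord0 j) (A x) (B x) (@pi R); clear => y z a b p; ring.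
  rewrite big_split/= -!mulr_sumr big_split/= -!mulr_suml sumrB -!/(sqnorm _) sqnorm_ctr AB.
  rewrite /comb /S1 /S2 /XW -!gam_sq -/(A x) -/(B x).
  by move: (sqnorm _) (sqnorm _) (sqnorm _) (A x) (B x) (gam x) (@pi R); clear => y z t a b w p; ring.
have sgi j : Sq mu (g j).
  have [_ cg _] := cug; split; first exact: continuous_measurable_rV.
  apply: (Int_dom _ (icomb (pi ^+ 2) (2 * pi ^+ 2 * c) (- (2 * pi ^+ 2 * c * be ^+ 2)) 0)).
    by apply: continuous_measurable_rV; exact: ctsX.
  move=> x; rewrite ger0_norm ?sqr_ge0// -sg_ (bigD1 j)//= lerDl.
  by apply: sumr_ge0 => k _; exact: sqr_ge0.
have eE : energy g = n%:R * pi + pi * c * n%:R - 2 * pi ^+ 2 * c * be ^+ 2.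
  rewrite /energy -(J_sum (fun j => (sgi j).2)) (J_ext _ sg_) jcomb.
  by move: p0 => /lt0r_neq0; move: (@pi R) (n%:R : R); clear => p N p0; field.
have mE : mass u = 2 + 2 * c.
  rewrite /mass (@J_ext _ _ _ mu _ (fun x => A x ^+ 2 + B x ^+ 2 + 2 * c * W x)) => [|x]; last first.
    by rewrite -[2 * c * W x]mulrA -AB /u /twob -/(A x) -/(B x); ring.
  rewrite (JD (IntD sA.2 sB.2) (IntZ _ iW)) (JD sA.2 sB.2) (JZ _ iW) jW.
  by rewrite [J mu (fun x => A x ^+ 2)](mass_gams (ctr be)) [J mu (fun x => B x ^+ 2)](mass_gams (ctr (- be))) mulr1.
have wpu i : weakp i u (g i) := C1_weakp i cug.
(* u has unbounded support; the stability inequality with constant 0 supplies integrability of PP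
   (u). *)
have s0 : @stab R n 0 by move=> w h wh; rewrite mul0r; exact: DD_ge0.
have [iP _] := stab_weak s0 su sgi wpu.
have Flge x : comb (- pi) (- (2 * pi * c)) (- (2 * pi * c * be ^+ 2)) (4 * pi * be * c) x <= Fl (u x).
  have u0 : 0 < u x := addr_gt0 (A0 x) (B0 x).
  have lnA b : gam (x - b) <= u x -> - pi * sqnorm (x - b) <= ln (u x ^+ 2).
    have gb := gam_gt0 (x - b).
    move=> h; rewrite -[leLHS]expRK -/(W _) -gam_sq ler_ln ?posrE ?exprn_gt0//.
    by rewrite ler_pXn2r ?nnegrE ?(ltW u0)// ltW.
  have hA : A x <= u x by rewrite /u /twob -/(A x) -/(B x); have := B0 x; move: (A x) (B x); clear => *; lra.
  have hB : B x <= u x by rewrite /u /twob -/(A x) -/(B x); have := A0 x; move: (A x) (B x); clear => *; lra.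
  have hd : `|- pi * sqnorm (x - ctr be) - - pi * sqnorm (x - ctr (- be))| = 2 * (2 * pi * be * `|x ord0 i0|).
    have pb : 0 <= 4 * pi * be by apply: mulr_ge0 be0; apply: mulr_ge0 (ltW p0); exact: ler0n.
    have -> : 2 * (2 * pi * be * `|x ord0 i0|) = `|4 * pi * be * x ord0 i0|.
      by rewrite normrM (ger0_norm pb); move: `|x ord0 i0| (@pi R); clear => *; ring.
    by rewrite !sqnormD_ctr; congr `|_|; move: (sqnorm x) (x ord0 i0) (@pi R); clear => *; ring.
  apply: le_trans (Fl_lower_arith (ltW (A0 x)) (ltW (B0 x)) (lnA _ hA) (lnA _ hB) hd).
  rewrite AB [A x ^+ 2]gam_sq [B x ^+ 2]gam_sq /comb /S1 /S2 /XW !sqnormD_ctr.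
  move: (W (x - ctr be)) (W (x - ctr (- be))) (W x) (sqnorm x) (x ord0 i0) `|x ord0 i0| (@pi R).
  by clear => w1 w2 w3 s t a p; lra.
have FlPP x : Fl (u x) = PP (u x) - Phi (u x) by rewrite /Phi opprB addrC subrK.
have iF : Int mu (fun x => Fl (u x)).
  apply: (Int_dom _ (IntD (Int_abs (icomb (- pi) (- (2 * pi * c)) (- (2 * pi * c * be ^+ 2)) (4 * pi * be * c))) iP)).
    by apply: measurableT_comp (Sq_meas su); apply: continuous_measurable_R; exact: cts_Fl.
  move=> x; have := Flge x; have := FlPP x; have /andP[] := Phi01 (u x); have := PP_ge0 (u x).
  move: (comb _ _ _ _ x) (PP _) (Phi _) (Fl _); clear => a p q f p0' q0 q1 fE h.
  by rewrite ler_norml; have := ler_norm (- a); have := normr_ge0 a; rewrite normrN; move: `|a|; clear -h fE q0 p0' => b; lra.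
have iPhi : Int mu (fun x => Phi (u x)).
  by apply: Int_ext (IntB iP iF) => x; rewrite FlPP opprB addrC subrK.
exists u, g; split => //; split => //.
rewrite -(JB iP iPhi) -(J_ext _ FlPP).
have hL := J_le (icomb _ _ _ _) iF Flge; rewrite jcomb in hL.
apply: (@strict_arith pi l c K kappa be (mass u) (ov2 u) (xln (mass u)) _ (d2 u) n%:R) => //.
- exact: ov2_twob.
- rewrite /xln mE; apply: ler_wpM2l; first by rewrite addr_ge0// mulr_ge0// ltW.
  rewrite (_ : 2 + 2 * c = 2 * (1 + c)); last by ring.
  rewrite lnM ?posrE// ?addr_gt0// lerD2l.
  by apply: le_trans (ln_le_sub1 (addr_gt0 ltr01 c0)) _; rewrite addrC addKr.
rewrite eE !lerD2r; move: hL; have := p0.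
have -> : (2 * - pi + - (2 * pi * c)) * (n%:R / (2 * pi)) = - n%:R - c * n%:R.
  by move: p0 => /lt0r_neq0; move: (@pi R) (n%:R : R); clear => p N p0; field.
rewrite -(ler_pM2l p0) => _; rewrite -subr_ge0; move: (J mu _); clear => j h; rewrite -subr_ge0.
by apply: le_trans h _; lra.
Qed.

End two_bumps.

(** * Back to the functionals on H^1 *)

Section sobolev_link.
Context (R : realType) (n : nat).
Local Notation mu := (lebesgue_rV R n).
Implicit Types (u v w : 'rV[R]_n -> R) (g : 'I_n -> 'rV[R]_n -> R) (x b : 'rV[R]_n) (a q : R).

Lemma L2P u : L2 u <-> Sq mu u.
Proof.
split=> [lu|[mf iF]].
  split; last exact: Lfun2_integrable_sqr.
  by move: lu; rewrite /L2/= inE => /andP[]; rewrite inE.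
rewrite /L2/= inE; apply/andP; split; rewrite inE//= /finite_norm unlock.
apply: poweR_lty; rewrite (eq_integral (fun x => (u x ^+ 2)%:E)) => [|x _].
  by rewrite JE ?ltry.
by rewrite /= powR_mulrn// real_normK// num_real.
Qed.

Lemma normL2E u : Sq mu u -> normL2 u = (nrm mu u)%:E.
Proof.
move=> su; rewrite /normL2 unlock (eq_integral (fun x => (u x ^+ 2)%:E)) => [|x _].
  by rewrite (JE su.2) poweR_EFin powR12_sqrt// J_ge0// => x; exact: sqr_ge0.
by rewrite /= powR_mulrn// real_normK// num_real.
Qed.

(* [weakp] only tests against the explicit functions of [Sm]; mollifying
   [(u, g)] extends it to all C^1 functions with bounded support. *)
Lemma weakp_C1c u g phi d i : Sq mu u -> (forall i, Sq mu (g i)) -> (forall i, weakp i u (g i)) ->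
  C1c phi d -> J mu (fun x => u x * d i x) = - J mu (fun x => g i x * phi x).
Proof.
move=> su sg w pd_; have cp := C1c_Cc pd_; have cdp := C1c_Ccd i pd_.
have /choice[rho hr] (k : nat) : exists rho : 'rV[R]_n -> R, [/\ mollifier rho, Sm rho,
    nrm mu (fun x => mol rho u x - u x) <= k.+1%:R^-1 &
    nrm mu (fun x => mol rho (g i) x - g i x) <= k.+1%:R^-1].
  have k0 : 0 < k.+1%:R^-1 :> R by rewrite invr_gt0.
  have [r r0 hr] := mol_cvg su k0; have [r' r0' hr'] := mol_cvg (sg i) k0.
  have m0 : 0 < Num.min r r' by rewrite lt_min r0.
  have [rho mr [Sr hrr]] := smooth_mollifier n m0; exists rho; split => //.
    by apply: hr => // y /hrr; rewrite le_min => /andP[].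
  by apply: hr' => // y /hrr; rewrite le_min => /andP[].
have sm v k : Sq mu v -> Sq mu (mol (rho k) v) by move=> sv; have [m _ _ _] := hr k; exact: (Sq_mol m sv).1.
have L v : Sq mu v -> (forall k, nrm mu (fun x => mol (rho k) v x - v x) <= k.+1%:R^-1) ->
    L2cvg mu (fun k => mol (rho k) v) v.
  move=> sv h e e0; exists (Num.bound e^-1) => k Kk; apply: le_trans (h k) _.
  rewrite invf_ple ?posrE//; apply: le_trans (_ : (Num.bound e^-1)%:R <= _); last by rewrite ler_nat ltnW.
  by apply: ltW; apply: archi_boundP; rewrite invr_ge0 ltW.
have Lu : L2cvg mu (fun k => mol (rho k) u) u by apply: L => // k; have [] := hr k.
have Lg : L2cvg mu (fun k => mol (rho k) (g i)) (g i) by apply: L => // k; have [] := hr k.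
have c1 := J_mul_cvg (fun k => sm u k su) su (Cc_Sq cdp) Lu.
have c2 := J_mul_cvg (fun k => sm (g i) k (sg i)) (sg i) (Cc_Sq cp) Lg.
have e : (fun k => J mu (fun x => mol (rho k) u x * d i x)) =
    (fun k => - J mu (fun x => mol (rho k) (g i) x * phi x)).
  apply/funext => k; have [mr Sr _ _] := hr k.
  have ug := C1_mol Sr (mollifier_bsupp mr) su sg w; have [cu cg _] := ug.
  have := J_C1c0 i (C1cM pd_ ug); rewrite JD; [|by apply: Cc_Int; exact: CcM|by apply: Cc_Int; exact: CcM].
  move=> /eqP; rewrite addr_eq0 => /eqP e'.
  rewrite (@J_ext _ _ _ mu _ (fun x => d i x * mol (rho k) u x)) => [|x]; last by rewrite mulrC.
  by rewrite e'; congr (- _); apply: J_ext => x; rewrite mulrC.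
rewrite e in c1; apply: (cvg_seq_unique c1); exact: cvgN.
Qed.

Lemma weakp_is_weak_partial u g : Sq mu u -> (forall i, Sq mu (g i)) ->
  (forall i, weakp i u (g i)) -> forall i, is_weak_partial i u (g i).
Proof.
move=> su sg w i phi /test_C1c cp; have sp := C1c_Sq cp; have sd := Cc_Sq (C1c_Ccd i cp).
by rewrite (JE (Int_mul su sd)) (JE (Int_mul (sg i) sp)) (weakp_C1c i su sg w cp).
Qed.

Lemma is_weak_partial_weakp i u v : Sq mu u -> Sq mu v -> is_weak_partial i u v -> weakp i u v.
Proof.
move=> su sv h phi Sp bp; have tp := Sm_test Sp bp; have cp := test_C1c tp.
have := h phi tp; rewrite (JE (Int_mul su (Cc_Sq (C1c_Ccd i cp)))) (JE (Int_mul sv (C1c_Sq cp))).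
by move=> [].
Qed.

Lemma H1_weak u : H1 u -> [/\ Sq mu u, forall i, Sq mu (weak_partial i u) &
  forall i, weakp i u (weak_partial i u)].
Proof.
move=> [/L2P su h]; have H i : L2 (weak_partial i u) /\ is_weak_partial i u (weak_partial i u).
  apply: (@xgetPex _ (cst 0) [set g | L2 g /\ is_weak_partial i u g]).
  by have [g lg wg] := h i; exists g.
split => // i; have [/L2P sg wg] := H i => //; exact: is_weak_partial_weakp.
Qed.

Lemma weak_H1 u g : Sq mu u -> (forall i, Sq mu (g i)) -> (forall i, weakp i u (g i)) -> H1 u.
Proof.
move=> su sg w; split=> [|i]; first exact/L2P.
by exists (g i); [exact/L2P|exact: weakp_is_weak_partial].
Qed.

(** By uniqueness of weak derivatives the chosen representatives agree with g almost everywhere. *)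
Lemma dirichletE u g : Sq mu u -> (forall i, Sq mu (g i)) -> (forall i, weakp i u (g i)) ->
  dirichlet u = (energy g)%:E.
Proof.
move=> su sg w; have [_ s' w'] := H1_weak (weak_H1 su sg w).
rewrite /dirichlet JE; last by apply: Int_sum => i; exact: (s' i).2.
rewrite (J_sum (fun i => (s' i).2)) /energy; congr EFin; apply: eq_bigr => i _.
have ae := weakp_unique (sg i) (s' i) (w i) (w' i).
have ae2 : {ae mu, forall x, g i x ^+ 2 = weak_partial i u x ^+ 2} by apply: filterS ae => x ->.
exact: (J_ae (Int_meas (s' i).2) (sg i).2 ae2).2.
Qed.

Lemma gaussiansP w : gaussians w -> exists a b, w = fun x => a * gam (x - b).
Proof. by []. Qed.

Lemma Sq_gaussian w : gaussians w -> Sq mu w.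
Proof. by move=> /gaussiansP[a [b ->]]; apply: SqZ; exact: Sq_gams. Qed.

(** Completing the square in the amplitude a, which is optimal at [ovl u b]: this identifies [d2]
    with a squared distance. *)
Lemma nrmB_gaussian u a b : Sq mu u ->
  nrm mu (fun x => u x - a * gam (x - b)) ^+ 2 = mass u - ovl u b ^+ 2 + (a - ovl u b) ^+ 2.
Proof.
move=> su; have sg := Sq_gams b; rewrite nrm_sq.
rewrite (@J_ext _ _ _ mu _ (fun x => (u x + (- a) * gam (x - b)) ^+ 2)) => [|x]; last by rewrite mulNr.
by rewrite (J_sqD (- a) su sg) -/(ovl u b) -!/(mass _) mass_gams; move: (mass _) (ovl _ _) => m o; ring.
Qed.

Lemma d2_le_gaussian u w : Sq mu u -> gaussians w -> d2 u <= nrm mu (fun x => u x - w x) ^+ 2.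
Proof.
move=> su /gaussiansP[a [b ->]]; rewrite nrmB_gaussian// /d2.
by have := ov2_ge b su; have := sqr_ge0 (a - ovl u b); move: (mass u) (ov2 u) (_ ^+ 2) (_ ^+ 2) => m o y z; lra.
Qed.

Lemma d2_attained u : Sq mu u -> exists2 w, gaussians w & nrm mu (fun x => u x - w x) ^+ 2 = d2 u.
Proof.
move=> su; have [b hb] := ov2_attained su; exists (fun x => ovl u b * gam (x - b)).
  by exists (ovl u b), b.
by rewrite nrmB_gaussian// subrr expr0n addr0 hb.
Qed.

Lemma dist_gaussiansE u : Sq mu u -> dist_gaussians u = (Num.sqrt (d2 u))%:E.
Proof.
move=> su; have nE w : gaussians w -> normL2 (u \- w) = (nrm mu (fun x => u x - w x))%:E.
  by move=> gw; apply: normL2E; apply: SqB => //; exact: Sq_gaussian.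
apply/eqP; rewrite eq_le; apply/andP; split.
  have [w gw e] := d2_attained su; rewrite -e sqrtr_sqr ger0_norm ?nrm_ge0// -nE//.
  by apply: ereal_inf_lbound; exists w.
apply/ereal_infP => _ [w gw <-]; rewrite nE// lee_fin.
rewrite -[leRHS]ger0_norm ?nrm_ge0// -sqrtr_sqr; apply: ler_wsqrtr; exact: d2_le_gaussian.
Qed.

(** The distance to M is attained, so it vanishes only for functions that agree almost everywhere
    with a Gaussian. *)
Lemma H1_not_gaussianP u : H1_not_gaussian u <-> H1 u /\ 0 < d2 u.
Proof.
split=> -[hu h]; split => //; have [su _ _] := H1_weak hu.
  rewrite lt_neqAle d2_ge0// andbT eq_sym; apply/eqP => d0; apply: h.
  have [w gw e] := d2_attained su; exists w => //.
  have sw := SqB su (Sq_gaussian gw).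
  have n0 : nrm mu (fun x => u x - w x) = 0 by apply/eqP; rewrite -sqrf_eq0 e d0.
  by apply: filterS (nrm_eq0 sw n0) => x /eqP; rewrite subr_eq0 => /eqP.
move=> [w gw uw]; have sw := SqB su (Sq_gaussian gw).
have n0 : nrm mu (fun x => u x - w x) = 0.
  by apply: nrm_ae0 sw.1 _; apply: filterS uw => x /(_ I) ->; rewrite subrr.
by have := d2_le_gaussian su gw; rewrite n0 expr0n leNgt h.
Qed.

Lemma entropy_integrand u x : 0 < mass u -> Sq mu u ->
  u x ^+ 2 * ln (u x ^+ 2 / fine (normL2 u) ^+ 2) = PP (u x) - Phi (u x) - ln (mass u) * u x ^+ 2.
Proof.
move=> m0 su; rewrite (normL2E su)/= nrm_sq -/(mass u) /Phi subKr.
have [->|ux] := eqVneq (u x) 0; first by rewrite Fl0 expr0n/= mul0r mulr0 subr0.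
have ux2 : 0 < u x ^+ 2 by rewrite exprn_even_gt0.
by rewrite ln_div ?posrE// mulrBr /Fl /xln (mulrC (ln _)).
Qed.

Lemma entropyE u : 0 < mass u -> Sq mu u -> Int mu (fun x => PP (u x)) -> Int mu (fun x => Phi (u x)) ->
  entropy u = (J mu (fun x => PP (u x)) - J mu (fun x => Phi (u x)) - xln (mass u))%:E.
Proof.
move=> m0 su iP iF; rewrite /entropy.
under eq_integral do rewrite entropy_integrand//.
have i1 := IntB iP iF; have i2 := IntZ (ln (mass u)) su.2.
by rewrite (JE (IntB i1 i2)) (JB i1 i2) (JB iP iF) (JZ _ su.2) -/(mass u) /xln mulrC.
Qed.

Lemma ge0_not_Int (f : 'rV[R]_n -> R) : measurable_fun setT f -> (forall x, 0 <= f x) -> ~ Int mu f ->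
  (\int[mu]_x (f x)%:E = +oo)%E.
Proof.
move=> mf f0 nf; apply: contrapT => /eqP; rewrite -ltey => lt; apply: nf.
have le : (\int[mu]_x (f x)%:E <= (fine (\int[mu]_x (f x)%:E))%:E)%E.
  by rewrite fineK// ge0_fin_numE// integral_ge0// => x _; rewrite lee_fin.
exact: (Int_ge0 mf f0 le).1.
Qed.

(** The integrand is an integrable function minus Phi (u) >= 0: its positive part is integrable, and
    its negative part cannot be. *)
Lemma entropyNy u : 0 < mass u -> Sq mu u -> Int mu (fun x => PP (u x)) -> ~ Int mu (fun x => Phi (u x)) ->
  entropy u = -oo%E.
Proof.
move=> m0 su iP nF; rewrite /entropy.
under eq_integral do rewrite entropy_integrand//.
pose G x := PP (u x) - ln (mass u) * u x ^+ 2; have iG : Int mu G := IntB iP (IntZ _ su.2).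
pose h x := PP (u x) - Phi (u x) - ln (mass u) * u x ^+ 2.
have mPh := measurable_Phi su.1.
have hE x : h x = G x - Phi (u x) by rewrite /h /G addrAC.
have mh : measurable_fun setT h.
  by rewrite (_ : h = fun x => G x - Phi (u x)); [exact: measurable_funB (Int_meas iG) mPh|apply/funext].
have Ph0 x : 0 <= Phi (u x) by have /andP[] := Phi01 (u x).
have ip : Int mu (h^\+).
  apply: (Int_dom _ (Int_abs iG)) => [|x]; first exact: measurable_funrpos.
  rewrite ger0_norm ?funrpos_ge0// /funrpos ge_max normr_ge0 andbT hE.
  by have := Ph0 x; have := ler_norm (G x); move: (Phi _) (G x) `|G x|; clear => *; lra.
have nn : ~ Int mu (h^\-).
  move=> iN; apply: nF; apply: Int_ext (IntB iG (IntB ip iN)) => x.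
  rewrite (_ : h^\+ x - h^\- x = h x); last by rewrite -[in RHS](funrposBneg h).
  by rewrite hE opprB addrC subrK.
rewrite -/h integralE funerpos funerneg (JE ip).
by rewrite [X in (_ - X)%E](ge0_not_Int _ _ nn)//; exact: measurable_funrneg.
Qed.

Lemma mass_gt0 u : Sq mu u -> 0 < d2 u -> 0 < mass u.
Proof. by move=> su d0; apply: lt_le_trans d0 (d2_le su). Qed.

Lemma quotientE u g : Sq mu u -> (forall i, Sq mu (g i)) -> (forall i, weakp i u (g i)) -> 0 < d2 u ->
  Int mu (fun x => PP (u x)) -> Int mu (fun x => Phi (u x)) ->
  quotient u = ((energy g - pi * (J mu (fun x => PP (u x)) - J mu (fun x => Phi (u x))) +
    pi * xln (mass u) - n%:R * pi * mass u) / d2 u)%:E.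
Proof.
move=> su sg w d0 iP iF; rewrite /quotient /deficit (dirichletE su sg w).
rewrite (entropyE (mass_gt0 su d0) su iP iF) (JE su.2) -/(mass u) dist_gaussiansE//.
rewrite -EFin_expe sqr_sqrtr ?ltW// inver gt_eqF//.
move: (energy g) (J mu (fun x => PP (u x))) (J mu (fun x => Phi (u x))) => e y z.
move: (xln (mass u)) => t; move: (mass u) (d2 u) (@pi R) => m d p.
rewrite -[LHS]/(((e - p * (y - z - t) - n%:R * p * m) / d)%:E); congr (_ / _)%:E; ring.
Qed.

Lemma quotienty u g : Sq mu u -> (forall i, Sq mu (g i)) -> (forall i, weakp i u (g i)) -> 0 < d2 u ->
  Int mu (fun x => PP (u x)) -> ~ Int mu (fun x => Phi (u x)) -> quotient u = +oo%E.
Proof.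
move=> su sg w d0 iP nF; rewrite /quotient /deficit (dirichletE su sg w).
rewrite (entropyNy (mass_gt0 su d0) su iP nF) (JE su.2) dist_gaussiansE//.
rewrite -EFin_expe sqr_sqrtr ?ltW// inver gt_eqF//.
rewrite gt0_muleNy ?lte_fin ?pi_gt0//= gt0_mulye// lte_fin invr_gt0//.
Qed.

Lemma stab_quotient q u : stab n q -> H1_not_gaussian u -> (q%:E <= quotient u)%E.
Proof.
move=> Hq /H1_not_gaussianP[hu d0]; have [su sg w] := H1_weak hu.
have [iP h] := stab_weak Hq su sg w.
have [iF|nF] := pselect (Int mu (fun x => Phi (u x))); last by rewrite (quotienty su sg w d0 iP nF) leey.
by rewrite (quotientE su sg w d0 iP iF) lee_fin ler_pdivlMr//; exact: h.
Qed.

(** The inequality defining [stab] passes to the supremum, so a largest constant exists; evaluating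
    it on the two Gaussians makes the upper bound strict for that constant itself. *)
Lemma stab_sup : (0 < n)%N -> exists q, [/\ 0 <= q, q < 2 * pi * ln 2, stab n q &
  forall q', q < q' -> ~ stab n q'].
Proof.
move=> n0; pose S := [set q : R | 0 <= q /\ stab n q].
have S0 : S 0 by split => // w h wh; rewrite mul0r; exact: DD_ge0.
have [u [g [su sg w [iF lt]]]] := two_bumps_strict R (Ordinal n0).
have d0 := d2_ge0 su.
have S_lt q : stab n q -> q * d2 u < 2 * pi * ln 2 * d2 u.
  by move=> Hq; have [_ h] := stab_weak Hq su sg w; exact: le_lt_trans (h iF) lt.
have dp : 0 < d2 u.
  by rewrite lt_neqAle d0 andbT; apply/eqP => e; have := S_lt 0 S0.2; rewrite -e !mulr0 ltxx.
have S_lt' q : stab n q -> q < 2 * pi * ln 2 by move=> /S_lt; rewrite ltr_pM2r.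
have hS : has_sup S.
  by split; [exists 0|exists (2 * pi * ln 2) => q [_ /S_lt' /ltW]].
have s0 : 0 <= sup S by apply: ub_le_sup hS.2 _ S0.
have Hs : stab n (sup S).
  move=> w' h wh; have := d2_ge0 (C1c_Sq wh); rewrite le_eqVlt => /orP[/eqP <-|dw].
    by rewrite mulr0; exact: DD_ge0.
  rewrite -ler_pdivlMr//; apply: ge_sup; first by exists 0.
  by move=> q [_ Hq]; rewrite ler_pdivlMr//; exact: Hq.
exists (sup S); split => //; first exact: S_lt'.
move=> q' qq' Hq'; have : q' <= sup S by apply: ub_le_sup hS.2 _ _; split => //; apply: le_trans s0 (ltW qq').
by rewrite leNgt qq'.
Qed.

End sobolev_link.

Theorem theorem1p1 (R : realType) (N : nat) (hN : (1 <= N)%N) :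
  (sharp_constant R N < (2 * pi * ln 2)%:E)%E /\
  exists u : 'rV[R]_N -> R,
    H1_not_gaussian u /\ quotient u = sharp_constant R N.
Proof.
have [q [q0 qQ Hq Hmax]] := stab_sup R hN.
have [u [g [[su sg w d0] [iP iF le]]]] := minimizer_exists q0 qQ Hq Hmax.
have hu : H1_not_gaussian u by apply/H1_not_gaussianP; split => //; exact: weak_H1 su sg w.
have lb : (q%:E <= sharp_constant R N)%E.
  by apply/ereal_infP => _ [v hv <-]; exact: stab_quotient.
have ub : (quotient u <= q%:E)%E by rewrite (quotientE su sg w d0 iP iF) lee_fin ler_pdivrMr.
have ul : (sharp_constant R N <= quotient u)%E by apply: ereal_inf_lbound; exists u.
split; first by apply: le_lt_trans ul _; apply: le_lt_trans ub _; rewrite lte_fin.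
by exists u; split => //; apply/eqP; rewrite eq_le ul andbT; exact: le_trans ub lb.
Qed.
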